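(* Let $k$ be an odd positive integer and let $S$ be a surface of genus $g\geq 1$ with at least one puncture. Then any filling set of curves on $S$ pairwise intersecting at most $k$ times has cardinality at least $N$, where $N$ is the smallest positive integer satisfying $$\frac{k}{2}N(N-1)-\frac{N}{2}\left(\frac{N}{M_g(k)}-1\right)\geq|\chi(S)|.$$
   Context: Surfaces are connected, orientable and of finite type; a surface of genus $g$ with $n$ punctures has Euler characteristic $\chi(S)=2-2g-n$. A simple closed curve is essential if it is not homotopic to a point or to a puncture. ''Curve'' always means a simple, closed, essential curve. A set $\Gamma$ of pairwise non-homotopic curves on $S$ fills (is a filling set) if the complement $S\setminus\Gamma$ is a union of topological disks and once-punctured disks. $M_g(k)$ denotes the maximum cardinality of a set of pairwise non-homotopic curves on the closed surface of genus $g$ which pairwise intersect at most $k$ times. *)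

(* Defs.v *)
From HB Require Import structures.
From mathcomp Require Import all_boot all_order all_algebra.
From mathcomp Require Import all_classical all_reals all_analysis.
Import Order.TTheory GRing.Theory Num.Theory.
Import numFieldNormedType.Exports.

Set Implicit Arguments.
Unset Strict Implicit.
Unset Printing Implicit Defensive.

Local Open Scope classical_set_scope.
Local Open Scope ring_scope.
Local Open Scope card_scope.

(* f restricts to a homeomorphism from A onto B, for the subspace topologies. *)
Definition homeomorphism_on (X Y : topologicalType) (A : set X) (B : set Y)
    (f : X -> Y) : Prop :=
  [/\ set_bij A B f, {within A, continuous f} &
   exists h : Y -> X,
     (forall x, A x -> h (f x) = x) /\ {within B, continuous h}].

Definition homeomorphic (X Y : topologicalType) (A : set X) (B : set Y) : Prop :=
  exists f : X -> Y, homeomorphism_on A B f.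

(* The surface z^2 = F(x, y) in R^3, where F >= 0 holds exactly on the disk of
   radius 4 (g + 1) around the origin minus the g open unit disks around the
   points (4 i, 0), i < g. These have disjoint closures inside the big disk, so
   the surface is the double of a closed disk with g holes, i.e. the closed
   connected orientable surface of genus g. *)
Definition genus_surface (R : realType) (g : nat) : set (R * R * R) :=
  [set v | v.2 ^+ 2 =
    ((4 * g.+1)%:R ^+ 2 - v.1.1 ^+ 2 - v.1.2 ^+ 2) *
    \prod_(i < g) ((v.1.1 - (4 * i)%:R) ^+ 2 + v.1.2 ^+ 2 - 1)].

Arguments genus_surface R g : clear implicits.

Definition closed_surface (R : realType) (g : nat) (T : topologicalType) : Prop :=
  homeomorphic [set: T] (genus_surface R g).

(* A punctured surface is given by a closed surface T together with the finite
   set P of its punctures; the surface itself is ~` P. *)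
Section Curves.
Variables (R : realType) (T : topologicalType) (P : set T).

(* The circle is R / Z: loops are 1-periodic maps, and c is injective on the
   circle exactly when c s = c t forces s - t to be an integer. *)
Definition simple_loop (c : R -> T) : Prop :=
  [/\ continuous c, (forall t, ~ P (c t)) &
      forall s t, c s = c t <-> s - t \is a Num.int].

(* The homotopy parameter ranges over the whole line; only [0, 1] matters, since
   a homotopy over [0, 1] extends by precomposing with the retraction of the
   line onto [0, 1]. *)
Definition free_homotopy (H : R * R -> T) (c d : R -> T) : Prop :=
  [/\ continuous H, (forall s t, H (s, t + 1) = H (s, t)),
      (forall t, H (0, t) = c t) & (forall t, H (1, t) = d t)].

Definition loop_homotopic (c d : R -> T) : Prop :=
  exists H : R * R -> T, free_homotopy H c d /\ forall u, ~ P (H u).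

(* Shrinking to the puncture p: the homotopy takes place in the surface until it
   reaches p at time 1. *)
Definition homotopic_to_puncture (c : R -> T) (p : T) : Prop :=
  exists H : R * R -> T, free_homotopy H c (cst p) /\
    forall s t, s < 1 -> ~ P (H (s, t)).

Definition essential (c : R -> T) : Prop :=
  (forall x, ~ P x -> ~ loop_homotopic c (cst x)) /\
  (forall p, P p -> ~ homotopic_to_puncture c p).

(* Curves are unoriented and unparametrized. *)
Definition parametrizes (c : R -> T) (a : set T) : Prop :=
  simple_loop c /\ range c = a.

Definition curve (a : set T) : Prop :=
  exists c : R -> T, parametrizes c a /\ essential c.

Definition homotopic (a b : set T) : Prop :=
  exists c d : R -> T, [/\ parametrizes c a, parametrizes d b & loop_homotopic c d].

(* In some chart around x, the curves a and b are the two coordinate axes. *)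
Definition crosses_at (a b : set T) (x : T) : Prop :=
  exists (U : set T) (f : T -> R * R),
    [/\ open U, U x, homeomorphism_on U [set: R * R] f,
        f @` (U `&` a) = [set v | v.2 = 0] &
        f @` (U `&` b) = [set v | v.1 = 0]] /\ f x = (0, 0).

(* As usual for curves on surfaces, all intersections are transverse crossings:
   tangencies are excluded, and otherwise the parity of the number of common
   points would carry no homotopical information. Curves in pairwise minimal
   position satisfy this. *)
Definition intersect_at_most (k : nat) (a b : set T) : Prop :=
  (forall x, (a `&` b) x -> crosses_at a b x) /\ a `&` b #<= `I_k.

Definition curve_set (G : set (set T)) : Prop :=
  (forall a, G a -> curve a) /\
  (forall a b, G a -> G b -> a <> b -> ~ homotopic a b).

Definition pairwise_intersect_at_most (k : nat) (G : set (set T)) : Prop :=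
  forall a b, G a -> G b -> a <> b -> intersect_at_most k a b.

Definition open_disk (A : set T) : Prop :=
  homeomorphic A [set v : R * R | v.1 ^+ 2 + v.2 ^+ 2 < 1].

(* The point missing from a once-punctured disk has to be a puncture of the
   surface: an annulus between two curves, although homeomorphic to a
   once-punctured disk, does not qualify. *)
Definition once_punctured_disk (A : set T) : Prop :=
  exists p, [/\ P p, ~ A p & open_disk (p |` A)].

Definition fills (G : set (set T)) : Prop :=
  let C := ~` P `\` \bigcup_(a in G) a in
  forall x, C x ->
    open_disk (connected_component C x) \/
    once_punctured_disk (connected_component C x).

Definition filling_set (G : set (set T)) : Prop := curve_set G /\ fills G.

End Curves.

Definition is_max_curves (R : realType) (g k m : nat) : Prop :=
  let admissible (G : set (set (genus_surface R g))) :=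
    curve_set R set0 G /\ pairwise_intersect_at_most R k G in
  (exists G, admissible G /\ G #= `I_m) /\
  (forall G, admissible G -> G #<= `I_m).

(* M_g(k); the default value 0 would only be used if no maximum existed. *)
Definition max_curves (R : realType) (g k : nat) : nat :=
  xget 0%N [set m | is_max_curves R g k m].

Definition euler_char (g n : nat) : int := 2 - 2 * g%:Z - n%:Z.

Definition counting_inequality (R : realType) (g n k N : nat) : Prop :=
  `|euler_char g n|%:~R <=
    k%:R / 2 * N%:R * (N%:R - 1)
    - N%:R / 2 * (N%:R / (max_curves R g k)%:R - 1) :> rat.

(* Main.v *)
(* All cohomology is first cohomology over F_2, handled by hand. A cocycle on A
   is a function of two points which near every point of A is a difference
   h p + h q; it is a coboundary when a single h, its potential, works near every
   point of A. The key facts are that a disk has no cohomology and a punctured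
   disk has exactly one nontrivial class.

   Let X be the union of a filling set. A potential on X of a cocycle on the
   punctured surface extends to a neighbourhood of X and from there across every
   complementary disk or once-punctured disk, so restriction to X is injective.
   The surface carries 2 ^ (2 g + n - 1) independent classes, whereas adding the
   curves one by one, each meeting the previous ones, shows that X carries at
   most 2 ^ (1 + V) of them, V being the sum of the numbers of intersection points
   over all pairs of curves. Hence |chi| <= V.

   A simple loop c has a dual cocycle, whose integral along a loop transverse to c
   is the parity of the number of crossings, and whose integral along c itself
   vanishes because the surface is orientable. Curves that pairwise cross an odd
   number of times therefore remain essential and non-homotopic in the closed
   surface, so there are at most M_g(k) of them. As k is odd, a pair crossing an
   even number of times has at most k - 1 common points, and by Turan's theorem
   there are at least N (N / M_g(k) - 1) / 2 such pairs among N curves. *)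

Require Import Defs.
From HB Require Import structures.
From mathcomp Require Import all_boot all_order all_algebra.
From mathcomp Require Import all_classical all_reals all_analysis.
From mathcomp Require Import ring lra zify.
Import Order.TTheory GRing.Theory Num.Theory.
Import numFieldNormedType.Exports.

Set Implicit Arguments.
Unset Strict Implicit.
Unset Printing Implicit Defensive.

Local Open Scope classical_set_scope.
Local Open Scope ring_scope.

(** The curves are only continuous, so there are no tubular neighbourhoods or triangulations to work
    with; integrals of cocycles along loops need nothing more than continuity. The dual of a simple
    loop [c] can therefore not be read off a strip around [c]. Its value at two nearby points p, q
    is instead defined as the integral along [c] of a small cocycle that is singular exactly at p
    and q (a [kernel]), which counts how often [c] crosses a short arc from p to q. Orientability is
    not part of the record [surface]: it is extracted from the equation of the model, where all
    classes are computed explicitly, a symmetry theorem exchanges the two loops in a dual integral,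
    and the resulting pairing turns out to be alternating. The exponent 2 g + n - 1 is made of 2 g,
    since the g + 1 boundary circles and the g + 1 slices of the model each satisfy one relation,
    and of n - 1 kernels joining one puncture to the others. Dimensions are replaced by
    cardinalities: a family of pairwise non-cohomologous cocycles is thinned out by the pigeonhole
    principle, one factor 2 for each bit of information. *)

Lemma quad_bound (m a b s : nat) : (a ^ 2 <= m * s)%N -> (2 * a * b <= m * b ^ 2 + s)%N.
Proof.
move=> h; rewrite -leq_sqr.
have h1 : (4 * (m * b ^ 2 * s) <= (m * b ^ 2 + s) ^ 2)%N := (nat_AGM2 (m * b ^ 2) s).1.
apply: leq_trans h1; rewrite !expnMn -mulnA leq_mul2l /=.
by rewrite mulnAC leq_mul2r h orbT.
Qed.

(** * Turan's theorem *)

Section Turan.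
Variables (V : finType) (e : rel V).
Hypothesis e_sym : symmetric e.
Implicit Types (A B S : {set V}) (x y v : V).

Definition independent S := [forall x in S, forall y in S, (x != y) ==> ~~ e x y].
Definition deg A x := #|[set y in A | (y != x) && e x y]|.
Definition edges A := (\sum_(x in A) deg A x)%N.

(** Induction on the bound M. A vertex of minimal degree is removed together with its neighbours; an
    independent set of what remains can be enlarged by that vertex, so M drops by one. Note that
    [edges] counts every edge twice. *)
Lemma turan M A : (forall S, S \subset A -> independent S -> (#|S| <= M)%N) ->
  (#|A| ^ 2 <= M * (#|A| + edges A))%N.
Proof.
elim: M A => [|M IH] A indA.
  have [->|/set0Pn[x xA]] := eqVneq A finset.set0; first by rewrite cards0.
  have i1 : independent [set x]%SET.
    apply/forall_inP => y; rewrite inE => /eqP->; apply/forall_inP => z; rewrite inE => /eqP->.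
    by rewrite eqxx.
  by have := indA [set x]%SET; rewrite cards1 finset.sub1set xA => /(_ isT i1).
have [->|/set0Pn[v0 v0A]] := eqVneq A finset.set0; first by rewrite cards0.
have [v vA vmin] := @arg_minnP _ v0 (fun x => x \in A) (deg A) v0A.
pose B := (v |: [set y in A | (y != v) && e v y])%SET.
pose A' := (A :\: B)%SET.
have BA : B \subset A.
  by apply/fintype.subsetP => y; rewrite !inE => /orP[/eqP->//|/andP[]].
have cB : #|B| = (deg A v).+1.
  by rewrite cardsU1 !inE eqxx andbF.
have cA : #|A| = (#|A'| + #|B|)%N.
  by rewrite -(cardsID B A) (finset.setIidPr BA) addnC.
have indA' S : S \subset A' -> independent S -> (#|S| <= M)%N.
  move=> SA' iS; have vS : v \notin S.
    by apply/negP => /(fintype.subsetP SA'); rewrite !inE eqxx.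
  have := indA (v |: S)%SET; rewrite cardsU1 vS; apply.
    apply/fintype.subsetP => y; rewrite !inE => /orP[/eqP->//|/(fintype.subsetP SA')].
    by rewrite inE => /andP[].
  have nv y : y \in S -> ~~ e v y.
    move=> /(fintype.subsetP SA'); rewrite !inE negb_or negb_and => /andP[/andP[yv +] yA].
    by rewrite yA yv.
  apply/forall_inP => x; rewrite !inE => xS; apply/forall_inP => y; rewrite !inE => yS.
  apply/implyP => xy; case/orP: xS => [/eqP xv|xS]; case/orP: yS => [/eqP yv|yS].
  - by rewrite xv yv eqxx in xy.
  - by rewrite xv; exact: nv.
  - by rewrite yv e_sym; exact: nv.
  - by have /forall_inP/(_ x xS)/forall_inP/(_ y yS) := iS; rewrite xy.
have := IH A' indA' => h.
have eA : (edges A' + #|B| * deg A v <= edges A)%N.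
  have EA : edges A = (\sum_(x in B) deg A x + \sum_(x in A') deg A x)%N.
    rewrite /edges (big_setID B) /= (finset.setIidPr BA); congr (_ + _)%N.
  rewrite EA addnC; apply: leq_add.
    rewrite -sum_nat_const; apply: leq_sum => x xB; apply: vmin.
    exact: (fintype.subsetP BA).
  apply: leq_sum => x xA'; apply: subset_leq_card; apply/fintype.subsetP => y.
  by rewrite !inE => /andP[/andP[_ ->] ->].
(* This bounds the mixed term 2 |A'| |B| of the square of |A'| + |B|; the terms then add up exactly
   to the claim, because the vertices of B have degree at least |B| - 1 each. *)
have q := quad_bound #|B| h.
rewrite cA sqrnD.
have dB : deg A v = #|B|.-1 by rewrite cB.
rewrite dB in eA; move: q eA h; rewrite cB /=.
move: (deg A v) (edges A) (edges A') #|A'| => dd EA EA' a' q eA h.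
have eM : (M.+1 * (EA' + dd.+1 * dd) <= M.+1 * EA)%N by rewrite leq_mul2l eA.
by rewrite -!mulnn in q h *; nia.
Qed.

End Turan.

(** * Cocycles and potentials *)

Ltac bool_atom t := lazymatch t with true => fail | false => fail
  | addb _ _ => fail | negb _ => fail | _ => idtac end.
Ltac bool_ring := repeat match goal with
  | |- context [addb ?x ?y] => first [bool_atom x; destruct x | bool_atom y; destruct y]
  | |- context [negb ?x] => bool_atom x; destruct x
  end; try reflexivity; try done.

Section Cocycles.
Variable X : topologicalType.
Implicit Types (A B : set X) (n m : X -> X -> bool) (h k : X -> bool).

Definition addcoc n m : X -> X -> bool := fun p q => n p q (+) m p q.
Definition nul : X -> X -> bool := fun _ _ => false.

Definition potential A n h := forall x, A x -> exists2 U, nbhs x U &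
  forall p q, U p -> U q -> A p -> A q -> n p q = h p (+) h q.

(* Only the germ along the diagonal matters: the value of a cocycle at two distant
   points is junk. *)
Definition cocycle A n := forall x, A x -> exists (U : set X) h, nbhs x U /\
  forall p q, U p -> U q -> A p -> A q -> n p q = h p (+) h q.

Definition coboundary A n := exists h, potential A n h.

(** A potential of the zero cocycle is a locally constant function, so this is connectedness in the
    form in which potentials are compared. *)
Definition conn A := forall h, potential A nul h -> forall p q, A p -> A q -> h p = h q.

Lemma potential_sub A B n h : B `<=` A -> potential A n h -> potential B n h.
Proof.
move=> BA Ah x Bx; have [U Ux UP] := Ah x (BA _ Bx).
by exists U => // p q Up Uq /BA Ap /BA Aq; apply: UP.
Qed.

Lemma cocycle_sub A B n : B `<=` A -> cocycle A n -> cocycle B n.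
Proof.
move=> BA Ah x Bx; have [U [h [Ux UP]]] := Ah x (BA _ Bx).
by exists U, h; split=> // p q Up Uq /BA Ap /BA Aq; apply: UP.
Qed.

Lemma coboundary_sub A B n : B `<=` A -> coboundary A n -> coboundary B n.
Proof. by move=> BA [h Ah]; exists h; apply: potential_sub Ah. Qed.

Lemma potentialD A n m h k : potential A n h -> potential A m k ->
  potential A (addcoc n m) (fun x => h x (+) k x).
Proof.
move=> Ah Ak x Ax; have [U Ux UP] := Ah x Ax; have [V Vx VP] := Ak x Ax.
exists (U `&` V) => [|p q [Up Vp] [Uq Vq] Ap Aq]; first exact: filterI.
by rewrite /addcoc UP // VP // addbACA.
Qed.

Lemma cocycleD A n m : cocycle A n -> cocycle A m -> cocycle A (addcoc n m).
Proof.
move=> Ah Ak x Ax; have [U [h [Ux UP]]] := Ah x Ax.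
have [V [k [Vx VP]]] := Ak x Ax.
exists (U `&` V), (fun x => h x (+) k x).
split=> [|p q [Up Vp] [Uq Vq] Ap Aq]; first exact: filterI.
by rewrite /addcoc UP // VP // addbACA.
Qed.

Lemma coboundaryD A n m : coboundary A n -> coboundary A m -> coboundary A (addcoc n m).
Proof. by move=> [h Ah] [k Ak]; exists (fun x => h x (+) k x); exact: potentialD. Qed.

Lemma potential_eq A n m h k : (forall p q, A p -> A q -> n p q = m p q) ->
  (forall p, A p -> h p = k p) -> potential A n h -> potential A m k.
Proof.
move=> nm hk Ah x Ax; have [U Ux UP] := Ah x Ax.
by exists U => // p q Up Uq Ap Aq; rewrite -nm // UP // !hk.
Qed.

Lemma coboundary_eq A n m : (forall p q, A p -> A q -> n p q = m p q) ->
  coboundary A n -> coboundary A m.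
Proof. by move=> nm [h Ah]; exists h; apply: potential_eq Ah. Qed.

Lemma cocycle_eq A n m : (forall p q, A p -> A q -> n p q = m p q) ->
  cocycle A n -> cocycle A m.
Proof.
move=> nm An x Ax; have [U [h [Ux UP]]] := An x Ax.
by exists U, h; split=> // p q Up Uq Ap Aq; rewrite -nm // UP.
Qed.

Lemma coboundary_cancel A n m : coboundary A n -> coboundary A (addcoc n m) -> coboundary A m.
Proof.
move=> An Anm; apply: coboundary_eq (coboundaryD An Anm) => p q _ _.
by rewrite /addcoc addKb.
Qed.

Lemma potential_local A n h :
  (forall x, A x -> exists2 V, nbhs x V & potential (A `&` V) n h) -> potential A n h.
Proof.
move=> Ah x Ax; have [V Vx Vh] := Ah x Ax.
have [U Ux UP] := Vh x (conj Ax (nbhs_singleton Vx)).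
by exists (U `&` V) => [|p q [? ?] [? ?] ? ?]; [exact: filterI|exact: UP].
Qed.

Lemma potential_cst A n h b : potential A n h -> potential A n (fun x => h x (+) b).
Proof.
move=> Ah x Ax; have [U Ux UP] := Ah x Ax; exists U => // p q Up Uq Ap Aq.
by rewrite UP // addbACA addbb addbF.
Qed.

Lemma conn_potential A n h k p q : conn A -> potential A n h -> potential A n k ->
  A p -> A q -> h p (+) k p = h q (+) k q.
Proof.
move=> cA Ah Ak Ap Aq; apply: (cA (fun x => h x (+) k x)) => //.
apply: potential_eq (potentialD Ah Ak) => // a b _ _.
by rewrite /addcoc addbb.
Qed.

Lemma cocycle_refl A n p : cocycle A n -> A p -> n p p = false.
Proof.
move=> An Ap; have [U [h [Up UP]]] := An p Ap.
by rewrite UP ?addbb //; exact: nbhs_singleton.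
Qed.

Lemma conn_glue A B : conn A -> conn B -> (exists x, A x /\ B x) -> conn (A `|` B).
Proof.
move=> cA cB [x [Ax Bx]] h hh.
have hA := potential_sub (@subsetUl _ A B) hh.
have hB := potential_sub (@subsetUr _ A B) hh.
have aux y : (A `|` B) y -> h y = h x.
  by case=> [?|?]; [exact: (cA h hA)|exact: (cB h hB)].
by move=> p q /aux -> /aux ->.
Qed.

End Cocycles.
Arguments nul {X}.

Section Pullback.
Variables X Y : topologicalType.

(** Continuity relative to B, spelled out with neighbourhoods of the ambient space, which is how
    potentials are formulated as well. *)
Definition cont_on (B : set Y) (f : Y -> X) := forall y, B y -> forall U, nbhs (f y) U ->
  exists2 V, nbhs y V & forall z, V z -> B z -> U (f z).

Definition pull (f : Y -> X) (n : X -> X -> bool) : Y -> Y -> bool := fun p q => n (f p) (f q).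

Lemma cont_on_continuous (B : set Y) (f : Y -> X) :
  (forall y, B y -> {for y, continuous f}) -> cont_on B f.
Proof. by move=> fc y By U fU; exists (f @^-1` U) => //; exact: fc. Qed.

Lemma cont_on_within (B : set Y) (f : Y -> X) : {within B, continuous f} -> cont_on B f.
Proof.
move=> /subspace_continuousP fc y By U fU.
by exists [set z | B z -> U (f z)] => [|z]; [exact: (fc y By)|exact].
Qed.

Lemma pull_potential (A : set X) (B : set Y) f n h : (forall y, B y -> A (f y)) ->
  cont_on B f -> potential A n h -> potential B (pull f n) (h \o f).
Proof.
move=> BA fc Ah y By; have [U Ux UP] := Ah _ (BA y By).
have [V Vy VU] := fc y By U Ux; exists V => // p q Vp Vq Bp Bq.
by apply: UP; [exact: VU|exact: VU|exact: BA|exact: BA].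
Qed.

Lemma pull_cocycle (A : set X) (B : set Y) f n : (forall y, B y -> A (f y)) ->
  cont_on B f -> cocycle A n -> cocycle B (pull f n).
Proof.
move=> BA fc Ah y By; have [U [h [Ux UP]]] := Ah _ (BA y By).
have [V Vy VU] := fc y By U Ux; exists V, (h \o f); split=> // p q Vp Vq Bp Bq.
by apply: UP; [exact: VU|exact: VU|exact: BA|exact: BA].
Qed.

Lemma pull_coboundary (A : set X) (B : set Y) f n : (forall y, B y -> A (f y)) ->
  cont_on B f -> coboundary A n -> coboundary B (pull f n).
Proof. by move=> BA fc [h Ah]; exists (h \o f); exact: pull_potential Ah. Qed.

Lemma conn_image (A : set X) (B : set Y) f : (forall y, B y -> A (f y)) ->
  (forall x, A x -> exists2 y, B y & f y = x) -> cont_on B f -> conn B -> conn A.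
Proof.
move=> BA AB fc cB h Ah p q /AB[y By <-] /AB[z Bz <-].
exact: (cB (h \o f) (pull_potential BA fc Ah)).
Qed.

End Pullback.

(** * Integrals along paths and loops *)

Section Line.
Variable R : realType.
Implicit Types (a b c s t : R).

(** Real induction on the supremum of the points reached from a0. It replaces every subdivision of
    an interval into small pieces: a property of intervals that is additive and holds for small
    intervals around each point holds for the whole interval. *)
Lemma cousin (P : R -> R -> Prop) a0 b0 : a0 <= b0 ->
  (forall a b c, a0 <= a -> a <= b -> b <= c -> c <= b0 -> P a b -> P b c -> P a c) ->
  (forall x, a0 <= x -> x <= b0 -> exists2 e : R, 0 < e & forall a b, a0 <= a -> a <= x ->
     x <= b -> b <= b0 -> x - e < a -> b < x + e -> P a b) ->
  P a0 b0.
Proof.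
move=> ab Padd Ploc.
pose S := [set x | a0 <= x <= b0 /\ P a0 x].
have Sa : S a0.
  split; first by rewrite lexx ab.
  have [e e0 eP] := Ploc a0 (lexx _) ab.
  by apply: eP => //; lra.
have hS : has_sup S by split; [exists a0|exists b0 => x [/andP[]]].
have Sle := sup_upper_bound hS.
have as_ : a0 <= sup S by exact: Sle.
have sb : sup S <= b0 by apply: ge_sup; [exists a0|move=> x [/andP[]]].
have [e e0 eP] := Ploc _ as_ sb.
have [x [/andP[ax xb] Px] xs] := sup_adherent e0 hS.
have xS : x <= sup S by apply: Sle; split=> //; rewrite ax xb.
have [sb2|sb2] := leP (sup S + e / 2) b0.
  have : S (sup S + e / 2).
    split; first by apply/andP; split => //; lra.
    by apply: (Padd a0 x) => //; [lra|apply: eP => //; lra].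
  by move/Sle; lra.
by apply: (Padd a0 x) => //; apply: eP => //; lra.
Qed.

Lemma nbhs_realP t (U : set R) : nbhs t U ->
  exists2 e : R, 0 < e & forall s, t - e < s -> s < t + e -> U s.
Proof.
move=> /nbhs_ballP[e /= e0 eU]; exists e => // s ts st; apply: eU.
by rewrite /ball /= ltr_norml; apply/andP; split; lra.
Qed.

Lemma nbhs_real t e : 0 < e -> nbhs t [set s | t - e < s < t + e].
Proof.
move=> e0; apply/nbhs_ballP; exists e => //= s; rewrite /ball /= ltr_norml => /andP[? ?].
by apply/andP; split; lra.
Qed.

Lemma nbhs_itvR (a b t : R) : a < t -> t < b -> nbhs t [set s : R | a < s /\ s < b].
Proof.
move=> at_ tb; have h1 : 0 < t - a by lra.
have h2 : 0 < b - t by lra.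
apply: filterS (filterI (nbhs_real t h1) (nbhs_real t h2)) => s /= [/andP[? ?] /andP[? ?]].
by split; lra.
Qed.

Definition convexR (A : set R) := forall a b c, A a -> A c -> a <= b -> b <= c -> A b.

Lemma conn_convexR (A : set R) : convexR A -> conn A.
Proof.
move=> cA h Ah.
suff H a b : A a -> A b -> a <= b -> h a = h b.
  by move=> p q Ap Aq; case: (leP p q) => [|/ltW] /H -> //.
move=> Aa Ab ab; apply: (@cousin (fun x y => h x = h y)) => //.
  by move=> ? ? ? _ _ _ _ -> ->.
move=> x ax xb; have Ax : A x by apply: (cA a x b).
have [U Ux UP] := Ah x Ax; have [e e0 eU] := nbhs_realP Ux.
exists e => // s t as_ sx xt tb xs te.
have := UP s t; rewrite /nul.
case: (h s); case: (h t) => //= ->//; try (apply: eU; lra).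
- by apply: (cA a s b) => //; lra.
- by apply: (cA a t b) => //; lra.
- by apply: (cA a s b) => //; lra.
- by apply: (cA a t b) => //; lra.
Qed.

Definition Icc a b : set R := [set x | a <= x /\ x <= b].

Lemma conn_Icc a b : conn (Icc a b).
Proof. by apply: conn_convexR => x y z [? ?] [? ?] ? ?; split; lra. Qed.

Section PathIntegral.
Variable X : topologicalType.
Implicit Types (A : set X) (n m : X -> X -> bool) (f : R -> X).

(* A relation, since the integral v of n along f need not exist. *)
Definition pint n f a b (v : bool) := exists2 k, potential (Icc a b) (pull f n) k & k a (+) k b = v.

Lemma pint_uniq n f a b v w : a <= b -> pint n f a b v -> pint n f a b w -> v = w.
Proof.
move=> ab [h hh <-] [k kk <-].
have := conn_potential (p := a) (q := b) (@conn_Icc a b) hh kk.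
have [aa bb] : Icc a b a /\ Icc a b b by split; split; lra.
by move=> /(_ aa bb); bool_ring.
Qed.

(** The second potential is shifted to agree with the first at b. Two points on opposite sides of b
    are then compared through a local potential of the cocycle at b, which is why the cocycle
    condition on the union is required. *)
Lemma pint_cat n f a b c v w : a <= b -> b <= c -> cocycle (Icc a c) (pull f n) ->
  pint n f a b v -> pint n f b c w -> pint n f a c (v (+) w).
Proof.
move=> ab bc nc [h hh <-] [k kk <-].
pose g t := if t <= b then h t else k t (+) k b (+) h b.
exists g; last by rewrite /g ab; case: ifPn => [cb|_]; [have -> : c = b by lra|]; bool_ring.
move=> x [ax xc]; have [xb|xb|xb] := ltgtP x b.
- have [U Ux UP] := hh x (conj ax (ltW xb)).
  have b0 : 0 < b - x by lra.
  exists (U `&` [set s | x - (b - x) < s < x + (b - x)]).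
    by apply: filterI => //; exact: nbhs_real.
  move=> p q [Up /andP[p1 p2]] [Uq /andP[q1 q2]] [? ?] [? ?].
  by rewrite /g !ifT ?UP //; try split; lra.
- have [U Ux UP] := kk x (conj (ltW xb) xc).
  have b0 : 0 < x - b by lra.
  exists (U `&` [set s | x - (x - b) < s < x + (x - b)]).
    by apply: filterI => //; exact: nbhs_real.
  move=> p q [Up /andP[p1 p2]] [Uq /andP[q1 q2]] [? ?] [? ?].
  rewrite /g !ifF ?UP //; try (split; lra); try (apply/negbTE; rewrite -ltNge; lra).
  by bool_ring.
- subst x.
  have [U Ub UP] := hh b (conj ab (lexx _)).
  have [V Vb VP] := kk b (conj (lexx _) bc).
  have [W [l [Wb WP]]] := nc b (conj ab bc).
  have gl p : U p -> V p -> W p -> Icc a c p -> g p = l p (+) l b (+) h b.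
    move=> Up Vp Wp ip; have := WP p b Wp (nbhs_singleton Wb) ip (conj ab bc).
    have := nbhs_singleton Ub; have := nbhs_singleton Vb => Vb1 Ub1.
    rewrite /g; case: leP => pb <-.
      have i1 : Icc a b p by case: ip.
      have i2 : Icc a b b by [].
      by rewrite (UP p b) //; bool_ring.
    have i1 : Icc b c p by case: ip; split; lra.
    have i2 : Icc b c b by [].
    by rewrite (VP p b) //; bool_ring.
  exists (U `&` V `&` W) => [|p q [[Up Vp] Wp] [[Uq Vq] Wq] ip iq].
    by do 2?apply: filterI.
  by rewrite !gl // WP //; bool_ring.
Qed.

Lemma pint_exists n f a b : a <= b -> cocycle (Icc a b) (pull f n) -> exists v, pint n f a b v.
Proof.
move=> ab nc.
apply: (@cousin (fun s t => exists v, pint n f s t v)) => //.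
  move=> x y z ax xy yz zb [v vP] [w wP]; exists (v (+) w).
  apply: (pint_cat (b := y)) => //.
  by apply: cocycle_sub nc => t [? ?]; split; lra.
move=> x ax xb; have [U [h [Ux UP]]] := nc x (conj ax xb).
have [e e0 eU] := nbhs_realP Ux.
exists e => // s t as_ sx xt tb xs te; exists (h s (+) h t); exists h => // y [sy yt].
exists U.
  apply: (@filterS _ _ _ _ _ _ (@nbhs_itvR (x - e) (x + e) y _ _)) => [z [? ?]||].
  - exact: eU.
  - exact: lt_le_trans sy.
  - exact: le_lt_trans yt _.
by move=> p q Up Uq [? ?] [? ?]; apply: UP => //; split; lra.
Qed.

Lemma pint_diff A n h f a b : a <= b -> potential A n h -> (forall t, Icc a b t -> A (f t)) ->
  cont_on (Icc a b) f -> pint n f a b (h (f a) (+) h (f b)).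
Proof. by move=> ab Ah fA fc; exists (h \o f) => //; exact: pull_potential Ah. Qed.

End PathIntegral.
End Line.

(** * Continuity at a point *)

Definition cts (X Y : topologicalType) (f : X -> Y) x := {for x, continuous f}.

Section ContinuousAt.
Variable X : topologicalType.
Implicit Types (x : X).

Lemma cts_cst (Y : topologicalType) (c : Y) x : cts (fun=> c) x.
Proof. exact: cvg_cst. Qed.

Lemma cts_id x : cts (fun y => y) x.
Proof. exact: cvg_id. Qed.

Lemma cts_pair (Y Z : topologicalType) (f : X -> Y) (g : X -> Z) x :
  cts f x -> cts g x -> cts (fun x => (f x, g x)) x.
Proof.
move=> fc gc U [[P Q] /= [Px Qx] PQ].
have {}Px : nbhs x (f @^-1` P) := fc _ Px; have {}Qx : nbhs x (g @^-1` Q) := gc _ Qx.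
suff: nbhs x [set y | U (f y, g y)] by [].
by apply: filterS (filterI Px Qx) => y [Py Qy]; apply: PQ.
Qed.

Lemma cts_fst (Y Z : topologicalType) (f : X -> Y * Z) x : cts f x -> cts (fun x => (f x).1) x.
Proof. by move=> fc; exact: (cvg_comp _ _ fc cvg_fst). Qed.

Lemma cts_snd (Y Z : topologicalType) (f : X -> Y * Z) x : cts f x -> cts (fun x => (f x).2) x.
Proof. by move=> fc; exact: (cvg_comp _ _ fc cvg_snd). Qed.

Lemma cts_comp (Y Z : topologicalType) (f : X -> Y) (g : Y -> Z) x :
  cts f x -> cts g (f x) -> cts (fun x => g (f x)) x.
Proof. by move=> fc gc; exact: (cvg_comp _ _ fc gc). Qed.

Variable R : realType.
Implicit Types (f g : X -> R).

Lemma cts_add f g x : cts f x -> cts g x -> cts (fun x => f x + g x) x.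
Proof. by move=> fc gc; exact: cvgD. Qed.

Lemma cts_opp f x : cts f x -> cts (fun x => - f x) x.
Proof. by move=> fc; exact: cvgN. Qed.

Lemma cts_mul f g x : cts f x -> cts g x -> cts (fun x => f x * g x) x.
Proof. by move=> fc gc; exact: cvgM. Qed.

Lemma cts_exp f x (n : nat) : cts f x -> cts (fun x => f x ^+ n) x.
Proof.
move=> fc; elim: n => [|n IH]; first exact: cts_cst.
have -> : (fun x => f x ^+ n.+1) = (fun x => f x * f x ^+ n) by apply/funext => y; rewrite exprS.
exact: cts_mul.
Qed.

Lemma cts_inv f x : f x != 0 -> cts f x -> cts (fun x => (f x)^-1) x.
Proof. by move=> f0 fc; exact: cvgV. Qed.

Lemma cts_norm f x : cts f x -> cts (fun x => `|f x|) x.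
Proof. by move=> fc; exact: cvg_norm. Qed.

Lemma cts_sqrt f x : cts f x -> cts (fun x => Num.sqrt (f x)) x.
Proof. by move=> fc; apply: (cts_comp fc); exact: sqrt_continuous. Qed.

Lemma cts_prod (I : Type) (r : seq I) (F : I -> X -> R) x :
  (forall i, cts (F i) x) -> cts (fun x => \prod_(i <- r) F i x) x.
Proof.
move=> Fc; elim: r => [|i r IH].
  have -> : (fun x => \prod_(i <- [::]) F i x) = fun=> 1 by apply/funext => y; rewrite big_nil.
  exact: cts_cst.
have -> : (fun x => \prod_(j <- i :: r) F j x) = (fun x => F i x * \prod_(j <- r) F j x).
  by apply/funext => y; rewrite big_cons.
exact: cts_mul.
Qed.

Lemma cts_lt f g x : cts f x -> cts g x -> f x < g x -> nbhs x [set y | f y < g y].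
Proof.
move=> fc gc fg; pose c := (f x + g x) / 2.
have fU : nbhs (f x) [set s | s < c] by apply: lt_nbhsl; rewrite /c; lra.
have gU : nbhs (g x) [set s | c < s] by apply: lt_nbhsr; rewrite /c; lra.
have {}fU : nbhs x (f @^-1` [set s | s < c]) := fc _ fU.
have {}gU : nbhs x (g @^-1` [set s | c < s]) := gc _ gU.
by apply: filterS (filterI fU gU) => y [/= ? ?]; lra.
Qed.

End ContinuousAt.

Ltac cts := repeat first [ assumption | apply: cts_cst | apply: cts_id | apply: cts_pair
  | apply: cts_add | apply: cts_opp | apply: cts_mul | apply: cts_exp | apply: cts_norm
  | apply: cts_sqrt | apply: cts_prod => ? | apply: cts_inv | apply: cts_fst | apply: cts_snd ].

(** * Integration along the fibres of a homotopy and star-shaped sets *)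

Section Prism.
Variables (R : realType) (X Y : topologicalType).
Implicit Types (A : set X) (B : set Y) (n : X -> X -> bool) (K : Y -> R -> X).

Definition joint_cont B K := forall y t, B y -> Icc 0 1 t -> forall U, nbhs (K y t) U ->
  exists V (e : R), [/\ nbhs y V, 0 < e & forall z s, V z -> B z -> Icc 0 1 s ->
    t - e < s -> s < t + e -> U (K z s)].

Lemma joint_cont_continuous B (K : Y * R -> X) :
  (forall y t, B y -> Icc 0 1 t -> {for (y, t), continuous K}) ->
  joint_cont B (fun y t => K (y, t)).
Proof.
move=> Kc y t By it U KU; have [[P Q] /= [Py Qt] PQ] := Kc y t By it U KU.
have [e e0 eQ] := nbhs_realP Qt.
by exists P, e; split => // z s Pz _ _ ts st; apply: (PQ (z, s)); split=> //=; exact: eQ.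
Qed.

Lemma joint_cont_fiber B K y : joint_cont B K -> B y -> cont_on (Icc 0 1) (K y).
Proof.
move=> Kc By t it U KU; have [V [e [Vy e0 eU]]] := Kc y t By it U KU.
exists [set s | t - e < s < t + e]; first exact: nbhs_real.
by move=> s /andP[? ?] is_; apply: eU => //; exact: nbhs_singleton.
Qed.

(** The chain homotopy of a prism: the integral along the vertical paths is a potential for the
    difference of the restrictions to bottom and top. *)
Lemma prism A B n K (b : Y -> bool) : cocycle A n ->
  (forall y t, B y -> Icc 0 1 t -> A (K y t)) -> joint_cont B K ->
  (forall y, B y -> pint n (K y) 0 1 (b y)) ->
  potential B (fun y z => n (K y 0) (K z 0) (+) n (K y 1) (K z 1)) b.
Proof.
move=> nc KA Kc bP.
have fc y : B y -> cocycle (Icc 0 1) (pull (K y) n).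
  by move=> By; apply: (pull_cocycle _ _ nc) => [t|]; [exact: KA|exact: joint_cont_fiber Kc By].
move=> y By.
have [V [g [Vy gP gE]]] : exists (V : set Y) (g : Y -> bool), [/\ nbhs y V,
    forall z, V z -> B z -> pint n (K z) 0 1 (g z) &
    forall z z', V z -> V z' -> B z -> B z' ->
      n (K z 0) (K z' 0) (+) n (K z 1) (K z' 1) = g z (+) g z'].
  (* The point y is fixed and the induction runs over the time interval, so the neighbourhood V of y
     shrinks only finitely often. *)
  apply: (@cousin R (fun s t => exists (V : set Y) (g : Y -> bool), [/\ nbhs y V,
    forall z, V z -> B z -> pint n (K z) s t (g z) &
    forall z z', V z -> V z' -> B z -> B z' ->
      n (K z s) (K z' s) (+) n (K z t) (K z' t) = g z (+) g z'])) => //.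
    move=> r s t r0 rs st t1 [V [g [Vy gP gE]]] [W [k [Wy kP kE]]].
    exists (V `&` W), (fun z => g z (+) k z); split; first exact: filterI.
      move=> z [Vz Wz] Bz; apply: (pint_cat rs st _ (gP z Vz Bz) (kP z Wz Bz)).
      by apply: cocycle_sub (fc z Bz) => u [? ?]; split; lra.
    move=> z z' [Vz Wz] [Vz' Wz'] Bz Bz'.
    by rewrite addbACA -gE // -kE //; bool_ring.
  move=> x x0 x1; have ix : Icc 0 1 x by [].
  have [U [h [Ux UP]]] := nc _ (KA y x By ix).
  have [V [e [Vy e0 eU]]] := Kc y x By ix U Ux.
  exists e => // s t s0 sx xt t1 xs te.
  exists V, (fun z => h (K z s) (+) h (K z t)).
  have is1 : Icc 0 1 s by split; lra.
  have it1 : Icc 0 1 t by split; lra.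
  have UK z r : V z -> B z -> s <= r -> r <= t -> U (K z r).
    by move=> Vz Bz sr rt; apply: eU => //; try split; lra.
  split=> // [z Vz Bz|z z' Vz Vz' Bz Bz'].
    exists (fun r => h (K z r)) => // r _; exists setT; first exact: filterT.
    move=> p q _ _ [sp pt] [sq qt].
    have ip : Icc 0 1 p by split; lra.
    have iq : Icc 0 1 q by split; lra.
    by apply: UP; [exact: UK|exact: UK|exact: (KA z p Bz ip)|exact: (KA z q Bz iq)].
  have [ss tt] := (lexx s, lexx t); have st : s <= t by lra.
  have UE r : Icc 0 1 r -> s <= r -> r <= t ->
      n (K z r) (K z' r) = h (K z r) (+) h (K z' r).
    by move=> ir sr rt; apply: UP; [exact: UK|exact: UK|exact: (KA z r Bz ir)|exact: (KA z' r Bz' ir)].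
  by rewrite !UE // addbACA.
exists V => // z z' Vz Vz' Bz Bz'; rewrite gE //.
by rewrite (pint_uniq ler01 (gP z Vz Bz) (bP z Bz)) (pint_uniq ler01 (gP z' Vz' Bz') (bP z' Bz')).
Qed.

End Prism.

Section Plane.
Variable R : realType.
Local Notation P := (R * R)%type.
Implicit Types (A : set P) (x y v : P) (n : P -> P -> bool).

Lemma nbhs_boxP x (U : set P) : nbhs x U -> exists2 e : R, 0 < e &
  forall v, x.1 - e < v.1 -> v.1 < x.1 + e -> x.2 - e < v.2 -> v.2 < x.2 + e -> U v.
Proof.
case=> -[Q1 Q2] /= [Q1x Q2x] QU.
have [e e0 eQ] := nbhs_realP Q1x; have [f f0 fQ] := nbhs_realP Q2x.
exists (Num.min e f); first by rewrite lt_min e0.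
move=> v; case: (ltP e f) => ef *; apply: QU; split=> /=; [apply: eQ|apply: fQ|apply: eQ|apply: fQ]; lra.
Qed.

Lemma nbhs_box x (a b c d : R) : a < x.1 -> x.1 < b -> c < x.2 -> x.2 < d ->
  nbhs x [set v : P | [/\ a < v.1, v.1 < b, c < v.2 & v.2 < d]].
Proof.
move=> ax xb cx xd.
exists ([set s | a < s /\ s < b], [set s | c < s /\ s < d]) => /=.
  by split; exact: nbhs_itvR.
by move=> v [/= [? ?] [? ?]]; split.
Qed.

Definition star A c := A c /\ forall y t, A y -> 0 <= t -> t <= 1 ->
  A (c.1 + t * (y.1 - c.1), c.2 + t * (y.2 - c.2)).

Let K c (yt : P * R) : P :=
  (c.1 + yt.2 * (yt.1.1 - c.1), c.2 + yt.2 * (yt.1.2 - c.2)).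

Let Kcont c : continuous (K c).
Proof. by move=> yt; change (cts (K c) yt); rewrite /K; cts. Qed.

(** Poincare lemma: [prism] for the contraction to c. At time 0 the contraction is constant and
    contributes n c c, which is zero; at time 1 it is the identity. *)
Lemma star_coboundary A c n : star A c -> cocycle A n -> coboundary A n.
Proof.
move=> [Ac sA] nc.
have KA y t : A y -> Icc 0 1 t -> A (K c (y, t)) by move=> Ay [? ?]; exact: sA.
have jc : joint_cont A (fun y t => K c (y, t)).
  by apply: joint_cont_continuous => y t _ _; exact: Kcont.
have ex y : exists v : bool, A y -> pint n (fun t => K c (y, t)) 0 1 v.
  have [Ay|nAy] := pselect (A y); last by exists true.
  have pc : cocycle (Icc 0 1) (pull (fun t => K c (y, t)) n).
    by apply: (pull_cocycle _ _ nc) => [t|]; [exact: KA|exact: (joint_cont_fiber jc Ay)].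
  by have [v vP] := pint_exists ler01 pc; exists v.
have [b bP] := choice ex.
have := prism nc KA jc bP => bpot; exists b.
apply: potential_eq bpot => // p q Ap Aq.
rewrite /K /= !mul0r !addr0 !mul1r ![_ + (_ - _)]addrC !subrK.
by rewrite (cocycle_refl nc) //; [case: p Ap => ? ?; case: q Aq | case: c Ac {sA KA jc ex bP}].
Qed.

Lemma star_conn A c : star A c -> conn A.
Proof.
move=> [Ac sA] h Ah.
suff H y : A y -> h y = h c by move=> p q Ap Aq; rewrite H // H.
move=> Ay; pose f t := K c (y, t).
have fc : cont_on (Icc 0 1) f.
  apply: (@joint_cont_fiber R _ _ A (fun y t => K c (y, t))) => //.
  by apply: joint_cont_continuous => ? ? _ _; exact: Kcont.
have := @conn_Icc R 0 1 (h \o f) (pull_potential (A := A) _ fc Ah).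
move=> /(_ _ 0 1) => H.
have -> : y = f 1 by rewrite /f /K /= !mul1r ![_ + (_ - _)]addrC !subrK; case: (y).
have -> : c = f 0 by rewrite /f /K /= !mul0r !addr0; case: (c).
apply/esym/H; [by move=> t [? ?]; exact: sA|by split; lra|by split; lra].
Qed.

End Plane.

(** * The punctured plane *)

Section PuncturedPlane.
Variable R : realType.
Local Notation P := (R * R)%type.
Implicit Types (A : set P) (x y u v : P) (n : P -> P -> bool) (a b c d t M : R).

Lemma seg_gt a c (y : R) t : a < c -> a < y -> 0 <= t -> t <= 1 -> a < c + t * (y - c).
Proof.
move=> ac ay t0 t1; have -> : c + t * (y - c) = (1 - t) * c + t * y by ring.
have [->|tn] := eqVneq t 0; first by lra.
have : 0 < t by rewrite lt_neqAle eq_sym tn.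
nra.
Qed.

Lemma seg_lt a c (y : R) t : c < a -> y < a -> 0 <= t -> t <= 1 -> c + t * (y - c) < a.
Proof.
move=> ac ay t0 t1; have := @seg_gt (- a) (- c) (- y) t _ _ t0 t1.
have -> : - c + t * (- y - - c) = - (c + t * (y - c)) by ring.
by rewrite !ltrN2; apply.
Qed.

Definition box a b c d : set P := [set v | [/\ a < v.1, v.1 < b, c < v.2 & v.2 < d]].

Lemma star_box a b c d x : box a b c d x -> star (box a b c d) x.
Proof.
move=> bx; split=> // y t [y1 y2 y3 y4] t0 t1; case: bx => x1 x2 x3 x4.
by split; [exact: seg_gt|exact: seg_lt|exact: seg_gt|exact: seg_lt].
Qed.

Lemma conn_box a b c d : conn (box a b c d).
Proof. by move=> h hh p q bp bq; exact: (star_conn (star_box bp) hh). Qed.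

Definition sector (i : 'I_4) M : set P := [set v |
  match val i with 0%N => M < v.1 | 1%N => M < v.2 | 2%N => v.1 < - M | _ => v.2 < - M end].

Lemma star_sector i M x : sector i M x -> star (sector i M) x.
Proof.
move=> bx; split=> // y t; move: bx; rewrite /sector /=.
by case: i => -[|[|[|[|//]]]] _ /=; [exact: seg_gt|exact: seg_gt|exact: seg_lt|exact: seg_lt].
Qed.

Lemma conn_sector i M : conn (sector i M).
Proof. by move=> h hh p q bp bq; exact: (star_conn (star_sector bp) hh). Qed.

Definition outer M : set P := [set v | [\/ M < v.1, M < v.2, v.1 < - M | v.2 < - M]].

Lemma sector_outer M i : sector i M `<=` outer M.
Proof.
move=> v; rewrite /sector /=; case: i => -[|[|[|[|//]]]] _ /= ?;
by [apply: Or41|apply: Or42|apply: Or43|apply: Or44].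
Qed.

Lemma conn_outer M : 0 <= M -> conn (outer M).
Proof.
move=> M0 h hh.
have H i : forall p q, sector i M p -> sector i M q -> h p = h q.
  by apply: conn_sector; apply: potential_sub hh; exact: sector_outer.
have aux p q : M < p.2 -> M < q.2 -> h p = h q by exact: (H (@Ordinal 4 1 isT)).
have H2 p : outer M p -> h p = h (M + 1, M + 1).
  case=> Mp.
  - by apply: (H ord0) => //; rewrite /sector /=; lra.
  - by apply: aux => //=; lra.
  - rewrite (H (@Ordinal 4 2 isT) p (- M - 1, M + 1)) //; first by apply: aux => /=; lra.
    by rewrite /sector /=; lra.
  - rewrite (H ord_max p (M + 1, - M - 1)) //; last by rewrite /sector /=; lra.
    by apply: (H ord0) => //; rewrite /sector /=; lra.
by move=> p q op oq; rewrite H2 // H2.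
Qed.

(** The jump across the positive half of the first axis; its integral is the winding number around
    the origin modulo 2. *)
Definition chi u v := [&& 0 < u.1, 0 < v.1 & (u.2 < 0) (+) (v.2 < 0)].

Definition P0 : set P := [set v | ~ (v.1 = 0 /\ v.2 = 0)].
Definition slit : set P := [set v | ~ (0 <= v.1 /\ v.2 = 0)].
Definition right_half : set P := [set v | 0 < v.1].

Lemma chi_right : potential right_half chi (fun v => v.2 < 0).
Proof.
move=> x xr; exists setT => [|p q _ _ pr qr]; first exact: filterT.
by move: pr qr; rewrite /chi /right_half /= => -> ->.
Qed.

Lemma chi_slit : potential slit chi (fun=> false).
Proof.
move=> x xs; have [x2|x2|x2] := ltgtP x.2 0.
- exists (box (x.1 - 1) (x.1 + 1) (x.2 - 1) 0); first by apply: nbhs_box => //; lra.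
  by move=> p q [_ _ _ p2] [_ _ _ q2] _ _; rewrite /chi p2 q2 !andbF.
- exists (box (x.1 - 1) (x.1 + 1) 0 (x.2 + 1)); first by apply: nbhs_box => //; lra.
  by move=> p q [_ _ p2 _] [_ _ q2 _] _ _; rewrite /chi !(ltNge _ 0) !ltW // !andbF.
- have x1 : x.1 < 0 by rewrite ltNge; apply/negP => ?; apply: xs.
  exists (box (x.1 - 1) 0 (x.2 - 1) (x.2 + 1)); first by apply: nbhs_box => //; lra.
  by move=> p q [_ p1 _ _] [_ q1 _ _] _ _; rewrite /chi !(ltNge 0) !ltW.
Qed.

Lemma slit_nbhs x : slit x -> nbhs x slit.
Proof.
move=> xs; have [x2|x2|x2] := ltgtP x.2 0.
- apply: (@filterS _ _ _ (box (x.1 - 1) (x.1 + 1) (x.2 - 1) 0)).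
    by move=> v [_ _ _ v2] [_ e]; rewrite e ltxx in v2.
  by apply: nbhs_box => //; lra.
- apply: (@filterS _ _ _ (box (x.1 - 1) (x.1 + 1) 0 (x.2 + 1))).
    by move=> v [_ _ v2 _] [_ e]; rewrite e ltxx in v2.
  by apply: nbhs_box => //; lra.
- have x1 : x.1 < 0 by rewrite ltNge; apply/negP => ?; apply: xs.
  apply: (@filterS _ _ _ (box (x.1 - 1) 0 (x.2 - 1) (x.2 + 1))).
    by move=> v [_ v1 _ _] [e _]; rewrite leNgt v1 in e.
  by apply: nbhs_box => //; lra.
Qed.

Lemma right_nbhs x : right_half x -> nbhs x right_half.
Proof.
move=> x1; apply: (@filterS _ _ _ (box 0 (x.1 + 1) (x.2 - 1) (x.2 + 1))) => [v []//|].
by apply: nbhs_box => //; lra.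
Qed.

Lemma P0_cover x : P0 x -> slit x \/ right_half x.
Proof.
move=> x0; case: (ltP 0 x.1) => x1; [by right|left=> -[x1' x2]].
by apply: x0; split=> //; apply/eqP; rewrite eq_le x1 x1'.
Qed.

Lemma slit_P0 : slit `<=` P0.
Proof. by move=> v vs [v1 v2]; apply: vs; rewrite v1 v2. Qed.

Lemma right_P0 : right_half `<=` P0.
Proof. by move=> v; rewrite /right_half /= => v0 [v1 _]; rewrite v1 ltxx in v0. Qed.

Lemma star_slit : star slit (-1, 0).
Proof.
split=> [[/= ? _]|y t ys t0 t1 /= []]; first by lra.
rewrite add0r subr0 opprK => /= h1 h2.
have [tz|tn] := eqVneq t 0; first by move: h1; rewrite tz mul0r; lra.
have y2 : y.2 = 0 by move/eqP: h2; rewrite mulf_eq0 (negPf tn) => /eqP.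
have y1 : y.1 < 0 by rewrite ltNge; apply/negP => ?; apply: ys.
have : 0 < t by rewrite lt_neqAle eq_sym tn.
nra.
Qed.

Lemma star_right : star right_half (1, 0).
Proof. by split=> [|y t ? ? ?]; [rewrite /right_half /=; lra|exact: seg_gt]. Qed.

(** Mayer-Vietoris for the star-shaped sets [slit] and [right_half], which meet in two open
    quadrants. Two potentials differ by a constant on each quadrant, and only the sum of both
    constants matters. *)
Lemma punctured_class n : cocycle P0 n ->
  exists m : bool, coboundary P0 (fun u v => n u v (+) (m && chi u v)).
Proof.
move=> nc.
have [h hh] := star_coboundary star_slit (cocycle_sub slit_P0 nc).
have [k kk] := star_coboundary star_right (cocycle_sub right_P0 nc).
pose up : P := (1, 1); pose dn : P := (1, -1).
have [c1 c1E] : exists c : bool, h up (+) k up = c by exists (h up (+) k up).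
have [c2 c2E] : exists c : bool, h dn (+) k dn = c by exists (h dn (+) k dn).
have hk1 v : 0 < v.1 -> 0 < v.2 -> h v = k v (+) c1.
  have cq : conn [set v : P | 0 < v.1 /\ 0 < v.2].
    apply: (@star_conn _ _ up); split=> [|y t [? ?] ? ?]; first by split => /=; lra.
    by split; apply: seg_gt => //=; lra.
  have s1 : [set v : P | 0 < v.1 /\ 0 < v.2] `<=` slit by move=> w [? ?] [? ?]; lra.
  have s2 : [set v : P | 0 < v.1 /\ 0 < v.2] `<=` right_half by move=> w [].
  have iu : [set v : P | 0 < v.1 /\ 0 < v.2] up by split => /=; lra.
  move=> v1 v2; have iv : [set v : P | 0 < v.1 /\ 0 < v.2] v by [].
  have := conn_potential cq (potential_sub s1 hh) (potential_sub s2 kk) iv iu.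
  by rewrite c1E => <-; bool_ring.
have hk2 v : 0 < v.1 -> v.2 < 0 -> h v = k v (+) c2.
  have cq : conn [set v : P | 0 < v.1 /\ v.2 < 0].
    apply: (@star_conn _ _ dn); split=> [|y t [? ?] ? ?]; first by split => /=; lra.
    by split; [apply: seg_gt|apply: seg_lt] => //=; lra.
  have s1 : [set v : P | 0 < v.1 /\ v.2 < 0] `<=` slit by move=> w [? ?] [? ?]; lra.
  have s2 : [set v : P | 0 < v.1 /\ v.2 < 0] `<=` right_half by move=> w [].
  have iu : [set v : P | 0 < v.1 /\ v.2 < 0] dn by split => /=; lra.
  move=> v1 v2; have iv : [set v : P | 0 < v.1 /\ v.2 < 0] v by [].
  have := conn_potential cq (potential_sub s1 hh) (potential_sub s2 kk) iv iu.
  by rewrite c2E => <-; bool_ring.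
(* The class is nontrivial exactly when the two constants differ; in that case [chi] makes up for
   the difference below the axis. *)
pose m := c1 (+) c2; exists m.
pose l v := if 0 < v.1 then k v (+) (m && (v.2 < 0)) (+) c1 else h v.
exists l; apply: potential_local => x /P0_cover[xs|xr].
- exists slit; first exact: slit_nbhs.
  apply: (potential_sub (@subIsetr _ _ _)).
  have mchi : potential slit (fun u v => m && chi u v) (fun=> false).
    by move=> y ys; have [U Uy UP] := chi_slit ys; exists U => // p q *; rewrite UP // andbF.
  apply: potential_eq (potentialD hh mchi) => // v vs; rewrite addbF /l.
  case: ltP => // v1; have [v2|v2|v2] := ltgtP v.2 0.
  + by rewrite hk2 // andbT /m; bool_ring.
  + by rewrite hk1 // andbF; bool_ring.
  + by exfalso; apply: vs; rewrite v2 ltW.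
- exists right_half; first exact: right_nbhs.
  apply: (potential_sub (@subIsetr _ _ _)).
  have mchi : potential right_half (fun u v => m && chi u v) (fun v => m && (v.2 < 0)).
    move=> y ys; have [U Uy UP] := chi_right ys; exists U => // p q *; rewrite UP //.
    by case: (m).
  apply: potential_eq (potential_cst c1 (potentialD kk mchi)) => // v vs.
  by rewrite /l vs.
Qed.

Definition ann a b : set P := [set v | [/\ - b < v.1, v.1 < b, - b < v.2, v.2 < b & outer a v]].

(** A tour around the annulus through four boxes: on the upper, left and lower box [chi] vanishes,
    so a potential would be constant there, whereas the right box forces a change. The bounds a and
    b are free, so the class survives both near the origin and near infinity. *)
Lemma chi_not_coboundary a b : 0 <= a -> a < b -> ~ coboundary (ann a b) chi.
Proof.
move=> a0 ab [h hh]; pose m := (a + b) / 2.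
have [am mb] : a < m /\ m < b by rewrite /m; lra.
have H (D : set P) (p q : P) : D `<=` ann a b -> (exists r s t w : R, D = box r s t w) ->
    (forall u v, D u -> D v -> chi u v = false) -> D p -> D q -> h p = h q.
  move=> Da [r [s [t [w Dbox]]]] Dchi Dp Dq.
  have cD : conn D by rewrite Dbox; exact: conn_box.
  by apply: cD => //; apply: potential_eq (potential_sub Da hh).
have top : h (m, m) = h (- m, m).
  apply: (H (box (-b) b a b)); last 2 first.
  - by split=> /=; lra.
  - by split=> /=; lra.
  - by move=> v [? ? ? ?]; split; [..|apply: Or42]; lra.
  - by exists (-b), b, a, b.
  - move=> u v [_ _ u2 _] [_ _ v2 _]; rewrite /chi !(ltNge _ 0) !ltW ?andbF //; lra.
have left_ : h (- m, m) = h (- m, - m).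
  apply: (H (box (-b) (-a) (-b) b)); last 2 first.
  - by split=> /=; lra.
  - by split=> /=; lra.
  - by move=> v [? ? ? ?]; split; [..|apply: Or43]; lra.
  - by exists (-b), (-a), (-b), b.
  - by move=> u v [_ u1 _ _] [_ v1 _ _]; rewrite /chi !(ltNge 0) !ltW //; lra.
have bot : h (- m, - m) = h (m, - m).
  apply: (H (box (-b) b (-b) (-a))); last 2 first.
  - by split=> /=; lra.
  - by split=> /=; lra.
  - by move=> v [? ? ? ?]; split; [..|apply: Or44]; lra.
  - by exists (-b), b, (-b), (-a).
  - move=> u v [_ _ _ u2] [_ _ _ v2].
    have u0 : u.2 < 0 by lra.
    have v0 : v.2 < 0 by lra.
    by rewrite /chi u0 v0 !andbF.
have br : box a b (-b) b `<=` ann a b.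
  by move=> v [? ? ? ?]; split; [..|apply: Or41]; lra.
have br2 : box a b (-b) b `<=` right_half by move=> v [? _ _ _]; rewrite /right_half /=; lra.
have := conn_potential (p := (m, m)) (q := (m, - m)) (@conn_box a b (-b) b) (potential_sub br hh)
  (potential_sub br2 chi_right).
have b1 : box a b (-b) b (m, m) by split=> /=; lra.
have b2 : box a b (-b) b (m, -m) by split=> /=; lra.
have m0 : (m < 0) = false by apply/negbTE; rewrite -leNgt; lra.
have m1 : - m < 0 by lra.
by rewrite top left_ bot /= m0 m1 => /(_ b1 b2); case: (h _).
Qed.

Lemma ann_outer a b : ann a b `<=` outer a. Proof. by move=> v []. Qed.

Lemma outer_P0 M : 0 <= M -> outer M `<=` P0.
Proof. by move=> M0 v ov [v1 v2]; case: ov; rewrite ?v1 ?v2; lra. Qed.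

Lemma P0_coboundary (D : set P) a b n : 0 <= a -> a < b -> ann a b `<=` D -> D `<=` P0 ->
  cocycle P0 n -> coboundary D n -> coboundary P0 n.
Proof.
move=> a0 ab aD D0 nc Dn; have [[] mn] := punctured_class nc; last first.
  by apply: coboundary_eq mn => u v _ _; rewrite addbF.
exfalso; apply: (@chi_not_coboundary a b) => //; apply: (coboundary_sub aD).
exact: coboundary_cancel Dn (coboundary_sub D0 mn).
Qed.

(** This is how potentials cross a complementary disk (Z the plane) or once-punctured disk (Z =
    [P0]). Triviality near infinity forces triviality on all of Z, since [chi] is detected on any
    annulus; as [outer M] is connected, the new potential can be shifted to agree with the given
    one. *)
Lemma extend_outer (Z : set P) n M k : Z = setT \/ Z = P0 -> 0 <= M -> cocycle Z n ->
  potential (outer M) n k -> exists2 h, potential Z n h & forall v, outer M v -> h v = k v.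
Proof.
move=> HZ M0 nc ok.
have oZ : outer M `<=` Z by case: HZ => -> //; exact: outer_P0.
have [h hh] : coboundary Z n.
  case: HZ => E; move: nc; rewrite E => nc.
    by apply: (@star_coboundary _ _ (0, 0)).
  apply: (@P0_coboundary (outer M) M (M + 1)) => //; first by lra.
  - exact: ann_outer.
  - exact: outer_P0.
  - by exists k.
pose w : P := (M + 1, 0).
have ow : outer M w by apply: Or41 => /=; lra.
exists (fun v => h v (+) (h w (+) k w)); first exact: potential_cst.
move=> v ov; have := conn_potential (conn_outer M0) (potential_sub oZ hh) ok ov ow.
by move=> <-; bool_ring.
Qed.

End PuncturedPlane.

(** * Integrals along loops and their homotopy invariance *)

Section Loops.
Variables (R : realType) (X : topologicalType).
Implicit Types (n m : X -> X -> bool) (c : R -> X) (A : set X).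

Definition loop c := (forall t, cts c t) /\ forall t, c (t + 1) = c t.

Lemma line_coboundary (n : R -> R -> bool) : cocycle setT n -> coboundary setT n.
Proof.
move=> nc; pose pr (v : R * R) : R := v.1.
have prc : cont_on setT pr.
  by apply: cont_on_continuous => v _; change (cts pr v); rewrite /pr; cts.
have [k kk] : coboundary setT (pull pr n).
  by apply: (@star_coboundary _ _ (0, 0)) => //; apply: pull_cocycle prc nc.
exists (k \o (fun t : R => (t, 0))).
apply: (@pull_potential _ _ setT setT (fun t : R => (t, 0)) _ _ _ _ kk) => //.
by apply: cont_on_continuous => v _; change (cts (fun t : R => (t, 0 : R)) v); cts.
Qed.

(** The circle is unrolled to the line, where every cocycle has a potential; the integral is the
    change of this potential over one period. *)
Definition oint n c (v : bool) := exists2 k, potential setT (pull c n) k &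
  forall t, k (t + 1) (+) k t = v.

Lemma loop_cont_on c (A : set R) : loop c -> cont_on A c.
Proof. by case=> cc _; apply: cont_on_continuous => t _; exact: cc. Qed.

Lemma conn_line : conn [set: R].
Proof. exact: conn_convexR. Qed.

Lemma loop_potential_period n c k : loop c -> potential setT (pull c n) k ->
  forall t, k (t + 1) (+) k t = k 1 (+) k 0.
Proof.
move=> [_ c1] kk t.
have k1 : potential setT (pull c n) (fun t => k (t + 1)).
  have := @pull_potential _ _ setT setT (fun t : R => t + 1) _ _ _ _ kk.
  move=> /(_ (fun _ _ => I)) H; apply: (potential_eq _ _ (H _)) => //.
    by move=> p q _ _; rewrite /pull !c1.
  by apply: cont_on_continuous => u _; change (cts (fun t : R => t + 1) u); cts.
have := conn_potential conn_line k1 kk (I : setT t) (I : setT 0).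
by rewrite add0r.
Qed.

Lemma oint_exists n c A : loop c -> (forall t, A (c t)) -> cocycle A n -> exists v, oint n c v.
Proof.
move=> lc cA nc.
have [k kk] : coboundary setT (pull c n).
  by apply: line_coboundary; apply: (pull_cocycle _ _ nc) => //; exact: loop_cont_on.
by exists (k 1 (+) k 0), k => //; exact: loop_potential_period lc kk.
Qed.

Lemma oint_uniq n c v w : oint n c v -> oint n c w -> v = w.
Proof.
move=> [h hh hv] [k kk kw].
have := conn_potential conn_line hh kk (I : setT 0) (I : setT 1).
rewrite -(hv 0) -(kw 0) add0r.
by case: (h 0); case: (h 1); case: (k 0); case: (k 1).
Qed.

Lemma ointD n m c v w : oint n c v -> oint m c w -> oint (addcoc n m) c (v (+) w).
Proof.
move=> [h hh hv] [k kk kw]; exists (fun t => h t (+) k t).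
  exact: potentialD hh kk.
by move=> t; rewrite -(hv t) -(kw t) addbACA.
Qed.

Lemma oint_coboundary n c A : loop c -> (forall t, A (c t)) -> coboundary A n -> oint n c false.
Proof.
move=> lc cA [h hh]; exists (h \o c) => [|t]; last by case: lc => _ c1 /=; rewrite c1 addbb.
by apply: (pull_potential _ _ hh) => //; exact: loop_cont_on.
Qed.

Lemma oint_cohomologous n m c A v : loop c -> (forall t, A (c t)) ->
  coboundary A (addcoc n m) -> oint n c v -> oint m c v.
Proof.
move=> lc cA nm nv; have := ointD nv (oint_coboundary lc cA nm).
rewrite addbF => -[k kk kv]; exists k => //; apply: potential_eq kk => // p q _ _.
by rewrite /pull /addcoc addKb.
Qed.

Lemma oint_cst n x : cocycle setT n -> oint n (fun _ : R => x) false.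
Proof.
move=> nc; exists (fun=> false) => // t _; exists setT; first exact: filterT.
by move=> p q _ _ _ _; rewrite /pull (cocycle_refl nc).
Qed.

(** The pullback to the plane has a potential k, and shifting k by one period gives another one.
    They differ by a single constant, which is the integral along every stage of the homotopy. *)
Lemma oint_homotopy n (H : R * R -> X) v : (forall u, cts H u) ->
  (forall s t, H (s, t + 1) = H (s, t)) -> cocycle setT n ->
  oint n (fun t => H (0, t)) v -> oint n (fun t => H (1, t)) v.
Proof.
move=> Hc H1 nc [l ll lv].
have Hcont : cont_on setT H by apply: cont_on_continuous => u _; exact: Hc.
have [k kk] : coboundary setT (pull H n).
  by apply: (@star_coboundary _ _ (0, 0)) => //; apply: pull_cocycle Hcont nc.
pose sh (u : R * R) : R * R := (u.1, u.2 + 1).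
have k1 : potential setT (pull H n) (k \o sh).
  have := @pull_potential _ _ setT setT sh _ _ _ _ kk.
  move=> /(_ (fun _ _ => I)) E; apply: (potential_eq _ _ (E _)) => //.
    by move=> [p p'] [q q'] _ _; rewrite /pull !H1.
  by apply: cont_on_continuous => u _; change (cts sh u); rewrite /sh; cts.
have cP : conn [set: R * R] by exact: (@star_conn _ _ (0, 0)).
have slice s : potential setT (pull (fun t => H (s, t)) n) (fun t => k (s, t)).
  apply: (@pull_potential _ _ setT setT (fun t => (s, t)) _ _ _ _ kk) => //.
  by apply: cont_on_continuous => u _; change (cts (fun t : R => (s, t)) u); cts.
exists (fun t => k (1, t)) => // t.
have := conn_potential cP k1 kk (I : setT (1, t)) (I : setT (0, 0)).
rewrite /sh /= => ->.
have := conn_potential conn_line ll (slice 0) (I : setT (0 + 1)) (I : setT 0).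
by rewrite -(lv 0); case: (l _); case: (l _); case: (k _); case: (k _).
Qed.

End Loops.

(** * Compact connected surfaces *)

Section Surfaces.
Variable R : realType.
Local Notation P := (R * R)%type.

(** Charts are onto the whole plane, so that chart domains and their punctured versions are
    connected with known cohomology and no radius has to be carried along. *)
Definition chart (T : topologicalType) (U : set T) (f : T -> P) (h : P -> T) : Prop :=
  [/\ forall x, U x -> nbhs x U, forall x, U x -> h (f x) = x,
      forall v, U (h v), forall v, f (h v) = v &
      (forall x, U x -> cts f x) /\ (forall v, cts h v)].

(** The metric serves for uniform radii on the compact space. Neither the genus nor an orientation
    is recorded, so the construction of dual cocycles and their symmetry hold for every closed
    surface with such a metric. *)
Record surface (T : topologicalType) (d : T -> T -> R) : Prop := Surface {
  dist_refl : forall x, d x x = 0;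
  dist_gt0 : forall x y, x <> y -> 0 < d x y;
  dist_sym : forall x y, d x y = d y x;
  dist_tri : forall x y z, d x z <= d x y + d y z;
  dist_nbhs : forall x U, nbhs x U <-> exists2 e : R, 0 < e & forall y, d x y < e -> U y;
  surface_compact : compact [set: T];
  surface_conn : conn [set: T];
  surface_chart : forall (q : T) (V : set T), nbhs q V -> exists (U : set T) f h,
    [/\ chart U f h, U q, f q = (0, 0) & U `<=` V] }.

Section Charts.
Variables (T : topologicalType) (U : set T) (f : T -> P) (h : P -> T).
Hypothesis cUfh : chart U f h.
Implicit Types (n : T -> T -> bool) (A : set T).

Let h_cont B : cont_on B h.
Proof. by case: cUfh => _ _ _ _ [_ hc]; apply: cont_on_continuous => v _; exact: hc. Qed.

Lemma chart_nbhs x : U x -> nbhs x U. Proof. by case: cUfh => + _ _ _ _; exact. Qed.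
Lemma chartK x : U x -> h (f x) = x. Proof. by case: cUfh => _ + _ _ _; exact. Qed.
Lemma chart_in v : U (h v). Proof. by case: cUfh. Qed.
Lemma chartKV v : f (h v) = v. Proof. by case: cUfh => _ _ _ + _. Qed.
Lemma chart_cts x : U x -> cts f x. Proof. by case: cUfh => _ _ _ _ [+ _]; exact. Qed.
Lemma chart_inv_cts v : cts h v. Proof. by case: cUfh => _ _ _ _ [_ +]; exact. Qed.

Lemma chart_pull_cocycle A B n : (forall v, B v -> A (h v)) -> cocycle A n ->
  cocycle B (pull h n).
Proof. by move=> BA; apply: pull_cocycle. Qed.

Lemma chart_pull_potential A B n k : (forall v, B v -> A (h v)) -> potential A n k ->
  potential B (pull h n) (k \o h).
Proof. by move=> BA; apply: pull_potential. Qed.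

Lemma chart_push_potential A B n k : A `<=` U -> (forall x, A x -> B (f x)) ->
  potential B (pull h n) k -> potential A n (k \o f).
Proof.
move=> AU AB kk.
have fc : cont_on A f by apply: cont_on_continuous => x /AU; exact: chart_cts.
apply: potential_eq (pull_potential AB fc kk) => // p q /AU Up /AU Uq.
by rewrite /pull !chartK.
Qed.

Lemma conn_chart : conn U.
Proof.
apply: (@conn_image _ _ _ setT h) => //; first by move=> v _; exact: chart_in.
  by move=> x Ux; exists (f x) => //; rewrite chartK.
exact: (@star_conn _ _ (0, 0)).
Qed.

Lemma conn_P0 : conn (@P0 R).
Proof.
have -> : @P0 R = @slit R `|` @right_half R.
  apply/seteqP; split=> [v /P0_cover//|v [|]]; [exact: slit_P0|exact: right_P0].
apply: conn_glue; [exact: star_conn (star_slit R)|exact: star_conn (star_right R)|].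
by exists (1, 1); split; [case=> _ /= ?|rewrite /right_half /=]; lra.
Qed.

Lemma chart_P0 q : f q = (0, 0) -> U q -> forall v, P0 v -> (U `\ q) (h v).
Proof.
move=> fq Uq v v0; split; first exact: chart_in.
move=> hq; apply: v0; have : f (h v) = f q by rewrite hq.
by rewrite chartKV fq => ->.
Qed.

Lemma P0_chart q : f q = (0, 0) -> U q -> forall x, (U `\ q) x -> P0 (f x).
Proof.
move=> fq Uq x [Ux xq] [e1 e2]; apply: xq; rewrite -(chartK Ux) -(chartK Uq) fq.
by congr h; rewrite [f x]surjective_pairing e1 e2.
Qed.

Lemma conn_punctured_chart q : f q = (0, 0) -> U q -> conn (U `\ q).
Proof.
move=> fq Uq; apply: (@conn_image _ _ _ (@P0 R) h) => //; last exact: conn_P0.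
  exact: chart_P0.
by move=> x Ux; exists (f x); [exact: P0_chart Ux|rewrite chartK //; case: Ux].
Qed.

End Charts.
End Surfaces.

(** * Dual cocycles of simple loops *)

Section Surface.
Variables (R : realType) (T : topologicalType) (d : T -> T -> R).
Hypothesis sT : surface d.
Local Notation P := (R * R)%type.
Implicit Types (n m : T -> T -> bool) (A K U V O : set T) (p q x y : T).

Lemma ball_nbhs x (e : R) : 0 < e -> nbhs x [set y | d x y < e].
Proof. by move=> e0; apply/(dist_nbhs sT); exists e. Qed.

Lemma surface_hausdorff : hausdorff_space T.
Proof.
move=> x y xy; apply: contrapT => /(dist_gt0 sT) xy0.
have h0 : 0 < d x y / 2 by lra.
have [z [/= xz yz]] := xy _ _ (ball_nbhs x h0) (ball_nbhs y h0).
have := dist_tri sT x z y; rewrite (dist_sym sT z y); lra.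
Qed.

Lemma compact_nbhsC K x : compact K -> ~ K x -> nbhs x (~` K).
Proof.
move=> Kc Kx; apply: open_nbhs_nbhs; split => //.
by apply: closed_openC; exact: compact_closed surface_hausdorff Kc.
Qed.

Lemma closed_compact_surface K : closed K -> compact K.
Proof. by move=> Kc; apply: (subclosed_compact Kc (surface_compact sT)). Qed.

(** Existence of a Lebesgue number, for any property of points and radii that is inherited by
    smaller radii. *)
Lemma unif (Pr : T -> R -> Prop) :
  (forall x e e', 0 < e' -> e' <= e -> Pr x e -> Pr x e') ->
  (forall x, exists2 e, 0 < e & forall y, d x y < e -> Pr y e) ->
  exists2 e, 0 < e & forall x, Pr x e.
Proof.
move=> Pmon Ploc.
have [+ _] := @compact_near_coveringP T [set: T].
move=> /(_ (surface_compact sT)) cov.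
have := cov R (0^'+) (fun e x => Pr x e) _.
move=> /(_ _)[].
  move=> x _; have [e e0 eP] := Ploc x.
  exists ([set y | d x y < e], [set e' | 0 < e' < e]) => /=.
    split; first exact: ball_nbhs.
    near=> z; apply/andP; split; near: z; [exact: nbhs_right_gt|exact: nbhs_right_lt].
  move=> [y e'] [/= dy /andP[e'0 e'e]].
  by apply: (Pmon y e) => //; [exact: ltW|exact: eP].
move=> e /= e0 eP; exists (e / 2); first by lra.
by move=> x; apply: eP => //=; rewrite ?sub0r ?normrN ?gtr0_norm; lra.
Unshelve. all: by end_near. Qed.

Definition cbox (M : R) : set P := [set v | [/\ - M <= v.1, v.1 <= M, - M <= v.2 & v.2 <= M]].

Lemma cbox_compact M : compact (cbox M).
Proof.
have -> : cbox M = [set` `[- M, M]] `*` [set` `[- M, M]].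
  apply/seteqP; split=> v /=; rewrite !in_itv /=.
    by move=> [-> -> -> ->].
  by move=> [/andP[? ?] /andP[? ?]]; split.
by apply: compact_setX; exact: segment_compact.
Qed.

Lemma outerE M v : outer M v <-> ~ cbox M v.
Proof.
split; first by case=> ? [? ? ? ?]; lra.
move=> nb; apply: contrapT => no; apply: nb.
split; rewrite leNgt; apply/negP => ?; apply: no;
  by [apply: Or43|apply: Or41|apply: Or44|apply: Or42].
Qed.

Section ChartCompact.
Variables (U : set T) (f : T -> P) (h : P -> T).
Hypothesis cUfh : chart U f h.

Lemma chart_cbox_compact M : compact (h @` cbox M).
Proof.
apply: continuous_compact; last exact: cbox_compact.
by apply: continuous_subspaceT => v; exact: chart_inv_cts cUfh v.
Qed.

Lemma chart_bounded K : closed K -> K `<=` U -> exists2 M, 0 <= M & forall x, K x -> cbox M (f x).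
Proof.
move=> Kc KU.
have [e e0 eP] : exists2 e, 0 < e & forall x, K x -> e * `|(f x).1| < 1 /\ e * `|(f x).2| < 1.
  apply: (@unif (fun x e => K x -> e * `|(f x).1| < 1 /\ e * `|(f x).2| < 1)).
    move=> x e e' e'0 e'e H /H[h1 h2]; split.
      by apply: le_lt_trans h1; apply: ler_wpM2r.
    by apply: le_lt_trans h2; apply: ler_wpM2r.
  move=> x; have [Kx|Kx] := pselect (K x); last first.
    have : nbhs x (~` K) by apply: compact_nbhsC => //; exact: closed_compact_surface.
    by move=> /(dist_nbhs sT)[e e0 eK]; exists e => // y /eK.
  pose c := `|(f x).1| + `|(f x).2| + 1.
  have c0 : 0 < c by rewrite /c; have := normr_ge0 (f x).1; have := normr_ge0 (f x).2; lra.
  have fc := chart_cts cUfh (KU _ Kx).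
  have : nbhs x [set y | `|(f y).1| < c] by apply: cts_lt; [cts|cts|rewrite /c; have := normr_ge0 (f x).2; lra].
  have : nbhs x [set y | `|(f y).2| < c] by apply: cts_lt; [cts|cts|rewrite /c; have := normr_ge0 (f x).1; lra].
  move=> /(dist_nbhs sT)[e1 e10 e1P] /(dist_nbhs sT)[e2 e20 e2P].
  pose e := Num.min c^-1 (Num.min e1 e2).
  have ec : e <= c^-1 by rewrite ge_min lexx.
  have ee1 : e <= e1 by rewrite !ge_min lexx !orbT.
  have ee2 : e <= e2 by rewrite !ge_min lexx !orbT.
  have e0 : 0 < e by rewrite !lt_min invr_gt0 c0 e10.
  exists e => // y xy _.
  have b1 : `|(f y).1| < c by apply: e2P; lra.
  have b2 : `|(f y).2| < c by apply: e1P; lra.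
  have key a : 0 <= a -> a < c -> e * a < 1.
    move=> a0 ac; have : e * c <= 1 by rewrite -ler_pdivlMr // div1r.
    have : e * a < e * c by rewrite ltr_pM2l.
    lra.
  by split; apply: key.
exists e^-1; first by rewrite invr_ge0 ltW.
move=> x /eP[h1 h2].
have b1 : `|(f x).1| <= e^-1 by rewrite -[e^-1]mulr1 ler_pdivlMl // ltW.
have b2 : `|(f x).2| <= e^-1 by rewrite -[e^-1]mulr1 ler_pdivlMl // ltW.
by move: b1 b2; rewrite !ler_norml => /andP[? ?] /andP[? ?]; split.
Qed.

End ChartCompact.

Definition locally_zero n x := exists2 U, nbhs x U & forall p q, U p -> U q -> n p q = false.
Definition supp_in n (D : set T) := forall x, ~ D x -> locally_zero n x.

Lemma locally_zero_potential n A : (forall x, A x -> locally_zero n x) ->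
  potential A n (fun=> false).
Proof. by move=> An x /An[U Ux UP]; exists U => // p q Up Uq _ _; rewrite UP. Qed.

Lemma locally_zeroD n m x : locally_zero n x -> locally_zero m x -> locally_zero (addcoc n m) x.
Proof.
move=> [U Ux UP] [V Vx VP]; exists (U `&` V); first exact: filterI.
by move=> p q [Up Vp] [Uq Vq]; rewrite /addcoc UP // VP.
Qed.

Lemma supp_in_sub n D D' : D `<=` D' -> supp_in n D -> supp_in n D'.
Proof. by move=> DD nD x Dx; apply: nD => /DD. Qed.

(** Vanishing of the residue at q: a cocycle is allowed to be singular at q, and only the punctured
    neighbourhood counts. *)
Definition triv q n := exists2 V, nbhs q V & coboundary (V `\ q) n.

Lemma triv_sub q n m V : nbhs q V -> coboundary (V `\ q) (addcoc n m) -> triv q n -> triv q m.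
Proof.
move=> Vq nm [W Wq Wn]; exists (V `&` W); first exact: filterI.
have s1 : (V `&` W) `\ q `<=` W `\ q by move=> x [[]].
have s2 : (V `&` W) `\ q `<=` V `\ q by move=> x [[]].
exact: coboundary_cancel (coboundary_sub s1 Wn) (coboundary_sub s2 nm).
Qed.

Lemma trivD q n m : triv q n -> triv q m -> triv q (addcoc n m).
Proof.
move=> [V Vq Vn] [W Wq Wn]; exists (V `&` W); first exact: filterI.
by apply: coboundaryD; [apply: coboundary_sub Vn|apply: coboundary_sub Wn] => x [[]].
Qed.

Lemma coboundary_addC A n m : coboundary A (addcoc n m) -> coboundary A (addcoc m n).
Proof. by apply: coboundary_eq => p q _ _; rewrite /addcoc addbC. Qed.

Lemma cocycle_triv A q n : A q -> cocycle A n -> nbhs q A -> triv q n.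
Proof.
move=> Aq nA qA; have [U [h [Uq UP]]] := nA q Aq.
exists (U `&` A); first exact: filterI.
exists h => x [[Ux Ax] _]; exists setT; first exact: filterT.
by move=> a b _ _ [[Ua Aa] _] [[Ub Ab] _]; exact: UP.
Qed.

Lemma locally_zero_triv q n : locally_zero n q -> triv q n.
Proof.
move=> [U Uq UP]; exists U => //; exists (fun=> false) => x _.
by exists setT; [exact: filterT|move=> a b _ _ [? _] [? _]; rewrite UP].
Qed.

(** Residues live in F_2 by [punctured_class], so two nonzero ones cancel. This is the addition rule
    behind all manipulations of kernels. *)
Lemma not_triv_add q V n m : nbhs q V -> cocycle (V `\ q) n -> cocycle (V `\ q) m ->
  ~ triv q n -> ~ triv q m -> triv q (addcoc n m).
Proof.
move=> Vq nc mc nt mt; have [U [f [h [cU Uq fq UV]]]] := surface_chart sT Vq.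
have hV v : P0 v -> (V `\ q) (h v).
  by move=> v0; have [? ?] := chart_P0 cU fq Uq v0; split=> //; exact: UV.
have key l : cocycle (V `\ q) l -> ~ triv q l -> coboundary (@P0 R) (addcoc (pull h l) (@chi R)).
  move=> lc lt; have [[] hm] := punctured_class (chart_pull_cocycle cU hV lc).
    by apply: coboundary_eq hm.
  exfalso; apply: lt; exists U; first exact: chart_nbhs cU _ Uq.
  have {hm}[k kk] := hm; exists (k \o f).
  apply: (chart_push_potential cU _ (P0_chart cU fq Uq)) => [x []//|].
  by apply: potential_eq kk => // a b _ _; rewrite addbF.
exists U; first exact: chart_nbhs cU _ Uq.
have [k kk] := coboundaryD (key n nc nt) (key m mc mt); exists (k \o f).
apply: (chart_push_potential cU _ (P0_chart cU fq Uq)) => [x []//|].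
by apply: potential_eq kk => // a b _ _; rewrite /addcoc addbACA addbb addbF.
Qed.

Lemma not_triv_addr q n m : ~ triv q n -> triv q m -> ~ triv q (addcoc n m).
Proof.
move=> nt mt nmt; apply: nt.
have [V Vq VP] := trivD nmt mt; exists V => //.
by apply: coboundary_eq VP => a b _ _; rewrite /addcoc -addbA addbb addbF.
Qed.

(** A punctured chart domain is connected, so the given potential differs from a local potential at
    q by a constant, which prescribes the value at q. *)
Lemma extend_point A q n k : A q -> nbhs q A -> cocycle A n -> potential (A `\ q) n k ->
  exists2 k', potential A n k' & forall x, x <> q -> k' x = k x.
Proof.
move=> Aq qA nc kk; have [W [l [Wq WP]]] := nc q Aq.
have [U [f [h [cU Uq fq UV]]]] := surface_chart sT (filterI Wq qA).
have [x [Ux xq]] : exists x, (U `\ q) x.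
  exists (h (1, 0)); apply: (chart_P0 cU fq Uq) => -[/= /eqP].
  by rewrite oner_eq0.
have ll : potential (U `\ q) n l.
  move=> y _; exists setT; first exact: filterT.
  by move=> a b _ _ [/UV[Wa Aa] _] [/UV[Wb Ab] _]; exact: WP.
have kU : potential (U `\ q) n k.
  by apply: potential_sub kk => y [/UV[_ Ay] yq].
pose c := k x (+) l x.
have klE y : (U `\ q) y -> k y = l y (+) c.
  move=> Uy; have := conn_potential (conn_punctured_chart cU fq Uq) kU ll Uy (conj Ux xq).
  by rewrite /c => <-; bool_ring.
exists (fun y => if `[< y = q >] then l q (+) c else k y); last first.
  by move=> y yq; rewrite asboolF.
move=> y Ay; have [yq|yq] := pselect (y = q).
  exists U; first by rewrite yq; exact: chart_nbhs cU _ Uq.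
  have aux a : U a -> (if `[< a = q >] then l q (+) c else k a) = l a (+) c.
    by move=> Ua; case: asboolP => [->//|aq]; rewrite klE.
  move=> a b Ua Ub Aa Ab; rewrite !aux // addbACA addbb addbF.
  by have [Wa _] := UV a Ua; have [Wb _] := UV b Ub; exact: WP.
have [V Vy VP] := kk y (conj Ay yq).
exists (V `&` [set z | d y z < d y q]).
  by apply: filterI => //; apply: ball_nbhs; exact: dist_gt0.
have nq a : [set z | d y z < d y q] a -> a <> q by move=> /= + E; rewrite E ltxx.
move=> a b [Va /nq aq] [Vb /nq bq] Aa Ab; rewrite !asboolF //; exact: VP.
Qed.

(** A singularity without residue is removed by subtracting the coboundary of a local potential cut
    off outside a small ball around q. Inside the ball the new cocycle is zero, outside it nothing
    changes. *)
Lemma removal A q n O : nbhs q O -> cocycle (A `\ q) n -> triv q n ->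
  exists n' g, [/\ cocycle A n', potential (A `\ q) (addcoc n n') g &
    forall x, ~ O x -> exists2 W, nbhs x W & forall u v, W u -> W v -> n' u v = n u v].
Proof.
move=> Oq nc [V Vq [k kk]].
have [r0 r00 rP] := (dist_nbhs sT _ _).1 (filterI Oq Vq).
(* The cut happens at radius r while k stays available up to 2 r, so both sides of the cut are
   covered by the same local potential. *)
pose r := r0 / 2; have r_gt0 : 0 < r by rewrite /r; lra.
pose B x := d q x < r.
have BV x : d q x < 2 * r -> O x /\ V x by move=> xr; apply: rP; rewrite /r in xr; lra.
pose g x := B x && k x.
pose n' u v := if B u && B v then false else n u v (+) g u (+) g v.
have dtri x y : d q x <= d q y + d y x by exact: dist_tri.
have Bo x : B x -> nbhs x [set y | B y].
  move=> Bx; have h0 : 0 < r - d q x by rewrite subr_gt0.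
  by apply: filterS (ball_nbhs x h0) => y /= xy; rewrite /B; have := dtri y x; lra.
have Vo x : d q x < 2 * r -> nbhs x [set y | d q y < 2 * r].
  move=> Bx; have h0 : 0 < 2 * r - d q x by rewrite subr_gt0.
  by apply: filterS (ball_nbhs x h0) => y /= xy; have := dtri y x; lra.
have Bc (x : T) : r < d q x -> nbhs x [set y | r < d q y].
  move=> Bx; have h0 : 0 < d q x - r by rewrite subr_gt0.
  by apply: filterS (ball_nbhs x h0) => y /= xy; have := dtri x y; rewrite (dist_sym sT y x); lra.
have n'E u v : r < d q u -> r < d q v -> n' u v = n u v.
  move=> ru rv; have Bu : B u = false by apply/negbTE; rewrite -leNgt ltW.
  have Bv : B v = false by apply/negbTE; rewrite -leNgt ltW.
  by rewrite /n' /g Bu Bv /= !addbF.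
have far x : r < d q x -> exists2 W, nbhs x W & forall u v, W u -> W v -> n' u v = n u v.
  by move=> rx; exists [set y | r < d q y]; [exact: Bc|exact: n'E].
have near_ x : x <> q -> d q x < 2 * r -> exists2 W, nbhs x W & forall u v, W u -> W v ->
    (n' u v = n u v (+) g u (+) g v /\ n u v = k u (+) k v).
  move=> xq xr; have [_ Vx] := BV x xr.
  have [U Ux UP] := kk x (conj Vx xq).
  have xq0 := dist_gt0 sT xq.
  exists (U `&` [set y | d q y < 2 * r] `&` [set y | d x y < d x q]).
    by apply: filterI; [apply: filterI => //; exact: Vo|exact: ball_nbhs].
  have nq a : [set z | d x z < d x q] a -> a <> q by move=> /= + E; rewrite E ltxx.
  move=> u v [[Uu ru] /nq uq] [[Uv rv] /nq vq].
  have [_ Vu] := BV u ru; have [_ Vv] := BV v rv.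
  have E := UP u v Uu Uv (conj Vu uq) (conj Vv vq).
  split=> //; rewrite /n' /g; case: ifPn => // /andP[Bu Bv].
  by rewrite Bu Bv E /=; bool_ring.
exists n', g; split.
- move=> x Ax; have [Bx|Bx] := boolP (B x).
    exists [set y | B y], (fun=> false); split; first exact: Bo.
    by move=> u v /= Bu Bv _ _; rewrite /n' Bu Bv.
  have rx : r <= d q x by rewrite leNgt.
  have xq : x <> q by move=> E; move: rx; rewrite E (dist_refl sT); lra.
  have [x2|x2] := ltP (d q x) (2 * r).
    have [W Wx WP] := near_ x xq x2.
    exists W, (fun y => k y (+) g y); split=> // u v Wu Wv _ _.
    by have [-> ->] := WP u v Wu Wv; bool_ring.
  have [U [l [Ux UP]]] := nc x (conj Ax xq).
  have rx2 : r < d q x by lra.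
  exists (U `&` [set y | r < d q y]), l; split; first by apply: filterI => //; exact: Bc.
  have nq a : r < d q a -> a <> q by move=> + E; rewrite E (dist_refl sT); lra.
  move=> u v [Uu ru] [Uv rv] Au Av; rewrite n'E // UP //; split=> //; exact: nq.
- move=> x [Ax xq]; have [x2|x2] := ltP (d q x) (2 * r).
    have [W Wx WP] := near_ x xq x2; exists W => // u v Wu Wv _ _.
    by rewrite /addcoc; have [-> _] := WP u v Wu Wv; bool_ring.
  have rx2 : r < d q x by lra.
  exists [set y | r < d q y]; first exact: Bc.
  move=> u v /= ru rv _ _; rewrite /addcoc n'E // addbb /g.
  have Bu : B u = false by apply/negbTE; rewrite -leNgt ltW.
  have Bv : B v = false by apply/negbTE; rewrite -leNgt ltW.
  by rewrite Bu Bv.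
- move=> x Ox; apply: far; rewrite ltNge; apply/negP => xr; apply: Ox.
  by have [] := BV x _ => //; lra.
Qed.

End Surface.

(** * Cocycles with finitely many singularities *)

Section Kernels.
Variables (R : realType) (T : topologicalType) (d : T -> T -> R).
Hypothesis sT : surface d.
Local Notation P := (R * R)%type.
Implicit Types (n m : T -> T -> bool) (A K U V O D : set T) (p q x y : T) (F : seq T).

Definition off F : set T := [set x | x \notin F].

Lemma off_nbhs F q : nbhs q [set x : T | x \in F -> x = q].
Proof.
elim: F => [|a F IH]; first by apply: (@filterS _ _ _ setT); [move=> x _|exact: filterT].
have [->|aq] := pselect (a = q).
  by apply: filterS IH => x /= H; rewrite in_cons => /orP[/eqP//|]; exact: H.
have h0 : 0 < d q a by apply: (dist_gt0 sT) => E; exact: aq.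
have B := ball_nbhs sT _ h0.
suff : nbhs q ([set x | x \in F -> x = q] `&` [set y | d q y < d q a]).
  apply: filterS => x /= [H xa].
  by rewrite in_cons => /orP[/eqP E|]; [rewrite E ltxx in xa|exact: H].
exact: filterI.
Qed.

Lemma removal_seq F n O : (forall q, q \in F -> nbhs q O /\ triv q n) ->
  cocycle (off F) n ->
  exists n' g, [/\ cocycle setT n', potential (off F) (addcoc n n') g &
    forall x, ~ O x -> exists2 W, nbhs x W & forall u v, W u -> W v -> n' u v = n u v].
Proof.
elim: F n => [|q F IH] n Ft nc.
  exists n, (fun=> false); split.
  - by apply: cocycle_sub nc => x _ /=.
  - by move=> x _; exists setT => [|u v _ _ _ _]; [exact: filterT|rewrite /addcoc addbb].
  - by move=> x _; exists setT => //; exact: filterT.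
have [qF|qF] := boolP (q \in F).
  have E : off (q :: F) = off F.
    apply/seteqP; split=> x; rewrite /off /= in_cons negb_or; first by case/andP.
    by move=> xF; rewrite xF andbT; apply: contraNneq xF => ->.
  by rewrite E in nc *; apply: IH => // x xF; apply: Ft; rewrite in_cons xF orbT.
have E : off (q :: F) = off F `\ q.
  apply/seteqP; split=> x; rewrite /off /= in_cons negb_or.
    by move=> /andP[/eqP xq xF]; split.
  by move=> [xF /eqP xq]; rewrite xq.
rewrite E in nc *.
have [Oq tq] := Ft q (mem_head _ _).
have [n1 [g1 [c1 p1 l1]]] := removal sT Oq nc tq.
have [|n2 [g2 [c2 p2 l2]]] := IH n1 _ c1.
  move=> x xF; have [|Ox tx] := Ft x; first by rewrite in_cons xF orbT.
  split=> //; apply: (triv_sub (off_nbhs (q :: F) x) _ tx); exists g1.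
  apply: potential_sub p1 => y [yF yx].
  have : off (q :: F) y by apply/negP => /yF; exact: yx.
  by rewrite E.
exists n2, (fun x => g1 x (+) g2 x); split=> //.
  have s : off F `\ q `<=` off F by move=> x [].
  apply: potential_eq (potentialD p1 (potential_sub s p2)) => // u v _ _.
  by rewrite /addcoc; bool_ring.
move=> x Ox; have [W1 W1x W1P] := l1 x Ox; have [W2 W2x W2P] := l2 x Ox.
exists (W1 `&` W2); first exact: filterI.
by move=> u v [? ?] [? ?]; rewrite W2P // W1P.
Qed.

(** In the chart the cocycle vanishes near infinity, so by [extend_outer] it has a potential that is
    zero there; this potential extends by zero to the surface. *)
Lemma small_support U (f : T -> P) (h : P -> T) K n : chart U f h -> closed K -> K `<=` U -> cocycle setT n ->
  supp_in n K -> coboundary setT n.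
Proof.
move=> cU Kc KU nc nK; have [M M0 KM] := chart_bounded sT cU Kc KU.
have hK v : outer M v -> ~ K (h v).
  by move=> /outerE ov /KM; rewrite (chartKV cU); exact: ov.
have Z : [set: P] = setT \/ [set: P] = @P0 R by left.
have pc : cocycle [set: P] (pull h n) by exact: (chart_pull_cocycle cU _ nc).
have p0 : potential (outer M) (pull h n) (fun=> false).
  apply: (chart_pull_potential cU (A := ~` K) (k := fun=> false)) => //.
  exact: locally_zero_potential.
have [k kk k0] := extend_outer Z M0 pc p0.
exists (fun x => `[< U x >] && k (f x)).
move=> x _; have [Ux|Ux] := pselect (U x).
  have kf : potential U n (k \o f) by exact: (chart_push_potential cU _ _ kk).
  have [W Wx WP] := kf x Ux; exists (W `&` U) => [|u v [Wu Uu] [Wv Uv] _ _].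
    by apply: filterI => //; exact: chart_nbhs cU _ Ux.
  by rewrite !asboolT // WP.
have [W Wx WP] := nK x (fun Kx => Ux (KU _ Kx)).
have xM : ~ (h @` cbox M) x by case=> v _ hv; apply: Ux; rewrite -hv; exact: (chart_in cU).
exists (W `&` ~` (h @` cbox M)).
  by apply: filterI => //; apply: (compact_nbhsC sT) => //; exact: chart_cbox_compact cU M.
have aux u : ~ (h @` cbox M) u -> `[< U u >] && k (f u) = false.
  move=> uM; case: asboolP => //= Uu; rewrite k0 //.
  by apply/outerE => ?; apply: uM; exists (f u) => //; rewrite (chartK cU).
by move=> u v [Wu /aux uM] [Wv /aux vM] _ _; rewrite uM vM WP.
Qed.

Lemma closed_ball_closed p (r : R) : closed [set x | d p x <= r].
Proof.
rewrite -openC openE => x /= /negP; rewrite -ltNge => rx.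
have h0 : 0 < d p x - r by lra.
apply: filterS (ball_nbhs sT _ h0) => y /= xy; apply/negP; rewrite -ltNge.
by have := dist_tri sT p y x; rewrite (dist_sym sT y x); lra.
Qed.

(** This is the source of all uniqueness: a cocycle supported in a small disk is determined, up to
    coboundaries, by its residues. Residue-free singularities are removed and [small_support]
    applies to the rest. *)
Lemma chain_zero U (f : T -> P) (h : P -> T) p (r1 r : R) F m : chart U f h -> (forall x, d p x < r -> U x) ->
  r1 < r -> cocycle (off F) m -> (forall q, q \in F -> d p q < r1 /\ triv q m) ->
  supp_in m [set x | d p x < r1] -> coboundary (off F) m.
Proof.
move=> cU rU r1r mc Fm ms.
have [q qF|n' [g [nc ng nl]]] := @removal_seq F m [set x | d p x < r1] _ mc.
  have [qr tq] := Fm q qF; split=> //.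
  have h0 : 0 < r1 - d p q by lra.
  by apply: filterS (ball_nbhs sT _ h0) => y /= qy; have := dist_tri sT p q y; lra.
have : coboundary setT n'.
  apply: (small_support cU (@closed_ball_closed p r1) _ nc).
    by move=> x /= xr; apply: rU; lra.
  move=> x xr; have xr1 : ~ [set x | d p x < r1] x by move=> /= ?; apply: xr => /=; lra.
  have [W Wx WP] := nl x xr1; have [V Vx VP] := ms x xr1.
  by exists (W `&` V) => [|u v [? ?] [? ?]]; [exact: filterI|rewrite WP // VP].
move=> /(coboundary_sub (@subsetT _ (off F))) n'c.
by apply: coboundary_cancel n'c _; apply: coboundary_addC; exists g.
Qed.

(* The class that detects whether a path from p to q inside D is crossed. *)
Definition kernel p q D n := [/\ cocycle (off [:: p; q]) n, ~ triv p n, ~ triv q n & supp_in n D].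

Lemma kernel_sub p q D D' n : D `<=` D' -> kernel p q D n -> kernel p q D' n.
Proof. by move=> DD [? ? ? ?]; split=> //; apply: supp_in_sub DD _. Qed.

Lemma kernel_sym p q D n : kernel p q D n -> kernel q p D n.
Proof.
move=> [nc ? ? ?]; split=> //; apply: cocycle_sub nc => x; rewrite /off /= !inE !negb_or.
by rewrite andbC.
Qed.

Lemma off_nbhs_sub F q V : (forall x, V x -> x \in F -> x = q) -> V `\ q `<=` off F.
Proof. by move=> H x [Vx xq]; apply/negP => xF; apply: xq; apply: H. Qed.

Lemma not_triv_add_off F q n m : cocycle (off F) n -> cocycle (off F) m ->
  ~ triv q n -> ~ triv q m -> triv q (addcoc n m).
Proof.
move=> nc mc; apply: (not_triv_add sT (off_nbhs F q)).
  by apply: cocycle_sub nc; exact: off_nbhs_sub.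
by apply: cocycle_sub mc; exact: off_nbhs_sub.
Qed.

Lemma cocycle_triv_off F q n : cocycle (off F) n -> q \notin F -> triv q n.
Proof.
move=> nc qF; apply: (cocycle_triv (A := off F)) => //.
apply: filterS (off_nbhs F q) => x /= H; apply/negP => xF.
by rewrite -(H xF) xF in qF.
Qed.

Lemma off_sub F F' : {subset F <= F'} -> off F' `<=` off F.
Proof. by move=> FF x; apply: contra; exact: FF. Qed.

(* Two kernels sharing an end point cancel there, as H^1 of a punctured disk is F_2. *)
Lemma kernel_comp p q r D n m : p <> q -> q <> r -> p <> r -> kernel p q D n -> kernel q r D m ->
  [/\ cocycle (off [:: p; q; r]) (addcoc n m), ~ triv p (addcoc n m),
      triv q (addcoc n m), ~ triv r (addcoc n m) & supp_in (addcoc n m) D].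
Proof.
move=> /eqP pq /eqP qr /eqP pr [nc np nq ns] [mc mq mr ms].
have s1 : off [:: p; q; r] `<=` off [:: p; q].
  by apply: off_sub => x; rewrite !inE => /orP[] ->; rewrite ?orbT.
have s2 : off [:: p; q; r] `<=` off [:: q; r].
  by apply: off_sub => x; rewrite !inE => /orP[] ->; rewrite ?orbT.
have nc' := cocycle_sub s1 nc; have mc' := cocycle_sub s2 mc.
split.
- exact: cocycleD.
- apply: not_triv_addr => //; apply: (cocycle_triv_off mc).
  by rewrite !inE negb_or pq.
- exact: (not_triv_add_off nc' mc').
- have tn : triv r n by apply: (cocycle_triv_off nc); rewrite !inE negb_or eq_sym pr eq_sym qr.
  move=> H; apply: mr; have [V Vr VP] := trivD tn H; exists V => //.
  by apply: coboundary_eq VP => a b _ _; rewrite /addcoc addKb.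
- by move=> x xD; apply: locally_zeroD; [exact: ns|exact: ms].
Qed.

End Kernels.

(** * The model kernel in the plane *)

Section Cuts.
Variable R : realType.
Local Notation P := (R * R)%type.
Implicit Types (u v : P).

Definition cut_box v := [&& 0 < v.1, v.1 < 1, - 1 < v.2 & v.2 < 1].
(** The jump across the unit segment. Near each end point it looks like [chi], up to a reflection,
    hence both residues are nonzero; the surrounding box keeps the rest of the line from being
    cut. *)
Definition xcut u v := [&& cut_box u, cut_box v & (u.2 < 0) (+) (v.2 < 0)].

Definition segment01 : set P := [set v | [/\ 0 <= v.1, v.1 <= 1 & v.2 = 0]].

Lemma cut_inner : potential (box 0 1 (-1) 1) xcut (fun v : P => v.2 < 0).
Proof.
move=> x _; exists setT => [|u v _ _ [u1 u2 u3 u4] [v1 v2 v3 v4]]; first exact: filterT.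
by rewrite /xcut /cut_box u1 u2 u3 u4 v1 v2 v3 v4.
Qed.

Lemma cut_supp (v : P) : ~ segment01 v -> exists2 U, nbhs v U &
  forall a b, U a -> U b -> xcut a b = false.
Proof.
move=> vS; have [v2|v2|v2] := ltgtP v.2 0.
- exists (box (v.1 - 1) (v.1 + 1) (v.2 - 1) 0); first by apply: nbhs_box => //; lra.
  by move=> a b [_ _ _ a2] [_ _ _ b2]; rewrite /xcut a2 b2 !andbF.
- exists (box (v.1 - 1) (v.1 + 1) 0 (v.2 + 1)); first by apply: nbhs_box => //; lra.
  by move=> a b [_ _ a2 _] [_ _ b2 _]; rewrite /xcut !(ltNge _ 0) !ltW // !andbF.
- have [v1|v1] := ltP v.1 0.
    exists (box (v.1 - 1) 0 (v.2 - 1) (v.2 + 1)); first by apply: nbhs_box => //; lra.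
    by move=> a b [_ a1 _ _] [_ b1 _ _]; rewrite /xcut /cut_box !(ltNge 0) !ltW.
  have [v1'|v1'] := ltP 1 v.1.
    exists (box 1 (v.1 + 1) (v.2 - 1) (v.2 + 1)); first by apply: nbhs_box => //; lra.
    by move=> a b [a1 _ _ _] [b1 _ _ _]; rewrite /xcut /cut_box !(ltNge _ 1) (ltW a1) /= andbF.
  by exfalso; apply: vS.
Qed.

Lemma cut_cocycle : cocycle [set v : P | v <> (0, 0) /\ v <> (1, 0)] xcut.
Proof.
move=> v [v0 v1]; have [vS|vS] := pselect (segment01 v); last first.
  by have [U Uv UP] := cut_supp vS; exists U, (fun=> false); split=> // p q ? ? _ _; exact: UP.
have [a b c] := vS.
have a' : 0 < v.1.
  by rewrite lt_neqAle a andbT; apply/eqP => E; apply: v0; rewrite [v]surjective_pairing -E c.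
have b' : v.1 < 1.
  by rewrite lt_neqAle b andbT; apply/eqP => E; apply: v1; rewrite [v]surjective_pairing E c.
have vb : box 0 1 (-1) 1 v by split=> //; lra.
have [U Uv UP] := cut_inner vb.
exists (U `&` box 0 1 (-1) 1), (fun v : P => v.2 < 0); split.
  by apply: filterI => //; case: vb => *; exact: nbhs_box.
by move=> p q [Up pb] [Uq qb] _ _; exact: UP.
Qed.

Lemma ann_sub (e : R) : ann 0 e `<=` @P0 R `&` box (- e) e (- e) e.
Proof. by move=> v [? ? ? ? ov]; split; [exact: outer_P0 ov|split]. Qed.

Lemma cut_not_triv0 V : nbhs ((0, 0) : P) V -> ~ coboundary (V `\ ((0, 0) : P)) xcut.
Proof.
move=> /nbhs_boxP[e /= e0 eV] Vc.
pose e' := Num.min e 1; have e'0 : 0 < e' by rewrite lt_min e0 ltr01.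
have e'e : e' <= e by rewrite ge_min lexx.
have e'1 : e' <= 1 by rewrite ge_min lexx orbT.
apply: (@chi_not_coboundary R 0 e') => //.
have s : ann 0 e' `<=` V `\ ((0, 0) : P).
  move=> v /ann_sub[v0 [? ? ? ?]]; split; first by apply: eV; lra.
  by move=> E; apply: v0; rewrite E.
apply: coboundary_eq (coboundary_sub s Vc) => u v [u1 u2 u3 u4 _] [v1 v2 v3 v4 _].
rewrite /xcut /cut_box /chi.
have -> : u.1 < 1 by lra.
have -> : - 1 < u.2 by lra.
have -> : u.2 < 1 by lra.
have -> : v.1 < 1 by lra.
have -> : - 1 < v.2 by lra.
have -> : v.2 < 1 by lra.
by rewrite !andbT.
Qed.

Lemma cut_not_triv1 V : nbhs ((1, 0) : P) V -> ~ coboundary (V `\ ((1, 0) : P)) xcut.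
Proof.
move=> V1 Vc; pose r v : P := (1 - v.1, v.2).
have rc v : cts r v by rewrite /r; cts.
have r0 : r (0, 0) = (1, 0) by rewrite /r /= subr0.
apply: (@cut_not_triv0 (r @^-1` V)); first by apply: rc; rewrite r0.
have := @pull_coboundary _ _ _ ((r @^-1` V) `\ ((0, 0) : P)) r _ _ _ Vc.
move=> /(_ _ _)[].
- move=> v [rv v0]; split=> // E; apply: v0.
  move: E; rewrite /r => -[E1 E2]; rewrite [v]surjective_pairing E2.
  by congr (_, _); lra.
- by apply: cont_on_continuous => v _; exact: rc.
move=> k kk; exists k; apply: potential_eq kk => // a b _ _.
have box_r v : cut_box (r v) = cut_box v.
  rewrite /cut_box /r /= subr_gt0 ltrBlDr -ltrBlDl subrr.
  by rewrite andbCA.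
by rewrite /pull /xcut !box_r.
Qed.

End Cuts.

Section Dual.
Variables (R : realType) (T : topologicalType) (d : T -> T -> R).
Hypothesis sT : surface d.
Local Notation P := (R * R)%type.
Implicit Types (n m : T -> T -> bool) (A K U V O D : set T) (p q x y : T) (F : seq T).

Lemma cdivK1 (a b w1 w2 : R) : w1 ^+ 2 + w2 ^+ 2 != 0 ->
  w1 * ((a * w1 + b * w2) / (w1 ^+ 2 + w2 ^+ 2)) -
  w2 * ((b * w1 - a * w2) / (w1 ^+ 2 + w2 ^+ 2)) = a.
Proof. by move=> D0; field. Qed.

Lemma cdivK2 (a b w1 w2 : R) : w1 ^+ 2 + w2 ^+ 2 != 0 ->
  w2 * ((a * w1 + b * w2) / (w1 ^+ 2 + w2 ^+ 2)) +
  w1 * ((b * w1 - a * w2) / (w1 ^+ 2 + w2 ^+ 2)) = b.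
Proof. by move=> D0; field. Qed.

(** With the plane read as the complex numbers, [f'] is the quotient (f - f p) / (f q - f p), and
    [h'] undoes it by multiplication with w. *)
Lemma chart_affine U (f : T -> P) (h : P -> T) p q : chart U f h -> U p -> U q -> p <> q ->
  let w : P := ((f q).1 - (f p).1, (f q).2 - (f p).2) in
  let D := w.1 ^+ 2 + w.2 ^+ 2 in
  exists (f' : T -> P) (h' : P -> T), [/\ 0 < D,
    forall x, f' x = ((((f x).1 - (f p).1) * w.1 + ((f x).2 - (f p).2) * w.2) / D,
                      (((f x).2 - (f p).2) * w.1 - ((f x).1 - (f p).1) * w.2) / D),
    chart U f' h', f' p = (0, 0) & f' q = (1, 0)].
Proof.
move=> cU Up Uq pq w D.
pose f' x : P := ((((f x).1 - (f p).1) * w.1 + ((f x).2 - (f p).2) * w.2) / D,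
                  (((f x).2 - (f p).2) * w.1 - ((f x).1 - (f p).1) * w.2) / D).
have D0 : 0 < D.
  have w0 : w.1 != 0 \/ w.2 != 0.
    apply: contrapT => /not_orP[/negP/negPn/eqP w1 /negP/negPn/eqP w2]; apply: pq.
    rewrite -(chartK cU Up) -(chartK cU Uq); congr h.
    rewrite [LHS]surjective_pairing [RHS]surjective_pairing.
    by move: w1 w2; rewrite /w /= => w1 w2; congr (_, _); lra.
  rewrite lt_neqAle eq_sym addr_ge0 ?sqr_ge0 // andbT paddr_eq0 ?sqr_ge0 // !sqrf_eq0.
  by case: w0 => /negPf ->; rewrite ?andbF.
have Dn : D != 0 by rewrite gt_eqF.
exists f', (fun v => h ((f p).1 + w.1 * v.1 - w.2 * v.2, (f p).2 + w.2 * v.1 + w.1 * v.2)).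
split => //.
- split=> [x|x Ux|v|v|]; [exact: (chart_nbhs cU)| |exact: (chart_in cU)| |].
  + rewrite -[RHS](chartK cU Ux); congr h; rewrite [RHS]surjective_pairing /f' /=.
    by congr (_, _); rewrite -addrA ?cdivK1 ?cdivK2 // addrC subrK.
  + rewrite /f' (chartKV cU) /= -/w -/D [RHS]surjective_pairing; congr (_, _).
      by apply: (mulIf Dn); rewrite mulfVK // /D /=; ring.
    by apply: (mulIf Dn); rewrite mulfVK // /D /=; ring.
  + split=> [x Ux|v].
      have fc := chart_cts cU Ux.
      by change (cts f' x); rewrite /f'; cts.
    by apply: cts_comp; [cts|exact: (chart_inv_cts cU)].
- by rewrite /f' !subrr !mul0r addr0 subr0 mul0r.
- rewrite /f'; congr (_, _); first by rewrite -[RHS](divff Dn) /D /w /= !expr2.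
  by rewrite /w /= [X in X - _]mulrC subrr mul0r.
Qed.

Definition cutn U (f : T -> P) u v := [&& `[< U u >], `[< U v >] & xcut (f u) (f v)].

Lemma cutn_kernel U (f : T -> P) (h : P -> T) p q : chart U f h -> U p -> U q ->
  f p = (0, 0) -> f q = (1, 0) -> kernel p q (U `&` f @^-1` (@segment01 R)) (cutn U f).
Proof.
move=> cU Up Uq fp fq.
have supp : supp_in (cutn U f) (U `&` f @^-1` (@segment01 R)).
  move=> x nx; have [Ux|Ux] := pselect (U x).
    have fx : ~ segment01 (f x) by move=> ?; apply: nx.
    have [W Wx WP] := cut_supp fx.
    have fW : nbhs x (f @^-1` W) by exact: (chart_cts cU Ux) Wx.
    by exists (f @^-1` W) => // u v Wu Wv; rewrite /cutn WP // !andbF.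
  have xM : ~ (h @` cbox 1) x by case=> v _ hv; apply: Ux; rewrite -hv; exact: (chart_in cU).
  exists (~` (h @` cbox 1)).
    by apply: (compact_nbhsC sT) => //; exact: chart_cbox_compact cU 1.
  move=> u v uM _; rewrite /cutn; case: asboolP => //= Uu.
  suff -> : xcut (f u) (f v) = false by rewrite andbF.
  rewrite /xcut; case: (boolP (cut_box (f u))) => //= /and4P[? ? ? ?].
  exfalso; apply: uM; exists (f u); last by rewrite (chartK cU).
  by split; lra.
have pullE : pull h (cutn U f) = @xcut R.
  apply/funext => u; apply/funext => v; rewrite /pull /cutn !asboolT ?(chartKV cU) //.
    exact: (chart_in cU).
  exact: (chart_in cU).
split=> //.
- move=> x; rewrite /off /= !inE negb_or => /andP[/eqP xp /eqP xq].
  have [Ux|Ux] := pselect (U x); last first.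
    have [|W Wx WP] := supp x; first by case.
    by exists W, (fun=> false); split=> // u v ? ? _ _; exact: WP.
  have fx0 : f x <> (0, 0) /\ f x <> (1, 0).
    split=> E; [apply: xp|apply: xq]; rewrite -(chartK cU Ux) E.
      by rewrite -fp (chartK cU).
    by rewrite -fq (chartK cU).
  have [W [k [Wx WP]]] := @cut_cocycle R (f x) fx0.
  have fW : nbhs x (f @^-1` W) by exact: (chart_cts cU Ux) Wx.
  have n0 : nbhs x [set y | f y <> (0, 0) /\ f y <> (1, 0)].
    have /(compact_nbhsC sT) : compact (h @` [set ((0, 0) : P); ((1, 0) : P)]).
      apply: continuous_compact; last by apply: finite_compact; exact: finite_set2.
      by apply: continuous_subspaceT => v; exact: chart_inv_cts cU v.
    have xn : ~ (h @` [set ((0, 0) : P); ((1, 0) : P)]) x.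
      case=> v [->|->] hx; [apply: xp|apply: xq]; rewrite -hx.
        by rewrite -fp (chartK cU).
      by rewrite -fq (chartK cU).
    move=> /(_ _ xn) H; apply: filterS (filterI H (chart_nbhs cU Ux)) => y [yn Uy].
    by split=> E; apply: yn; exists (f y); rewrite ?(chartK cU) // E; [left|right].
  exists (f @^-1` W `&` U `&` [set y | f y <> (0, 0) /\ f y <> (1, 0)]), (k \o f).
  split; first by do 2?apply: filterI => //; exact: chart_nbhs cU _ Ux.
  by move=> u v [[Wu Uu] u0] [[Wv Uv] v0] _ _; rewrite /cutn !asboolT //= WP.
- move=> [V Vp Vc]; apply: (@cut_not_triv0 R (h @^-1` V)).
    by apply: (chart_inv_cts cU); rewrite -fp (chartK cU).
  rewrite -pullE; apply: (pull_coboundary _ _ Vc) => [v [hv v0]|].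
    by split=> // E; apply: v0; rewrite -(chartKV cU v) E fp.
  by apply: cont_on_continuous => v _; exact: (chart_inv_cts cU).
- move=> [V Vp Vc]; apply: (@cut_not_triv1 R (h @^-1` V)).
    by apply: (chart_inv_cts cU); rewrite -fq (chartK cU).
  rewrite -pullE; apply: (pull_coboundary _ _ Vc) => [v [hv v0]|].
    by split=> // E; apply: v0; rewrite -(chartKV cU v) E fq.
  by apply: cont_on_continuous => v _; exact: (chart_inv_cts cU).
Qed.

Lemma kernel_exists V x : nbhs x V -> exists2 W, nbhs x W &
  forall p q, W p -> W q -> p <> q -> exists n, kernel p q V n.
Proof.
move=> Vx; have [U [f [h [cU Ux fx UV]]]] := surface_chart sT Vx.
exists U; first exact: chart_nbhs cU _ Ux.
move=> p q Up Uq pq; have [f' [h' [_ _ cU' fp fq]]] := chart_affine cU Up Uq pq.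
eexists; apply: kernel_sub (cutn_kernel cU' Up Uq fp fq).
by move=> y [/UV].
Qed.

Lemma uniform_chart : exists2 r, 0 < r & forall p, exists U (f : T -> P) (h : P -> T),
  chart U f h /\ forall x, d p x < r -> U x.
Proof.
apply: (unif sT (Pr := fun p r => exists U (f : T -> P) (h : P -> T),
  chart U f h /\ forall x, d p x < r -> U x)).
  move=> x e e' _ e'e [U [f [h [cU eU]]]]; exists U, f, h; split=> // y ye.
  by apply: eU; exact: lt_le_trans ye e'e.
move=> x; have xT : nbhs x [set: T] by exact: filterT.
have [U [f [h [cU Ux fx _]]]] := surface_chart sT xT.
have [e e0 eU] := (dist_nbhs sT _ _).1 (chart_nbhs cU Ux).
exists (e / 2); first by lra.
move=> y xy; exists U, f, h; split=> // z yz; apply: eU.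
by have := dist_tri sT x y z; lra.
Qed.

(** By [kernel_exists] near each point and compactness. The separation s depends only on the size r
    allowed for the support. *)
Lemma uniform_kernel (r : R) : 0 < r -> exists2 s, 0 < s & forall p q, d p q < s -> p <> q ->
  exists n, kernel p q [set x | d p x < r] n.
Proof.
move=> r0.
have [s s0 sP] : exists2 s, 0 < s & forall p q, d p q < s -> p <> q ->
    exists n, kernel p q [set x | d p x < r] n.
  apply: (unif sT (Pr := fun p s => forall q, d p q < s -> p <> q ->
    exists n, kernel p q [set x | d p x < r] n)).
    by move=> x e e' _ e'e H q xq; apply: H; exact: lt_le_trans xq e'e.
  move=> x; have h0 : 0 < r / 2 by lra.
  have [W Wx WP] := kernel_exists (ball_nbhs sT x h0).
  have [e e0 eW] := (dist_nbhs sT _ _).1 Wx.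
  exists (Num.min (e / 2) (r / 2)); first by rewrite lt_min; apply/andP; split; lra.
  move=> y; rewrite lt_min => /andP[xy1 xy2] q; rewrite lt_min => /andP[yq1 yq2] yq.
  have [n kn] : exists n, kernel y q [set z | d x z < r / 2] n.
    apply: WP => //; apply: eW; first by lra.
    by have := dist_tri sT x y q; lra.
  exists n; apply: kernel_sub kn => z /= xz.
  by have := dist_tri sT y x z; rewrite (dist_sym sT y x); lra.
by exists s.
Qed.

Lemma kernel_end p q D n : kernel p q D n -> D q.
Proof.
move=> [_ _ nq ns]; apply: contrapT => /ns /locally_zero_triv; exact: nq.
Qed.

Definition simple (c : R -> T) := loop c /\ forall s t, c s = c t <-> s - t \is a Num.int.

Lemma simple_compact c : simple c -> compact (range c).
Proof.
move=> [[cc c1] _].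
have -> : range c = c @` [set` `[0, 1]].
  apply/seteqP; split=> x [t _ <-]; last by exists t.
  exists (t - (Num.floor t)%:~R).
    have := floorD1_gt t; have := ge_floor t; rewrite intrD mulr1z => h1 h2.
    by rewrite /= in_itv /=; apply/andP; split; lra.
  have cz (z : int) s : c (s + z%:~R) = c s.
    have cn (k : nat) u : c (u + k%:R) = c u.
      elim: k u => [|k IH] u; first by rewrite addr0.
      by rewrite -natr1 addrA c1 IH.
    case: z => k; first exact: cn.
    by rewrite NegzE mulrNz -(cn k.+1) subrK.
  by rewrite -mulrNz cz.
by apply: continuous_compact; [apply: continuous_subspaceT|exact: segment_compact].
Qed.

Lemma conn_off2 U (f : T -> P) (h : P -> T) p q : chart U f h -> U p -> U q -> p <> q ->
  conn (U `&` off [:: p; q]).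
Proof.
move=> cU Up Uq pq; have [f' [h' [_ _ cU' fp fq]]] := chart_affine cU Up Uq pq.
pose B : set P := [set v | 0 < v.2] `|` [set v | v.1 < 0] `|` [set v | v.2 < 0]
  `|` [set v | 0 < v.1 /\ v.1 < 1] `|` [set v | 1 < v.1].
have cB : conn B.
  apply: conn_glue; first (apply: conn_glue; first (apply: conn_glue; first apply: conn_glue)).
  - by apply: (@star_conn _ _ (0, 1)); split=> [/=|y t ? ? ?]; [lra|exact: seg_gt].
  - by apply: (@star_conn _ _ (-1, 0)); split=> [/=|y t ? ? ?]; [lra|apply: seg_lt => //=; lra].
  - by exists (-1, 1); split => /=; lra.
  - by apply: (@star_conn _ _ (0, -1)); split=> [/=|y t ? ? ?]; [lra|apply: seg_lt => //=; lra].
  - by exists (-1, -1); split; [right|] => /=; lra.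
  - apply: (@star_conn _ _ (1/2, 0)); split=> [/=|y t [? ?] ? ?]; first by split; lra.
    by split; [apply: seg_gt|apply: seg_lt] => //=; lra.
  - by exists (1/2, 1); split; [left; left|] => /=; lra.
  - by apply: (@star_conn _ _ (2, 0)); split=> [/=|y t ? ? ?]; [lra|apply: seg_gt => //=; lra].
  - by exists (2, 1); split; [left; left; left|] => /=; lra.
apply: (@conn_image _ _ _ B h') => //.
- move=> v vB; split; first exact: (chart_in cU').
  rewrite /off /= !inE negb_or; apply/andP; split; apply/eqP => E; move: vB;
    rewrite -(chartKV cU' v) E ?fp ?fq /B => -[[[[]|]|[]]|] /=; rewrite ?ltxx ?ltr10 ?ltr01 //; lra.
- move=> x [Ux]; rewrite /off /= !inE negb_or => /andP[/eqP xp /eqP xq].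
  exists (f' x); last by rewrite (chartK cU').
  have [x2|x2|x2] := ltgtP (f' x).2 0.
  + by left; left; right.
  + by left; left; left; left.
  + have [x1|x1|x1] := ltgtP (f' x).1 0.
    * by left; left; left; right.
    * have [x3|x3|x3] := ltgtP (f' x).1 1.
      - by left; right.
      - by right.
      - exfalso; apply: xq; rewrite -(chartK cU' Ux) -(chartK cU' Uq) fq.
        by rewrite [f' x]surjective_pairing x2 x3.
    * exfalso; apply: xp; rewrite -(chartK cU' Ux) -(chartK cU' Up) fp.
      by rewrite [f' x]surjective_pairing x1 x2.
- by apply: cont_on_continuous => v _; exact: (chart_inv_cts cU').
Qed.

End Dual.

Section DualCocycle.
Variables (R : realType) (T : topologicalType) (d : T -> T -> R).
Hypothesis sT : surface d.
Implicit Types (n m : T -> T -> bool) (A K U V O D : set T) (p q x y : T) (F : seq T).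

Lemma loop_repr (c : R -> T) (a : R) x : loop c -> range c x -> exists s, [/\ a <= s, s < a + 1 & c s = x].
Proof.
move=> [_ c1] [t _ <-].
exists (t - (Num.floor (t - a))%:~R).
have := floorD1_gt (t - a); have := ge_floor (t - a); rewrite intrD mulr1z => h1 h2.
have cz (z : int) s : c (s + z%:~R) = c s.
  have cn (k : nat) u : c (u + k%:R) = c u.
    elim: k u => [|k IH] u; first by rewrite addr0.
    by rewrite -natr1 addrA c1 IH.
  case: z => k; first exact: cn.
  by rewrite NegzE mulrNz -(cn k.+1) subrK.
by split; [lra|lra|rewrite -mulrNz cz].
Qed.

Lemma int_small (z : R) : z \is a Num.int -> - 1 < z -> z < 1 -> z = 0.
Proof.
move=> /intrP[m ->] m1 m2.
have {}m2 : m < 1 by rewrite -(ltr_int R).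
have {}m1 : - 1 < m by rewrite -(ltr_int R) mulrNz.
by have -> : m = 0 by lia.
Qed.

Lemma simple_inj (c : R -> T) s t : simple c -> c s = c t -> - 1 < s - t -> s - t < 1 -> s = t.
Proof. by move=> [_ cs] /cs /int_small H h1 h2; apply/eqP; rewrite -subr_eq0 H. Qed.

(** If c filled a chart domain U, removing the two points c (t - e) and c (t + e) would split U into
    the short and the long arc of c, although a plane minus two points is connected. Hence points
    can always be moved off the curve. *)
Lemma simple_dense (c : R -> T) x V : simple c -> nbhs x V -> exists2 y, V y & ~ range c y.
Proof.
move=> sc Vx; apply: contrapT => H.
have Vc y : V y -> range c y by move=> Vy; apply: contrapT => yc; apply: H; exists y.
have [U [f [h [cU Ux fx UV]]]] := surface_chart sT Vx.
have [t _ ct] := Vc x (UV _ Ux).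
have [cc c1] := sc.1.
have : nbhs t (c @^-1` U) by apply: cc; rewrite ct; exact: (chart_nbhs cU).
move=> /nbhs_realP[e0 e00 eU].
pose e := Num.min (e0 / 4) (1 / 8).
have e_gt0 : 0 < e by rewrite lt_min; apply/andP; split; lra.
have ee0 : e <= e0 / 4 by rewrite ge_min lexx.
have e8 : e <= 1 / 8 by rewrite ge_min lexx orbT.
have Ut s : t - 3 * e <= s -> s <= t + 3 * e -> U (c s) by move=> ? ?; apply: eU; lra.
pose A := c @` [set` `[t - e, t + e]]; pose B := c @` [set` `[t + e, t - e + 1]].
have cpt a b : compact (c @` [set` `[a, b]]).
  by apply: continuous_compact; [apply: continuous_subspaceT|exact: segment_compact].
pose p1 := c (t - e); pose p2 := c (t + e).
have p12 : p1 <> p2 by move=> /(simple_inj sc); lra.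
have Up1 : U p1 by apply: Ut; lra.
have Up2 : U p2 by apply: Ut; lra.
have AB y : A y -> B y -> y = p1 \/ y = p2.
  move=> [s /=]; rewrite in_itv /= => /andP[s1 s2] <- [s' /=]; rewrite in_itv /= => /andP[s1' s2'] E.
  have [s'1|s'1] := ltP s' (t - e + 1).
    have E' : s' = s by apply: (simple_inj sc E); lra.
    by right; rewrite /p2; congr c; lra.
  by left; rewrite -E /p1 -(c1 (t - e)); congr c; lra.
have UAB y : U y -> A y \/ B y.
  move=> /UV/Vc yc; have [s [s1 s2 <-]] := loop_repr (t - e) sc.1 yc.
  by have [ste|ste] := leP s (t + e); [left|right]; exists s => //=; rewrite in_itv /=; apply/andP; split; lra.
have gA : potential (U `&` off [:: p1; p2]) nul (fun y => `[< A y >]).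
  move=> y [Uy yo]; have [Ay|Ay] := pselect (A y).
    have yB : ~ B y.
      move=> By; have := AB y Ay By; move: yo; rewrite /off /= !inE negb_or => /andP[/eqP ? /eqP ?].
      by case.
    exists (~` B); first by apply: (compact_nbhsC sT) => //; exact: cpt.
    move=> u v Bu Bv [Uu _] [Uv _]; rewrite !asboolT //; by case: (UAB _ Uu) => //; case: (UAB _ Uv).
  exists (~` A); first by apply: (compact_nbhsC sT) => //; exact: cpt.
  by move=> u v Au Av _ _; rewrite !asboolF.
have i1 : (U `&` off [:: p1; p2]) (c t).
  split; first by apply: Ut; lra.
  by rewrite /off /= !inE negb_or; apply/andP; split; apply/eqP => /(simple_inj sc); lra.
have i2 : (U `&` off [:: p1; p2]) (c (t + 2 * e)).
  split; first by apply: Ut; lra.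
  by rewrite /off /= !inE negb_or; apply/andP; split; apply/eqP => /(simple_inj sc); lra.
have := conn_off2 cU Up1 Up2 p12 gA i1 i2.
rewrite asboolT; last by exists t => //=; rewrite in_itv /=; apply/andP; split; lra.
rewrite asboolF // => -[s /=]; rewrite in_itv /= => /andP[s1 s2] /(simple_inj sc); lra.
Qed.

(** The dual at p, q is the integral along c of a small kernel with ends p and q. Two such kernels
    are cohomologous by [chain_zero], so the choice is irrelevant; the cocycle rule comes from
    composing kernels; and away from c the kernel can be taken disjoint from c, which makes the
    integral vanish. *)
Lemma dual_exists (c : R -> T) : simple c -> exists n e0, [/\ cocycle setT n, 0 < e0,
  forall x, ~ range c x -> locally_zero n x &
  forall p q m v, p <> q -> ~ range c p -> ~ range c q -> kernel p q [set x | d p x < e0] m ->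
    oint m c v -> n p q = v].
Proof.
move=> sc; have lc := sc.1.
have [r r0 rP] := uniform_chart sT.
have h4 : 0 < r / 4 by lra.
have [s' s'0 s'P] := uniform_kernel sT h4.
pose s := Num.min s' (r / 4).
have s0 : 0 < s by rewrite lt_min s'0 h4.
have sr : s <= r / 4 by rewrite ge_min lexx orbT.
have sP p q : d p q < s -> p <> q -> exists n, kernel p q [set x | d p x < r / 4] n.
  by move=> pq; apply: s'P; rewrite lt_min in pq; case/andP: pq.
have int_kernel p q D n : ~ range c p -> ~ range c q -> kernel p q D n -> exists v, oint n c v.
  move=> cp cq [nc _ _ _]; apply: (oint_exists lc _ nc) => t.
  by rewrite /off /= !inE negb_or; apply/andP; split; apply/eqP => E; [apply: cp|apply: cq]; rewrite -E; exists t.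
have uniq p q n m v w : p <> q -> ~ range c p -> ~ range c q ->
    kernel p q [set x | d p x < r / 2] n -> kernel p q [set x | d p x < r / 2] m ->
    oint n c v -> oint m c w -> v = w.
  move=> pq cp cq [nc np nq ns] [mc mp mq ms] nv mw.
  have [U [f [h [cU rU]]]] := rP p.
  have r2 : r / 2 < r by lra.
  have nm : coboundary (off [:: p; q]) (addcoc n m).
    apply: (chain_zero sT cU rU r2); first exact: cocycleD.
      move=> z; rewrite !inE => /orP[/eqP->|/eqP->].
        by split; [rewrite (dist_refl sT); lra|exact: (not_triv_add_off sT nc mc)].
      split; last exact: (not_triv_add_off sT nc mc).
      exact: (kernel_end (And4 nc np nq ns)).
    by move=> z zr; apply: locally_zeroD; [exact: ns|exact: ms].
  have co t : off [:: p; q] (c t).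
    by rewrite /off /= !inE negb_or; apply/andP; split; apply/eqP => E; [apply: cp|apply: cq]; rewrite -E; exists t.
  exact: oint_uniq (oint_cohomologous lc co nm nv) mw.
(* Being an existential statement, J is false when no kernel exists; [J_spec] shows that for close
   points off c any kernel in the larger disk of radius r / 2 gives the same value. *)
pose J p q := `[< p <> q /\ exists2 n, kernel p q [set x | d p x < r / 4] n & oint n c true >].
have J_spec p q n v : p <> q -> ~ range c p -> ~ range c q -> d p q < s ->
    kernel p q [set x | d p x < r / 2] n -> oint n c v -> J p q = v.
  move=> pq cp cq ds kn nv.
  have [m km] := sP p q ds pq; have [w mw] := int_kernel _ _ _ _ cp cq km.
  have s42 : [set x | d p x < r / 4] `<=` [set x | d p x < r / 2] by move=> x /=; lra.
  have vw := uniq _ _ _ _ _ _ pq cp cq kn (kernel_sub s42 km) nv mw.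
  rewrite /J vw; case: w mw {vw} => mw; first by rewrite asboolT //; split=> //; exists m.
  rewrite asboolF // => -[_ [m' km' m't]].
  by have := uniq _ _ _ _ _ _ pq cp cq (kernel_sub s42 km) (kernel_sub s42 km') mw m't.
have J_refl p : J p p = false by rewrite /J asboolF // => -[].
have J_sym p q : ~ range c p -> ~ range c q -> d p q < s -> J p q = J q p.
  move=> cp cq pqs; have [->//|pq] := pselect (p = q).
  have [n kn] := sP p q pqs pq; have [v nv] := int_kernel _ _ _ _ cp cq kn.
  rewrite (J_spec p q n v) //; last by apply: kernel_sub kn => x /=; lra.
  rewrite (J_spec q p n v) //; first by move=> E; apply: pq.
    by rewrite (dist_sym sT).
  apply: kernel_sub (kernel_sym kn) => x /= xr.
  by have := dist_tri sT q p x; rewrite (dist_sym sT q p); lra.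
have J_add p q z : ~ range c p -> ~ range c q -> ~ range c z -> d p q < s -> d q z < s -> d p z < s ->
    J p q (+) J q z = J p z.
  move=> cp cq cz pqs qzs pzs.
  have [<-|pq] := pselect (p = q); first by rewrite J_refl.
  have [<-|qz] := pselect (q = z); first by rewrite J_refl addbF.
  have [<-|pz] := pselect (p = z); first by rewrite J_refl J_sym ?addbb // (dist_sym sT).
  have [n1 k1] := sP p q pqs pq; have [v1 nv1] := int_kernel _ _ _ _ cp cq k1.
  have [n2 k2] := sP q z qzs qz; have [v2 nv2] := int_kernel _ _ _ _ cq cz k2.
  have [n3 k3] := sP p z pzs pz; have [v3 nv3] := int_kernel _ _ _ _ cp cz k3.
  have s42 x : [set x0 | d x x0 < r / 4] `<=` [set x0 | d x x0 < r / 2] by move=> y /=; lra.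
  rewrite (J_spec p q n1 v1) //; last exact: kernel_sub k1.
  rewrite (J_spec q z n2 v2) //; last exact: kernel_sub k2.
  rewrite (J_spec p z n3 v3) //; last exact: kernel_sub k3.
  have B1 : [set x | d p x < r / 4] `<=` [set x | d p x < r / 2] by exact: s42.
  have B2 : [set x | d q x < r / 4] `<=` [set x | d p x < r / 2].
    by move=> x /= xr; have := dist_tri sT p q x; lra.
  have [c12 p12 q12 z12 s12] := kernel_comp sT pq qz pz (kernel_sub B1 k1) (kernel_sub B2 k2).
  have [c3 p3 z3 s3] := kernel_sub B1 k3.
  have c3' : cocycle (off [:: p; q; z]) n3.
    by apply: cocycle_sub c3; apply: off_sub => x; rewrite !inE => /orP[] ->; rewrite ?orbT.
  have [U [f [h [cU rU]]]] := rP p.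
  have r2 : r / 2 < r by lra.
  have co t : off [:: p; q; z] (c t).
    rewrite /off /= !inE !negb_or; apply/and3P; split; apply/eqP => E;
      [apply: cp|apply: cq|apply: cz]; by rewrite -E; exists t.
  have Z : coboundary (off [:: p; q; z]) (addcoc (addcoc n1 n2) n3).
    apply: (chain_zero sT cU rU r2); first exact: cocycleD.
      move=> w; rewrite !inE => /or3P[/eqP->|/eqP->|/eqP->].
      - by split; [rewrite (dist_refl sT); lra|exact: (not_triv_add_off sT c12 c3')].
      - split; first by lra.
        apply: trivD => //; apply: (cocycle_triv_off sT c3).
        rewrite !inE negb_or; apply/andP; split; apply/eqP => //.
        by move=> E; apply: pq.
      - by split; [lra|exact: (not_triv_add_off sT c12 c3')].
    by move=> w wr; apply: locally_zeroD; [exact: s12|exact: s3].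
  have := oint_uniq (oint_coboundary lc co Z) (ointD (ointD nv1 nv2) nv3).
  by case: v1 nv1 => _; case: v2 nv2 => _; case: v3 nv3 => _.
have s9 : 0 < s / 9 by lra.
(* The integral makes sense only for end points off c. A point of c is represented by a nearby point
   off c; the margin s / 9 keeps representatives of points at distance below s / 3 within s of each
   other. *)
have rep_ex u : exists w, [/\ ~ range c w, d u w < s / 9 & ~ range c u -> w = u].
  have [cu|cu] := pselect (range c u).
    by have [w /= uw cw] := simple_dense sc (ball_nbhs sT u s9); exists w; split.
  by exists u; split=> //; rewrite (dist_refl sT).
have [rep repP] := choice rep_ex.
have rep_d u v : d u v < s / 3 -> d (rep u) (rep v) < s.
  move=> uv; have [_ h1 _] := repP u; have [_ h2 _] := repP v.
  have := dist_tri sT (rep u) u (rep v); rewrite (dist_sym sT (rep u) u).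
  by have := dist_tri sT u v (rep v); lra.
pose n u v := J (rep u) (rep v).
exists n, s; split=> //.
- move=> x _; have h6 : 0 < s / 6 by lra.
  exists [set y | d x y < s / 6], (fun y => J (rep x) (rep y)); split; first exact: ball_nbhs.
  move=> u v /= xu xv _ _; have [cu _ _] := repP u; have [cv _ _] := repP v; have [cx _ _] := repP x.
  have dxu : d (rep x) (rep u) < s by apply: rep_d; lra.
  have dxv : d (rep x) (rep v) < s by apply: rep_d; lra.
  have duv : d (rep u) (rep v) < s.
    by apply: rep_d; have := dist_tri sT u x v; rewrite (dist_sym sT u x); lra.
  by rewrite /n -(J_add (rep x) (rep u) (rep v)) // addKb.
- move=> x cx; have cxn : nbhs x (~` range c).
    by apply: (compact_nbhsC sT) => //; exact: simple_compact.
  have h8 : 0 < r / 8 by lra.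
  have [W Wx WP] := kernel_exists sT (filterI cxn (ball_nbhs sT x h8)).
  have h4' : 0 < s / 4 by lra.
  exists (W `&` [set y | d x y < s / 4] `&` ~` range c).
    by do 2?apply: filterI => //; exact: ball_nbhs.
  move=> u v [[Wu xu] cu] [[Wv xv] cv].
  have [_ _ ru] := repP u; have [_ _ rv] := repP v.
  rewrite /n ru // rv //; have [->|uv] := pselect (u = v); first by rewrite J_refl.
  have duv : d u v < s.
    by have := dist_tri sT u x v; rewrite (dist_sym sT u x) /=; move: xu xv => /=; lra.
  have [m km] := WP u v Wu Wv uv.
  apply: (J_spec u v m) => //.
    apply: kernel_sub km => y /= [_ xy].
    by have := dist_tri sT u x y; rewrite (dist_sym sT u x); move: xu => /=; lra.
  apply: (oint_coboundary (A := range c)) => //.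
  exists (fun=> false); apply: locally_zero_potential => y cy.
  by have [_ _ _ ms] := km; apply: ms => -[].
- move=> p q m v pq cp cq km mv; have [_ _ rp] := repP p; have [_ _ rq] := repP q.
  rewrite /n rp // rq //; apply: (J_spec p q m) => //; first exact: (kernel_end km).
  by apply: kernel_sub km => y /=; lra.
Qed.

End DualCocycle.

(** * Crossings and their parity *)

Section Crossing.
Variables (R : realType) (T : topologicalType) (d : T -> T -> R).
Hypothesis sT : surface d.
Implicit Types (n m : T -> T -> bool) (A K U V O D : set T) (p q x y : T) (F : seq T).

Lemma conn_itv (phi : R -> R) (a b : R) : (forall t, a < t -> t < b -> cts phi t /\ phi t != 0) ->
  forall s t, a < s -> s < b -> a < t -> t < b -> (phi s < 0) = (phi t < 0).
Proof.
move=> H s t as_ sb at_ tb.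
apply: (@conn_convexR R [set t | a < t /\ t < b] _ (fun t => phi t < 0)) => //.
  by move=> x y z [? ?] [? ?] ? ?; split; lra.
move=> x [ax xb]; have [xc x0] := H x ax xb.
have [x1|x1|x1] := ltgtP (phi x) 0; last by rewrite x1 eqxx in x0.
  exists [set y | phi y < 0]; first by apply: cts_lt; [exact: xc|exact: cts_cst|].
  by move=> p q /= -> ->.
exists [set y | 0 < phi y]; first by apply: cts_lt; [exact: cts_cst|exact: xc|].
by move=> p q /= ? ? _ _; rewrite !(ltNge _ 0) !ltW.
Qed.

(** Equal signs on both sides of the zero would, by the intermediate value theorem, make the
    function take some value twice. *)
Lemma sign_change (phi : R -> R) (t0 e : R) : 0 < e -> phi t0 = 0 ->
  (forall t, t0 - e < t -> t < t0 + e -> cts phi t) ->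
  (forall s t, t0 - e < s -> s < t0 + e -> t0 - e < t -> t < t0 + e -> phi s = phi t -> s = t) ->
  exists b, forall s t, t0 - e < s -> s < t0 -> t0 < t -> t < t0 + e ->
    (phi s < 0) = ~~ b /\ (phi t < 0) = b.
Proof.
move=> e0 phi0 phic phi_inj.
have nz t : t0 - e < t -> t < t0 + e -> t <> t0 -> phi t != 0.
  by move=> ? ? tt0; apply/eqP => E; apply: tt0; apply: phi_inj; rewrite ?phi0 //; lra.
pose p := t0 + e / 2; pose q := t0 - e / 2.
have L s : t0 - e < s -> s < t0 -> (phi s < 0) = (phi q < 0).
  move=> ? ?; apply: (@conn_itv phi (t0 - e) t0) => //; try (rewrite /q; lra).
  by move=> t ? ?; split; [apply: phic; lra|apply: nz; lra].
have Rt s : t0 < s -> s < t0 + e -> (phi s < 0) = (phi p < 0).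
  move=> ? ?; apply: (@conn_itv phi t0 (t0 + e)) => //; try (rewrite /p; lra).
  by move=> t ? ?; split; [apply: phic; lra|apply: nz; lra].
exists (phi p < 0) => s t s1 s2 t1 t2; split; last by rewrite Rt.
rewrite L //.
have pn : phi p != 0 by apply: nz; rewrite /p; lra.
have qn : phi q != 0 by apply: nz; rewrite /q; lra.
have [pt1 pt2] : t0 < p /\ p < t0 + e by rewrite /p; lra.
have [qt1 qt2] : t0 - e < q /\ q < t0 by rewrite /q; lra.
have ivt (a b v : R) : t0 - e < a -> a <= b -> b < t0 + e ->
    (phi a <= v <= phi b \/ phi b <= v <= phi a) -> exists2 c, a <= c <= b & phi c = v.
  move=> a1 ab b1 H.
  have [||c] := @IVT R phi a b v ab.
  - apply/continuous_in_subspaceT => x; rewrite inE /= in_itv /= => /andP[? ?].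
    by apply: phic; lra.
  - case: H => /andP[H1 H2]; rewrite /Num.min /Num.max; case: ltP => ?; apply/andP; split; lra.
  by rewrite in_itv /= => ? <-; exists c.
have [pp|pp|pp] := ltgtP (phi p) 0; have [qp|qp|qp] := ltgtP (phi q) 0 => //=;
  try (by rewrite pp eqxx in pn); try (by rewrite qp eqxx in qn).
- exfalso; have [pq|pq] := leP (phi p) (phi q).
    have [||||c /andP[c1 c2] E] := ivt t0 p (phi q); try lra.
    by have := phi_inj c q; rewrite E; lra.
  have [||||c /andP[c1 c2] E] := ivt q t0 (phi p); try lra.
  by have := phi_inj c p; rewrite E; lra.
- exfalso; have [pq|pq] := leP (phi q) (phi p).
    have [||||c /andP[c1 c2] E] := ivt t0 p (phi q); try lra.
    by have := phi_inj c q; rewrite E; lra.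
  have [||||c /andP[c1 c2] E] := ivt q t0 (phi p); try lra.
  by have := phi_inj c p; rewrite E; lra.
Qed.

(** Along one period starting just before t0, a potential changes once at t0 and is constant on the
    remaining open interval, because the cocycle vanishes near all other points of the loop. *)
Lemma oint_one_cut (c : R -> T) n A (t0 e : R) g b W : simple c -> cocycle A n ->
  (forall t, A (c t)) -> nbhs (c t0) W -> (forall u v, W u -> W v -> n u v = g u (+) g v) ->
  (forall t, c t <> c t0 -> locally_zero n (c t)) -> 0 < e ->
  (forall s t, t0 - e < s -> s < t0 -> t0 < t -> t < t0 + e -> g (c s) = ~~ b /\ g (c t) = b) ->
  oint n c true.
Proof.
move=> sc nc cA W0 nW nz e0 gP; have lc := sc.1; have [cc c1] := lc.
have [v [k kk kv]] := oint_exists lc cA nc.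
suff -> : true = v by exists k.
have : nbhs t0 (c @^-1` W) by exact: cc W0.
move=> /nbhs_realP[e1 e10 e1W].
have [U Ut0 UP] := kk t0 I; have [e2 e20 e2U] := nbhs_realP Ut0.
pose r := Num.min (Num.min e e1) (Num.min e2 1).
have r0 : 0 < r by rewrite !lt_min e0 e10 e20 ltr01.
have [[re re1] [re2 r1]] : (r <= e /\ r <= e1) /\ (r <= e2 /\ r <= 1).
  by rewrite !ge_min !lexx !orbT.
pose s := t0 - r / 2; pose t := t0 + r / 2.
have [gs gt] : g (c s) = ~~ b /\ g (c t) = b by apply: gP; rewrite /s /t; lra.
have kst : k s (+) k t = true.
  rewrite -UP // /pull; try (apply: e2U; rewrite /s /t; lra).
  rewrite nW; last 2 first.
  - by apply: e1W; rewrite /s; lra.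
  - by apply: e1W; rewrite /t; lra.
  by rewrite gs gt; case: (b).
have kconst : k t = k (s + 1).
  apply: (@conn_convexR R [set t | t0 < t /\ t < t0 + 1]).
  - by move=> x y z [? ?] [? ?] ? ?; split; lra.
  - move=> x [x1 x2]; have [|V Vx VP] := nz x; first by move=> /(simple_inj sc); lra.
    have Vc : nbhs x (c @^-1` V) by exact: cc Vx.
    have [U' U'x U'P] := kk x I.
    exists (U' `&` c @^-1` V) => [|y z [? ?] [? ?] _ _]; first exact: filterI.
    by rewrite /nul -U'P // /pull VP.
  - by rewrite /t; split; lra.
  - by rewrite /s; split; lra.
by rewrite -(kv s) -kst kconst addbC.
Qed.

End Crossing.

Section Crossing.
Variables (R : realType) (T : topologicalType) (d : T -> T -> R).
Hypothesis sT : surface d.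
Local Notation P := (R * R)%type.
Implicit Types (n m : T -> T -> bool) (A K U V O D : set T) (p q x y : T) (F : seq T).

Definition axes_at (U : set T) (f : T -> P) (h : P -> T) (a b : set T) x : Prop :=
  [/\ chart U f h, U x, f x = (0, 0),
      forall y, U y -> (a y <-> (f y).2 = 0) & forall y, U y -> (b y <-> (f y).1 = 0)].

(** The points p and q sit on b on either side of the loop. The kernel that cuts the segment between
    them is crossed by the loop exactly once, at x, so its integral is 1. *)
Lemma crossing_kernel (c : R -> T) b U f h x (e0 : R) : simple c -> 0 < e0 ->
  axes_at U f h (range c) b x -> exists2 y0 : R, 0 < y0 & forall y1 y2 : R, - y0 < y1 -> y1 < y0 ->
    - y0 < y2 -> y2 < y0 -> y1 * y2 < 0 ->
    let p := h (0, y1) in let q := h (0, y2) in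
    [/\ p <> q, ~ range c p, ~ range c q &
      exists2 n, kernel p q [set z | d p z < e0] n & oint n c true].
Proof.
move=> sc e00 [cU Ux fx fa fb]; have lc := sc.1; have [cc c1] := lc.
have hx : h (0, 0) = x by rewrite -fx (chartK cU).
have h2 : 0 < e0 / 2 by lra.
have : nbhs ((0, 0) : P) (h @^-1` [set z | d x z < e0 / 2]).
  by apply: (chart_inv_cts cU); rewrite hx; exact: ball_nbhs.
move=> /nbhs_boxP[y0 /= y00 y0P]; exists y0 => // y1 y2 y1a y1b y2a y2b y12.
set p := h (0, y1); set q := h (0, y2); rewrite /=.
have y1n : y1 != 0 by apply: contraTneq y12 => ->; rewrite mul0r ltxx.
have y2n : y2 != 0 by apply: contraTneq y12 => ->; rewrite mulr0 ltxx.
have L0 : y2 - y1 != 0.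
  rewrite subr_eq0; apply: contraTneq y12 => ->.
  by rewrite -leNgt -expr2 sqr_ge0.
have Up : U p by exact: (chart_in cU).
have Uq : U q by exact: (chart_in cU).
have fp : f p = (0, y1) by rewrite (chartKV cU).
have fq : f q = (0, y2) by rewrite (chartKV cU).
have pq : p <> q.
  move=> E; have : f p = f q by rewrite E.
  by rewrite fp fq => -[E']; move: L0; rewrite E' subrr eqxx.
have cp : ~ range c p by move=> /(fa p Up); rewrite fp /=; move/eqP: y1n.
have cq : ~ range c q by move=> /(fa q Uq); rewrite fq /=; move/eqP: y2n.
have [f' [h' [D0 f'E cU' f'p f'q]]] := chart_affine cU Up Uq pq.
move: D0 f'E; rewrite fp fq /= subr0 expr0n /= add0r => D0 f'E.
pose L := y2 - y1.
have {}f'E z : f' z = (((f z).2 - y1) / L, - (f z).1 / L).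
  rewrite f'E !subr0 !mulr0 add0r sub0r -/L; congr (_, _).
    by field.
  by field.
split=> //.
have kn := cutn_kernel sT cU' Up Uq f'p f'q.
have suppE z : (U `&` f' @^-1` (@segment01 R)) z -> exists2 y : R, - y0 < y /\ y < y0 & z = h (0, y).
  move=> [Uz [/=]]; rewrite f'E /= => s1 s2 s3.
  exists (f z).2; last first.
    rewrite -{1}(chartK cU Uz) [f z]surjective_pairing /=; congr (h (_, _)).
    by apply/eqP; move/eqP: s3; rewrite mulf_eq0 invr_eq0 (negPf L0) orbF oppr_eq0.
  pose s := ((f z).2 - y1) / L.
  have -> : (f z).2 = y1 + s * (y2 - y1) by rewrite /s /L mulfVK //; lra.
  by split; [apply: seg_gt|apply: seg_lt].
exists (cutn U f').
  apply: kernel_sub kn => z /suppE[y [ya yb] ->] /=.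
  have H w : - y0 < w -> w < y0 -> d x (h (0, w)) < e0 / 2 by move=> ? ?; apply: y0P => /=; lra.
  have := dist_tri sT p x (h (0, y)); rewrite (dist_sym sT p x).
  by have := H y1 y1a y1b; have := H y ya yb; rewrite -/p; lra.
have [t0 _ ct0] : range c x by apply/(fa x Ux); rewrite fx.
have [nc _ _ ns] := kn.
pose W := U `&` f' @^-1` box 0 1 (-1) 1.
have Wx : W x.
  split=> //; rewrite /= f'E fx /= !sub0r oppr0 mul0r.
  have : 0 < - y1 / L < 1.
    have [y1s|y1s] := ltP 0 y1.
      have y2s : y2 < 0 by move: y12; rewrite pmulr_rlt0.
      have L1 : L < 0 by rewrite /L; lra.
      rewrite ltr_ndivlMr // ltr_ndivrMr // mul0r mul1r /L; apply/andP; split; lra.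
    have y1s' : y1 < 0 by rewrite lt_neqAle y1n.
    have y2s : 0 < y2 by move: y12; rewrite nmulr_rlt0.
    have L1 : 0 < L by rewrite /L; lra.
    rewrite ltr_pdivlMr // ltr_pdivrMr // mul0r mul1r /L; apply/andP; split; lra.
  by move=> /andP[? ?]; split => //=; lra.
have Wn : nbhs x W.
  apply: filterI; first exact: (chart_nbhs cU).
  apply: (chart_cts cU' Ux); case: Wx => _ [? ? ? ?]; exact: nbhs_box.
have cW : nbhs t0 (c @^-1` W) by apply: cc; rewrite ct0.
have [e e1 eW] := nbhs_realP cW.
pose phi t := (f' (c t)).2.
have inU t : t0 - e < t -> t < t0 + e -> U (c t) by move=> ? ?; have [] := eW t.
pose e' := Num.min e (1/2).
have e'0 : 0 < e' by rewrite lt_min e1; lra.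
have e'e : e' <= e by rewrite ge_min lexx.
have e'1 : e' <= 1/2 by rewrite ge_min lexx orbT.
have fc2 t : t0 - e < t -> t < t0 + e -> (f (c t)).2 = 0.
  by move=> ta tb; apply/(fa _ (inU t ta tb)); exists t.
have [|||b' bP] := @sign_change R phi t0 e' e'0.
- by rewrite /phi ct0 f'E fx /= oppr0 mul0r.
- move=> t ta tb; have Ut : U (c t) by apply: inU; lra.
  change (cts (fun t => (f' (c t)).2) t); apply: cts_snd; apply: cts_comp; first exact: cc.
  exact: (chart_cts cU' Ut).
- move=> s t sa sb ta tb; rewrite /phi !f'E /= => /(mulIf _) E.
  apply: (simple_inj sc); [|lra|lra].
  have Us : U (c s) by apply: inU; lra.
  have Ut : U (c t) by apply: inU; lra.
  have E1 : (f (c s)).1 = (f (c t)).1 by apply: oppr_inj; apply: E; rewrite invr_eq0.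
  have E2s : (f (c s)).2 = 0 by apply: fc2; lra.
  have E2t : (f (c t)).2 = 0 by apply: fc2; lra.
  rewrite -(chartK cU Us) -(chartK cU Ut) [f (c s)]surjective_pairing.
  by rewrite [f (c t)]surjective_pairing E1 E2s E2t.
apply: (@oint_one_cut _ _ c _ (off [:: p; q]) t0 e' (fun z => (f' z).2 < 0) b' W) => //.
- move=> t; rewrite /off /= !inE negb_or; apply/andP; split; apply/eqP => E;
  [apply: cp|apply: cq]; by rewrite -E; exists t.
- by rewrite ct0.
- move=> u v [Uu [u1 u2 u3 u4]] [Uv [v1 v2 v3 v4]].
  by rewrite /cutn /xcut /cut_box !asboolT // u1 u2 u3 u4 v1 v2 v3 v4.
- move=> t ctn; apply: ns => /[dup] [[Ut _]] /suppE[y _ cty].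
  have : (f (c t)).2 = 0 by apply/(fa _ Ut); exists t.
  by rewrite cty (chartKV cU) /= => y0'; apply: ctn; rewrite cty y0' ct0 hx.
Qed.

End Crossing.

Section Crossing.
Variables (R : realType) (T : topologicalType) (d : T -> T -> R).
Hypothesis sT : surface d.
Implicit Types (n m : T -> T -> bool) (A K U V O D : set T) (p q x y : T) (F : seq T).

Lemma odd_absz_succ (z : int) : odd `|(z + 1)%R|%N = ~~ odd `|z|%N.
Proof.
case: z => n; first by rewrite (_ : Posz n + 1 = n.+1) ?PoszD ?addn1 //=; lia.
by rewrite NegzE (_ : - n.+1%:Z + 1 = - n%:Z) ?abszN /= ?negbK //; lia.
Qed.

(** J is a step function that jumps exactly at the translates of t0 by integers and absorbs there
    the jump of m. Sums of such functions over all crossings will be potentials. *)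
Lemma flip_fun (m : R -> R -> bool) (t0 e : R) : cocycle setT m ->
  (forall s t, m (s + 1) (t + 1) = m s t) -> 0 < e ->
  (forall s t, t0 - e < s -> s < t0 -> t0 < t -> t < t0 + e -> m s t = true) ->
  exists J : R -> bool, [/\ forall t, J (t + 1) = ~~ J t,
    forall t, t - t0 \isn't a Num.int -> exists2 U, nbhs t U & forall u v, U u -> U v -> J u = J v &
    forall t, t - t0 \is a Num.int -> exists2 U, nbhs t U &
      forall u v, U u -> U v -> m u v = J u (+) J v].
Proof.
move=> mc m1 e0 mP.
have [U [l [Ut0 UP]]] := mc t0 I.
have {}UP u v : U u -> U v -> m u v = l u (+) l v by move=> *; exact: UP.
have [e1 e10 e1U] := nbhs_realP Ut0.
pose r := Num.min (Num.min e e1) 1.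
have r0 : 0 < r by rewrite !lt_min e0 e10 ltr01.
have [re [re1 r1]] : r <= e /\ (r <= e1 /\ r <= 1).
  by rewrite !ge_min !lexx !orbT.
have Ul s : t0 - r < s -> s < t0 + r -> U s by move=> ? ?; apply: e1U; lra.
have mz (z : int) s t : m (s + z%:~R) (t + z%:~R) = m s t.
  have mn (k : nat) (a b : R) : m (a + k%:R) (b + k%:R) = m a b.
    elim: k a b => [|k IH] a b; first by rewrite !addr0.
    by rewrite -natr1 !addrA m1 IH.
  case: z => k; first exact: mn.
  by rewrite NegzE mulrNz -(mn k.+1) !subrK.
pose s0 := t0 - r / 2; pose t1 := t0 + r / 2.
have lE s t : t0 - r < s -> s < t0 -> t0 < t -> t < t0 + r -> l s = ~~ l t.
  move=> ? ? ? ?; have := mP s t; rewrite UP; try (apply: Ul; lra).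
  move=> /(_ _ _ _ _) H; have {}H : l s (+) l t = true by apply: H; lra.
  by move: H; case: (l s); case: (l t).
have lL s : t0 - r < s -> s < t0 -> l s = l s0.
  by move=> ? ?; rewrite (lE s t1) ?(lE s0 t1) // /s0 /t1; lra.
have lR s : t0 < s -> s < t0 + r -> l s = ~~ l s0.
  by move=> ? ?; rewrite (lE s0 s) ?negbK // /s0; lra.
have shift (J : R -> bool) : (forall t, J (t + 1) = ~~ J t) ->
    (forall u v, t0 - r < u -> u < t0 + r -> t0 - r < v -> v < t0 + r -> m u v = J u (+) J v) ->
    forall t, t - t0 \is a Num.int -> exists2 U, nbhs t U &
      forall u v, U u -> U v -> m u v = J u (+) J v.
  move=> J1 Jm t /intrP[z tz].
  have Jz u v : J (u + z%:~R) (+) J (v + z%:~R) = J u (+) J v.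
    have Jn (k : nat) (a b : R) : J (a + k%:R) (+) J (b + k%:R) = J a (+) J b.
      elim: k a b => [|k IH] a b; first by rewrite !addr0.
      by rewrite -natr1 !addrA !J1 addbN addNb negbK IH.
    case: z {tz} => k; first exact: Jn.
    by rewrite NegzE mulrNz -(Jn k.+1) !subrK.
  exists [set u | t - r < u < t + r]; first exact: nbhs_real.
  move=> u v /= /andP[? ?] /andP[? ?].
  rewrite -[u](subrK z%:~R) -[v](subrK z%:~R) mz Jz; apply: Jm; lra.
have ceil_eq (x : R) (z : int) : z%:~R - 1 < x -> x <= z%:~R -> Num.ceil x = z.
  by move=> xa xb; apply: ceil_def; rewrite xb andbT intrD mulrNz.
have floor_eq (x : R) (z : int) : z%:~R <= x -> x < z%:~R + 1 -> Num.floor x = z.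
  by move=> xa xb; apply: floor_def; rewrite xa intrD.
have nonint t : t - t0 \isn't a Num.int -> exists2 U, nbhs t U & forall u, U u ->
    Num.floor (u - t0) = Num.floor (t - t0) /\ Num.ceil (u - t0) = Num.floor (t - t0) + 1.
  move=> tn; set z := Num.floor (t - t0).
  have z1 : z%:~R < t - t0.
    rewrite lt_neqAle ge_floor andbT; apply/eqP => E; move/negP: tn; apply.
    by rewrite -E intr_int.
  have z2 : t - t0 < z%:~R + 1 by have := floorD1_gt (t - t0); rewrite intrD.
  exists [set u | z%:~R + t0 < u /\ u < z%:~R + 1 + t0]; first by apply: nbhs_itvR; lra.
  move=> u /= [u1 u2]; split; first by apply: floor_eq; lra.
  by apply: ceil_eq; rewrite intrD mulr1z; lra.
(* At t0 itself the local potential may take the value of either side; ceiling and floor are the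
   step functions continuous from the left and from the right. *)
have [lt0|lt0] := eqVneq (l t0) (l s0).
  pose J (t : R) := odd `|Num.ceil (t - t0)|%N.
  have J1 t : J (t + 1) = ~~ J t.
    by rewrite /J addrAC ceilDrz ?int_num1 // ?ceil1 ?odd_absz_succ // -[1]/(1%:~R) intrKceil odd_absz_succ.
  exists J; split=> //; last apply: (shift J J1).
    by move=> t /nonint[V Vt VP]; exists V => // u v /VP[_ +] /VP[_]; rewrite /J => -> ->.
  have JE u : t0 - r < u -> u < t0 + r -> J u = l u (+) l s0.
    move=> ua ub; rewrite /J; have [u0|u0|u0] := ltgtP u t0.
    - by rewrite (ceil_eq _ 0) /=; try lra; rewrite lL // addbb.
    - by rewrite (ceil_eq _ 1) /=; try lra; rewrite lR //; case: (l s0).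
    - by rewrite (ceil_eq _ 0) /=; try lra; rewrite u0 lt0 addbb.
  move=> u v ? ? ? ?; rewrite UP ?JE //; first by bool_ring.
    by apply: Ul.
  by apply: Ul.
pose J (t : R) := odd `|Num.floor (t - t0)|%N.
have J1 t : J (t + 1) = ~~ J t.
  by rewrite /J addrAC floorDrz ?int_num1 // ?floor1 ?odd_absz_succ // -[1]/(1%:~R) intrKfloor odd_absz_succ.
exists J; split=> //; last apply: (shift J J1).
  by move=> t /nonint[V Vt VP]; exists V => // u v /VP[+ _] /VP[+ _]; rewrite /J => -> ->.
have JE u : t0 - r < u -> u < t0 + r -> J u = l u (+) ~~ l s0.
  move=> ua ub; rewrite /J; have [u0|u0|u0] := ltgtP u t0.
  - by rewrite (floor_eq _ (- 1)) /=; try (rewrite ?mulrN1z; lra); rewrite lL //; case: (l s0).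
  - by rewrite (floor_eq _ 0) /=; try lra; rewrite lR // addbb.
  - rewrite (floor_eq _ 0) /=; try lra; rewrite u0.
    by move: lt0; case: (l t0); case: (l s0).
move=> u v ? ? ? ?; rewrite UP ?JE //; first by bool_ring.
  by apply: Ul.
by apply: Ul.
Qed.

End Crossing.

Section Parity.
Variables (R : realType) (T : topologicalType) (d : T -> T -> R).
Hypothesis sT : surface d.
Local Notation P := (R * R)%type.
Implicit Types (n m : T -> T -> bool) (A K U V O D : set T) (p q x y : T).

Definition dual_cocycle (c : R -> T) n (e0 : R) := [/\ cocycle setT n, 0 < e0,
  forall x, ~ range c x -> locally_zero n x &
  forall p q m v, p <> q -> ~ range c p -> ~ range c q -> kernel p q [set x | d p x < e0] m ->
    oint m c v -> n p q = v].

(** Just before and just after the crossing, [dd] lies on opposite sides of c, so [crossing_kernel]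
    joined to the defining property of the dual gives the value 1. *)
Lemma crossing_flip (c dd : R -> T) n e0 U (f : T -> P) (h : P -> T) (t0 : R) : simple c -> simple dd ->
  dual_cocycle c n e0 -> axes_at U f h (range c) (range dd) (dd t0) ->
  exists2 e : R, 0 < e & forall s t, t0 - e < s -> s < t0 -> t0 < t -> t < t0 + e ->
    n (dd s) (dd t) = true.
Proof.
move=> sc sd [nc e00 nz nP] ax; have [y0 y00 y0P] := crossing_kernel sT sc e00 ax.
have [cU Ux fx fa fb] := ax; have [dc d1] := sd.1.
have : nbhs t0 (dd @^-1` (U `&` f @^-1` box (- y0) y0 (- y0) y0)).
  apply: dc; apply: filterI; first exact: (chart_nbhs cU).
  by apply: (chart_cts cU Ux); rewrite fx; apply: nbhs_box => /=; lra.
move=> /nbhs_realP[e1 e10 e1P].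
pose e := Num.min e1 (1/2).
have e_gt0 : 0 < e by rewrite lt_min e10; lra.
have ee1 : e <= e1 by rewrite ge_min lexx.
have e12 : e <= 1/2 by rewrite ge_min lexx orbT.
pose psi t := (f (dd t)).2.
have inU t : t0 - e < t -> t < t0 + e -> U (dd t) by move=> ? ?; have [||? _] := e1P t; try lra.
have inb t : t0 - e < t -> t < t0 + e -> - y0 < psi t < y0.
  by move=> ? ?; have [||_ [_ _ ? ?]] := e1P t; try lra; apply/andP.
have fd1 t : t0 - e < t -> t < t0 + e -> (f (dd t)).1 = 0.
  by move=> ta tb; apply/(fb _ (inU t ta tb)); exists t.
have ddE t : t0 - e < t -> t < t0 + e -> dd t = h (0, psi t).
  by move=> ta tb; rewrite -(fd1 t) // -surjective_pairing (chartK cU) //; exact: inU.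
have psi_inj s t : t0 - e < s -> s < t0 + e -> t0 - e < t -> t < t0 + e -> psi s = psi t -> s = t.
  by move=> ? ? ? ? E; apply: (simple_inj sd); [rewrite !ddE // E|lra|lra].
have psi0 : psi t0 = 0 by rewrite /psi fx.
have [|b bP] := @sign_change R psi t0 e e_gt0 psi0 _ psi_inj.
  move=> t ta tb; have Ut := inU t ta tb.
  change (cts (fun t => (f (dd t)).2) t); apply: cts_snd; apply: cts_comp; first exact: dc.
  exact: (chart_cts cU Ut).
exists e => // s t s1 s2 t1 t2.
have [bs bt] := bP s t s1 s2 t1 t2.
have sn : psi s != 0.
  by apply/eqP => E; have := psi_inj s t0; rewrite E psi0; lra.
have tn : psi t != 0.
  by apply/eqP => E; have := psi_inj t t0; rewrite E psi0; lra.
have prod : psi s * psi t < 0.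
  move: bs bt; case: (b) => /= bs bt.
    have s0 : 0 < psi s by rewrite lt_neqAle eq_sym sn leNgt bs.
    by rewrite pmulr_rlt0.
  have t0' : 0 < psi t by rewrite lt_neqAle eq_sym tn leNgt bt.
  by rewrite pmulr_llt0.
rewrite ddE ?(ddE t); try lra.
have /andP[a1 a2] : - y0 < psi s < y0 by apply: inb; lra.
have /andP[b1 b2] : - y0 < psi t < y0 by apply: inb; lra.
have [pq cp cq [m km mt]] := y0P (psi s) (psi t) a1 a2 b1 b2 prod.
exact: (nP _ _ m).
Qed.

(** The sum S of the step functions of all crossings is a potential of the dual along [dd], and each
    summand changes once per period. *)
Lemma cross_parity (c dd : R -> T) n e0 (Xs : seq T) : simple c -> simple dd ->
  dual_cocycle c n e0 -> uniq Xs -> (forall x, x \in Xs <-> range c x /\ range dd x) ->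
  (forall x, x \in Xs -> exists U (f : T -> P) (h : P -> T), axes_at U f h (range c) (range dd) x) ->
  oint n dd (odd (size Xs)).
Proof.
move=> sc sd dn uX XE XC; have [nc e00 nz nP] := dn; have [dc d1] := sd.1.
pose m := pull dd n.
have mc : cocycle setT m by apply: (pull_cocycle _ _ nc) => //; apply: loop_cont_on; exact: sd.1.
have m1 s t : m (s + 1) (t + 1) = m s t by rewrite /m /pull !d1.
have XF x : x \in Xs -> exists (t0 : R) (J : R -> bool), [/\ dd t0 = x, forall t, J (t + 1) = ~~ J t,
    forall t, dd t <> x -> exists2 U, nbhs t U & forall u v, U u -> U v -> J u = J v &
    forall t, dd t = x -> exists2 U, nbhs t U & forall u v, U u -> U v -> m u v = J u (+) J v].
  move=> xX; have [U [f [h ax]]] := XC x xX; have [_ [t0 _ dt0]] := (XE x).1 xX.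
  rewrite -dt0 in ax.
  have [e e_gt0 eP] := crossing_flip sc sd dn ax.
  have [J [J1 J2 J3]] := flip_fun mc m1 e_gt0 eP.
  exists t0, J; split=> // t dt.
    by apply: J2; apply/negP => /((sd.2 t t0).2); rewrite dt0.
  by apply: J3; apply/(sd.2 t t0); rewrite dt0.
have [S [S1 S2 S3]] : exists S : R -> bool, [/\ forall t, S (t + 1) (+) S t = odd (size Xs),
    forall t, dd t \notin Xs -> exists2 U, nbhs t U & forall u v, U u -> U v -> S u = S v &
    forall t, dd t \in Xs -> exists2 U, nbhs t U & forall u v, U u -> U v -> m u v = S u (+) S v].
  elim: Xs uX XF {XE XC} => [|x Xs IH] /=.
    by move=> _ _; exists (fun=> false); split=> // t _; exists setT => //; exact: filterT.
  move=> /andP[xX uX] XF; have [|S [S1 S2 S3]] := IH uX.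
    by move=> y yX; apply: XF; rewrite in_cons yX orbT.
  have [t0 [J [dt0 J1 J2 J3]]] := XF x (mem_head _ _).
  exists (fun t => S t (+) J t); split=> t.
  - by rewrite -(S1 t) J1; case: (S _); case: (S _); case: (J _).
  - rewrite in_cons negb_or => /andP[/eqP tx tX].
    have [U Ut UP] := S2 t tX; have [V Vt VP] := J2 t tx.
    exists (U `&` V) => [|u v [Uu Vu] [Uv Vv]]; first exact: filterI.
    by rewrite (UP u v) // (VP u v).
  - rewrite in_cons => /orP[/eqP tx|tX].
      have [|U Ut UP] := S2 t; first by rewrite tx.
      have [V Vt VP] := J3 t tx.
      exists (U `&` V) => [|u v [Uu Vu] [Uv Vv]]; first exact: filterI.
      by rewrite VP // (UP u v) // addbACA addbb.
    have [U Ut UP] := S3 t tX; have [|V Vt VP] := J2 t.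
      by move=> tx; rewrite tx (negPf xX) in tX.
    exists (U `&` V) => [|u v [Uu Vu] [Uv Vv]]; first exact: filterI.
    by rewrite UP // (VP u v) // addbACA addbb addbF.
exists S => // t _; have [tX|tX] := boolP (dd t \in Xs).
  by have [U Ut UP] := S3 t tX; exists U => // u v Uu Uv _ _; rewrite -UP.
have [U Ut UP] := S2 t tX.
have [|V Vt VP] := nz (dd t).
  by move=> ct; move/negP: tX; apply; apply/XE; split=> //; exists t.
have Vc : nbhs t (dd @^-1` V) by exact: dc Vt.
exists (U `&` dd @^-1` V) => [|u v [Uu Vu] [Uv Vv] _ _]; first exact: filterI.
by rewrite /pull VP // (UP u v) // addbb.
Qed.

End Parity.

(** * Symmetry of the dual pairing *)

Section Transverse.
Variables (R : realType) (T : topologicalType) (d : T -> T -> R).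
Hypothesis sT : surface d.
Implicit Types (n m : T -> T -> bool) (A V : set T) (p q r x y : T) (c : R -> T) (F : seq T).

Definition thin A := closed A /\ forall x V, nbhs x V -> exists2 y, V y & ~ A y.

Lemma thin1 p : thin [set p].
Proof.
split=> [|x V Vx]; first by apply: compact_closed; [exact: surface_hausdorff sT|exact: compact_set1].
have [U [f [h [cU Ux fx UV]]]] := surface_chart sT Vx.
have [xp|xp] := pselect (x = p); last by exists x => //; exact: UV.
exists (h (1, 0)); first by apply: UV; exact: (chart_in cU).
move=> /(congr1 f); rewrite (chartKV cU) -xp fx => -[/eqP]; by rewrite oner_eq0.
Qed.

Lemma thin_simple c : simple c -> thin (range c).
Proof.
move=> sc; split=> [|x V]; last exact: (simple_dense sT sc).
by apply: compact_closed; [exact: surface_hausdorff sT|exact: simple_compact].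
Qed.

(** A finite case of the Baire property. The induction carries a whole neighbourhood that avoids the
    earlier sets, which uses that they are closed. *)
Lemma thin_seq (I : Type) (s : seq I) (Q : I -> set T) : (forall i, thin (Q i)) ->
  forall x V, nbhs x V -> exists2 y, V y & foldr (fun i S => ~ Q i y /\ S) True s.
Proof.
move=> tQ; suff H : forall x V, nbhs x V -> exists y, nbhs y V /\ nbhs y [set y | foldr (fun i S => ~ Q i y /\ S) True s].
  move=> x V Vx; have [y [Vy Sy]] := H x V Vx; exists y; first exact: nbhs_singleton.
  exact: (nbhs_singleton Sy).
elim: s => [|i s IH] x V Vx; first by exists x; split=> //; exact: filterT.
have [y [Vy Sy]] := IH x V Vx.
have [cQ dQ] := tQ i.
have [U [f [h [cU Uy _ UV]]]] := surface_chart sT (filterI Vy Sy).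
have [z Uz nz] := dQ y U (chart_nbhs cU Uy).
exists z; have Uz' := chart_nbhs cU Uz; split.
  by apply: filterS Uz' => w /UV[].
have nQ : nbhs z (~` Q i) by apply: open_nbhs_nbhs; split=> //; exact: closed_openC.
by apply: filterS (filterI nQ Uz') => w [nw /UV[_ Sw]].
Qed.

Lemma finite_small (I : finType) (Q : I -> R -> Prop) :
  (forall i (a b : R), 0 < b -> b <= a -> Q i a -> Q i b) ->
  (forall i, exists2 a : R, 0 < a & Q i a) -> exists2 a : R, 0 < a & forall i, Q i a.
Proof.
move=> Qm Qe; suff [a a0 aP] : exists2 a : R, 0 < a & forall i, i \in enum I -> Q i a.
  by exists a => // i; apply: aP; rewrite mem_enum.
elim: (enum I) => [|i s [a a0 IH]]; first by exists 1.
have [b b0 bP] := Qe i; exists (Num.min a b); first by rewrite lt_min a0 b0.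
move=> k; rewrite inE => /orP[/eqP->|ks].
  by apply: Qm bP; rewrite ?lt_min ?a0 ?b0 // ge_min lexx orbT.
by apply: Qm (IH k ks); rewrite ?lt_min ?a0 ?b0 // ge_min lexx.
Qed.

(** At the common end the residues cancel, so this singularity is removable and a kernel between the
    outer ends remains, up to a coboundary. *)
Lemma kernel_join p q r n m : p <> q -> q <> r -> p <> r -> kernel p q setT n -> kernel q r setT m ->
  exists2 n', kernel p r setT n' & coboundary (off [:: p; q; r]) (addcoc (addcoc n m) n').
Proof.
move=> pq qr pr kn km; have [cnm ntp tq ntr _] := kernel_comp sT pq qr pr kn km.
have qA : nbhs q (off [:: p; r]).
  have H := off_nbhs sT [:: p; r] q; apply: filterS H => x /= xP.
  rewrite /off /= !inE; apply/negP => /orP[/eqP xp|/eqP xr].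
    by apply: pq; rewrite -xp; apply: xP; rewrite xp inE eqxx.
  by apply: qr; rewrite -xr; apply/esym; apply: xP; rewrite xr !inE eqxx orbT.
have sub : off [:: p; r] `\ q `<=` off [:: p; q; r].
  by move=> x [] /= xA xq; move: xA; rewrite /off /= !inE !negb_or => /andP[-> ->]; rewrite andbT; apply/eqP.
have cA : cocycle (off [:: p; r] `\ q) (addcoc n m) := cocycle_sub sub cnm.
have [n' [k [cn' kp _]]] := removal sT (filterT : nbhs q setT) cA tq.
have sub' : off [:: p; q; r] `<=` off [:: p; r] `\ q.
  move=> x; rewrite /off /= !inE !negb_or => /and3P[-> xq ->]; split=> //.
  exact/eqP.
have kp' := potential_sub sub' kp.
exists n'; last by exists k.
have nt z : z = p \/ z = r -> ~ triv z (addcoc n m) -> ~ triv z n'.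
  move=> zpr nt tz; apply: nt.
  have Vz := off_nbhs sT [:: p; q; r] z.
  apply: (triv_sub Vz _ tz); apply: coboundary_addC; exists k; apply: potential_sub kp'.
  by move=> x [/= xP xz]; rewrite /off /=; apply/negP => /xP.
by split; [exact: cn'|apply: nt => //; left|apply: nt => //; right|move=> x nx; case: nx].
Qed.

(** The points that can be joined to p by a kernel form an open and closed set, by [kernel_exists]
    and [kernel_join]. *)
Lemma kernel_any p q : p <> q -> exists n, kernel p q setT n.
Proof.
move=> pq; pose h x := `[< x = p \/ exists n, kernel p x setT n >].
have lc : potential setT nul h.
  move=> x _; have [W Wx WP] := kernel_exists sT (filterT : nbhs x setT).
  have step u v : W u -> W v -> h u -> h v.
    move=> Wu Wv /asboolP hu; apply/asboolP.
    have [->//|vp] := pselect (v = p); first by left.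
    have [uv|uv] := pselect (u = v); first by rewrite -uv.
    have [m km] := WP u v Wu Wv uv; right; case: hu => [up|[n kn]].
      by exists m; rewrite -up.
    have [up|up] := pselect (u = p); first by exists m; rewrite -up.
    have [n' kn' _] := @kernel_join p u v n m (fun H => up (esym H)) uv (fun H => vp (esym H)) kn km.
    by exists n'.
  exists W => // u v Wu Wv _ _; rewrite /nul; apply/esym/negbTE/negPn.
  case hu : (h u); first by rewrite (step u v).
  by case hv : (h v) => //; move: hu; rewrite (step v u).
have hp : h p by apply/asboolP; left.
have : h q by rewrite (surface_conn sT lc (I : setT q) (I : setT p)).
by move=> /asboolP[qp|//]; case: pq.
Qed.

Lemma removal2 p q m : kernel p q setT m -> forall n, kernel p q setT n ->
  exists2 n', cocycle setT n' & coboundary (off [:: p; q]) (addcoc (addcoc n m) n').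
Proof.
move=> [cm mp mq _] n [cn np nq _].
have [||n' [k [cn' kp _]]] := @removal_seq _ _ _ sT [:: p; q] (addcoc n m) setT.
- move=> z zpq; split; first exact: filterT.
  apply: (not_triv_add_off sT cn cm).
    by move: zpq; rewrite !inE => /orP[/eqP->|/eqP->].
  by move: zpq; rewrite !inE => /orP[/eqP->|/eqP->].
- exact: cocycleD.
- by exists n' => //; exists k.
Qed.

(* The sum of small kernels between consecutive points of a fine subdivision of c
   extends over the subdivision points; integrating it along dd i and using the
   defining property of the dual of dd i turns it into an integral along c. *)
Theorem dual_symmetry (I : finType) (dd : I -> R -> T) (nn : I -> T -> T -> bool) (ee : I -> R) c :
  loop c -> (forall i, simple (dd i)) -> (forall i, dual_cocycle d (dd i) (nn i) (ee i)) ->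
  exists2 z, cocycle setT z & forall i w, oint (nn i) c w -> oint z (dd i) w.
Proof.
move=> lc sdd dual.
have cnn i : cocycle setT (nn i) by case: (dual i).
have [r r0 rP] : exists2 r : R, 0 < r & forall i, r <= ee i.
  have A1 i (a b : R) : 0 < b -> b <= a -> a <= ee i -> b <= ee i by move=> _; exact: le_trans.
  have A2 i : exists2 a : R, 0 < a & a <= ee i by case: (dual i) => _ e0 _ _; exists (ee i).
  by have [r r0 rP] := finite_small A1 A2; exists r.
have [s s0 sP] := uniform_kernel sT r0.
have [dl dl0 dlP] : exists2 a : R, 0 < a & forall i x, exists k : T -> bool, forall p q,
    d x p < a -> d x q < a -> nn i p q = k p (+) k q.
  apply: (@finite_small I (fun i a => forall x, exists k : T -> bool, forall p q,
    d x p < a -> d x q < a -> nn i p q = k p (+) k q)) => [i a b b0 ba H x|i].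
    by have [k kP] := H x; exists k => p q xp xq; apply: kP; apply: lt_le_trans ba.
  apply: (unif sT) => [x a b b0 ba [k kP]|x].
    by exists k => p q xp xq; apply: kP; apply: lt_le_trans ba.
  have [U [k [Ux UP]]] := cnn i x Logic.I.
  have [a a0 aP] := proj1 (dist_nbhs sT x U) Ux.
  exists (a / 2); first by rewrite divr_gt0.
  move=> y xy; exists k => p q yp yq; apply: UP => //; apply: aP.
    by apply: le_lt_trans (dist_tri sT x y p) _; lra.
  by apply: le_lt_trans (dist_tri sT x y q) _; lra.
(* With end points within [et] of points of c, themselves within [et] of c x, any two of them are
   closer than 4 [et], so both the small kernels and the local potentials of all duals apply. *)
pose et := Num.min s dl / 4.
have et0 : 0 < et by rewrite divr_gt0 // lt_min s0 dl0.
have ets : 4 * et <= s by rewrite /et mulrC divfK // ge_min lexx.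
have etd : 4 * et <= dl by rewrite /et mulrC divfK // ge_min lexx orbT.
have pick (F : seq T) x V : nbhs x V -> exists y, [/\ V y, y \notin F & forall i, ~ range (dd i) y].
  pose Q (z : T + I) := match z with inl p => [set p] | inr i => range (dd i) end.
  have tQ z : thin (Q z) by case: z => [p|i]; [exact: thin1|exact: thin_simple].
  move=> Vx; have [y Vy Sy] := thin_seq ([seq inl p | p <- F] ++ [seq inr i | i <- enum I]) tQ Vx.
  have S (z : seq (T + I)) : foldr (fun i S => ~ Q i y /\ S) True z -> forall i, List.In i z -> ~ Q i y.
    by elim: z => //= a z' IH [na /IH H] i [<-//|/H].
  have S' := S _ Sy; exists y; split=> //.
    apply/negP => yF; apply: (S' (inl y)) => //.
    apply/List.in_app_iff; left; apply/List.in_map_iff; exists y; split=> //.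
    elim: F yF {Sy S S'} => //= a F IH; rewrite inE => /orP[/eqP->|/IH]; [by left|by right].
  move=> i yi; apply: (S' (inr i)) => //.
  apply/List.in_app_iff; right; apply/List.in_map_iff; exists i; split=> //.
  have : i \in enum I by rewrite mem_enum.
  elim: (enum I) => //= a F1 IH; rewrite inE => /orP[/eqP->|/IH]; [by left|by right].
have small p q : d p q < s -> p <> q -> (forall i, ~ range (dd i) p) -> (forall i, ~ range (dd i) q) ->
    exists2 K, kernel p q setT K & forall i, oint K (dd i) (nn i p q).
  move=> pqs pq offp offq; have [K kK] := sP p q pqs pq; exists K; first by apply: kernel_sub kK.
  move=> i; have cK : cocycle (off [:: p; q]) K by case: kK.
  have dK t : off [:: p; q] (dd i t).
    rewrite /off /= !inE; apply/negP => /orP[/eqP E|/eqP E].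
      by apply: (offp i); rewrite -E; exists t.
    by apply: (offq i); rewrite -E; exists t.
  have [v ov] := oint_exists (proj1 (sdd i)) dK cK.
  case: (dual i) => _ _ _ dP; rewrite (dP p q K v) //.
  by apply: kernel_sub kK => x /= H; apply: lt_le_trans (rP i).
have avoid F i : (forall x, x \in F -> forall i, ~ range (dd i) x) -> forall t, off F (dd i t).
  by move=> FP t; rewrite /off /=; apply/negP => /FP /(_ i); apply; exists t.
(* The integral of K along each [dd i] is that of the dual of [dd i] along the path from p to c a,
   along c to c b, and on to q. Auxiliary points are kept off all [dd i] so that these integrals
   exist. *)
pose good (a b : R) := forall p q, d (c a) p < et -> d (c b) q < et -> p <> q ->
  (forall i, ~ range (dd i) p) -> (forall i, ~ range (dd i) q) ->
  exists2 K, kernel p q setT K & forall i w, pint (nn i) c a b w ->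
    oint K (dd i) (nn i p (c a) (+) w (+) nn i (c b) q).
have cc (a b : R) i : cocycle (Icc a b) (pull c (nn i)).
  by apply: (@pull_cocycle _ _ setT) => //; exact: loop_cont_on.
have g01 : good 0 1.
  apply: cousin; first exact: ler01.
    move=> a b b' _ ab bb _ Pab Pbb p q pa qb pq offp offq.
    have [x [xb xF xoff]] := pick [:: p; q] (c b) _ (ball_nbhs sT (c b) et0).
    move: xF; rewrite !inE negb_or => /andP[/eqP xp /eqP xq].
    have [K kK oK] := Pab p x pa xb (fun H => xp (esym H)) offp xoff.
    have [K' kK' oK'] := Pbb x q xb qb xq xoff offq.
    have [K2 kK2 coK2] := kernel_join (fun H => xp (esym H)) xq pq kK kK'.
    exists K2 => // i w pw.
    have [w1 pw1] := pint_exists ab (cc a b i); have [w2 pw2] := pint_exists bb (cc b b' i).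
    have wE := pint_uniq (le_trans ab bb) pw (pint_cat ab bb (cc a b' i) pw1 pw2).
    have av : forall t, off [:: p; x; q] (dd i t).
      by apply: avoid => z; rewrite !inE => /or3P[/eqP->|/eqP->|/eqP->].
    have := oint_cohomologous (proj1 (sdd i)) av coK2 (ointD (oK i _ pw1) (oK' i _ pw2)).
    have nsym : nn i (c b) x = nn i x (c b).
      have [k kP] := dlP i (c b).
      have cbb : d (c b) (c b) = 0 by exact: (dist_refl sT).
      by rewrite /= in xb; rewrite (kP (c b) x) 1?(kP x (c b)) 1?addbC //; lra.
    rewrite nsym wE; congr oint.
    by case: (nn i p _); case: (nn i x _); case: (nn i (c b') q); case: (w1); case: (w2).
  move=> x _ _.
  have cx : nbhs x [set t | d (c x) (c t) < et] := proj1 lc x _ (ball_nbhs sT (c x) et0).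
  have [e1 e10 e1P] := nbhs_realP cx; exists e1 => // a b _ ax xb _ ea eb p q pa qb pq offp offq.
  have ca : d (c x) (c a) < et by apply: e1P; lra.
  have cb : d (c x) (c b) < et by apply: e1P; lra.
  have xp : d (c x) p < 2 * et by apply: le_lt_trans (dist_tri sT _ (c a) _) _; lra.
  have xq : d (c x) q < 2 * et by apply: le_lt_trans (dist_tri sT _ (c b) _) _; lra.
  have pqs : d p q < s.
    by apply: le_lt_trans (dist_tri sT _ (c x) _) _; rewrite (dist_sym sT p); lra.
  have [K kK oK] := small p q pqs pq offp offq; exists K => // i w pw.
  have [k kP] := dlP i (c x).
  have xx : d (c x) (c x) < dl by rewrite (dist_refl sT).
  have -> : w = nn i (c a) (c b).
    have pk : potential [set y | d (c x) y < dl] (nn i) k.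
      by move=> y _; exists setT; [exact: filterT|move=> u v _ _ Au Av; exact: kP].
    rewrite (kP (c a) (c b)); [|lra|lra].
    apply: (pint_uniq _ pw); first lra.
    apply: (pint_diff _ pk); [lra| |exact: loop_cont_on].
    move=> t [t1 t2]; have H : d (c x) (c t) < et by apply: e1P; lra.
    by rewrite /=; lra.
  have := oK i; rewrite !kP; [|lra|lra|lra|lra|lra|lra|lra|lra]; congr oint.
  by case: (k p); case: (k q); case: (k (c a)); case: (k (c b)).
have [p [pa _ offp]] := pick [::] (c 0) _ (ball_nbhs sT (c 0) et0).
have [q [qa qp offq]] := pick [:: p] (c 0) _ (ball_nbhs sT (c 0) et0).
have pq : p <> q by move=> E; move: qp; rewrite E inE eqxx.
have c10 : c 1 = c 0 by rewrite -(proj2 lc 0) add0r.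
have qa1 : d (c 1) q < et by rewrite c10.
have [K kK oK] := g01 p q pa qa1 pq offp offq.
have pqs : d p q < s.
  by apply: le_lt_trans (dist_tri sT _ (c 0) _) _; rewrite (dist_sym sT p); rewrite /= in pa qa; lra.
(* K has gone once around c while K' joins p to q directly; their sum has no residues left and so
   comes from a cocycle of the whole surface. *)
have [K' kK' oK'] := small p q pqs pq offp offq.
have [z cz coz] := removal2 kK' kK; exists z => // i w [k kp kw].
have pw : pint (nn i) c 0 1 w.
  by exists k; [exact: potential_sub kp|rewrite addbC -(add0r 1) kw].
have av : forall t, off [:: p; q] (dd i t).
  by apply: avoid => y; rewrite !inE => /orP[/eqP->|/eqP->].
have := oint_cohomologous (proj1 (sdd i)) av coz (ointD (oK i w pw) (oK' i)).
rewrite c10; have [k' kP] := dlP i (c 0).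
have xx : d (c 0) (c 0) = 0 by exact: (dist_refl sT).
rewrite /= in pa qa; rewrite !kP; [|lra|lra|lra|lra|lra|lra].
by congr oint; case: (k' p); case: (k' q); case: (k' (c 0)); case: (w).
Qed.

End Transverse.

Lemma conn_connected (T : topologicalType) (A : set T) : conn A -> connected A.
Proof.
move=> cA B [b Bb] [C oC BC] [D cD BD].
have Ab : A b by move: Bb; rewrite BC => -[].
have lc : potential A nul (fun x => `[< B x >]).
  move=> x Ax; have [Bx|nBx] := pselect (B x).
    exists C; first by apply: open_nbhs_nbhs; split=> //; move: Bx; rewrite BC => -[].
    move=> p q Cp Cq Ap Aq; have Bp : B p by rewrite BC.
    have Bq : B q by rewrite BC.
    by rewrite !asboolT.
  exists (~` D); first by apply: open_nbhs_nbhs; split; [exact: closed_openC|move=> Dx; apply: nBx; rewrite BD].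
  move=> p q Dp Dq Ap Aq; rewrite !asboolF //; first by rewrite BD => -[].
  by rewrite BD => -[].
apply/seteqP; split=> [x|x Ax]; first by rewrite BC => -[].
have := cA _ lc x b Ax Ab; rewrite (asboolT Bb); exact: asboolW.
Qed.

(** * Extending potentials to the complement of a filling set *)

Section Components.
Variables (R : realType) (T : topologicalType) (d : T -> T -> R).
Hypothesis sT : surface d.
Local Notation P := (R * R)%type.
Implicit Types (n m : T -> T -> bool) (A C V W X : set T) (p q r x y : T) (F : seq T).

(** If the property failed for the whole space, the complements of the sets having it would form a
    proper filter, and a cluster point of that filter contradicts the local assumption. *)
Lemma compact_induction (Pr : set T -> Prop) : Pr set0 -> (forall A B, A `<=` B -> Pr B -> Pr A) ->
  (forall A B, Pr A -> Pr B -> Pr (A `|` B)) -> (forall y, exists2 V, nbhs y V & Pr V) -> Pr setT.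
Proof.
move=> P0 Pm PU Pl; apply: contrapT => nP.
pose F : set_system T := [set S | Pr (~` S)].
have FF : ProperFilter F.
  split; first by rewrite /F /= setC0.
  split; first by rewrite /F /= setCT.
    by move=> A B FA FB; rewrite /F /= setCI; exact: PU.
  by move=> A B AB; apply: Pm; exact: subsetC.
have FT : F setT by rewrite /F /= setCT.
have [y [_ cl]] := surface_compact sT FF FT.
have [V Vy PV] := Pl y.
have FV : F (~` V) by rewrite /F /= setCK.
by have [z [nz z2]] := cl _ _ FV Vy.
Qed.

Lemma nbhs_open A : (forall x, A x -> nbhs x A) -> open A.
Proof. by move=> H; rewrite openE => x Ax; exact: H. Qed.

Lemma comp_open C x y : open C -> connected_component C x y -> nbhs y (connected_component C x).
Proof.
move=> oC xy; have Cy := connected_component_sub xy.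
have Cn : nbhs y C by apply: open_nbhs_nbhs.
have [U [f [h [cU Uy _ UC]]]] := surface_chart sT Cn.
apply: filterS (chart_nbhs cU Uy); rewrite (same_connected_component xy).
by apply: connected_component_max => //; apply: conn_connected; exact: (conn_chart cU).
Qed.

Lemma comp_eq C x y z : connected_component C x z -> connected_component C y z ->
  connected_component C x = connected_component C y.
Proof. by move=> /same_connected_component -> /same_connected_component ->. Qed.

Lemma disk_chart A : open A -> homeomorphic A [set v : P | v.1 ^+ 2 + v.2 ^+ 2 < 1] ->
  exists (f : T -> P) (h : P -> T), chart A f h.
Proof.
move=> oA [f0 [[f1 f2 f3] fc [h0 [h0K hc]]]].
pose r (v : P) := v.1 ^+ 2 + v.2 ^+ 2.
(* Radial stretching of the open unit disk onto the plane, with inverse [psi]. *)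
pose phi (v : P) : P := (v.1 / Num.sqrt (1 - r v), v.2 / Num.sqrt (1 - r v)).
pose psi (v : P) : P := (v.1 / Num.sqrt (1 + r v), v.2 / Num.sqrt (1 + r v)).
have r0 v : 0 <= r v by rewrite addr_ge0 // sqr_ge0.
have rc v : cts r v by rewrite /r; cts.
have p1 v : 0 < 1 + r v by have := r0 v; lra.
have sq v : Num.sqrt (1 + r v) ^+ 2 = 1 + r v by rewrite sqr_sqrtr // ltW.
have rpsi v : r (psi v) = r v / (1 + r v).
  by rewrite /r /psi /= !expr_div_n -!/(r v) sq -mulrDl.
have rpsi1 v : r (psi v) < 1 by rewrite rpsi ltr_pdivrMr //; have := r0 v; lra.
have phipsi v : phi (psi v) = v.
  rewrite /phi rpsi; have -> : 1 - r v / (1 + r v) = (1 + r v)^-1.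
    by field; rewrite gt_eqF.
  rewrite sqrtrV ?ltW // /psi /= !invrK !divfK ?gt_eqF ?sqrtr_gt0 //.
  by rewrite -surjective_pairing.
have psiphi v : r v < 1 -> psi (phi v) = v.
  move=> v1; have s0 : 0 < 1 - r v by lra.
  have rphi : r (phi v) = r v / (1 - r v).
    by rewrite /r /phi /= !expr_div_n -!/(r v) sqr_sqrtr ?ltW // -mulrDl.
  rewrite /psi rphi; have -> : 1 + r v / (1 - r v) = (1 - r v)^-1.
    by field; rewrite gt_eqF.
  rewrite sqrtrV ?ltW // /phi /= !invrK !divfK ?gt_eqF ?sqrtr_gt0 //.
  by rewrite -surjective_pairing.
pose D : set P := [set v | r v < 1].
have oD v : D v -> nbhs v D.
  by move=> Dv; apply: cts_lt; [exact: rc|exact: cts_cst|].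
have fr x : A x -> r (f0 x) < 1 by move=> Ax; exact: (f1 x Ax).
have h0A v : D v -> A (h0 v) /\ f0 (h0 v) = v.
  by move=> Dv; have [x Ax <-] := f3 v Dv; rewrite h0K.
exists (phi \o f0), (h0 \o psi); split.
- by move=> x Ax; apply: open_nbhs_nbhs.
- by move=> x Ax /=; rewrite psiphi ?h0K //; exact: fr.
- by move=> v; have [] := h0A (psi v) (rpsi1 v).
- by move=> v /=; have [_ ->] := h0A (psi v) (rpsi1 v).
split=> [x Ax|v].
  have fx : cts f0 x.
    have nA : nbhs x A by apply: open_nbhs_nbhs.
    move=> U fU; have [V Vx VU] := cont_on_within fc Ax fU.
    suff : nbhs x [set y | U (f0 y)] by [].
    by apply: filterS (filterI Vx nA) => y [Vy Ay]; exact: VU.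
  apply: (@cts_comp _ _ _ f0 phi) => //.
  have s0 : 0 < 1 - r (f0 x) by have := fr x Ax; lra.
  have rx := rc (f0 x).
  by rewrite /phi; cts; rewrite gt_eqF // sqrtr_gt0.
apply: (@cts_comp _ _ _ psi h0).
  have rx := rc v.
  by rewrite /psi; cts; rewrite gt_eqF // sqrtr_gt0.
have Dv : D (psi v) := rpsi1 v.
move=> U fU; have [V Vx VU] := cont_on_within hc Dv fU.
suff : nbhs (psi v) [set y | U (h0 y)] by [].
by apply: filterS (filterI Vx (oD _ Dv)) => y [Vy Ay]; exact: VU.
Qed.

Lemma conn_off F : conn (off F).
Proof.
elim: F => [|q F IH]; first by move=> h hp x y _ _; apply: (surface_conn sT) => //; apply: potential_sub hp.
have [qF|qF] := boolP (q \in F).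
  move=> h hp x y Ax Ay; apply: (IH h).
  - by apply: potential_sub hp => z; rewrite /off /= inE negb_or => zF; rewrite zF andbT; apply: contraNneq zF => ->.
  - by move: Ax; rewrite /off /= inE negb_or => /andP[].
  - by move: Ay; rewrite /off /= inE negb_or => /andP[].
move=> h hp x y Ax Ay.
have qn : nbhs q (off F).
  apply: filterS (off_nbhs sT F q) => z /= zq; rewrite /off /=; apply/negP => zF.
  by move: qF; rewrite -(zq zF) zF.
have hp' : potential (off F `\ q) nul h.
  apply: potential_sub hp => z [zF zq]; rewrite /off /= inE negb_or.
  by apply/andP; split=> //; apply/eqP.
have cn : cocycle (off F) (@nul T) by move=> z _; exists setT, (fun=> false); split=> //; exact: filterT.
have [k kp kE] := extend_point sT qF qn cn hp'.
move: Ax Ay; rewrite /off /= !inE !negb_or => /andP[/eqP xq xF] /andP[/eqP yq yF].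
by rewrite -kE // -(kE y yq); apply: IH.
Qed.

Lemma coboundary_off F n : cocycle setT n -> coboundary (off F) n -> coboundary setT n.
Proof.
elim: F => [|q F IH] cn cb; first by apply: coboundary_sub cb.
apply: IH => //; have [qF|qF] := boolP (q \in F).
  apply: coboundary_sub cb => z zF; rewrite /off /= inE negb_or (zF : z \notin F) andbT.
  by apply: contraNneq (zF : z \notin F) => ->.
have [h hp] := cb.
have qn : nbhs q (off F).
  apply: filterS (off_nbhs sT F q) => z /= zq; rewrite /off /=; apply/negP => zF.
  by move: qF; rewrite -(zq zF) zF.
have hp' : potential (off F `\ q) n h.
  apply: potential_sub hp => z [zF zq]; rewrite /off /= inE negb_or.
  by apply/andP; split=> //; apply/eqP.
have [k kp kE] := extend_point sT qF qn (cocycle_sub (@subsetT _ _) cn) hp'.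
by exists k.
Qed.

(* A component either is a chart domain, or becomes one once its puncture is added. *)
Definition filled (Ps : seq T) A A' := (A' = A \/ exists p, [/\ p \in Ps, ~ A p & A' = p |` A]) /\
  exists (f : T -> P) (h : P -> T), chart A' f h.

Lemma puncture_chart X F p V : closed X -> ~ X p -> nbhs p V -> exists U (f : T -> P) (h : P -> T),
  [/\ chart U f h, U p, f p = (0, 0), U `<=` V & U `\ p `<=` off F `\` X].
Proof.
move=> cX Xp Vp.
have nX : nbhs p (~` X) by apply: open_nbhs_nbhs; split=> //; exact: closed_openC.
have [U [f [h [cU Up fp UV]]]] := surface_chart sT (filterI Vp (filterI nX (off_nbhs sT F p))).
exists U, f, h; split=> // [x /UV[]//|x [/UV[_ [Xx Fx]] xp]]; split=> //.
by apply/negP => /Fx.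
Qed.

Lemma open_offX F X : closed X -> open (off F `\` X).
Proof.
move=> cX; apply: nbhs_open => x [xF Xx].
have nX : nbhs x (~` X) by apply: open_nbhs_nbhs; split=> //; exact: closed_openC.
apply: filterS (filterI nX (off_nbhs sT F x)) => y [Xy yF]; split=> //; apply/negP => /[dup] /yF ->.
by rewrite (negPf xF).
Qed.

(** A homeomorphism with the disk says nothing yet about how the puncture sits in the surface; what
    has to be shown is that A together with p is a neighbourhood of p. *)
Lemma filled_exists (Ps : seq T) X x : closed X -> (off Ps `\` X) x ->
  (forall p, X p -> p \notin Ps) ->
  let A := connected_component (off Ps `\` X) x in
  homeomorphic A [set v : P | v.1 ^+ 2 + v.2 ^+ 2 < 1] \/
  (exists p, [/\ p \in Ps, ~ A p & homeomorphic (p |` A) [set v : P | v.1 ^+ 2 + v.2 ^+ 2 < 1]]) ->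
  exists A', filled Ps A A'.
Proof.
move=> cX Cx XP A; have oC := @open_offX Ps X cX.
have Ao y : A y -> nbhs y A by move=> Ay; exact: comp_open.
case=> [hA|[p [pP Ap hA]]].
  by exists A; split; [left|apply: disk_chart hA; exact: nbhs_open].
exists (p |` A); split; first by right; exists p.
suff pn : nbhs p (p |` A).
  apply: disk_chart hA; apply: nbhs_open => y [->//|Ay].
  by apply: filterS (Ao y Ay) => z ?; right.
have Xp : ~ X p by move=> /XP; rewrite pP.
have [U [f [h [cU Up fp _ UC]]]] := @puncture_chart X Ps p setT cX Xp filterT.
have cUp : connected (U `\ p) by apply: conn_connected; exact: (conn_punctured_chart cU).
have [[y [[Uy yp] Ay]]|nA] := pselect (exists y, (U `\ p) y /\ A y).
  apply: filterS (chart_nbhs cU Up) => z Uz.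
  have [->|zp] := pselect (z = p); first by left.
  right; rewrite /A (same_connected_component Ay).
  by apply: (connected_component_max (B := U `\ p)).
(* If the punctured chart at p missed A, then p would be an isolated point of the disk formed by p
   and A. Moving slightly away from its image in the plane gives the contradiction. *)
exfalso; have UA y : U y -> A y -> False by move=> Uy Ay; apply: nA; exists y; split=> //; split=> // yp; apply: Ap; rewrite -yp.
have [f0 [[f1 f2 f3] fc [h0 [h0K hc]]]] := hA.
have pD : [set v : P | v.1 ^+ 2 + v.2 ^+ 2 < 1] (f0 p) by apply: f1; left.
have h0p : h0 (f0 p) = p by apply: h0K; left.
have Uh : nbhs (h0 (f0 p)) U by rewrite h0p; exact: (chart_nbhs cU Up).
have [V Vp VU] := cont_on_within hc pD Uh.
have oD : nbhs (f0 p) [set v : P | v.1 ^+ 2 + v.2 ^+ 2 < 1].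
  by apply: cts_lt => //; [cts|exact: cts_cst].
have [ep ep0 eP] := nbhs_boxP (filterI Vp oD).
pose v : P := ((f0 p).1 + ep / 2, (f0 p).2).
have [vU vD] : U (h0 v) /\ v.1 ^+ 2 + v.2 ^+ 2 < 1.
  have [vV vD] : (V `&` [set v : P | v.1 ^+ 2 + v.2 ^+ 2 < 1]) v.
    by apply: eP; rewrite /v /=; lra.
  by split=> //; exact: VU.
have [z [zp|Az] zv] := f3 v vD.
  by move: (congr1 fst zv); rewrite zp /v /=; lra.
by apply: (UA (h0 v)) => //; rewrite -zv h0K //; right.
Qed.

End Components.

Lemma cts_nbhs (X Y : topologicalType) (f : X -> Y) x (U : set Y) : cts f x -> nbhs (f x) U ->
  nbhs x (f @^-1` U).
Proof. by move=> fc /fc. Qed.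

Section Extension.
Variables (R : realType) (T : topologicalType) (d : T -> T -> R).
Hypothesis sT : surface d.
Local Notation P := (R * R)%type.
Variables (Ps : seq T) (X : set T).
Hypothesis cX : closed X.
Hypothesis XPs : X `<=` off Ps.
Local Notation C := (off Ps `\` X).
Implicit Types (n m : T -> T -> bool) (A V W : set T) (p q r x y : T) (h k H : T -> bool).

Lemma outer_mono (M N : R) : M <= N -> @outer R N `<=` outer M.
Proof. by move=> MN v [] ?; [constructor 1|constructor 2|constructor 3|constructor 4]; lra. Qed.

Lemma cbox_norm (v : P) : cbox (`|v.1| + `|v.2|) v.
Proof.
have := ler_norm v.1; have := ler_norm v.2; have := ler_norm (- v.1); have := ler_norm (- v.2).
by rewrite !normrN; have := normr_ge0 v.1; have := normr_ge0 v.2; split; lra.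
Qed.

Lemma recenter A (f : T -> P) (g : P -> T) p : chart A f g -> A p ->
  exists (f' : T -> P) (g' : P -> T), chart A f' g' /\ f' p = (0, 0).
Proof.
move=> cA Ap; have [c1 c2 c3 c4 [c5 c6]] := cA.
exists (fun x => ((f x).1 - (f p).1, (f x).2 - (f p).2)),
  (fun v : P => g (v.1 + (f p).1, v.2 + (f p).2)); split; last by rewrite !subrr.
split=> //.
- by move=> x Ax /=; rewrite !subrK -surjective_pairing c2.
- by move=> v; rewrite c4 /= !addrK -surjective_pairing.
split=> [x Ax|v]; first by have := c5 x Ax => ?; cts.
by apply: (@cts_comp _ _ _ (fun v : P => (v.1 + (f p).1, v.2 + (f p).2)) g); [cts|exact: c6].
Qed.

Section End.
Variables (x0 : T) (A' W : set T) (f : T -> P) (g : P -> T).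
Hypothesis X0 : X !=set0.
Local Notation A := (connected_component C x0).
Hypothesis AA' : A' = A \/ exists p, [/\ p \in Ps, ~ A p & A' = p |` A].
Hypothesis cA : chart A' f g.

Lemma sub_A' : A `<=` A'.
Proof. by case: AA' => [->//|[p [_ _ ->]]] x Ax; right. Qed.

Lemma X_A' x : X x -> ~ A' x.
Proof.
move=> Xx; have nA : ~ A x by move=> /connected_component_sub[].
case: AA' => [->//|[p [pP _ ->]] [xp|//]].
by move: (XPs Xx); rewrite /off /= xp pP.
Qed.

Lemma outer_A : exists2 M : R, 0 <= M & forall v, outer M v -> A (g v).
Proof.
case: AA' => [A'A|[p [_ _ A'p]]].
  by exists 0 => // v _; rewrite -A'A; exact: (chart_in cA).
exists (`|(f p).1| + `|(f p).2|); first by rewrite addr_ge0.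
move=> v ov; have := chart_in cA v; rewrite {1}A'p => -[gp|//].
by move/outerE: ov; case; rewrite -(chartKV cA v) gp; exact: cbox_norm.
Qed.

(* The circle around y bounds a disk on either side, in A' and around y, so that A'
   together with y would be a closed surface disjoint from X. *)
Lemma sphere_absurd y U (f1 : T -> P) (g1 : P -> T) : chart U f1 g1 -> U y -> f1 y = (0, 0) ->
  ~ A' y -> ~ X y -> U `\ y `<=` C -> (exists z, (U `\ y) z /\ A z) -> False.
Proof.
move=> cU Uy f1y yA' Xy UC [z [Uz Az]].
have UA : U `\ y `<=` A'.
  move=> t Ut; apply: sub_A'; rewrite (same_connected_component Az).
  apply: (connected_component_max (B := U `\ y)) => //.
  by apply: conn_connected; exact: (conn_punctured_chart cU).
pose I : set T := [set x | U x /\ box (-1) 1 (-1) 1 (f1 x)].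
have Io x : I x -> nbhs x I.
  move=> [Ux [b1 b2 b3 b4]]; apply: filterI; first exact: (chart_nbhs cU).
  by apply: (chart_cts cU Ux); exact: nbhs_box.
pose K2 := g1 @` cbox 1.
have clK2 : closed K2.
  by apply: compact_closed; [exact: surface_hausdorff sT|exact: (chart_cbox_compact cU)].
have IK2 : I `<=` K2.
  move=> x [Ux [b1 b2 b3 b4]]; exists (f1 x); last exact: (chartK cU).
  by split; apply: ltW.
have K2U : K2 `<=` U by move=> x [v _ <-]; exact: (chart_in cU).
have Iy : I y by split=> //; rewrite f1y; split=> /=; lra.
pose S := K2 `&` ~` I.
have clS : closed S.
  by apply: closedI => //; apply: open_closedC; apply: nbhs_open => x; exact: Io.
have SA' : S `<=` A'.
  by move=> x [K2x nIx]; apply: UA; split; [exact: K2U|move=> xy; apply: nIx; rewrite xy].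
have [M M0 SM] := chart_bounded sT cA clS SA'.
pose K1 := g @` cbox M.
have clK1 : closed K1.
  by apply: compact_closed; [exact: surface_hausdorff sT|exact: (chart_cbox_compact cA)].
have K1A' : K1 `<=` A' by move=> x [v _ <-]; exact: (chart_in cA).
(* Far out in [A'] the square S is avoided, so points lie either in the open square I or off the
   closed square K2. As [outer M] is connected only one case occurs, and points close to y show that
   it is the first. *)
have bc : potential (outer M) nul (fun v => `[< I (g v) >]).
  move=> v ov; have [Iv|nIv] := pselect (I (g v)).
    have N : nbhs v (g @^-1` I) := cts_nbhs (chart_inv_cts cA (v := v)) (Io _ Iv).
    by exists (g @^-1` I) => // a b Ia Ib _ _; rewrite !asboolT.
  have nK : ~ K2 (g v).
    move=> K2v; move/outerE: ov; apply; rewrite -(chartKV cA v); apply: SM; split=> //.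
  have nK2 : nbhs (g v) (~` K2) by apply: open_nbhs_nbhs; split=> //; exact: closed_openC.
  have N : nbhs v (g @^-1` (~` K2)) := cts_nbhs (chart_inv_cts cA (v := v)) nK2.
  by exists (g @^-1` (~` K2)) => // a b Ia Ib _ _; rewrite !asboolF // => /IK2.
have [v1 ov1 Iv1] : exists2 v, outer M v & I (g v).
  have nK1 : nbhs y (~` K1) by apply: open_nbhs_nbhs; split; [exact: closed_openC|move=> /K1A'].
  have [_ th] := thin1 sT y.
  have [t [It nt] ty] := th y _ (filterI (Io y Iy) nK1).
  have A't : A' t by apply: UA; split=> //; case: It.
  exists (f t); last by rewrite (chartK cA A't).
  by apply/outerE => ct; apply: nt; exists (f t) => //; exact: (chartK cA A't).
have allI v : outer M v -> I (g v).
  move=> ov; have := conn_outer M0 bc ov ov1; rewrite (asboolT Iv1).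
  by move/asboolP.
have A'K x : A' x -> (K1 `|` K2) x.
  move=> A'x; have [c|/outerE/allI] := pselect (cbox M (f x)).
    by left; exists (f x) => //; exact: (chartK cA A'x).
  by rewrite (chartK cA A'x) => /IK2; right.
(* The set formed by y and [A'] is open and equals the compact union of K1 and K2, so it is the
   whole connected surface, which leaves no room for X. *)
have lc : potential setT nul (fun x => `[< (y |` A') x >]).
  move=> x _; have [Bx|nBx] := pselect ((y |` A') x).
    suff : nbhs x (y |` A') by move=> N; exists (y |` A') => // a b Ba Bb _ _; rewrite !asboolT.
    case: Bx => [->|A'x].
      apply: filterS (chart_nbhs cU Uy) => t Ut; have [->|ty] := pselect (t = y); first by left.
      by right; apply: UA.
    by apply: filterS (chart_nbhs cA A'x) => t; right.
  have nK : nbhs x (~` (K1 `|` K2)).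
    apply: open_nbhs_nbhs; split; first by apply: closed_openC; exact: closedU.
    case=> [/K1A'?|/K2U Ux]; first by apply: nBx; right.
    by apply: nBx; have [->|xy] := pselect (x = y); [left|right; apply: UA].
  have nB t : (~` (K1 `|` K2)) t -> ~ (y |` A') t.
    by move=> nt [ty|/A'K//]; apply: nt; right; rewrite ty; exact: IK2.
  by exists (~` (K1 `|` K2)) => // a b na nb _ _; rewrite !asboolF //; exact: nB.
case: X0 => x Xx; have := surface_conn sT lc (Logic.I : setT x) (Logic.I : setT y).
rewrite (asboolF (P := (y |` A') x)); last by case=> [xy|]; [apply: Xy; rewrite -xy|exact: X_A'].
by rewrite asboolT //; left.
Qed.

(** By compactness the far part of a filled component accumulates only on X: a point of [A'] has a
    bounded neighbourhood, another component is disjoint, and another puncture is excluded by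
    [sphere_absurd]. *)
Lemma end_in : (forall x, X x -> nbhs x W) -> exists2 M : R, 0 <= M & forall v, outer M v -> W (g v).
Proof.
move=> XW; have [M0 M00 M0P] := outer_A.
suff [M M1 MP] : exists2 M : R, 0 <= M & forall v, outer M v -> setT (g v) -> W (g v).
  by exists M => // v ov; exact: MP.
apply: (compact_induction sT (Pr := fun S => exists2 M : R, 0 <= M & forall v, outer M v -> S (g v) -> W (g v))).
- by exists 0.
- by move=> S S' SS [M M1 MP]; exists M => // v ov /SS; exact: MP.
- move=> S S' [M M1 MP] [N N1 NP]; exists (Num.max M N); first by rewrite le_max M1.
  move=> v ov [Sv|Sv]; [apply: MP => //|apply: NP => //].
    by apply: outer_mono ov; rewrite le_max lexx.
  by apply: outer_mono ov; rewrite le_max lexx orbT.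
move=> y; have [Xy|Xy] := pselect (X y).
  by exists W; [exact: XW|exists 0].
have [A'y|A'y] := pselect (A' y).
  pose M := `|(f y).1| + `|(f y).2| + 1.
  exists (A' `&` f @^-1` box (- M) M (- M) M).
    apply: filterI; first exact: (chart_nbhs cA).
    have [b1 b2 b3 b4] := cbox_norm (f y).
    by apply: (chart_cts cA A'y); apply: nbhs_box; rewrite /M; lra.
  exists M; first by rewrite /M; have := normr_ge0 (f y).1; have := normr_ge0 (f y).2; lra.
  move=> v /outerE ov [_]; rewrite /= (chartKV cA) => -[b1 b2 b3 b4]; case: ov.
  by split; apply: ltW.
have [yP|yP] := boolP (y \in Ps).
  have [U [f1 [g1 [cU Uy f1y _ UC]]]] := puncture_chart sT Ps cX Xy (filterT : nbhs y setT).
  exists U; first exact: (chart_nbhs cU).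
  exists M0 => // v ov Uv; exfalso.
  apply: (sphere_absurd cU Uy f1y A'y Xy UC); exists (g v); split; last exact: M0P.
  by split=> // gy; apply: A'y; rewrite -gy; exact: (chart_in cA).
have Cy : C y by split.
exists (connected_component C y).
  by apply: (comp_open sT); [exact: (open_offX sT)|exact: connected_component_refl].
exists M0 => // v /M0P Av yv; exfalso; apply: A'y; apply: sub_A'.
by rewrite (comp_eq Av yv); exact: connected_component_refl.
Qed.

End End.

(** Near its end the component lies in W, so H supplies the boundary data for [extend_outer]. The
    compact set K collects the places where the extension may disagree with H, and it stays away
    from X. *)
Lemma comp_extend n H W x0 A' : X !=set0 -> C x0 -> cocycle (off Ps) n -> potential W n H ->
  (forall x, X x -> nbhs x W) -> filled R Ps (connected_component C x0) A' ->
  exists k (K : set T), [/\ compact K, forall x, K x -> ~ X x,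
    potential (connected_component C x0) n k & forall y, connected_component C x0 y -> ~ K y -> k y = H y].
Proof.
move=> X0 Cx0 cn WH XW [AA' [f [g cA]]].
pose A := connected_component C x0.
have AP : A `<=` off Ps by move=> x /connected_component_sub[].
have AA := sub_A' AA'.
suff [f' [g' [Z [M [cA' ZZ M0 MW [AZ ZA]]]]]] : exists f' g' Z (M : R), [/\ chart A' f' g',
    Z = setT \/ Z = @P0 R, 0 <= M, forall v, outer M v -> W (g' v) &
    (forall x, A x -> Z (f' x)) /\ (forall v, Z v -> A (g' v))].
  have cp : cocycle Z (pull g' n).
    by apply: (chart_pull_cocycle cA' (A := off Ps)) => // v /ZA/AP.
  have pp : potential (outer M) (pull g' n) (H \o g').
    by apply: (chart_pull_potential cA' (A := W)).
  have [k kp kE] := extend_outer ZZ M0 cp pp.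
  exists (k \o f'), (g' @` cbox M); split.
  - exact: (chart_cbox_compact cA').
  - by move=> x [v _ <-] Xv; apply: (X_A' AA' Xv); exact: (chart_in cA').
  - by apply: (chart_push_potential cA' (A := A) (B := Z)).
  move=> y Ay nK; rewrite /= kE /= ?(chartK cA' (AA _ Ay)) //.
  by apply/outerE => c; apply: nK; exists (f' y) => //; rewrite (chartK cA' (AA _ Ay)).
case: (AA') => [A'A|[p [pP nAp A'p]]].
  have [M M0 MW] := end_in X0 AA' cA XW.
  exists f, g, setT, M; split=> //; first by left.
  by split=> // v _; rewrite -/A -[A]A'A; exact: (chart_in cA).
have A'p' : A' p by rewrite A'p; left.
have [f' [g' [cA' fp]]] := recenter cA A'p'.
have [M M0 MW] := end_in X0 AA' cA' XW.
exists f', g', (@P0 R), M; split=> //; first by right.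
split=> [x Ax|v v0].
  apply: (P0_chart cA' fp A'p'); split; first exact: AA.
  by move=> xp; apply: nAp; rewrite -xp.
have [gv gp] := chart_P0 cA' fp A'p' v0.
by move: gv; rewrite A'p => -[].
Qed.

(** The value at q is transported from any point of X within a quarter of a uniform radius; two
    candidates for the same q are close enough to share a local potential, so they give the same
    value. *)
Lemma extend_nbhd n h : cocycle (off Ps) n -> potential X n h -> exists W H,
  [/\ forall x, W x -> nbhs x W, X `<=` W, potential W n H & forall x, X x -> H x = h x].
Proof.
move=> cn hp.
have [dl dl0 dlP] : exists2 e : R, 0 < e & forall x, X x -> exists k : T -> bool,
    (forall p q, d x p < e -> d x q < e -> n p q = k p (+) k q) /\
    (forall p q, d x p < e -> d x q < e -> X p -> X q -> n p q = h p (+) h q).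
  apply: (unif sT (Pr := fun x e => X x -> exists k : T -> bool,
    (forall p q, d x p < e -> d x q < e -> n p q = k p (+) k q) /\
    (forall p q, d x p < e -> d x q < e -> X p -> X q -> n p q = h p (+) h q))).
    move=> x a b b0 ba H Xx; have [k [k1 k2]] := H Xx; exists k.
    by split=> p q p1 q1; [apply: k1|apply: k2]; exact: lt_le_trans ba.
  move=> x; have [Xx|Xx] := pselect (X x); last first.
    have nX : nbhs x (~` X) by apply: open_nbhs_nbhs; split=> //; exact: closed_openC.
    have [e e0 eP] := proj1 (dist_nbhs sT x _) nX.
    by exists e => // y /eP.
  have [U [k [Ux UP]]] := cn x (XPs Xx).
  have [V Vx VP] := hp x Xx.
  have nO : nbhs x (off Ps).
    apply: filterS (off_nbhs sT Ps x) => z /= zP; rewrite /off /=; apply/negP => zPs.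
    by move: (XPs Xx); rewrite /off /= -(zP zPs) zPs.
  have [a a0 aP] := proj1 (dist_nbhs sT x _) (filterI Ux (filterI Vx nO)).
  exists (a / 2); first by rewrite divr_gt0.
  move=> y xy _; exists k.
  have tri p : d y p < a / 2 -> d x p < a by move=> yp; apply: le_lt_trans (dist_tri sT x y p) _; lra.
  split=> p q /tri/aP[Up [Vp Op]] /tri/aP[Uq [Vq Oq]]; first exact: UP.
  exact: VP.
pose near x q := X x /\ d x q < dl / 4.
(* The default q is taken only when no point of X is near, and there H is not constrained. *)
pose sel q := xget q [set x | near x q].
have selP x q : near x q -> near (sel q) q.
  by move=> xq; apply: (@xgetPex T q [set x | near x q]); exists x.
pose H q := n (sel q) q (+) h (sel q).
have d0 x : d x x = 0 by exact: (dist_refl sT).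
have HE x q : near x q -> H q = n x q (+) h x.
  move=> nx; have [Xx xq] := nx; have [Xs sq] := selP x q nx.
  have [k [k1 k2]] := dlP x Xx.
  have xs : d x (sel q) < dl.
    by apply: le_lt_trans (dist_tri sT x q _) _; rewrite (dist_sym sT q); lra.
  have xx : d x x < dl by rewrite d0.
  have xq' : d x q < dl by lra.
  have := k2 _ _ xx xs Xx Xs; rewrite /H !k1 //.
  by case: (k x); case: (k (sel q)); case: (k q); case: (h x); case: (h (sel q)).
have HX x : X x -> H x = h x.
  move=> Xx; have [k [k1 _]] := dlP x Xx.
  rewrite (HE x x); last by split=> //; rewrite d0; lra.
  by rewrite k1 ?d0 // addbb.
have nb x y : near x y -> nbhs y [set z | near x z].
  move=> [Xx xy]; apply/(dist_nbhs sT); exists (dl / 4 - d x y); first by lra.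
  by move=> z yz; split=> //; apply: le_lt_trans (dist_tri sT x y z) _; lra.
exists [set q | exists x, near x q], H; split=> //.
- by move=> y [x xy]; apply: filterS (nb x y xy) => z ?; exists x.
- by move=> x Xx; exists x; split=> //; rewrite d0; lra.
move=> y [x xy]; exists [set z | near x z]; first exact: nb.
move=> p q xp xq _ _; rewrite (HE x p xp) (HE x q xq).
have [Xx xp'] := xp; have [_ xq'] := xq.
have [k [k1 _]] := dlP x Xx; have xx : d x x < dl by rewrite d0.
have xp2 : d x p < dl by lra.
have xq2 : d x q < dl by lra.
rewrite !k1 //.
by case: (k x); case: (k p); case: (k q); case: (h x).
Qed.

(** The potentials chosen on the components are independent of each other; the issue is to glue them
    along X, where infinitely many components might accumulate. *)
Theorem extend_potential n h : X !=set0 -> cocycle (off Ps) n -> potential X n h ->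
  (forall x, C x -> exists A', filled R Ps (connected_component C x) A') ->
  exists2 k, potential (off Ps) n k & forall x, X x -> k x = h x.
Proof.
move=> X0 cn hp fill.
have [W [H [Wo XW WH HX]]] := extend_nbhd cn hp.
have XW' x : X x -> nbhs x W by move=> /XW; exact: Wo.
have oC : open C by exact: (open_offX sT).
(* Compactness leaves only finitely many components that are not contained in W. On the others H
   itself is used, so near a point of X only finitely many closed sets disjoint from X have to be
   avoided. *)
have [Bs BsP] : exists Bs : seq (set T), forall x, C x -> ~ W x -> List.In (connected_component C x) Bs.
  suff [Bs BsP] : exists Bs : seq (set T), forall x, setT x -> C x -> ~ W x -> List.In (connected_component C x) Bs.
    by exists Bs => x; exact: BsP.
  apply: (compact_induction sT (Pr := fun S => exists Bs : seq (set T),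
    forall x, S x -> C x -> ~ W x -> List.In (connected_component C x) Bs)).
  - by exists [::].
  - by move=> S S' SS [Bs BsP]; exists Bs => x /SS; exact: BsP.
  - move=> S S' [Bs BsP] [Bt BtP]; exists (Bs ++ Bt) => x Sx Cx Wx; apply/List.in_app_iff.
    by case: Sx => Sx; [left; exact: BsP|right; exact: BtP].
  move=> y; have [Wy|Wy] := pselect (W y).
    by exists W; [exact: Wo|exists [::]].
  have Xy : ~ X y by move=> /XW.
  have [yP|yP] := boolP (y \in Ps).
    have [U [f1 [g1 [cU Uy f1y _ UC]]]] := puncture_chart sT Ps cX Xy (filterT : nbhs y setT).
    exists U; first exact: (chart_nbhs cU).
    have [_ th] := thin1 sT y; have [z Uz zy] := th y U (chart_nbhs cU Uy).
    exists [:: connected_component C z] => x Ux Cx _; left.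
    have xy : x <> y by move=> xy; case: Cx; rewrite xy /off /= yP.
    have Uc : connected (U `\ y) by apply: conn_connected; exact: (conn_punctured_chart cU).
    apply: same_connected_component.
    by apply: (connected_component_max (B := U `\ y)).
  exists (connected_component C y).
    by apply: (comp_open sT) => //; apply: connected_component_refl.
  exists [:: connected_component C y] => x yx _ _; left.
  exact: same_connected_component.
have [kK kKP] : exists kK : set T -> (T -> bool) * set T, forall x, C x -> 
    let A := connected_component C x in
    [/\ closed (kK A).2, forall x, (kK A).2 x -> ~ X x, potential A n (kK A).1,
      forall y, A y -> ~ (kK A).2 y -> (kK A).1 y = H y & A `<=` W -> (kK A).2 = set0].
  suff ex (A : set T) : exists kK : (T -> bool) * set T, forall x, C x -> A = connected_component C x ->
    [/\ closed kK.2, forall x, kK.2 x -> ~ X x, potential A n kK.1,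
      forall y, A y -> ~ kK.2 y -> kK.1 y = H y & A `<=` W -> kK.2 = set0].
    by have [kK kKP] := choice ex; exists kK => x Cx; exact: (kKP _ x Cx).
  have [[x [Cx ->]]|nx] := pselect (exists x, C x /\ A = connected_component C x); last first.
    by exists (H, set0) => x Cx Ax; case: nx; exists x.
  have [AW|AW] := pselect (connected_component C x `<=` W).
    exists (H, set0) => z Cz _; split=> //=; first exact: closed0.
    exact: potential_sub WH.
  have [A' fA'] := fill x Cx.
  have [k [K [cK KX kp kE]]] := comp_extend X0 Cx cn WH XW' fA'.
  exists (k, K) => z Cz _; split=> //.
  by apply: compact_closed => //; exact: surface_hausdorff sT.
pose k x := if `[< X x >] then h x else (kK (connected_component C x)).1 x.
exists k; last by move=> x Xx; rewrite /k asboolT.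
move=> x xP; have [Xx|Xx] := pselect (X x).
  have near : nbhs x [set y | C y -> ~ (kK (connected_component C y)).2 y].
    have N : nbhs x [set y | forall B, List.In B Bs -> (exists2 z, C z & B = connected_component C z) -> ~ (kK B).2 y].
      elim: Bs {BsP} => [|B Bs IH]; first by apply: filterS filterT => y _ B [].
      have [[z Cz Bz]|nB] := pselect (exists2 z, C z & B = connected_component C z); last first.
        by apply: filterS IH => y yP B' [<-//|]; exact: yP.
      have [clK KX _ _ _] := kKP z Cz; rewrite -Bz in clK KX.
      have nK : nbhs x (~` (kK B).2).
        by apply: open_nbhs_nbhs; split; [exact: closed_openC|move=> /KX].
      by apply: filterS (filterI nK IH) => y [yK yP] B' [<-//|]; exact: yP.
    apply: filterS N => y yP Cy.
    have [AW|AW] := pselect (connected_component C y `<=` W).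
      by have [_ _ _ _ ->] := kKP y Cy.
    have [z [yz Wz]] : exists z, connected_component C y z /\ ~ W z.
      by apply: contrapT => nz; apply: AW => z yz; apply: contrapT => Wz; apply: nz; exists z.
    apply: yP; last by exists y.
    rewrite (same_connected_component yz); apply: BsP => //.
    exact: connected_component_sub yz.
  have [V Vx VP] := WH x (XW _ Xx).
  have kH y : W y -> off Ps y -> (C y -> ~ (kK (connected_component C y)).2 y) -> k y = H y.
    move=> Wy yP yK; rewrite /k; case: asboolP => Xy; first by rewrite HX.
    have Cy : C y by [].
    have [_ _ _ kE _] := kKP y Cy; apply: kE; last exact: yK.
    exact: connected_component_refl.
  exists (V `&` (W `&` [set y | C y -> ~ (kK (connected_component C y)).2 y])).
    by apply: filterI => //; apply: filterI => //; exact: XW'.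
  move=> p q [Vp [Wp Np]] [Vq [Wq Nq]] pP qP.
  by rewrite !kH //; exact: VP.
have Cx : C x by [].
have [_ _ kp _ _] := kKP x Cx.
have [V Vx VP] := kp x (connected_component_refl Cx).
exists (V `&` connected_component C x).
  by apply: filterI => //; apply: (comp_open sT) => //; exact: connected_component_refl.
have kE y : connected_component C x y -> k y = (kK (connected_component C x)).1 y.
  move=> xy; rewrite /k asboolF; last by case: (connected_component_sub xy).
  by rewrite (same_connected_component xy).
by move=> p q [Vp xp] [Vq xq] pP qP; rewrite !kE //; exact: VP.
Qed.

End Extension.

(** * Counting classes on a union of curves *)

(** The largest fibre of phi is kept. This is the cardinality version of passing to the kernel of a
    linear map. *)
Lemma pigeonhole (W K : finType) (D : {set W}) (phi : W -> K) :
  exists D' : {set W}, [/\ D' \subset D, (#|D| <= #|D'| * #|K|)%N &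
    forall w w', w \in D' -> w' \in D' -> phi w = phi w'].
Proof.
pose F k : {set W} := [set w in D | phi w == k].
have cD : #|D| = (\sum_(k : K) #|F k|)%N.
  rewrite -sum1_card (partition_big phi xpredT) //=; apply: eq_bigr => k _.
  by rewrite -sum1_card; apply: eq_bigl => w; rewrite inE.
have [/eqP D0|] := boolP (#|D| == 0%N).
  by exists finset.set0; split; [exact: finset.sub0set|rewrite D0|move=> w w'; rewrite inE].
rewrite -lt0n => /card_gt0P[w0 _]; pose k0 := phi w0.
have [k _ kmax] := @arg_maxnP _ k0 xpredT (fun k => #|F k|) isT.
exists (F k); split.
- by apply/fintype.subsetP => w; rewrite inE => /andP[].
- have : (\sum_(i : K) #|F i| <= \sum_(i : K) #|F k|)%N by apply: leq_sum => i _; exact: (kmax i isT).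
  by rewrite -cD sum_nat_const mulnC.
- by move=> w w'; rewrite !inE => /andP[_ /eqP->] /andP[_ /eqP->].
Qed.

Section Gluing.
Variables (R : realType) (T : topologicalType) (d : T -> T -> R).
Hypothesis sT : surface d.
Implicit Types (n m : T -> T -> bool) (A B V W X : set T) (p q r x y : T) (h k : T -> bool).

Lemma closed_glue A B n h k : closed A -> closed B -> cocycle (A `|` B) n -> potential A n h ->
  potential B n k -> (forall x, A x -> B x -> h x = k x) -> coboundary (A `|` B) n.
Proof.
move=> cA cB cn Ah Bk hk; exists (fun x => if `[< A x >] then h x else k x) => x ABx.
have [K [ka [Kx KP]]] := cn x ABx.
have clo (D : set T) l : closed D -> potential D n l -> exists2 V, nbhs x V & forall p, V p -> D p ->
    D x /\ n x p = l x (+) l p.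
  move=> cD Dl; have [Dx|Dx] := pselect (D x).
    have [V Vx VP] := Dl x Dx; exists V => // p Vp Dp; split=> //.
    by apply: VP => //; exact: nbhs_singleton.
  exists (~` D); first by apply: open_nbhs_nbhs; split=> //; exact: closed_openC.
  by move=> p nD /nD.
have [V1 V1x V1P] := clo A h cA Ah; have [V2 V2x V2P] := clo B k cB Bk.
have Kxx : K x := nbhs_singleton Kx.
have nE p q : K p -> K q -> (A `|` B) p -> (A `|` B) q -> n p q = n x p (+) n x q.
  by move=> Kp Kq Up Uq; rewrite !KP //; case: (ka x); case: (ka p); case: (ka q).
pose l y := if `[< A y >] then h y else k y.
have lE p : V1 p -> V2 p -> (A `|` B) p -> n x p = l x (+) l p.
  move=> p1 p2 Up; rewrite /l; have [Ap|nAp] := pselect (A p).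
    by have [Ax ->] := V1P p p1 Ap; rewrite !asboolT.
  have Bp : B p by case: Up.
  have [Bx ->] := V2P p p2 Bp; rewrite (asboolF nAp).
  by case: asboolP => // Ax; rewrite hk.
exists (K `&` (V1 `&` V2)); first by apply: filterI => //; exact: filterI.
move=> p q [Kp [p1 p2]] [Kq [q1 q2]] Up Uq; rewrite nE // !lE // -/(l p) -/(l q).
by case: (l x); case: (l p); case: (l q).
Qed.

Lemma loop_period_int (c : R -> T) (k : R -> bool) s t : simple c -> (forall t, k (t + 1) = k t) ->
  c s = c t -> k s = k t.
Proof.
move=> [_ cP] kp /cP /intrP[z zE]; have -> : s = t + z%:~R by rewrite -zE addrC subrK.
have nat (m : nat) u : k (u + m%:R) = k u by elim: m => [|m IH]; rewrite ?addr0 // -natr1 addrA kp.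
case: z {zE} => m; first exact: nat.
by rewrite NegzE mulrNz -[in RHS](subrK (m.+1%:~R) t) -(nat m.+1 (t - m.+1%:R)).
Qed.

(** A potential on the line without period depends only on the point of the loop, and descends along
    a choice of parameters. *)
Lemma loop_coboundary (c : R -> T) n : simple c -> oint n c false -> coboundary (range c) n.
Proof.
move=> sc [k kp kE]; have lc : loop c := proj1 sc.
have kper t : k (t + 1) = k t by have := kE t; case: (k (t + 1)); case: (k t).
have [g gP] : exists g : T -> R, forall x, range c x -> c (g x) = x.
  have ex x : exists t : R, range c x -> c t = x.
    by have [[t _ tx]|nx] := pselect (range c x); [exists t|exists 0].
  by have [g gP] := choice ex; exists g.
have kg t : k (g (c t)) = k t by apply: (loop_period_int sc kper); apply: gP; exists t.
exists (k \o g) => x [t _ tx].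
have [U Ut UP] := kp t Logic.I; have [e e0 eU] := nbhs_realP Ut.
pose a := Num.min (e / 2) (1 / 4); have a0 : 0 < a by rewrite lt_min !divr_gt0.
have ae : a <= e / 2 by rewrite ge_min lexx.
have a4 : a <= 1 / 4 by rewrite ge_min lexx orbT.
(* Off the compact arc K, points of the loop have parameters close to t; this uses that a simple
   loop is a homeomorphism onto its image. *)
pose K := c @` (Icc (t + a) (t + 1 - a)).
have cK : closed K.
  apply: compact_closed; first exact: surface_hausdorff sT.
  apply: continuous_compact; first by apply: continuous_subspaceT => y; exact: (proj1 lc y).
  have -> : Icc (t + a) (t + 1 - a) = `[t + a, t + 1 - a]%classic.
    by apply/seteqP; split=> y /=; rewrite in_itv /= => /andP.
  exact: segment_compact.
have nK : nbhs x (~` K).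
  apply: open_nbhs_nbhs; split; first exact: closed_openC.
  move=> [s [s1 s2] sx]; have := simple_inj (s := s) (t := t) sc.
  by rewrite sx tx => H; have := H erefl; have : - 1 < s - t by [lra]; have : s - t < 1 by [lra]; move=> h1 h2 /(_ h2 h1); lra.
exists (~` K) => // p q np nq pc qc.
have near y : (~` K) y -> range c y -> exists2 s, c s = y & t - e < s /\ s < t + e.
  move=> ny yc; have [s [s1 s2 sy]] := loop_repr (t - a) lc yc.
  have [sa|sa] := ltP s (t + a); first by exists s => //; split; lra.
  by exfalso; apply: ny; exists s => //; split; lra.
have [s <- [s1 s2]] := near p np pc; have [s' <- [s1' s2']] := near q nq qc.
by rewrite /= !kg; apply: UP => //; exact: eU.
Qed.

End Gluing.

Section Counting.
Variables (R : realType) (T : topologicalType) (d : T -> T -> R).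
Hypothesis sT : surface d.
Variables (Ps : seq T) (W : finType) (nw : W -> T -> T -> bool).
Hypothesis cw : forall w, cocycle (off Ps) (nw w).
Hypothesis indep : forall w w', w != w' -> ~ coboundary (off Ps) (addcoc (nw w) (nw w')).
Implicit Types (D : {set W}) (x y : T).

(** Membership in one common class on B, stated pairwise so that no base element has to exist. *)
Definition coh (B : set T) D := forall w w', w \in D -> w' \in D -> coboundary B (addcoc (nw w) (nw w')).

(** If the whole punctured surface were a disk or a once-punctured disk, it would carry at most one
    nontrivial class. *)
Lemma no_curves A' : filled R Ps (off Ps) A' -> (#|W| <= 2)%N.
Proof.
move=> [AA' [f [g cA]]].
suff [D [DW cD]] : exists D : {set W}, (#|W| <= #|D| * 2)%N /\ coh (off Ps) D.
  suff : (#|D| <= 1)%N by lia.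
  rewrite leqNgt; apply/negP => /card_gt1P[w [w' [wD w'D ww]]].
  by apply: (indep ww); exact: cD.
case: AA' => [A'A|[p [_ pA A'p]]].
  exists finset.setT; split; first by rewrite cardsT; lia.
  move=> w w' _ _; have cn := cocycleD (cw w) (cw w').
  have cp : cocycle setT (pull g (addcoc (nw w) (nw w'))).
    by apply: (chart_pull_cocycle cA (A := off Ps)) => // v _; rewrite -A'A; exact: (chart_in cA).
  have [k kp] : coboundary setT (pull g (addcoc (nw w) (nw w'))).
    by apply: (@star_coboundary R setT (0, 0)) => //; split.
  exists (k \o f); apply: (chart_push_potential cA (B := setT)) => //.
  by rewrite A'A.
have A'p' : A' p by rewrite A'p; left.
have [f' [g' [cA' fp]]] := recenter cA A'p'.
have gin v : P0 v -> off Ps (g' v).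
  by move=> v0; have [gv gp] := chart_P0 cA' fp A'p' v0; move: gv; rewrite A'p => -[].
have cls w : exists m : bool, coboundary (@P0 R) (fun u v => pull g' (nw w) u v (+) (m && chi u v)).
  by apply: punctured_class; apply: (chart_pull_cocycle cA' (A := off Ps)).
have [m mP] := choice cls.
have [D [_ cD DP]] := pigeonhole [set: W] m.
exists D; split; first by move: cD; rewrite cardsT card_bool.
move=> w w' wD w'D; have := coboundaryD (mP w) (mP w'); rewrite (DP w w' wD w'D) => -[k kp].
exists (k \o f'); apply: (chart_push_potential cA' (A := off Ps) (B := @P0 R)).
- by move=> x Ax; rewrite A'p; right.
- move=> x Ax; apply: (P0_chart cA' fp A'p'); split; first by rewrite A'p; right.
  by move=> xp; apply: pA; rewrite -xp.
apply: potential_eq kp => // u v _ _; rewrite /addcoc /pull.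
by case: (m w' && _); case: (nw w _ _); case: (nw w' _ _).
Qed.

Variables (N : nat) (c : 'I_N -> R -> T) (m : 'I_N -> 'I_N -> nat) (pts : 'I_N -> 'I_N -> seq T).
Hypothesis sc : forall i, simple (c i).
Hypothesis cP : forall i t, off Ps (c i t).
Hypothesis mC : forall i k, m i k = m k i.
Hypothesis ptsP : forall i k x, i != k -> range (c i) x -> range (c k) x -> x \in pts i k.
Hypothesis pts_size : forall i k, i != k -> (size (pts i k) <= m i k)%N.
Implicit Types (S : {set 'I_N}).

Definition XS S : set T := [set x | exists2 i, i \in S & range (c i) x].

Lemma XS_closed S : closed (XS S).
Proof.
have -> : XS S = \bigcup_(i in [set i | i \in S]) range (c i).
  by apply/seteqP; split=> x [i iS xi]; exists i.
apply: closed_bigcup => [|i _]; last by case: (thin_simple sT (sc i)).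
exact: finite_finset.
Qed.

Lemma XS_off S : XS S `<=` off Ps. Proof. by move=> x [i _ [t _ <-]]; exact: cP. Qed.

Lemma loop_bits D i : exists D', [/\ D' \subset D, (#|D| <= #|D'| * 2)%N & coh (range (c i)) D'].
Proof.
have ex w : exists b, oint (nw w) (c i) b by exact: (oint_exists (proj1 (sc i)) (cP i) (cw w)).
have [b bP] := choice ex.
have [D' [DD cD DP]] := pigeonhole D b.
exists D'; split=> //; first by move: cD; rewrite card_bool.
move=> w w' wD w'D; apply: (loop_coboundary sT (sc i)).
by have := ointD (bP w) (bP w'); rewrite (DP w w' wD w'D) addbb.
Qed.

(** One bit is spent on the integral along the new curve, and one on each possible common point
    except [x0], where the free constant of a potential can be used. The total is exactly the length
    of L. *)
Lemma coh_step S D i (L : seq T) x0 : coh (XS S) D -> XS S x0 -> range (c i) x0 ->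
  (forall x, XS S x -> range (c i) x -> x \in L) ->
  exists D', (#|D| <= #|D'| * 2 ^ size L)%N /\ coh (XS (i |: S)%SET) D'.
Proof.
move=> cD Sx0 ix0 LP; have x0L := LP x0 Sx0 ix0.
have [D1 [DD1 cD1 iD1]] := loop_bits D i.
have [D10|/set0Pn[w0 w0D]] := eqVneq D1 finset.set0.
  exists finset.set0; split; last by move=> w w'; rewrite inE.
  by move: cD1; rewrite D10 cards0 mul0n.
have exH w : exists h, w \in D1 -> potential (XS S) (addcoc (nw w) (nw w0)) h.
  have [wD|wD] := boolP (w \in D1); last by exists (fun=> false).
  by have [h hp] := cD w w0 (fintype.subsetP DD1 w wD) (fintype.subsetP DD1 w0 w0D); exists h.
have exK w : exists h, w \in D1 -> potential (range (c i)) (addcoc (nw w) (nw w0)) h.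
  have [wD|wD] := boolP (w \in D1); last by exists (fun=> false).
  by have [h hp] := iD1 w w0 wD w0D; exists h.
have [H HP] := choice exH; have [K KP] := choice exK.
pose L' := rem x0 L.
(* The mismatch at x between the potentials on the old curves and on the new one, relative to the
   mismatch at [x0]. Potentials are taken relative to the fixed member [w0], so that one function
   per w suffices. *)
pose bit w x := (H w x (+) K w x) (+) (H w x0 (+) K w x0).
pose phi w : {ffun 'I_(size L') -> bool} := [ffun k : 'I_(size L') => bit w (nth x0 L' k)].
have [D2 [DD2 cD2 D2P]] := pigeonhole D1 phi.
exists D2; split.
  have sL : size L = (size L').+1 by rewrite /L' size_rem // prednK //; case: (L) x0L.
  apply: leq_trans cD1 _; rewrite sL expnS mulnA [(_ * 2)%N in X in (_ <= X)%N]mulnC -mulnA mulnC leq_mul2l /=.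
  by apply: leq_trans cD2 _; rewrite card_ffun card_bool card_ord.
move=> w w' wD w'D; have w1 := fintype.subsetP DD2 w wD; have w1' := fintype.subsetP DD2 w' w'D.
have bitE x : XS S x -> range (c i) x -> bit w x = bit w' x.
  move=> Sx ix; have xL := LP x Sx ix.
  have [->|xx0] := eqVneq x x0; first by rewrite /bit !addbb.
  have xL' : x \in L'.
    have := perm_mem (perm_to_rem x0L) x; rewrite xL inE (negPf xx0) /= => <-.
    by [].
  have := D2P w w' wD w'D => /ffunP; have si : (index x L' < size L')%N by rewrite index_mem.
  by move=> /(_ (Ordinal si)); rewrite !ffunE /= nth_index.
have XE : XS (i |: S)%SET = XS S `|` range (c i).
  apply/seteqP; split=> x.
    by move=> [k]; rewrite finset.in_setU1 => /orP[/eqP->|kS xk]; [right|left; exists k].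
  case=> [[k kS xk]|xi]; [exists k|exists i] => //; rewrite finset.in_setU1 ?kS ?orbT //.
  by rewrite eqxx.
rewrite XE.
pose n := addcoc (nw w) (nw w').
have nE p q : addcoc (addcoc (nw w) (nw w0)) (addcoc (nw w') (nw w0)) p q = n p q.
  by rewrite /n /addcoc; case: (nw w p q); case: (nw w0 p q); case: (nw w' p q).
have hS : potential (XS S) n (fun x => H w x (+) H w' x).
  by apply: potential_eq (potentialD (HP w w1) (HP w' w1')).
have hC : potential (range (c i)) n (fun x => K w x (+) K w' x).
  by apply: potential_eq (potentialD (KP w w1) (KP w' w1')).
pose b := (H w x0 (+) H w' x0) (+) (K w x0 (+) K w' x0).
have cU : cocycle (XS S `|` range (c i)) n.
  apply: (cocycle_sub (A := off Ps)); last exact: cocycleD.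
  by move=> x [/XS_off //|[t _ <-]]; exact: cP.
apply: (closed_glue (@XS_closed S) (proj1 (thin_simple sT (sc i))) cU hS (potential_cst b hC)).
move=> x Sx ix; have := bitE x Sx ix; rewrite /bit /b.
by case: (H w x); case: (H w' x); case: (K w x); case: (K w' x); case: (H w x0); case: (H w' x0); case: (K w x0); case: (K w' x0).
Qed.

Local Notation X := (XS [set: 'I_N]).
Hypothesis fill : forall x, (off Ps `\` X) x -> exists A', filled R Ps (connected_component (off Ps `\` X) x) A'.
Hypothesis N_gt0 : (0 < N)%N.

Lemma XS_range i : range (c i) `<=` X. Proof. by move=> x xi; exists i => //; rewrite finset.in_setT. Qed.

Lemma X_neq0 : X !=set0.
Proof. by exists (c (Ordinal N_gt0) 0); apply: (@XS_range (Ordinal N_gt0)); exists 0. Qed.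

(** A locally constant function on X is a potential of the zero cocycle, so it extends to the
    punctured surface, which is connected. Hence the curves can be ordered so that each one meets an
    earlier one. *)
Lemma X_conn : conn X.
Proof.
move=> h hp x y Xx Xy.
have cn : cocycle (off Ps) (@nul T) by move=> z _; exists setT, (fun=> false); split=> //; exact: filterT.
have [k kp kE] := extend_potential sT (@XS_closed _) (@XS_off _) X_neq0 cn hp fill.
by rewrite -!kE //; apply: (conn_off sT kp); [exact: (XS_off Xx)|exact: (XS_off Xy)].
Qed.

Lemma next_curve S : (0 < #|S|)%N -> (#|S| < N)%N -> exists i x, [/\ i \notin S, XS S x & range (c i) x].
Proof.
move=> /card_gt0P[i0 i0S] SN; apply: contrapT => none.
have [i1 i1S] : exists i, i \notin S.
  apply/existsP; apply: contraTT SN; rewrite negb_exists -leqNgt => /forallP allS.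
  rewrite -[X in (X <= _)%N]card_ord -cardsT; apply/subset_leq_card/fintype.subsetP => i _.
  by have := allS i; rewrite negbK.
have dis x : XS S x -> XS (~: S)%SET x -> False.
  by move=> Sx [i]; rewrite finset.in_setC => iS xi; apply: none; exists i, x.
have cov x : X x -> XS S x \/ XS (~: S)%SET x.
  move=> [i _ xi]; have [iS|iS] := boolP (i \in S); [left|right]; exists i => //.
  by rewrite finset.in_setC.
have lc : potential X nul (fun x => `[< XS S x >]).
  move=> x Xx; have nb S' : ~ XS S' x -> nbhs x (~` XS S').
    by move=> nS; apply: open_nbhs_nbhs; split=> //; apply: closed_openC; exact: XS_closed.
  case: (cov x Xx) => [Sx|Sx].
    have nS : ~ XS (~: S)%SET x by move=> /(dis x Sx).
    exists (~` XS (~: S)%SET); first exact: nb.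
    by move=> p q np nq Xp Xq; rewrite !asboolT //; [case: (cov q Xq)|case: (cov p Xp)].
  have nS : ~ XS S x by move=> /dis /(_ Sx).
  by exists (~` XS S); [exact: nb|move=> p q np nq _ _; rewrite !asboolF].
have S0 : XS S (c i0 0) by exists i0 => //; exists 0.
have S1 : XS (~: S)%SET (c i1 0) by exists i1; [rewrite finset.in_setC|exists 0].
have X0 : X (c i0 0) by apply: (@XS_range i0); exists 0.
have X1 : X (c i1 0) by apply: (@XS_range i1); exists 0.
have := X_conn lc X0 X1; rewrite asboolT // asboolF // => S1'.
exact: (dis _ S1').
Qed.

Definition inter S := (\sum_(i in S) \sum_(k in S | k != i) m i k)%N.

Lemma inter_add S i : i \notin S -> inter (i |: S)%SET = (inter S + (\sum_(k in S) m i k).*2)%N.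
Proof.
move=> iS; rewrite /inter big_setU1 //=.
have -> : (\sum_(k in (i |: S)%SET | k != i) m i k = \sum_(k in S) m i k)%N.
  apply: eq_bigl => k; rewrite finset.in_setU1; case: eqVneq => [->|_] /=; first by rewrite (negPf iS).
  by rewrite andbT.
have -> : (\sum_(a in S) \sum_(k in (i |: S)%SET | k != a) m a k =
    \sum_(a in S) (m a i + \sum_(k in S | k != a) m a k))%N.
  apply: eq_bigr => a aS; rewrite big_mkcondr /= big_setU1 //= -big_mkcondr /=.
  by rewrite (_ : (i != a)) //; apply: contraNneq iS => ->.
rewrite big_split /= -(eq_bigr _ (fun a _ => mC i a)) -addnn addnA addnC.
by rewrite addnC addnAC addnC.
Qed.

(** The first curve costs one bit and each later one as many bits as it has allowed common points
    with its predecessors. The doubled inequality matches the sum over ordered pairs. Classes that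
    agree on X agree on the punctured surface, so a single one is left at the end. *)
Theorem count_curves : exists e, (#|W| <= 2 ^ e)%N /\ (2 * e <= 2 + \sum_i \sum_(k | k != i) m i k)%N.
Proof.
suff H s : (s < N)%N -> exists S D e, [/\ #|S| = s.+1, coh (XS S) D, (#|W| <= #|D| * 2 ^ e)%N &
    (2 * e <= 2 + inter S)%N].
  have [S [D [e [cS cD WD eS]]]] := H N.-1 (ltac:(lia)).
  have ST : S = finset.setT.
    by apply/eqP; rewrite eqEcard finset.subsetT cardsT card_ord cS prednK // leqnn.
  exists e; split; last first.
    apply: leq_trans eS _; rewrite leq_add2l ST /inter.
    apply: eq_leq; apply: eq_big => [i|i _]; first by rewrite finset.in_setT.
    by apply: eq_bigl => k; rewrite finset.in_setT.
  have D1 : (#|D| <= 1)%N.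
    rewrite leqNgt; apply/negP => /card_gt1P[w [w' [wD w'D ww]]].
    have [h hp] := cD w w' wD w'D; rewrite ST in hp.
    have [k kp _] := extend_potential sT (@XS_closed _) (@XS_off _) X_neq0 (cocycleD (cw w) (cw w')) hp fill.
    by apply: (indep ww); exists k.
  by apply: leq_trans WD _; rewrite -[X in (_ <= X)%N]mul1n leq_mul2r D1 orbT.
elim: s => [_|s IH sN].
  pose i0 := Ordinal N_gt0.
  have [D [_ cD iD]] := loop_bits [set: W] i0.
  exists [set i0]%SET, D, 1%N; split; [by rewrite cards1| |by rewrite -cardsT expn1|by []].
  move=> w w' wD w'D; apply: coboundary_sub (iD w w' wD w'D) => x [i].
  by rewrite finset.in_set1 => /eqP->.
have [S [D [e [cS cD WD eS]]]] := IH (ltnW sN).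
have [||i [x [iS Sx ix]]] := @next_curve S; [by rewrite cS|by rewrite cS|].
pose L := flatten [seq pts i k | k <- enum S].
have LP y : XS S y -> range (c i) y -> y \in L.
  move=> [k kS yk] yi; apply/flatten_mapP; exists k; first by rewrite mem_enum.
  by apply: ptsP => //; apply: contraNneq iS => ->.
have [D' [DD' cD']] := coh_step cD Sx ix LP.
exists (i |: S)%SET, D', (e + size L)%N; split=> //.
- by rewrite cardsU1 iS cS.
- by apply: leq_trans WD _; rewrite addnC expnD mulnA leq_mul2r DD' orbT.
have sL : (size L <= \sum_(k in S) m i k)%N.
  rewrite /L size_flatten /shape -map_comp sumnE big_map big_enum /=.
  by apply: leq_sum => k kS; apply: pts_size; apply: contraNneq iS => ->.
by rewrite inter_add //; lia.
Qed.

End Counting.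

(** * The closed surface of genus g *)

Section Region.
Variables (R : realType) (g : nat).
Implicit Types (x y : R) (i k : nat).

Definition ctr i : R := (4 * i)%:R.
Definition big : R := (4 * g.+1)%:R.
Definition hole i x y : R := (x - ctr i) ^+ 2 + y ^+ 2 - 1.
Definition disk x y : R := big ^+ 2 - x ^+ 2 - y ^+ 2.
Definition height x y : R := disk x y * \prod_(i < g) hole i x y.

Lemma ctr_ge0 i : 0 <= ctr i. Proof. exact: ler0n. Qed.

Lemma ctr_lt i k : (i < k)%N -> ctr i + 4 <= ctr k.
Proof. by move=> ik; rewrite /ctr -natrD ler_nat; lia. Qed.

Lemma ctr_big i : (i < g)%N -> ctr i + 8 <= big.
Proof. by move=> ig; rewrite /ctr /big -natrD ler_nat; lia. Qed.

Lemma big_ge4 : 4 <= big. Proof. by rewrite /big ler_nat; lia. Qed.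

Lemma sqr_le_itv (z b : R) : 0 <= b -> z ^+ 2 <= b ^+ 2 -> - b <= z /\ z <= b.
Proof. by move=> b0; rewrite -ler_sqrt ?sqr_ge0 // !sqrtr_sqr (ger0_norm b0) ler_norml => /andP[]. Qed.

Lemma hole_bounds i x y (b : R) : 0 <= b -> hole i x y <= b ^+ 2 - 1 ->
  [/\ ctr i - b <= x, x <= ctr i + b & y ^+ 2 <= b ^+ 2].
Proof.
move=> b0; rewrite /hole => h.
have [x1 x2] : - b <= x - ctr i /\ x - ctr i <= b.
  by apply: sqr_le_itv => //; have := sqr_ge0 y; lra.
by split; [lra|lra|have := sqr_ge0 (x - ctr i); lra].
Qed.

Lemma disk_hole i x y : (i < g)%N -> disk x y <= 0 -> 3 < hole i x y.
Proof.
move=> ig dx; rewrite ltNge; apply/negP => hx.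
have [||x1 x2 y2] := @hole_bounds i x y 2; [lra|by move: hx; rewrite expr2; lra|].
move: dx; rewrite /disk; have := ctr_big ig; have := ctr_ge0 i; nra.
Qed.

(** The threshold 3 is 2 ^ 2 - 1: it means distance 2 from the centre, and the centres are at least
    4 apart. *)
Lemma hole_hole i k x y : i != k -> hole i x y < 3 -> 3 < hole k x y.
Proof.
move=> ik hi; rewrite ltNge; apply/negP => hk.
have [||x1 x2 y2] := @hole_bounds k x y 2; [lra|by move: hk; rewrite expr2; lra|].
have [||x3 x4 y4] := @hole_bounds i x y 2; [lra|by move: hi; rewrite expr2; lra|].
have s : (x - ctr i) ^+ 2 < 4 by move: hi; rewrite /hole; have := sqr_ge0 y; lra.
move: ik; rewrite neq_ltn => /orP[/ctr_lt|/ctr_lt]; nra.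
Qed.

Lemma height_ge0 x y : 0 <= disk x y -> (forall i, (i < g)%N -> 0 <= hole i x y) ->
  0 <= height x y.
Proof. by move=> d0 h0; apply: mulr_ge0 => //; apply: prodr_ge0 => i _; exact: h0. Qed.

Lemma height_gt0 x y : 0 < disk x y -> (forall i, (i < g)%N -> 0 < hole i x y) ->
  0 < height x y.
Proof. by move=> d0 h0; apply: mulr_gt0 => //; apply: prodr_gt0 => i _; exact: h0. Qed.

Lemma height_hole i x y (ig : (i < g)%N) : height x y =
  hole i x y * (disk x y * \prod_(k < g | k != Ordinal ig) hole k x y).
Proof. by rewrite /height (bigD1 (Ordinal ig)) //= mulrCA. Qed.

Lemma others_gt0 i x y (ig : (i < g)%N) : hole i x y < 3 ->
  0 < disk x y * \prod_(k < g | k != Ordinal ig) hole k x y.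
Proof.
move=> h0; apply: mulr_gt0.
  by rewrite ltNge; apply/negP => /(disk_hole ig); lra.
apply: prodr_gt0 => k ki; apply: lt_trans (hole_hole (k := k) _ h0); first by [].
by rewrite eq_sym.
Qed.

(** By the choice of radii at most one factor of the product can be nonpositive at any point, so the
    sign of the product decides the sign of each factor. *)
Lemma height_dom x y : 0 <= height x y ->
  0 <= disk x y /\ forall i, (i < g)%N -> 0 <= hole i x y.
Proof.
move=> G0; split=> [|i ig]; rewrite leNgt; apply/negP => neg.
  have : 0 < \prod_(i < g) hole i x y.
    by apply: prodr_gt0 => i _; apply: lt_trans (disk_hole (ltn_ord i) (ltW neg)).
  by move: G0; rewrite /height => + p0; rewrite pmulr_lge0 // leNgt neg.
have := others_gt0 ig (lt_trans neg _).
move: G0; rewrite (height_hole x y ig) => + p0.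
by rewrite pmulr_lge0 ?p0 //; first by rewrite leNgt neg.
Qed.

Lemma heightN x y : height x (- y) = height x y.
Proof. by rewrite /height /disk /hole sqrrN. Qed.

Lemma height_cts (X : topologicalType) (f h : X -> R) (p : X) : cts f p -> cts h p ->
  cts (fun q => height (f q) (h q)) p.
Proof. by move=> fc hc; rewrite /height /disk /hole; cts. Qed.

Lemma hole_cts (X : topologicalType) i (f h : X -> R) (p : X) : cts f p -> cts h p ->
  cts (fun q => hole i (f q) (h q)) p.
Proof. by move=> fc hc; rewrite /hole; cts. Qed.

Lemma disk_cts (X : topologicalType) (f h : X -> R) (p : X) : cts f p -> cts h p ->
  cts (fun q => disk (f q) (h q)) p.
Proof. by move=> fc hc; rewrite /disk; cts. Qed.

Lemma genus_surfaceE (v : R * R * R) :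
  genus_surface R g v <-> v.2 ^+ 2 = height v.1.1 v.1.2.
Proof. by rewrite /genus_surface /height /disk /hole /=. Qed.

End Region.

Section LocalChart.
Variables (R : realType) (T : topologicalType).
Local Notation P := (R * R)%type.

(** Explicit inverses are available only on a square, whereas charts must be onto the plane; the
    square is stretched in each coordinate separately, so the zero sets of the coordinates are
    kept. *)
Lemma local_chart (f : T -> P) (psi : P -> T) (W V : set T) (r : R) (p : T) :
  0 < r -> nbhs p V -> f p = (0, 0) -> W p -> (forall q, W q -> nbhs q W) ->
  (forall q, W q -> cts f q) ->
  (forall v, box (- r) r (- r) r v -> [/\ W (psi v), f (psi v) = v & cts psi v]) ->
  (forall q, W q -> box (- r) r (- r) r (f q) -> psi (f q) = q) ->
  exists U (f' : T -> P) (h' : P -> T), [/\ chart U f' h', U p, f' p = (0, 0), U `<=` V &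
    forall q, U q -> [/\ W q, (f' q).1 = 0 <-> (f q).1 = 0 & (f' q).2 = 0 <-> (f q).2 = 0]].
Proof.
move=> r0 Vp fp Wp Wo fc psiP psiK.
have box0 (a : R) : 0 < a -> box (- a) a (- a) a (0, 0) by move=> a0; split => /=; lra.
have psi0 : psi (0, 0) = p by rewrite -fp psiK // fp; exact: box0.
have [_ _ c0] := psiP _ (box0 r r0).
have : nbhs ((0, 0) : P) (psi @^-1` V) by apply: c0; rewrite psi0.
move=> /nbhs_boxP[e /= e0 eV].
pose a := Num.min r e; have a0 : 0 < a by rewrite lt_min r0 e0.
have ar : a <= r by rewrite ge_min lexx.
have ae : a <= e by rewrite ge_min lexx orbT.
(* Mutually inverse homeomorphisms between the interval from -a to a and the line, fixing 0. *)
pose be (s : R) := s / (a - `|s|); pose ga (t : R) := a * t / (1 + `|t|).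
have t1 (t : R) : 0 < 1 + `|t| by have := normr_ge0 t; lra.
have ga_lt t : - a < ga t /\ ga t < a.
  have H : `|ga t| < a.
    rewrite /ga !normrM normfV (ger0_norm (ltW (t1 t))) (gtr0_norm a0) ltr_pdivrMr //.
    by rewrite ltr_pM2l //; have := normr_ge0 t; lra.
  by move: H; rewrite ltr_norml => /andP.
have beK (s : R) : - a < s -> s < a -> ga (be s) = s.
  move=> s1 s2; have sa : 0 < a - `|s| by rewrite subr_gt0 ltr_norml s1 s2.
  rewrite /ga /be normrM normfV (gtr0_norm sa).
  have n1 : a - `|s| != 0 by rewrite gt_eqF.
  have n2 : a - `|s| + `|s| != 0 by rewrite subrK gt_eqF.
  have -> : 1 + `|s| / (a - `|s|) = a / (a - `|s|) by field.
  by field; rewrite n1 gt_eqF.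
have gaK (t : R) : be (ga t) = t.
  rewrite /be /ga !normrM normfV (gtr0_norm a0) (gtr0_norm (t1 t)).
  have n1 : 1 + `|t| != 0 by rewrite gt_eqF.
  have n2 : a != 0 by rewrite gt_eqF.
  have -> : a - a * `|t| / (1 + `|t|) = a / (1 + `|t|) by field.
  by field; rewrite n1 n2.
have bab v : box (- a) a (- a) a v -> box (- r) r (- r) r v by move=> [? ? ? ?]; split; lra.
have gbox v : box (- a) a (- a) a (ga v.1, ga v.2).
  by have [? ?] := ga_lt v.1; have [? ?] := ga_lt v.2; split.
exists [set q | W q /\ box (- a) a (- a) a (f q)], (fun q => (be (f q).1, be (f q).2)),
  (fun v => psi (ga v.1, ga v.2)); split.
- split.
  + move=> q [Wq [q1 q2 q3 q4]]; apply: filterI; first exact: Wo.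
    by apply: (fc q Wq); exact: nbhs_box.
  + move=> q [Wq bq]; have [q1 q2 q3 q4] := bq.
    by rewrite /= !beK // -surjective_pairing psiK //; exact: bab.
  + move=> v; have bv := gbox v; have [Wv fv _] := psiP _ (bab _ bv).
    by split=> //; rewrite fv.
  + move=> v; have bv := gbox v; have [Wv fv _] := psiP _ (bab _ bv).
    by rewrite fv /= !gaK -surjective_pairing.
  + split.
      move=> q [Wq [q1 q2 q3 q4]]; have fq := fc q Wq.
      have s1 : a - `|(f q).1| != 0 by rewrite gt_eqF // subr_gt0 ltr_norml q1 q2.
      have s2 : a - `|(f q).2| != 0 by rewrite gt_eqF // subr_gt0 ltr_norml q3 q4.
      by rewrite /be; cts.
    move=> v; apply: cts_comp; last by have [] := psiP _ (bab _ (gbox v)).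
    by rewrite /ga; cts; rewrite gt_eqF.
- by split=> //; rewrite fp; exact: box0.
- by rewrite fp /be /= !mul0r.
- move=> q [Wq bq]; rewrite -(psiK q Wq (bab _ bq)); case: bq => ? ? ? ?.
  by apply: eV; lra.
- move=> q [Wq [q1 q2 q3 q4]]; split=> //=; rewrite /be.
    have s1 : a - `|(f q).1| != 0 by rewrite gt_eqF // subr_gt0 ltr_norml q1 q2.
    split=> [/eqP|->]; last by rewrite mul0r.
    by rewrite mulf_eq0 invr_eq0 (negPf s1) orbF => /eqP.
  have s2 : a - `|(f q).2| != 0 by rewrite gt_eqF // subr_gt0 ltr_norml q3 q4.
  split=> [/eqP|->]; last by rewrite mul0r.
  by rewrite mulf_eq0 invr_eq0 (negPf s2) orbF => /eqP.
Qed.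

End LocalChart.

Section GenusSurface.
Variables (R : realType) (g : nat) (T : topologicalType) (e : T -> R * R * R) (j : R * R * R -> T).
Local Notation P := (R * R)%type.
Local Notation height := (height g).
Local Notation big := (big R g).
Local Notation disk := (disk g).

Definition genus_embedding := [/\ forall p, cts e p, forall p, genus_surface R g (e p),
  forall p, j (e p) = p, forall v, genus_surface R g v -> e (j v) = v &
  cont_on (genus_surface R g) j].
Hypothesis E : genus_embedding.

Definition cX p : R := (e p).1.1.
Definition cY p : R := (e p).1.2.
Definition cZ p : R := (e p).2.

Lemma cX_cts p : cts cX p.
Proof. by case: E => ec _ _ _ _; exact: (cts_fst (cts_fst (ec p))). Qed.
Lemma cY_cts p : cts cY p.
Proof. by case: E => ec _ _ _ _; exact: (cts_snd (cts_fst (ec p))). Qed.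
Lemma cZ_cts p : cts cZ p.
Proof. by case: E => ec _ _ _ _; exact: (cts_snd (ec p)). Qed.

Lemma cZE p : cZ p ^+ 2 = height (cX p) (cY p).
Proof. by case: E => _ es _ _ _; have /genus_surfaceE := es p. Qed.

Lemma genus_surface_in (x y z : R) : z ^+ 2 = height x y -> genus_surface R g (x, y, z).
Proof. by move=> h; apply/genus_surfaceE. Qed.

Lemma coord_inj p q : cX p = cX q -> cY p = cY q -> cZ p = cZ q -> p = q.
Proof.
case: E => _ _ je _ _ x y z; rewrite -(je p) -(je q); congr j.
rewrite [e p]surjective_pairing [e q]surjective_pairing [(e p).1]surjective_pairing.
by rewrite [(e q).1]surjective_pairing -/(cX p) -/(cY p) -/(cZ p) x y z.
Qed.

Lemma height_coord p : 0 <= height (cX p) (cY p).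
Proof. by rewrite -cZE sqr_ge0. Qed.

Lemma jP (x y z : R) : z ^+ 2 = height x y ->
  [/\ cX (j (x, y, z)) = x, cY (j (x, y, z)) = y & cZ (j (x, y, z)) = z].
Proof.
case: E => _ _ _ ej _ zE; have h : genus_surface R g (x, y, z) by exact/genus_surfaceE.
by rewrite /cX /cY /cZ ej.
Qed.

Lemma j_cts (Y : topologicalType) (A : set Y) (fx fy fz : Y -> R) y : A y -> nbhs y A ->
  (forall y, A y -> fz y ^+ 2 = height (fx y) (fy y)) -> cts fx y -> cts fy y -> cts fz y ->
  cts (fun y => j (fx y, fy y, fz y)) y.
Proof.
case: E => _ _ _ _ jc Ay Ay' fE fxc fyc fzc U /= jU.
have [V Vy VP] := jc (fx y, fy y, fz y) (genus_surface_in (fE y Ay)) U jU.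
have fc : cts (fun y => (fx y, fy y, fz y)) y by cts.
have fV : nbhs y ((fun y => (fx y, fy y, fz y)) @^-1` V) := fc _ Vy.
suff : nbhs y [set z | U (j (fx z, fy z, fz z))] by [].
apply: filterS (filterI Ay' fV) => z [Az Vz]; apply: VP => //.
by apply: genus_surface_in; exact: fE.
Qed.

Lemma j_cont_on (Y : topologicalType) (A : set Y) (fx fy fz : Y -> R) :
  (forall y, A y -> fz y ^+ 2 = height (fx y) (fy y)) ->
  (forall y, A y -> cts fx y) -> (forall y, A y -> cts fy y) -> (forall y, A y -> cts fz y) ->
  cont_on A (fun y => j (fx y, fy y, fz y)).
Proof.
case: E => _ _ _ _ jc fE fxc fyc fzc y Ay U jU.
have [V Vy VP] := jc (fx y, fy y, fz y) (genus_surface_in (fE y Ay)) U jU.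
have fc : cts (fun y => (fx y, fy y, fz y)) y.
  by apply: cts_pair; [apply: cts_pair; [exact: fxc|exact: fyc]|exact: fzc].
exists ((fun y => (fx y, fy y, fz y)) @^-1` V); first exact: fc.
by move=> z Vz Az; apply: VP => //; apply: genus_surface_in; exact: fE.
Qed.

Definition gdist p q := `|cX p - cX q| + `|cY p - cY q| + `|cZ p - cZ q|.

Lemma gdist_nbhs x (U : set T) : nbhs x U <-> exists2 r : R, 0 < r & forall y, gdist x y < r -> U y.
Proof.
split=> [Ux|[r r0 rU]].
  case: E => _ es je _ jc.
  have [V Vx VP] : exists2 V, nbhs (e x) V & forall z, V z -> genus_surface R g z -> U (j z).
    by apply: jc; [exact: es|rewrite je].
  have [[V1 V2] /= [/nbhs_boxP[a a0 aV] /nbhs_realP[b b0 bV]] VV] := Vx.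
  exists (Num.min a b); first by rewrite lt_min a0 b0.
  move=> y; rewrite /gdist lt_min => /andP[ya yb].
  rewrite -(je y); apply: VP => //; apply: VV.
  have := normr_ge0 (cX x - cX y); have := normr_ge0 (cY x - cY y); have := normr_ge0 (cZ x - cZ y).
  move=> h1 h2 h3.
  have : `|cX x - cX y| < a by lra.
  have : `|cY x - cY y| < a by lra.
  have : `|cZ x - cZ y| < b by lra.
  rewrite !ltr_norml => /andP[z1 z2] /andP[y1 y2] /andP[x1 x2].
  by split=> /=; [apply: aV|apply: bV]; rewrite -?/(cX _) -?/(cY _) -?/(cZ _); lra.
have r3 : 0 < r / 3 by lra.
have ball1 (f : T -> R) : cts f x -> nbhs x [set y | `|f x - f y| < r / 3].
  move=> fc; apply: cts_lt; [|exact: cts_cst|by rewrite subrr normr0].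
  by cts.
have H := filterI (ball1 cX (@cX_cts x)) (filterI (ball1 cY (@cY_cts x)) (ball1 cZ (@cZ_cts x))).
have S : [set y | `|cX x - cX y| < r / 3] `&` ([set y | `|cY x - cY y| < r / 3] `&`
    [set y | `|cZ x - cZ y| < r / 3]) `<=` U.
  by move=> y [/= ? [? ?]]; apply: rU; rewrite /gdist; lra.
exact: filterS S (H _ _).
Qed.

Lemma gdist_tri x y z : gdist x z <= gdist x y + gdist y z.
Proof.
rewrite /gdist.
have := ler_distD (cX y) (cX x) (cX z); have := ler_distD (cY y) (cY x) (cY z).
have := ler_distD (cZ y) (cZ x) (cZ z); lra.
Qed.

Lemma genus_compact : compact [set: T].
Proof.
pose D : set P := [set v | 0 <= disk v.1 v.2 /\ 0 <= height v.1 v.2].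
have Dc : compact D.
  have Db : D `<=` cbox big.
    move=> v [d0 _]; have b0 := big_ge4 R g.
    have [||a1 a2] := @sqr_le_itv R v.1 big; [lra|move: d0; rewrite /disk; have := sqr_ge0 v.2; lra|].
    have [||b1 b2] := @sqr_le_itv R v.2 big; [lra|move: d0; rewrite /disk; have := sqr_ge0 v.1; lra|].
    by split.
  apply: (subclosed_compact _ (@cbox_compact R big) Db).
  have dc v : cts (fun v : P => disk v.1 v.2) v by apply: disk_cts; cts.
  have hc v : cts (fun v : P => height v.1 v.2) v by apply: height_cts; cts.
  rewrite -openC openE => v /= nv.
  have [d0|d0] := ltP (disk v.1 v.2) 0.
    have H : nbhs v [set w : P | disk w.1 w.2 < 0].
      by apply: cts_lt; [exact: dc|exact: cts_cst|].
    by apply: filterS H => w /= dw [d1 _]; rewrite leNgt dw in d1.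
  have h0 : height v.1 v.2 < 0 by rewrite ltNge; apply/negP => h0; apply: nv.
  have H : nbhs v [set w : P | height w.1 w.2 < 0].
    by apply: cts_lt; [exact: hc|exact: cts_cst|].
  by apply: filterS H => w /= dw [_ d1]; rewrite leNgt dw in d1.
pose s (b : bool) (v : P) := j (v.1, v.2, (-1) ^+ b * Num.sqrt (height v.1 v.2)).
have sc b : compact (s b @` D).
  apply: continuous_compact Dc; apply/subspace_continuousP => v Dv.
  have scont : cont_on D (s b).
    apply: j_cont_on => w wD.
    - by case: wD => _ h0; rewrite exprMn sqrr_sign mul1r sqr_sqrtr.
    - by cts.
    - by cts.
    - have hw : cts (fun v : P => height v.1 v.2) w by apply: height_cts; cts.
      by apply: cts_mul; [exact: cts_cst|exact: cts_sqrt].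
  move=> U sU; have [V Vv VP] := scont v Dv U sU.
  by rewrite /within /=; apply: filterS Vv => w Vw Dw; exact: VP.
have -> : [set: T] = (s false @` D) `|` (s true @` D).
  apply/seteqP; split=> // p _.
  have Dp : D (cX p, cY p) by split; [have [] := height_dom (height_coord p)|exact: height_coord].
  have [z0|z0] := leP 0 (cZ p); [left|right]; exists (cX p, cY p) => //.
    rewrite /s /= expr0 mul1r -cZE sqrtr_sqr ger0_norm //.
    by case: E => _ _ je _ _; rewrite -[RHS]je /cX /cY /cZ -!surjective_pairing.
  rewrite /s /= expr1 mulN1r -cZE sqrtr_sqr ltr0_norm // opprK.
  by case: E => _ _ je _ _; rewrite -[RHS]je /cX /cY /cZ -!surjective_pairing.
exact: compactU.
Qed.

End GenusSurface.

Section GenusCharts.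
Variables (R : realType) (g : nat) (T : topologicalType) (e : T -> R * R * R) (j : R * R * R -> T).
Hypothesis E : genus_embedding g e j.
Local Notation P := (R * R)%type.
Local Notation height := (height g).
Local Notation cX := (cX e).
Local Notation cY := (cY e).
Local Notation cZ := (cZ e).

Definition has_charts p := forall V : set T, nbhs p V -> exists U (f : T -> P) (h : P -> T),
  [/\ chart U f h, U p, f p = (0, 0) & U `<=` V].

Lemma sheet_chart p : cZ p != 0 -> has_charts p.
Proof.
move=> Zp V Vp; pose t := cZ p < 0.
have tZ : 0 < (-1) ^+ t * cZ p.
  by rewrite /t -normrEsign normr_gt0.
have hp : 0 < height (cX p) (cY p) by rewrite -(cZE E) exprn_even_gt0.
pose hv (v : P) := height (cX p + v.1) (cY p + v.2).
have hvc v : cts hv v by apply: height_cts; cts.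
have : nbhs ((0, 0) : P) [set v | 0 < hv v].
  by apply: cts_lt; [exact: cts_cst|exact: hvc|rewrite /hv /= !addr0].
move=> /nbhs_boxP[r r0 rP].
pose psi (v : P) := j (cX p + v.1, cY p + v.2, (-1) ^+ t * Num.sqrt (hv v)).
pose W := [set q | 0 < (-1) ^+ t * cZ q].
have bE v : box (- r) r (- r) r v -> 0 < hv v by move=> [? ? ? ?]; apply: rP => /=; lra.
have hE v : box (- r) r (- r) r v -> ((-1) ^+ t * Num.sqrt (hv v)) ^+ 2 = hv v.
  by move=> /bE hv0; rewrite exprMn sqrr_sign mul1r sqr_sqrtr // ltW.
have [||||||U [f [h [cU Up fp UV _]]]] := @local_chart R T (fun q => (cX q - cX p, cY q - cY p)) psi W V r p r0 Vp; last by exists U, f, h.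
- by rewrite !subrr.
- exact: tZ.
- move=> q Wq; apply: cts_lt; [exact: cts_cst| |exact: Wq].
  by apply: cts_mul; [exact: cts_cst|exact: (cZ_cts E)].
- by move=> q _; have := @cX_cts _ _ _ _ _ E q; have := @cY_cts _ _ _ _ _ E q => ? ?; cts.
- move=> v bv; have [jx jy jz] := jP E (hE v bv); split.
  + rewrite /W /= /psi jz mulrA -expr2 sqrr_sign mul1r sqrtr_gt0; exact: bE.
  + by rewrite /psi jx jy ![_ + _ - _]addrAC !subrr !add0r -surjective_pairing.
  + have hc := hvc v.
    apply: (@j_cts _ _ _ _ _ E _ (box (- r) r (- r) r)) => //; last 3 first.
    * by cts.
    * by cts.
    * by apply: cts_mul; [exact: cts_cst|exact: cts_sqrt].
    by case: bv => *; exact: nbhs_box.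
- move=> q Wq bq; rewrite /psi /hv /= ![_ + (_ - _)]addrC !subrK -(cZE E) sqrtr_sqr.
  have -> : `|cZ q| = (-1) ^+ t * cZ q.
    have -> : `|cZ q| = `|(-1) ^+ t * cZ q| by rewrite normrM normr_sign mul1r.
    by rewrite gtr0_norm.
  rewrite mulrA -expr2 sqrr_sign mul1r; case: E => _ _ je _ _.
  by rewrite -[RHS]je /cX /cY /cZ -!surjective_pairing.
Qed.

(** After Z is divided by the square root of the positive factor [rest], the surface near a boundary
    circle becomes a quadric, with [ep] = 1 for the outer circle and -1 for a hole. It is solved for
    one planar coordinate, of sign [tau]; [swap] tells which one, and that coordinate must not
    vanish relative to the centre. *)
Lemma circle_chart (ep c rho : R) (rest : R -> R -> R) (swap : bool) p :
  (forall x y, height x y = ep * (rho ^+ 2 - (x - c) ^+ 2 - y ^+ 2) * rest x y) ->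
  ep * ep = 1 -> 
  (forall (X : topologicalType) (f h : X -> R) x, cts f x -> cts h x ->
     cts (fun q => rest (f q) (h q)) x) ->
  cZ p = 0 -> 0 < rest (cX p) (cY p) -> (if swap then cX p - c else cY p) != 0 ->
  forall V : set T, nbhs p V -> exists U (f : T -> P) (h : P -> T),
  [/\ chart U f h, U p, f p = (0, 0), U `<=` V &
    forall q, U q -> [/\ (swap -> 0 < (cX p - c) * (cX q - c)),
      (f q).1 = 0 <-> (if swap then cY q = cY p else cX q = cX p) & (f q).2 = 0 <-> cZ q = 0]].
Proof.
move=> hE ep2 rc Zp rp Bp V Vp.
pose A q := if swap then cY q else cX q - c.
pose B q := if swap then cX q - c else cY q.
have ABE q : (cX q - c) ^+ 2 + cY q ^+ 2 = A q ^+ 2 + B q ^+ 2.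
  by rewrite /A /B; case: (swap); rewrite // addrC.
pose tau : R := (-1) ^+ (B p < 0)%R.
have tau2 : tau * tau = 1 by rewrite /tau -expr2 sqrr_sign.
have tauB : 0 < tau * B p.
  by rewrite /tau -normrEsign normr_gt0.
pose s q := cZ q / Num.sqrt (rest (cX q) (cY q)).
have B2p : B p ^+ 2 = rho ^+ 2 - A p ^+ 2.
  have : height (cX p) (cY p) = 0 by rewrite -(cZE E) Zp expr0n.
  rewrite hE => /eqP; rewrite mulf_eq0 (gt_eqF rp) orbF mulf_eq0.
  have epn : ep != 0 by apply: contraTneq isT => e0; move: ep2; rewrite e0 mul0r => /esym/eqP; rewrite oner_eq0.
  by rewrite (negPf epn) /= => /eqP; have := ABE p; lra.
pose av (v : P) := A p + v.1.
pose bv (v : P) := tau * Num.sqrt (rho ^+ 2 - av v ^+ 2 - ep * v.2 ^+ 2).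
pose xv v := c + (if swap then bv v else av v).
pose yv v := if swap then av v else bv v.
have avc v : cts av v by rewrite /av; cts.
have bvc v : cts bv v by have := avc v => ?; rewrite /bv; cts.
have xvc v : cts xv v by rewrite /xv; have := avc v; have := bvc v; case: (swap) => ? ?; cts.
have yvc v : cts yv v by rewrite /yv; have := avc v; have := bvc v; case: (swap).
have b0 : bv (0, 0) = B p.
  rewrite /bv /av /= addr0 expr0n /= mulr0 subr0 -B2p sqrtr_sqr.
  have -> : `|B p| = `|tau * B p| by rewrite normrM /tau normr_sign mul1r.
  by rewrite gtr0_norm // mulrA tau2 mul1r.
have x0 : xv (0, 0) = cX p /\ yv (0, 0) = cY p.
  by rewrite /xv /yv b0 /av /= addr0 /A /B; case: (swap); split=> //; rewrite addrC subrK.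
have N1 : nbhs ((0, 0) : P) [set v | 0 < rho ^+ 2 - av v ^+ 2 - ep * v.2 ^+ 2].
  apply: cts_lt; [exact: cts_cst|by have := avc (0, 0) => ?; cts|].
  by rewrite /av /= addr0 expr0n /= mulr0 subr0 -B2p exprn_even_gt0.
have N2 : nbhs ((0, 0) : P) [set v | 0 < rest (xv v) (yv v)].
  by apply: cts_lt; [exact: cts_cst|exact: rc|case: x0 => -> ->].
have [r r0 rP] := nbhs_boxP (filterI N1 N2).
have bP v : box (- r) r (- r) r v -> 0 < rho ^+ 2 - av v ^+ 2 - ep * v.2 ^+ 2 /\ 0 < rest (xv v) (yv v).
  by move=> [? ? ? ?]; apply: rP => /=; lra.
pose zv v := v.2 * Num.sqrt (rest (xv v) (yv v)).
have b2 v : box (- r) r (- r) r v -> bv v ^+ 2 = rho ^+ 2 - av v ^+ 2 - ep * v.2 ^+ 2.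
  by move=> /bP[p1 _]; rewrite /bv exprMn /tau sqrr_sign mul1r sqr_sqrtr // ltW.
have xyE v : (xv v - c) ^+ 2 + yv v ^+ 2 = av v ^+ 2 + bv v ^+ 2.
  by rewrite /xv /yv [c + _]addrC addrK; case: (swap); rewrite // addrC.
have zE v : box (- r) r (- r) r v -> zv v ^+ 2 = height (xv v) (yv v).
  move=> bx; have [_ p2] := bP v bx.
  rewrite /zv exprMn sqr_sqrtr ?ltW // hE.
  have -> : rho ^+ 2 - (xv v - c) ^+ 2 - yv v ^+ 2 = ep * v.2 ^+ 2.
    by have := xyE v; rewrite (b2 v bx); lra.
  by rewrite mulrA ep2 mul1r.
pose psi v := j (xv v, yv v, zv v).
pose W := [set q | 0 < tau * B q /\ 0 < rest (cX q) (cY q)].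
have Xc q : cts cX q by exact: (cX_cts E).
have Yc q : cts cY q by exact: (cY_cts E).
have Zc q : cts cZ q by exact: (cZ_cts E).
have Ac q : cts A q by rewrite /A; have := Xc q; have := Yc q; case: (swap) => ? ?; cts.
have Bc q : cts B q by rewrite /B; have := Xc q; have := Yc q; case: (swap) => ? ?; cts.
have [||||||U [f [h [cU Up fp UV UP]]]] := @local_chart R T (fun q => (A q - A p, s q)) psi W V r p r0 Vp; last 1 first.
  exists U, f, h; split=> // q Uq; have [[q1 q2] q3 q4] := UP q Uq; split.
  - move=> sw; move: q1 tauB; rewrite /B sw => q1 tauB.
    have := mulr_gt0 q1 tauB; rewrite mulrACA tau2 mul1r mulrC; exact.
  - rewrite q3 /= /A; case: (swap); split; lra.
  - rewrite q4 /= /s; split=> [/eqP|->]; last by rewrite mul0r.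
    by rewrite mulf_eq0 invr_eq0 orbC gt_eqF ?sqrtr_gt0 //= => /eqP.
- by rewrite subrr /s Zp mul0r.
- by split.
- move=> q [q1 q2]; apply: filterI.
    by apply: cts_lt; [exact: cts_cst|have := Bc q => ?; cts|].
  by apply: cts_lt; [exact: cts_cst|exact: rc|].
- move=> q [q1 q2]; have := Ac q => ?; have := Zc q => ?.
  have rq : cts (fun q => rest (cX q) (cY q)) q by exact: rc.
  rewrite /s; apply: cts_pair; first by cts.
  apply: cts_mul => //; apply: cts_inv; last by cts.
  by rewrite gt_eqF // sqrtr_gt0.
- move=> v bx; have [p1 p2] := bP v bx; have [jx jy jz] := jP E (zE v bx).
  have BE : B (psi v) = bv v.
    by rewrite /B /psi jx jy /xv /yv; case: (swap); rewrite // addrC addKr.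
  have AE : A (psi v) = av v.
    by rewrite /A /psi jx jy /xv /yv; case: (swap); rewrite // addrC addKr.
  split.
  + split; first by rewrite BE /bv mulrA tau2 mul1r sqrtr_gt0.
    by rewrite /psi jx jy.
  + rewrite AE /s /psi jx jy jz /zv /av mulfK; last by rewrite gt_eqF // sqrtr_gt0.
    by rewrite [A p + _]addrC addrK -surjective_pairing.
  + have rv : cts (fun v => rest (xv v) (yv v)) v by exact: rc.
    apply: (@j_cts _ _ _ _ _ E _ (box (- r) r (- r) r)) => //; last first.
      by apply: cts_mul; [by cts|exact: cts_sqrt].
    by case: bx => *; exact: nbhs_box.
- move=> q [q1 q2] bx.
  have s2 : s q ^+ 2 = ep * (rho ^+ 2 - (cX q - c) ^+ 2 - cY q ^+ 2).
    rewrite /s exprMn exprVn sqr_sqrtr ?ltW // (cZE E) hE mulfK // gt_eqF //.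
  have aq : av (A q - A p, s q) = A q by rewrite /av /= addrC subrK.
  have bq : bv (A q - A p, s q) = B q.
    rewrite /bv aq /= s2 mulrA ep2 mul1r.
    have -> : rho ^+ 2 - A q ^+ 2 - (rho ^+ 2 - (cX q - c) ^+ 2 - cY q ^+ 2) = B q ^+ 2.
      by have := ABE q; lra.
    rewrite sqrtr_sqr; have -> : `|B q| = `|tau * B q| by rewrite normrM /tau normr_sign mul1r.
    by rewrite gtr0_norm // mulrA tau2 mul1r.
  have xq : xv (A q - A p, s q) = cX q.
    by rewrite /xv aq bq /A /B; case: (swap); rewrite addrC subrK.
  have yq : yv (A q - A p, s q) = cY q.
    by rewrite /yv aq bq /A /B; case: (swap).
  rewrite /psi /zv xq yq /= /s divfK; last by rewrite gt_eqF // sqrtr_gt0.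
  case: E => _ _ je _ _.
  by rewrite -[RHS]je /cX /cY /cZ -!surjective_pairing.
Qed.

End GenusCharts.

(** * The order of the boundary circles along the axis *)

Section Circles.
Variables (R : realType) (g : nat).
Implicit Types (x y : R) (i k l : nat).
Local Notation height := (height g).
Local Notation big := (big R g).
Local Notation disk := (disk g).
Local Notation hole := (@hole R).
Local Notation ctr := (ctr R).

(** Index 0 stands for the outer circle and i + 1 for the boundary of hole i. *)
Definition cen l : R := if l is i.+1 then ctr i else 0.
Definition rad l : R := if l is i.+1 then 1 else big.
Definition circ l x y : R := (x - cen l) ^+ 2 + y ^+ 2 - rad l ^+ 2.

Lemma rad_ge1 l : 1 <= rad l.
Proof. by case: l => //=; have := big_ge4 R g; lra. Qed.

Lemma circle_factor l : (l <= g)%N -> exists ep (rest : R -> R -> R), [/\ ep * ep = 1,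
  forall x y, height x y = ep * (rad l ^+ 2 - (x - cen l) ^+ 2 - y ^+ 2) * rest x y,
  forall (X : topologicalType) (f h : X -> R) (p : X), cts f p -> cts h p ->
     cts (fun q => rest (f q) (h q)) p &
  forall x y, circ l x y = 0 -> 0 < rest x y].
Proof.
case: l => [_|i ig]; rewrite /circ /=.
  exists 1, (fun x y => \prod_(i < g) hole i x y); split.
  - by rewrite mulr1.
  - by move=> x y; rewrite subr0 mul1r.
  - by move=> X f h x fc hc; apply: cts_prod => i; exact: hole_cts.
  - move=> x y c0; apply: prodr_gt0 => i _; apply: lt_trans (disk_hole (ltn_ord i) _); first by [].
    by move: c0; rewrite /disk subr0; lra.
exists (-1), (fun x y => disk x y * \prod_(k < g | k != Ordinal ig) hole k x y); split.
- by rewrite mulrNN mulr1.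
- by move=> x y; rewrite (height_hole x y ig); congr (_ * _); rewrite /hole; ring.
- move=> X f h x fc hc; apply: cts_mul; first exact: disk_cts.
  have -> : (fun x : X => \prod_(k < g | k != Ordinal ig) hole k (f x) (h x)) =
      (fun x : X => \prod_(k < g) (if k != Ordinal ig then hole k (f x) (h x) else 1)).
    by apply/funext => z; rewrite big_mkcond.
  apply: cts_prod => k; case: (k != Ordinal ig); last exact: cts_cst.
  exact: hole_cts.
- by move=> x y c0; apply: others_gt0; rewrite /hole; lra.
Qed.

Lemma circ_height l x y : (l <= g)%N -> circ l x y = 0 -> height x y = 0.
Proof.
move=> lg c0; have [ep [rest [_ -> _ _]]] := circle_factor lg.
have -> : rad l ^+ 2 - (x - cen l) ^+ 2 - y ^+ 2 = 0 by move: c0; rewrite /circ; lra.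
by rewrite mulr0 mul0r.
Qed.

Lemma height_circ x y : height x y = 0 -> exists2 l, (l <= g)%N & circ l x y = 0.
Proof.
move=> /eqP; rewrite /height mulf_eq0 => /orP[/eqP d0|].
  by exists 0%N => //; move: d0; rewrite /disk /circ /= subr0; lra.
move=> /prodf_eq0[[i ig] _ /eqP /= h0]; exists i.+1 => //.
by move: h0; rewrite /hole /circ /= expr1n.
Qed.

(* The index of the boundary circle near (x, y), with 0 for the outer one; only
   meaningful close to a boundary circle. *)
Definition clos x y : nat := if [pick i : 'I_g | hole i x y < 3] is Some i then (nat_of_ord i).+1 else 0.

Lemma clos_hole i x y : (i < g)%N -> hole i x y < 3 -> clos x y = i.+1.
Proof.
move=> ig hi; rewrite /clos; case: pickP => [k hk|/(_ (Ordinal ig))]; last by rewrite /= hi.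
congr _.+1; apply/eqP; rewrite eq_sym; apply/negPn/negP => ik.
by have := hole_hole ik hi; lra.
Qed.

Lemma clos_disk x y : (forall i, (i < g)%N -> 3 < hole i x y) -> clos x y = 0%N.
Proof.
move=> h3; rewrite /clos; case: pickP => // k hk.
by exfalso; have := h3 k (ltn_ord k); lra.
Qed.

Lemma clos_circ l x y : (l <= g)%N -> circ l x y = 0 -> clos x y = l.
Proof.
case: l => [_|i ig]; rewrite /circ /= => c0.
  apply: clos_disk => i ig; apply: (@disk_hole R g) => //.
  by move: c0; rewrite /disk subr0; lra.
by apply: clos_hole => //; rewrite /hole; lra.
Qed.

Lemma clos_le x y : (clos x y <= g)%N.
Proof. by rewrite /clos; case: pickP => // i _. Qed.

Lemma clos_near l (X : topologicalType) (f h : X -> R) p : (l <= g)%N -> cts f p -> cts h p ->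
  circ l (f p) (h p) = 0 -> nbhs p [set q | clos (f q) (h q) = l].
Proof.
move=> lg fc hc; case: l lg => [_|i ig]; rewrite /circ /= => c0.
  have H (i : 'I_g) : nbhs p [set q | 3 < hole i (f q) (h q)].
    apply: cts_lt; [exact: cts_cst|exact: hole_cts|apply: disk_hole => //].
    by move: c0; rewrite /disk subr0; lra.
  apply: filterS (filter_forall _ H) => q /= qP.
  by apply: clos_disk => i ig; exact: (qP (Ordinal ig)).
have H : nbhs p [set q | hole i (f q) (h q) < 3].
  by apply: cts_lt; [exact: hole_cts|exact: cts_cst|rewrite /hole; lra].
by apply: filterS H => q /= qP; exact: clos_hole.
Qed.

(** Numbers the intervals that the holes leave on the axis: gap k lies to the right of exactly k
    centres. *)
Definition gap x : nat := \sum_(i < g) (ctr i < x)%R.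

Lemma gapE k x : (k <= g)%N -> (forall i, (i < k)%N -> ctr i < x) ->
  (forall i, (k <= i)%N -> (i < g)%N -> x <= ctr i) -> gap x = k.
Proof.
move=> kg lo hi; rewrite /gap -(big_mkord xpredT (fun i => nat_of_bool (ctr i < x)%R)).
rewrite (big_cat_nat _ (n := k)) //= big_nat_cond (eq_bigr (fun=> 1%N)); last first.
  by move=> i; rewrite andbT => /andP[_ ik]; rewrite lo.
rewrite -big_nat_cond sum_nat_const_nat subn0 muln1.
rewrite big_nat_cond (eq_bigr (fun=> 0%N)); last first.
  by move=> i; rewrite andbT => /andP[ik ig]; rewrite ltNge hi.
by rewrite -big_nat_cond sum_nat_const_nat muln0 addn0.
Qed.

Lemma gap_le x : (gap x <= g)%N.
Proof.
rewrite /gap; have : (\sum_(i < g) (ctr i < x)%R <= \sum_(i < g) 1)%N.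
  by apply: leq_sum => i _; case: (_ < _)%R.
by rewrite sum_nat_const card_ord muln1.
Qed.

Lemma gap_near (X : topologicalType) (f : X -> R) p : cts f p ->
  (forall i, (i < g)%N -> f p != ctr i) -> nbhs p [set q | gap (f q) = gap (f p)].
Proof.
move=> fc fp.
have H (i : 'I_g) : nbhs p [set q | (ctr i < f q) = (ctr i < f p)].
  have := fp i (ltn_ord i); rewrite neq_lt => /orP[lt|lt].
    have L : nbhs p [set q | f q < ctr i] by apply: cts_lt => //; exact: cts_cst.
    by apply: filterS L => q /= lq; rewrite !ltNge (ltW lt) (ltW lq).
  have L : nbhs p [set q | ctr i < f q] by apply: cts_lt => //; exact: cts_cst.
  by apply: filterS L => q /= ->; rewrite lt.
by apply: filterS (filter_forall _ H) => q /= qP; apply: eq_bigr => i _; rewrite qP.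
Qed.

Definition lo k : R := if k is i.+1 then ctr i + 1 else - big.
Definition hi k : R := if (k < g)%N then ctr k - 1 else big.

Lemma ctr_le i k : (i <= k)%N -> ctr i <= ctr k.
Proof. by rewrite leq_eqVlt => /orP[/eqP->//|/ctr_lt]; have := ctr_lt; move=> _ /(_ R); lra. Qed.

Lemma lo_hi k : (k <= g)%N -> lo k + 2 <= hi k.
Proof.
rewrite /lo /hi; have b := big_ge4 R g; case: k => [_|k kg].
  by case: ifP => _; have := ctr_ge0 R 0; lra.
have k8 : ctr k + 8 <= big by exact: ctr_big.
by case: ifP => _; [have := ctr_lt R (ltnSn k); lra|lra].
Qed.

Lemma gap_between k x : (k <= g)%N -> lo k <= x -> x <= hi k -> gap x = k.
Proof.
move=> kg lx xh; apply: gapE => // i; rewrite ?ltnS => ik.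
  by case: k lx ik {kg xh} => // k /=; rewrite ltnS => lx /ctr_le; lra.
by move=> ig; move: xh; rewrite /hi (leq_ltn_trans ik ig); have := ctr_le ik; lra.
Qed.

Lemma height_between k x : (k <= g)%N -> lo k < x -> x < hi k -> 0 < height x 0.
Proof.
move=> kg lx xh; have b := big_ge4 R g.
have bx : - big < x /\ x < big.
  split.
    by case: k lx {kg xh} => //= k; have := ctr_ge0 R k; lra.
  by move: xh; rewrite /hi; case: ifP => // kg'; have := ctr_big R kg'; lra.
apply: height_gt0 => [|i ig]; first by rewrite /disk; case: bx; nra.
rewrite /hole; have [ik|ki] := ltnP i k.
  have : ctr i + 1 < x by case: k lx ik {kg xh} => // k /=; rewrite ltnS => lx /ctr_le; lra.
  nra.
have : x < ctr i - 1 by move: xh; rewrite /hi (leq_ltn_trans ki ig); have := ctr_le ki; lra.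
nra.
Qed.

Lemma height_between_itv x : 0 <= height x 0 -> (lo (gap x) <= x) /\ (x <= hi (gap x)).
Proof.
move=> h0; have [d0 hh] := height_dom h0.
have [||b1 b2] := @sqr_le_itv R x big; [by have := big_ge4 R g; lra|by move: d0; rewrite /disk; lra|].
have hc i : (i < g)%N -> x <= ctr i - 1 \/ ctr i + 1 <= x.
  move=> ig; have := hh i ig; rewrite /hole => hi0.
  by have [?|?] := leP x (ctr i - 1); [left|right; nra].
have mono i k : (i <= k)%N -> ctr k < x -> ctr i < x by move=> /ctr_le; lra.
have [k kg [kl kh]] : exists2 k, (k <= g)%N & (lo k <= x) /\ (x <= hi k).
  have ex : exists k, (g <= k)%N || (x <= ctr k - 1) by exists g; rewrite leqnn.
  case: (ex_minnP ex) => k /orP kP kmin.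
  have kg : (k <= g)%N by apply: kmin; rewrite leqnn.
  exists k => //; split.
    case: k kP kmin kg => //= k kP kmin kg.
    have [H|//] := hc k kg; have := kmin k; rewrite H orbT => /(_ isT); rewrite ltnn.
    by [].
  rewrite /hi; case: ifP => // kg'; case: kP => //.
  by rewrite leqNgt kg'.
by rewrite (gap_between kg kl kh).
Qed.

Lemma gap_ctr x i : (i < g)%N -> 0 <= height x 0 -> x != ctr i.
Proof.
move=> ig /height_dom[_ /(_ i ig)]; rewrite /hole; case: eqVneq => // ->; rewrite subrr expr0n /=; lra.
Qed.

Lemma lo_circ k : (k <= g)%N -> circ k (lo k) 0 = 0.
Proof. by case: k => [|k] _; rewrite /circ /=; ring. Qed.

(** Gap k runs from circle k to circle [next k]; the last gap ends on the outer circle again, so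
    circles and gaps alternate cyclically. *)
Definition next k := if (k < g)%N then k.+1 else 0%N.

Lemma hi_circ k : (k <= g)%N -> circ (next k) (hi k) 0 = 0.
Proof. by move=> kg; rewrite /circ /hi /next; case: ifP => _ /=; ring. Qed.

Lemma next_le k : (next k <= g)%N. Proof. by rewrite /next; case: ifP. Qed.

(** The gaps containing the leftmost and rightmost point of circle l. For the outer circle these are
    gap 0, by truncated predecessor, and gap g. *)
Definition lgap l := l.-1.
Definition rgap l := if l is 0 then g else l.

Lemma left_vertex l : (l <= g)%N -> cen l - rad l = if l is i.+1 then hi i else lo 0.
Proof. by case: l => [|i ig] /=; rewrite ?sub0r // /hi ig. Qed.

Lemma right_vertex l : (l <= g)%N -> cen l + rad l = if l is i.+1 then lo l else hi g.
Proof. by case: l => [|i ig] /=; rewrite ?add0r // /hi ltnn. Qed.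

Lemma gap_left l : (l <= g)%N -> gap (cen l - rad l) = lgap l.
Proof.
move=> lg; rewrite left_vertex //; case: l lg => [|i] ig.
  by apply: gap_between => //; have := lo_hi (leq0n g); lra.
by apply: gap_between; [exact: ltnW|have := lo_hi (ltnW ig); lra|exact: lexx].
Qed.

Lemma gap_right l : (l <= g)%N -> gap (cen l + rad l) = rgap l.
Proof.
move=> lg; rewrite right_vertex //; case: l lg => [|i] ig.
  by apply: gap_between => //; have := lo_hi (leqnn g); lra.
by apply: gap_between => //; have := lo_hi ig; lra.
Qed.

End Circles.

(** * Charts and contractible faces of the model *)

Section Faces.
Variables (R : realType) (g : nat) (T : topologicalType) (e : T -> R * R * R) (j : R * R * R -> T).
Hypothesis E : genus_embedding g e j.
Local Notation P := (R * R)%type.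
Local Notation height := (height g).
Local Notation big := (big R g).
Local Notation disk := (disk g).
Local Notation hole := (@hole R).
Local Notation cX := (cX e).
Local Notation cY := (cY e).
Local Notation cZ := (cZ e).

Lemma vertex_chart l p V : (l <= g)%N -> circ g l (cX p) (cY p) = 0 -> cY p = 0 -> nbhs p V ->
  exists U (f : T -> P) (h : P -> T), [/\ chart U f h, U p, f p = (0, 0), U `<=` V &
    forall q, U q -> ((f q).1 = 0 <-> cY q = 0) /\ ((f q).2 = 0 <-> cZ q = 0)].
Proof.
move=> lg c0 Y0 Vp; have [ep [rest [ep2 hE rc rp]]] := circle_factor R lg.
have Zp : cZ p = 0.
  by apply/eqP; rewrite -sqrf_eq0 (cZE E) (circ_height lg c0).
have Xp : cX p - cen R l != 0.
  apply: contra_eq_neq c0 => X0; rewrite /circ X0 Y0 expr0n /= !add0r oppr_eq0.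
  by rewrite sqrf_eq0 gt_eqF //; have := rad_ge1 R g l; lra.
have [U [f [h [cU Up fp UV UP]]]] :=
  @circle_chart _ _ _ _ _ E ep (cen R l) (rad R g l) rest true p hE ep2 rc Zp (rp _ _ c0) Xp V Vp.
exists U, f, h; split=> // q Uq; have [_ q1 q2] := UP q Uq.
by split=> //; rewrite q1 /= Y0.
Qed.

Lemma all_charts (p : T) : has_charts R p.
Proof.
have [Zp|Zp] := eqVneq (cZ p) 0; last exact: (sheet_chart E Zp).
have h0 : height (cX p) (cY p) = 0 by rewrite -(cZE E) Zp expr0n.
have [l lg c0] := height_circ h0.
have [Yp|Yp] := eqVneq (cY p) 0 => V Vp.
  have [U [f [h [cU Up fp UV UP]]]] := vertex_chart lg c0 Yp Vp.
  by exists U, f, h.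
have [ep [rest [ep2 hE rc rp]]] := circle_factor R lg.
have [U [f [h [cU Up fp UV UP]]]] :=
  @circle_chart _ _ _ _ _ E ep (cen R l) (rad R g l) rest false p hE ep2 rc Zp (rp _ _ c0) Yp V Vp.
by exists U, f, h.
Qed.

Definition sg (s : bool) : R := (-1) ^+ s.
Lemma sg2 s : sg s * sg s = 1. Proof. by rewrite /sg -expr2 sqrr_sign. Qed.
Lemma sgK s (x : R) : sg s * (sg s * x) = x. Proof. by rewrite mulrA sg2 mul1r. Qed.
Lemma sg_sqr s (x : R) : (sg s * x) ^+ 2 = x ^+ 2. Proof. by rewrite exprMn /sg sqrr_sign mul1r. Qed.
Lemma sg_lt (x : R) : 0 <= sg (x < 0)%R * x. Proof. by rewrite /sg -normrEsign. Qed.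

Definition pt s t (x y : R) : T := j (x, sg s * y, sg t * Num.sqrt (height x y)).
Definition face s t : set T := [set p | 0 <= sg s * cY p /\ 0 <= sg t * cZ p].

Lemma heightS s (x y : R) : height x (sg s * y) = height x y.
Proof. by case: s; rewrite /sg ?expr0 ?mul1r ?expr1 ?mulN1r ?heightN. Qed.

Lemma pt_height s t (x y : R) : 0 <= height x y ->
  (sg t * Num.sqrt (height x y)) ^+ 2 = height x (sg s * y).
Proof. by move=> h0; rewrite sg_sqr sqr_sqrtr // heightS. Qed.

Lemma pt_coord s t (x y : R) : 0 <= height x y ->
  [/\ cX (pt s t x y) = x, cY (pt s t x y) = sg s * y & cZ (pt s t x y) = sg t * Num.sqrt (height x y)].
Proof. by move=> h0; exact: (jP E (pt_height s t h0)). Qed.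

Lemma facePt s t p : face s t p -> p = pt s t (cX p) (sg s * cY p).
Proof.
move=> [Y0 Z0]; have h0 : 0 <= height (cX p) (sg s * cY p) by rewrite heightS (height_coord E).
have [px py pz] := pt_coord s t h0; apply: (coord_inj E); rewrite ?px ?py ?pz ?sgK //.
have -> : Num.sqrt (height (cX p) (sg s * cY p)) = sg t * cZ p.
  by rewrite heightS -(cZE E) -(sg_sqr t) sqrtr_sqr ger0_norm.
by rewrite sgK.
Qed.

Definition up (x : R) := Num.sqrt (big ^+ 2 - x ^+ 2).

Lemma coord_big p : - big <= cX p /\ cX p <= big.
Proof.
have [d0 _] := height_dom (height_coord E p); have b := big_ge4 R g.
by apply: sqr_le_itv; [lra|move: d0; rewrite /disk; have := sqr_ge0 (cY p); lra].
Qed.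

Lemma up_sqr (x : R) : - big <= x -> x <= big -> up x ^+ 2 = big ^+ 2 - x ^+ 2.
Proof. by move=> x1 x2; rewrite /up sqr_sqrtr //; have := big_ge4 R g; nra. Qed.

Lemma up_ge0 (x : R) : 0 <= up x. Proof. exact: sqrtr_ge0. Qed.

Lemma up_height (x : R) : - big <= x -> x <= big -> height x (up x) = 0.
Proof. by move=> x1 x2; rewrite /height /disk up_sqr // subrr mul0r. Qed.

Lemma le_up s p : face s true p \/ face s false p -> sg s * cY p <= up (cX p).
Proof.
move=> Fp; have Y0 : 0 <= sg s * cY p by case: Fp => -[].
have [d0 _] := height_dom (height_coord E p); have [x1 x2] := coord_big p.
have : (sg s * cY p) ^+ 2 <= up (cX p) ^+ 2.
  by rewrite sg_sqr up_sqr //; move: d0; rewrite /disk; lra.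
by have := up_ge0 (cX p); nra.
Qed.

(** Moves p straight away from the axis towards the outer circle over the same abscissa. This only
    increases the distances to the holes, so the path never leaves the face. *)
Definition lift_pt s t p (m : R) := pt s t (cX p) (sg s * cY p + m * (up (cX p) - sg s * cY p)).

Lemma lift_bounds s t p (m : R) : face s t p -> 0 <= m -> m <= 1 ->
  let y := sg s * cY p + m * (up (cX p) - sg s * cY p) in 0 <= y /\ 0 <= height (cX p) y.
Proof.
move=> Fp m0 m1 y; have [Y0 Z0] := Fp.
have Yu : sg s * cY p <= up (cX p) by apply: le_up; case: t Fp {Z0}; [left|right].
have yY : sg s * cY p <= y by rewrite /y; have : 0 <= m * (up (cX p) - sg s * cY p) by [apply: mulr_ge0 => //; lra]; lra.
have yu : y <= up (cX p).
  have : 0 <= (1 - m) * (up (cX p) - sg s * cY p) by apply: mulr_ge0; lra.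
  by rewrite /y; lra.
have [d0 hh] := height_dom (height_coord E p); have [x1 x2] := coord_big p.
have y2 : cY p ^+ 2 <= y ^+ 2 by rewrite -(sg_sqr s); nra.
split; first by lra.
apply: height_ge0 => [|i ig].
  by rewrite /disk; have := up_sqr x1 x2; nra.
by have := hh i ig; rewrite /hole; lra.
Qed.

Lemma lift0 s t p : face s t p -> lift_pt s t p 0 = p.
Proof. by move=> Fp; rewrite /lift_pt mul0r addr0 -facePt. Qed.

Lemma lift1 s t p : lift_pt s t p 1 = pt s t (cX p) (up (cX p)).
Proof. by rewrite /lift_pt mul1r addrC subrK. Qed.

Lemma joint_cont_prod (X Y : topologicalType) (B : set Y) (K : Y * R -> X) :
  cont_on [set u | B u.1 /\ Icc 0 1 u.2] K -> joint_cont B (fun y t => K (y, t)).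
Proof.
move=> Kc y t By t01 U KU.
have [V Vyt VP] := Kc (y, t) (conj By t01) U KU.
have [[V1 V2] /= [V1y /nbhs_realP[r r0 rP]] VV] := Vyt.
exists V1, r; split=> // z s V1z Bz s01 s1 s2; apply: VP => //.
by apply: VV; split=> //=; exact: rP.
Qed.

Lemma lift_cont s t : joint_cont (face s t) (lift_pt s t).
Proof.
apply: (@joint_cont_prod _ _ _ (fun u => lift_pt s t u.1 u.2)).
pose y (u : T * R) := sg s * cY u.1 + u.2 * (up (cX u.1) - sg s * cY u.1).
have Xc u : cts (fun u : T * R => cX u.1) u.
  by apply: (@cts_comp _ _ _ (fun u : T * R => u.1)); [cts|exact: (cX_cts E)].
have Yc u : cts (fun u : T * R => cY u.1) u.
  by apply: (@cts_comp _ _ _ (fun u : T * R => u.1)); [cts|exact: (cY_cts E)].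
have yc u : cts y u by have := Xc u => ?; have := Yc u => ?; rewrite /y /up; cts.
apply: (j_cont_on E) => u [Fu [u1 u2]].
- by rewrite (pt_height s) //; case: (lift_bounds Fu u1 u2).
- exact: Xc.
- by have := yc u => ?; cts.
- have : cts (fun u : T * R => height (cX u.1) (y u)) u by exact: height_cts.
  by move=> hc; apply: cts_mul; [exact: cts_cst|exact: cts_sqrt].
Qed.

Definition top s (x : R) : T := j (x, sg s * up x, 0).

Lemma pt_top s t (x : R) : - big <= x -> x <= big -> pt s t x (up x) = top s x.
Proof. by move=> x1 x2; rewrite /pt up_height // sqrtr0 mulr0. Qed.

Lemma top_cont s : cont_on (Icc (- big) big) (top s).
Proof.
apply: (j_cont_on E) => x [x1 x2].
- by rewrite heightS up_height // expr0n.
- by cts.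
- by rewrite /up; cts.
- by cts.
Qed.

(** Lifting retracts the face to an arc of the outer circle. [prism] gives a potential for the
    difference with the restriction to this arc, and on the arc a potential exists by integration
    over an interval. *)
Lemma face_coboundary s t n : cocycle setT n -> coboundary (face s t) n.
Proof.
move=> cn.
have ptc p : exists b, face s t p -> pint n (lift_pt s t p) 0 1 b.
  have [Fp|Fp] := pselect (face s t p); last by exists false.
  have [|b bP] := @pint_exists R T n (lift_pt s t p) 0 1 ler01; last by exists b.
  have c1 := joint_cont_fiber (@lift_cont s t) Fp.
  move=> y y01; have [U [h [Uy UP]]] := cn (lift_pt s t p y) Logic.I.
  have [V Vy VU] := c1 y y01 U Uy.
  exists (V `&` V), (h \o lift_pt s t p); split; first exact: filterI.
  by move=> a b [Va _] [Vb _] a01 b01; apply: UP => //; exact: VU.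
have [b bP] := choice ptc.
have pr := prism cn (fun _ _ _ _ => Logic.I) (@lift_cont s t) bP.
have b0 := big_ge4 R g.
have ct : cocycle (Icc (- big) big) (pull (top s) n).
  move=> x Ix; have [U [h [Uy UP]]] := cn (top s x) Logic.I.
  have [V Vy VU] := top_cont Ix Uy.
  exists V, (h \o top s); split=> // u v Vu Vv Iu Iv.
  by apply: UP => //; exact: VU.
have [|_ [k kp _]] := @pint_exists R T n (top s) (- big) big _ ct; first by lra.
exists (fun p => b p (+) k (cX p)).
have kX : potential (face s t) (fun p q => n (top s (cX p)) (top s (cX q))) (fun p => k (cX p)).
  move=> p _; have [U Ux UP] := kp (cX p) (coord_big p).
  exists (cX @^-1` U); first exact: (cX_cts E).
  by move=> u v Uu Uv _ _; apply: UP => //; exact: coord_big.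
apply: potential_eq (potentialD pr kX) => // p q Fp Fq.
have [p1 p2] := coord_big p; have [q1 q2] := coord_big q.
by rewrite /addcoc !lift0 // !lift1 !pt_top // -addbA addbb addbF.
Qed.

Lemma conn_genus : conn [set: T].
Proof.
move=> h hp.
have Ht s x : - big <= x -> x <= big -> h (top s x) = h (top s big).
  move=> x1 x2.
  have hp' : potential (Icc (- big) big) nul (h \o top s).
    move=> y Iy; have [U Uy UP] := hp (top s y) Logic.I.
    have [V Vy VU] := top_cont Iy Uy.
    by exists V => // a b Va Vb Ia Ib; apply: UP => //; apply: VU.
  by apply: (conn_Icc hp'); split; lra.
have Hp s t p : face s t p -> h p = h (top s (cX p)).
  move=> Fp; have [x1 x2] := coord_big p.
  have hp' : potential (Icc 0 1) nul (h \o lift_pt s t p).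
    move=> y Iy; have [U Uy UP] := hp (lift_pt s t p y) Logic.I.
    have [V Vy VU] := joint_cont_fiber (@lift_cont s t) Fp Iy Uy.
    by exists V => // a b Va Vb Ia Ib; apply: UP => //; apply: VU.
  rewrite -(pt_top s t x1 x2) -lift1 -[in LHS](lift0 Fp).
  by apply: (conn_Icc hp'); split; lra.
have top_big s : top s big = top false big.
  have : up big = 0 by rewrite /up subrr sqrtr0.
  by rewrite /top => ->; rewrite !mulr0.
have all p : h p = h (top false big).
  have [x1 x2] := coord_big p.
  rewrite (@Hp (cY p < 0)%R (cZ p < 0)%R p) ?Ht ?top_big //.
  by split; exact: sg_lt.
by move=> p q _ _; rewrite !all.
Qed.

Lemma genus_is_surface : surface (gdist e).
Proof.
split.
- by move=> x; rewrite /gdist !subrr normr0 !addr0.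
- move=> x y xy; rewrite ltNge; apply/negP => d0; apply: xy.
  move: d0; rewrite /gdist => d0.
  have := normr_ge0 (cX x - cX y); have := normr_ge0 (cY x - cY y); have := normr_ge0 (cZ x - cZ y).
  move=> h1 h2 h3.
  have z (a : R) : `|a| <= 0 -> a = 0 by rewrite normr_le0 => /eqP.
  by apply: (coord_inj E); apply/eqP; rewrite -subr_eq0; apply/eqP; apply: z; lra.
- by move=> x y; rewrite /gdist distrC [`|cY x - _|]distrC [`|cZ x - _|]distrC.
- exact: gdist_tri.
- exact: (gdist_nbhs E).
- exact: (genus_compact E).
- exact: conn_genus.
- by move=> q V Vq; exact: all_charts.
Qed.

End Faces.

(** * First cohomology of the surface of genus g *)

Section Trig.
Variable R : realType.
Implicit Types (s t : R).

Definition cosl t : R := cos (pi *+ 2 * t).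
Definition sinl t : R := sin (pi *+ 2 * t).

Lemma period_nat (X : Type) (f : R -> X) (k : nat) t : (forall t, f (t + 1) = f t) -> f (t + k%:R) = f t.
Proof. by move=> fp; elim: k => [|k IH]; rewrite ?addr0 // -natr1 addrA fp. Qed.

Lemma period_int (X : Type) (f : R -> X) s t : (forall t, f (t + 1) = f t) -> s - t \is a Num.int -> f s = f t.
Proof.
move=> fp /intrP[z zE]; have -> : s = t + z%:~R by rewrite -zE addrC subrK.
case: z {zE} => k; first exact: period_nat.
by rewrite NegzE mulrNz -[in RHS](subrK (k.+1%:~R) t) -(period_nat k.+1 (t - k.+1%:R) fp).
Qed.

Lemma cosl_cts t : cts cosl t.
Proof. by apply: (@cts_comp _ _ _ (fun t => pi *+ 2 * t) cos); [cts|exact: continuous_cos]. Qed.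
Lemma sinl_cts t : cts sinl t.
Proof. by apply: (@cts_comp _ _ _ (fun t => pi *+ 2 * t) sin); [cts|exact: continuous_sin]. Qed.

Lemma cosl1 t : cosl (t + 1) = cosl t.
Proof. by rewrite /cosl mulrDr mulr1 cosD2pi. Qed.
Lemma sinl1 t : sinl (t + 1) = sinl t.
Proof. by rewrite /sinl mulrDr mulr1 sinD2pi. Qed.

Lemma cosl2 t : cosl t ^+ 2 + sinl t ^+ 2 = 1. Proof. exact: cos2Dsin2. Qed.

Lemma sinlN t : sinl (- t) = - sinl t. Proof. by rewrite /sinl mulrN sinN. Qed.
Lemma coslN t : cosl (- t) = cosl t. Proof. by rewrite /cosl mulrN cosN. Qed.

Lemma sinl_gt0 t : 0 < t -> t < 1/2 -> 0 < sinl t.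
Proof.
move=> t0 t1; apply: sin_gt0_pi; have p0 := pi_gt0 R.
have -> : pi *+ 2 * t = pi * (2 * t) by rewrite mulr2n; ring.
apply/andP; split; first by apply: mulr_gt0 => //; lra.
by rewrite gtr_pMr //; lra.
Qed.

Lemma sinl_lt0 t : - (1/2) < t -> t < 0 -> sinl t < 0.
Proof. by move=> t0 t1; rewrite -oppr_gt0 -sinlN; apply: sinl_gt0; lra. Qed.

Lemma cosl0 : cosl 0 = 1. Proof. by rewrite /cosl mulr0 cos0. Qed.
Lemma half_pi : pi *+ 2 * (1/2) = pi :> R. Proof. by rewrite mulr2n; field. Qed.
Lemma coslh : cosl (1/2) = -1. Proof. by rewrite /cosl half_pi cospi. Qed.

Lemma cosl_eq1_half t : 0 <= t -> t <= 1/2 -> cosl t = 1 -> t = 0.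
Proof.
move=> t0 t1 c1; have p0 := pi_gt0 R.
have E2 : pi *+ 2 * t = pi * (2 * t) by rewrite mulr2n; ring.
have : pi *+ 2 * t = 0.
  apply: (@cos_inj R).
  - rewrite in_itv /= E2; apply/andP; split; first by apply: mulr_ge0; lra.
    by rewrite ger_pMr //; lra.
  - by rewrite in_itv /= lexx ltW.
  - by rewrite cos0; exact: c1.
by rewrite E2 => /eqP; rewrite mulf_eq0 gt_eqF //= => /eqP; lra.
Qed.

Lemma cosl_eq1 t : cosl t = 1 -> t \is a Num.int.
Proof.
move=> c1; pose f := t - (Num.floor t)%:~R.
have [f0 f1] : 0 <= f /\ f < 1.
  have := floor_le_tmp t; have := floorD1_gt t; rewrite /f intrD mulr1z; lra.
have cf : cosl f = 1.
  by rewrite -c1; apply: (period_int (f := cosl)); [exact: cosl1|rewrite /f addrAC subrr add0r rpredN intr_int].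
suff f00 : f = 0 by have -> : t = (Num.floor t)%:~R by [move: f00; rewrite /f; lra]; exact: intr_int.
have [h|h] := leP f (1/2); first exact: cosl_eq1_half.
have : 1 - f = 0.
  apply: cosl_eq1_half; [lra|lra|].
  by rewrite addrC cosl1 coslN.
lra.
Qed.

Lemma cosl_sinl_int s t : cosl s = cosl t -> sinl s = sinl t -> s - t \is a Num.int.
Proof.
move=> cE sE; apply: cosl_eq1; rewrite /cosl mulrBr cosB -!/(cosl _) -!/(sinl _) cE sE.
by rewrite -!expr2 cosl2.
Qed.

Lemma circle_param (a b : R) : a ^+ 2 + b ^+ 2 = 1 -> exists2 t, cosl t = a & sinl t = b.
Proof.
move=> ab; have a1 : -1 <= a <= 1.
  have [||? ?] := @sqr_le_itv R a 1; [lra|have := sqr_ge0 b; rewrite expr1n; lra|lra].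
have p0 := pi_gt0 R; have p2 : pi *+ 2 != 0 :> R by rewrite mulr2n gt_eqF //; lra.
pose t0 := acos a / (pi *+ 2).
have t0E : pi *+ 2 * t0 = acos a by rewrite /t0 mulrCA mulfV ?mulr1.
have c0 : cosl t0 = a by rewrite /cosl t0E acosK.
have s0 : sinl t0 = `|b|.
  rewrite /sinl t0E sin_acos //; have -> : 1 - a ^+ 2 = b ^+ 2 by lra.
  exact: sqrtr_sqr.
have [b0|b0] := leP 0 b; first by exists t0; rewrite // s0 ger0_norm.
by exists (- t0); rewrite ?coslN // sinlN s0 ltr0_norm // opprK.
Qed.

Lemma sign_near (X : topologicalType) (f : X -> R) x : cts f x -> f x != 0 ->
  nbhs x [set y | (f y < 0)%R = (f x < 0)%R].
Proof.
move=> fc; rewrite neq_lt => /orP[lt|lt].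
  have L : nbhs x [set y | f y < 0] by apply: cts_lt => //; exact: cts_cst.
  by apply: filterS L => y /= ->; rewrite lt.
have L : nbhs x [set y | 0 < f y] by apply: cts_lt => //; exact: cts_cst.
by apply: filterS L => y /= lq; rewrite !ltNge (ltW lt) (ltW lq).
Qed.

Lemma cts_sign (X : topologicalType) (f h : X -> R) x : cts f x -> cts h x ->
  (f x = 0 -> h x = 0) -> cts (fun x => (-1) ^+ (f x < 0)%R * h x) x.
Proof.
move=> fc hc fh; have [f0|f0] := eqVneq (f x) 0.
  have h0 := fh f0; rewrite /cts /prop_for /continuous_at /= h0 mulr0.
  apply/cvgrPdist_lt => /= ep ep0.
  have H : nbhs x [set y | `|h y| < ep].
    by apply: cts_lt; [cts|exact: cts_cst|rewrite h0 normr0].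
  by apply: filterS H => y /= hy; rewrite sub0r normrN normrM normr_sign mul1r.
have H := sign_near fc f0.
have c2 : cts (fun y => (-1) ^+ (f x < 0)%R * h y) x by cts.
move=> U /= /c2 hU; rewrite /= in hU.
have : nbhs x [set y | U ((-1) ^+ (f x < 0)%R * h y)] by [].
move=> hU'; suff : nbhs x [set y | U ((-1) ^+ (f y < 0)%R * h y)] by [].
by apply: filterS (filterI H hU') => y /= [-> ].
Qed.

(** The loop crosses at the two zeros of the sine, with weight [w false] where the cosine is 1 and
    [w true] where it is -1. *)
Lemma oint_turn (T : topologicalType) (n : T -> T -> bool) (c : R -> T) (w : bool -> bool) :
  (forall t, exists2 U, nbhs t U & forall a b, U a -> U b ->
    n (c a) (c b) = ((sinl a < 0) (+) (sinl b < 0)) && w (cosl t < 0)) ->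
  oint n c (w true (+) w false).
Proof.
move=> nP.
have cn : cocycle setT (pull c n).
  move=> t _; have [U Ut UP] := nP t; exists U, (fun a => (sinl a < 0) && w (cosl t < 0)).
  by split=> // a b Ua Ub _ _; rewrite /pull UP // andb_addl.
have [k kp] := line_coboundary cn.
have part (a0 b0 z : R) w0 : a0 < z -> z < b0 -> (forall t, a0 < t -> t < b0 -> sinl t = 0 -> t = z) ->
    w (cosl z < 0) = w0 -> forall s t, a0 < s -> s < b0 -> a0 < t -> t < b0 ->
    k s (+) k t = ((sinl s < 0) (+) (sinl t < 0)) && w0.
  move=> az zb zP wz s t s1 s2 t1 t2.
  pose J : set R := [set x | a0 < x /\ x < b0].
  have cJ : conn J by apply: conn_convexR => x y z' [? ?] [? ?] ? ?; split; lra.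
  have pJ : potential J (pull c n) (fun t => (sinl t < 0) && w0).
    move=> x [x1 x2]; have [U Ux UP] := nP x.
    have [x0|x0] := eqVneq (sinl x) 0.
      have xz := zP x x1 x2 x0; exists U => // p q Up Uq _ _.
      by rewrite /pull UP // xz wz andb_addl.
    have H := sign_near (@sinl_cts x) x0.
    exists (U `&` [set y | (sinl y < 0)%R = (sinl x < 0)%R]); first exact: filterI.
    by move=> p q [Up pE] [Uq qE] _ _; rewrite /pull UP // pE qE !addbb.
  have := conn_potential cJ (potential_sub (@subsetT _ J) kp) pJ (conj s1 s2) (conj t1 t2).
  by rewrite andb_addl; case: (k s); case: (k t); case: (_ && _); case: (_ && _).
exists k => // t.
have p1 : forall s t, - (1/2) < s -> s < 1/2 -> - (1/2) < t -> t < 1/2 ->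
    k s (+) k t = ((sinl s < 0) (+) (sinl t < 0)) && w false.
  apply: (part _ _ 0); [lra|lra| |by rewrite cosl0 ltNge ler01].
  move=> u u1 u2 u0; apply/eqP; case: ltgtP => // ul.
    by have := sinl_lt0 u1 ul; rewrite u0 ltxx.
  by have := sinl_gt0 ul u2; rewrite u0 ltxx.
have p2 : forall s t, 0 < s -> s < 1 -> 0 < t -> t < 1 ->
    k s (+) k t = ((sinl s < 0) (+) (sinl t < 0)) && w true.
  apply: (part _ _ (1/2)); [lra|lra| |by rewrite coslh ltrN10].
  move=> u u1 u2 u0; apply/eqP; case: ltgtP => // ul.
    by have := sinl_gt0 u1 ul; rewrite u0 ltxx.
  by have := @sinl_lt0 (u - 1); rewrite -sinl1 subrK u0 ltxx => H; apply: H; lra.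
have kper u : k (u + 1) (+) k u = k 1 (+) k 0.
  have sh : potential setT (pull c n) (fun u => k (u + 1)).
    move=> x _; have [U Ux UP] := kp (x + 1) Logic.I; have [V Vx VP] := nP x; have [W Wx WP] := nP (x + 1).
    have cs : cts (fun y : R => y + 1) x by cts.
    have U1 : nbhs x [set y | U (y + 1)] := cs _ Ux.
    have W1 : nbhs x [set y | W (y + 1)] := cs _ Wx.
    exists (V `&` ([set y | U (y + 1)] `&` [set y | W (y + 1)])); first by apply: filterI => //; exact: filterI.
    move=> p q [Vp [Up Wp]] [Vq [Uq Wq]] _ _; rewrite -UP // /pull VP // WP //.
    by rewrite !sinl1 cosl1.
  have := conn_potential (@conn_line R) sh kp (I : setT u) (I : setT 0).
  by rewrite add0r.
(* The period from -1/4 to 3/4 is split at 1/4, so that each half contains one zero of the sine in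
   its interior. *)
rewrite kper -(kper (- (1/4))).
have -> : - (1/4) + 1 = 3/4 :> R by lra.
have e1 : k (3/4) (+) k (1/4) = w true.
  rewrite p2; [|lra|lra|lra|lra].
  have -> : (sinl (3/4) < 0)%R = true.
    by have -> : 3/4 = - (1/4) + 1 :> R by [lra]; rewrite sinl1; apply: sinl_lt0; lra.
  by rewrite ltNge ltW //; apply: sinl_gt0; lra.
have e2 : k (1/4) (+) k (- (1/4)) = w false.
  rewrite p1; [|lra|lra|lra|lra].
  have -> : (sinl (- (1/4)) < 0)%R = true by apply: sinl_lt0; lra.
  by rewrite [(sinl (1/4) < 0)%R]ltNge ltW //; apply: sinl_gt0; lra.
by rewrite -e1 -e2; case: (k (3/4)); case: (k (1/4)); case: (k _).
Qed.

End Trig.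

Section CircleLoops.
Variables (R : realType) (g : nat) (T : topologicalType) (e : T -> R * R * R) (j : R * R * R -> T).
Hypothesis E : genus_embedding g e j.
Local Notation height := (height g).
Local Notation cX := (cX e).
Local Notation cY := (cY e).
Local Notation cZ := (cZ e).
Local Notation cen := (cen R).
Local Notation rad := (rad R g).
Local Notation circ := (circ g).
Local Notation lo := (lo R g).
Local Notation hi := (hi R g).
Local Notation clos := (clos g).
Local Notation gap := (gap g).
Local Notation next := (next g).
Local Notation rgap := (rgap g).
Implicit Types (l k : nat) (u v : nat -> bool) (x y : R) (p q : T) (t : R).

Definition cidx p := clos (cX p) (cY p).
Definition sidx p := gap (cX p).

(* The class that jumps by u l across the boundary circle l (where Z = 0) and by v k
   across the slice in the k-th gap (where Y = 0). *)
Definition Ncoc u v p q := ((cZ p < 0)%R (+) (cZ q < 0)%R) && u (cidx p) (+)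
  ((cY p < 0)%R (+) (cY q < 0)%R) && v (sidx p).

Lemma Z0_circ p : cZ p = 0 -> exists2 l, (l <= g)%N & circ l (cX p) (cY p) = 0.
Proof. by move=> Z0; apply: height_circ; rewrite -(cZE E) Z0 expr0n. Qed.

Lemma circ_Z0 l p : (l <= g)%N -> circ l (cX p) (cY p) = 0 -> cZ p = 0.
Proof. by move=> lg c0; apply/eqP; rewrite -sqrf_eq0 (cZE E) (circ_height lg c0). Qed.

Lemma cidx_near p : cZ p = 0 -> nbhs p [set q | cidx q = cidx p].
Proof.
move=> /Z0_circ[l lg c0]; rewrite {2}/cidx (clos_circ lg c0).
exact: (clos_near lg (@cX_cts _ _ _ _ _ E p) (@cY_cts _ _ _ _ _ E p) c0).
Qed.

Lemma Y0_height p : cY p = 0 -> 0 <= height (cX p) 0.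
Proof. by move=> Y0; have := height_coord E p; rewrite Y0. Qed.

Lemma sidx_near p : cY p = 0 -> nbhs p [set q | sidx q = sidx p].
Proof.
move=> Y0; apply: (gap_near (@cX_cts _ _ _ _ _ E p)) => i ig.
by apply: (gap_ctr ig); exact: Y0_height.
Qed.

(** The index functions jump far from the cuts only: where Z or Y is nonzero its sign is locally
    constant and the index is irrelevant, so it may be frozen at its value at x. *)
Lemma Ncoc_local u v (x : T) : exists2 U, nbhs x U & forall p q, U p -> U q ->
  Ncoc u v p q = ((cZ p < 0)%R (+) (cZ q < 0)%R) && u (cidx x) (+)
    ((cY p < 0)%R (+) (cY q < 0)%R) && v (sidx x).
Proof.
have [U1 xU1 UP1] : exists2 U, nbhs x U & forall p q, U p -> U q ->
    ((cZ p < 0)%R (+) (cZ q < 0)%R) && u (cidx p) = ((cZ p < 0)%R (+) (cZ q < 0)%R) && u (cidx x).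
  have [Z0|Z0] := eqVneq (cZ x) 0.
    by exists [set q | cidx q = cidx x]; [exact: cidx_near|move=> p q /= -> _].
  exists [set q | (cZ q < 0)%R = (cZ x < 0)%R]; first exact: (sign_near (@cZ_cts _ _ _ _ _ E x)).
  by move=> p q /= -> ->; rewrite addbb.
have [U2 xU2 UP2] : exists2 U, nbhs x U & forall p q, U p -> U q ->
    ((cY p < 0)%R (+) (cY q < 0)%R) && v (sidx p) = ((cY p < 0)%R (+) (cY q < 0)%R) && v (sidx x).
  have [Y0|Y0] := eqVneq (cY x) 0.
    by exists [set q | sidx q = sidx x]; [exact: sidx_near|move=> p q /= -> _].
  exists [set q | (cY q < 0)%R = (cY x < 0)%R]; first exact: (sign_near (@cY_cts _ _ _ _ _ E x)).
  by move=> p q /= -> ->; rewrite addbb.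
exists (U1 `&` U2) => [|p q [p1 p2] [q1 q2]]; first exact: filterI.
by rewrite /Ncoc UP1 // UP2.
Qed.

Lemma Ncoc_cocycle u v : cocycle setT (Ncoc u v).
Proof.
move=> x _; have [U xU UP] := Ncoc_local u v x.
exists U, (fun p => (cZ p < 0)%R && u (cidx x) (+) (cY p < 0)%R && v (sidx x)).
by split=> // p q Up Uq _ _; rewrite UP // !andb_addl addbACA.
Qed.

(** The loops [cloop] are the boundary circles, where the two sheets meet. The loops [sloop] below
    are the slices over the gaps, an interval of the axis doubled by the sign of Z, which is that of
    the sine. *)
Definition cloop l t : T := j (cen l + rad l * cosl t, rad l * sinl t, 0).
Definition mid k := (lo k + hi k) / 2.
Definition hal k := (hi k - lo k) / 2.
Definition sloop k t : T := j (mid k + hal k * cosl t, 0,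
  (-1) ^+ (sinl t < 0)%R * Num.sqrt (height (mid k + hal k * cosl t) 0)).

Lemma cloop_circ l t : circ l (cen l + rad l * cosl t) (rad l * sinl t) = 0.
Proof.
have -> : circ l (cen l + rad l * cosl t) (rad l * sinl t) =
  rad l ^+ 2 * (cosl t ^+ 2 + sinl t ^+ 2 - 1) by rewrite /circ; ring.
by rewrite cosl2 subrr mulr0.
Qed.

Lemma rad_gt0 l : 0 < rad l. Proof. by have := rad_ge1 R g l; lra. Qed.

Lemma cloop_height l t : (l <= g)%N ->
  (0 : R) ^+ 2 = height (cen l + rad l * cosl t) (rad l * sinl t).
Proof. by move=> lg; rewrite (circ_height lg (cloop_circ l t)) expr0n. Qed.

Lemma cloop_coord l t : (l <= g)%N -> [/\ cX (cloop l t) = cen l + rad l * cosl t,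
  cY (cloop l t) = rad l * sinl t & cZ (cloop l t) = 0].
Proof. by move=> lg; apply: (jP E); exact: cloop_height. Qed.

Lemma cosl_bounds t : -1 <= cosl t /\ cosl t <= 1.
Proof. by split; [exact: cos_geN1|exact: cos_le1]. Qed.

Lemma hal_gt0 k : (k <= g)%N -> 0 < hal k.
Proof. by move=> kg; have := lo_hi R kg; rewrite /hal; lra. Qed.

Lemma mid_bounds k t : (k <= g)%N -> lo k <= mid k + hal k * cosl t /\ mid k + hal k * cosl t <= hi k.
Proof.
move=> kg; have h0 := hal_gt0 kg; have [c1 c2] := cosl_bounds t.
have -> : lo k = mid k - hal k by rewrite /mid /hal; lra.
have -> : hi k = mid k + hal k by rewrite /mid /hal; lra.
nra.
Qed.

Lemma slice_height k x : (k <= g)%N -> lo k <= x -> x <= hi k -> 0 <= height x 0.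
Proof.
move=> kg; rewrite le_eqVlt => /orP[/eqP<- _|lx].
  by rewrite (circ_height kg (lo_circ R kg)).
rewrite le_eqVlt => /orP[/eqP->|xh]; last by exact: ltW (height_between kg lx xh).
by rewrite (circ_height (next_le g k) (hi_circ R kg)).
Qed.

Lemma sloop_height k t : (k <= g)%N ->
  ((-1) ^+ (sinl t < 0)%R * Num.sqrt (height (mid k + hal k * cosl t) 0)) ^+ 2 =
    height (mid k + hal k * cosl t) 0.
Proof.
move=> kg; have [l1 l2] := mid_bounds t kg.
by rewrite exprMn sqrr_sign mul1r sqr_sqrtr //; exact: (slice_height kg).
Qed.

Lemma sloop_coord k t : (k <= g)%N -> [/\ cX (sloop k t) = mid k + hal k * cosl t,
  cY (sloop k t) = 0 & cZ (sloop k t) =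
  (-1) ^+ (sinl t < 0)%R * Num.sqrt (height (mid k + hal k * cosl t) 0)].
Proof. by move=> kg; apply: (jP E); exact: sloop_height. Qed.

Lemma sinl0_cosl t : sinl t = 0 -> cosl t = 1 \/ cosl t = -1.
Proof.
move=> s0; have : cosl t ^+ 2 = 1 by rewrite -(cosl2 t) s0 expr0n addr0.
by move=> /eqP; rewrite sqrf_eq1 => /orP[/eqP|/eqP]; [left|right].
Qed.

Lemma sinl_height k t : (k <= g)%N -> sinl t != 0 -> 0 < height (mid k + hal k * cosl t) 0.
Proof.
move=> kg s0; have h0 := hal_gt0 kg; have [c1 c2] := cosl_bounds t.
have s2 : 0 < sinl t ^+ 2 by rewrite exprn_even_gt0.
have := cosl2 t => c12.
have c1' : -1 < cosl t by rewrite lt_neqAle c1 andbT; apply: contraTneq s2 => E1; rewrite -leNgt; have := c12; rewrite -E1; lra.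
have c2' : cosl t < 1 by rewrite lt_neqAle c2 andbT; apply: contraTneq s2 => E1; rewrite -leNgt; have := c12; rewrite E1; lra.
apply: (height_between kg).
  have -> : lo k = mid k - hal k by rewrite /mid /hal; lra.
  nra.
have -> : hi k = mid k + hal k by rewrite /mid /hal; lra.
nra.
Qed.

Lemma sloop_Z k t : (k <= g)%N -> (cZ (sloop k t) < 0)%R = (sinl t < 0)%R.
Proof.
move=> kg; have [_ _ ->] := sloop_coord t kg; case: (boolP (sinl t < 0)%R) => s0 /=.
  by rewrite expr1 mulN1r oppr_lt0 sqrtr_gt0 (sinl_height kg) ?s0 // lt_eqF.
by rewrite expr0 mul1r ltNge sqrtr_ge0.
Qed.

Lemma cloop_loop l : (l <= g)%N -> loop (cloop l).
Proof.
move=> lg; split=> t; last by rewrite /cloop cosl1 sinl1.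
have cc := @cosl_cts R t; have sc := @sinl_cts R t.
apply: (@j_cts _ _ _ _ _ E _ setT) => //; first exact: filterT.
- by move=> y _; exact: cloop_height.
- by cts.
- by cts.
- by cts.
Qed.

Lemma sloop_loop k : (k <= g)%N -> loop (sloop k).
Proof.
move=> kg; split=> t; last by rewrite /sloop cosl1 sinl1.
have cc := @cosl_cts R t; have sc := @sinl_cts R t.
have xc : cts (fun t => mid k + hal k * cosl t) t by cts.
apply: (@j_cts _ _ _ _ _ E _ setT) => //; first exact: filterT.
- by move=> y _; exact: sloop_height.
- by cts.
- apply: cts_sign => //; first by apply: cts_sqrt; apply: height_cts => //; cts.
  move=> s0; have -> : height (mid k + hal k * cosl t) 0 = 0; last by rewrite sqrtr0.
  have [->|->] := sinl0_cosl s0.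
    have -> : mid k + hal k * 1 = hi k by rewrite /mid /hal; lra.
    by rewrite (circ_height (next_le g k) (hi_circ R kg)).
  have -> : mid k + hal k * -1 = lo k by rewrite /mid /hal; lra.
  by rewrite (circ_height kg (lo_circ R kg)).
Qed.

Lemma cloop_simple l : (l <= g)%N -> simple (cloop l).
Proof.
move=> lg; split=> [|s t]; first exact: cloop_loop.
split=> [st|]; last by apply: period_int => ?; rewrite /cloop cosl1 sinl1.
have [sx sy _] := cloop_coord s lg; have [tx ty _] := cloop_coord t lg.
have r0 : rad l != 0 by rewrite gt_eqF ?rad_gt0.
apply: cosl_sinl_int; apply: (mulfI r0).
  by apply: (addrI (cen l)); rewrite -sx -tx st.
by rewrite -sy -ty st.
Qed.

Lemma sloop_simple k : (k <= g)%N -> simple (sloop k).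
Proof.
move=> kg; split=> [|s t]; first exact: sloop_loop.
split=> [st|]; last by apply: period_int => ?; rewrite /sloop cosl1 sinl1.
have [sx _ _] := sloop_coord s kg; have [tx _ _] := sloop_coord t kg.
have r0 : hal k != 0 by rewrite gt_eqF ?hal_gt0.
have cE : cosl s = cosl t by apply: (mulfI r0); apply: (addrI (mid k)); rewrite -sx -tx st.
have sE : (sinl s < 0)%R = (sinl t < 0)%R by rewrite -!(@sloop_Z k) // st.
apply: cosl_sinl_int => //.
have : sinl s ^+ 2 = sinl t ^+ 2 by have := cosl2 s; have := cosl2 t; rewrite cE; lra.
move=> /eqP; rewrite eqf_sqr => /orP[/eqP//|/eqP sN].
have [s0|s0] := ltP (sinl s) 0.
  by move: sE; rewrite s0 => /esym; move: s0; rewrite sN; lra.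
by move: sE; rewrite [LHS]ltNge s0 => /esym/negbT; rewrite -leNgt; move: s0; rewrite sN; lra.
Qed.

Lemma range_cloop l p : (l <= g)%N -> range (cloop l) p <-> circ l (cX p) (cY p) = 0.
Proof.
move=> lg; split=> [[t _ <-]|c0].
  by have [-> -> _] := cloop_coord t lg; exact: cloop_circ.
have r0 : rad l != 0 by rewrite gt_eqF ?rad_gt0.
have [|t ct st] := @circle_param R ((cX p - cen l) / rad l) (cY p / rad l).
  rewrite !expr_div_n -mulrDl; move: c0; rewrite /circ => c0.
  have -> : (cX p - cen l) ^+ 2 + cY p ^+ 2 = rad l ^+ 2 by lra.
  by rewrite mulfV // sqrf_eq0.
exists t => //; have [tx ty tz] := cloop_coord t lg; apply: (coord_inj E); rewrite ?tx ?ty ?tz.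
- by rewrite ct mulrC divfK // addrC subrK.
- by rewrite st mulrC divfK.
- by rewrite (circ_Z0 lg c0).
Qed.

Lemma range_sloop k p : (k <= g)%N -> range (sloop k) p <-> cY p = 0 /\ sidx p = k.
Proof.
move=> kg; split=> [[t _ <-]|[Y0 sk]].
  rewrite /sidx; have [-> -> _] := sloop_coord t kg; split=> //.
  by have [l1 l2] := mid_bounds t kg; exact: gap_between.
have [l1 l2] := height_between_itv (Y0_height Y0); rewrite -/(sidx p) sk in l1 l2.
have h0 := hal_gt0 kg; have hn : hal k != 0 by rewrite gt_eqF.
pose a := (cX p - mid k) / hal k.
have aE : mid k + hal k * a = cX p by rewrite /a mulrC divfK // addrC subrK.
have a1 : -1 <= a by rewrite /a ler_pdivlMr // /mid /hal; lra.
have a2 : a <= 1 by rewrite /a ler_pdivrMr // /mid /hal; lra.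
have a3 : 0 <= 1 - a ^+ 2 by nra.
have [|t ct st] := @circle_param R a ((-1) ^+ (cZ p < 0)%R * Num.sqrt (1 - a ^+ 2)).
  by rewrite [(_ * Num.sqrt _) ^+ 2]exprMn sqrr_sign mul1r sqr_sqrtr // addrC subrK.
exists t => //; have [tx ty tz] := sloop_coord t kg; apply: (coord_inj E); rewrite ?tx ?ty ?tz ?Y0 //.
  by rewrite ct.
have hE : height (mid k + hal k * cosl t) 0 = cZ p ^+ 2 by rewrite ct aE (cZE E) Y0.
rewrite hE sqrtr_sqr; have [Z0|Z0] := eqVneq (cZ p) 0; first by rewrite Z0 normr0 mulr0.
have s0 : sinl t != 0.
  apply: contraNneq Z0 => s0; rewrite -sqrf_eq0 -hE.
  have [->|->] := sinl0_cosl s0.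
    have -> : mid k + hal k * 1 = hi k by rewrite /mid /hal; lra.
    by rewrite (circ_height (next_le g k) (hi_circ R kg)).
  have -> : mid k + hal k * -1 = lo k by rewrite /mid /hal; lra.
  by rewrite (circ_height kg (lo_circ R kg)).
have -> : (sinl t < 0)%R = (cZ p < 0)%R.
  move: s0; rewrite st; case: (cZ p < 0)%R; rewrite ?expr1 ?expr0 ?mul1r ?mulN1r ?oppr_eq0 => s0.
    by rewrite oppr_lt0 lt_neqAle eq_sym s0 sqrtr_ge0.
  by rewrite ltNge sqrtr_ge0.
have [zl|zg] := ltP (cZ p) 0; first by rewrite ltr0_norm // expr1 mulN1r opprK.
by rewrite ger0_norm // expr0 mul1r.
Qed.

Lemma oint_cloop u v l : (l <= g)%N -> oint (Ncoc u v) (cloop l) (v (lgap l) (+) v (rgap l)).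
Proof.
move=> lg; apply: (@oint_turn R T (Ncoc u v) (cloop l) (fun b => v (if b then lgap l else rgap l))) => t.
have r0 := rad_gt0 l.
have YE a : (cY (cloop l a) < 0)%R = (sinl a < 0)%R.
  by have [_ -> _] := cloop_coord a lg; rewrite pmulr_rlt0.
have ZE a : (cZ (cloop l a) < 0)%R = false by have [_ _ ->] := cloop_coord a lg; rewrite ltxx.
have [s0|s0] := eqVneq (sinl t) 0.
  have [U xU UP] := Ncoc_local u v (cloop l t).
  exists (cloop l @^-1` U); first by apply: (proj1 (cloop_loop lg) t).
  move=> a b Ua Ub; rewrite UP // !ZE !YE /=; congr (_ && v _).
  rewrite /sidx; have [-> _ _] := cloop_coord t lg.
  have [->|->] := sinl0_cosl s0; first by rewrite mulr1 ltNge ler01 /= gap_right.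
  by rewrite mulrN1 ltrN10 gap_left.
exists [set y | (sinl y < 0)%R = (sinl t < 0)%R]; first exact: (sign_near (@sinl_cts R t)).
by move=> a b /= aE bE; rewrite /Ncoc !ZE !YE aE bE !addbb.
Qed.

Lemma oint_sloop u v k : (k <= g)%N -> oint (Ncoc u v) (sloop k) (u k (+) u (next k)).
Proof.
move=> kg; apply: (@oint_turn R T (Ncoc u v) (sloop k) (fun b => u (if b then k else next k))) => t.
have YE a : (cY (sloop k a) < 0)%R = false by have [_ -> _] := sloop_coord a kg; rewrite ltxx.
have ZE a : (cZ (sloop k a) < 0)%R = (sinl a < 0)%R by exact: sloop_Z.
have [s0|s0] := eqVneq (sinl t) 0.
  have [U xU UP] := Ncoc_local u v (sloop k t).
  exists (sloop k @^-1` U); first by apply: (proj1 (sloop_loop kg) t).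
  move=> a b Ua Ub; rewrite UP // !ZE !YE /= addbF; congr (_ && u _).
  rewrite /cidx; have [-> -> _] := sloop_coord t kg.
  have [->|->] := sinl0_cosl s0.
    have -> : mid k + hal k * 1 = hi k by rewrite /mid /hal; lra.
    by rewrite ltNge ler01 /= (clos_circ (next_le g k) (hi_circ R kg)).
  have -> : mid k + hal k * -1 = lo k by rewrite /mid /hal; lra.
  by rewrite ltrN10 (clos_circ kg (lo_circ R kg)).
exists [set y | (sinl y < 0)%R = (sinl t < 0)%R]; first exact: (sign_near (@sinl_cts R t)).
by move=> a b /= aE bE; rewrite /Ncoc !ZE !YE aE bE !addbb.
Qed.

End CircleLoops.

Section FirstCohomology.
Variables (R : realType) (g : nat) (T : topologicalType) (e : T -> R * R * R) (j : R * R * R -> T).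
Hypothesis E : genus_embedding g e j.
Hypothesis g_gt0 : (0 < g)%N.
Local Notation height := (height g).
Local Notation cX := (cX e).
Local Notation cY := (cY e).
Local Notation cZ := (cZ e).
Local Notation cen := (cen R).
Local Notation rad := (rad R g).
Local Notation circ := (circ g).
Local Notation lo := (lo R g).
Local Notation hi := (hi R g).
Local Notation cidx := (cidx g e).
Local Notation sidx := (sidx g e).
Local Notation Ncoc := (Ncoc g e).
Local Notation sg := (sg R).
Local Notation face := (face e).
Implicit Types (l k : nat) (u v : nat -> bool) (x y : R) (p q : T) (s t : bool).

Lemma const_path (A : set T) (phi : T -> bool) (gam : R -> T) (a b x y : R) : potential A nul phi ->
  cont_on (Icc a b) gam -> (forall x, Icc a b x -> A (gam x)) -> Icc a b x -> Icc a b y ->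
  phi (gam x) = phi (gam y).
Proof.
move=> Ap gc gA Ix Iy.
exact: (conn_Icc (pull_potential gA gc Ap) Ix Iy).
Qed.

Definition vert x : T := j (x, 0, 0).
Definition arcC l s x : T := j (x, sg s * Num.sqrt (rad l ^+ 2 - (x - cen l) ^+ 2), 0).
Definition arcB t x : T := j (x, 0, sg t * Num.sqrt (height x 0)).

Lemma arcC_circ l s x : cen l - rad l <= x -> x <= cen l + rad l ->
  circ l x (sg s * Num.sqrt (rad l ^+ 2 - (x - cen l) ^+ 2)) = 0.
Proof.
move=> x1 x2; rewrite /circ sg_sqr sqr_sqrtr; first by lra.
by have := rad_gt0 R g l; nra.
Qed.

Lemma arcC_coord l s x : (l <= g)%N -> cen l - rad l <= x -> x <= cen l + rad l ->
  [/\ cX (arcC l s x) = x, cY (arcC l s x) = sg s * Num.sqrt (rad l ^+ 2 - (x - cen l) ^+ 2) &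
    cZ (arcC l s x) = 0].
Proof. by move=> lg x1 x2; apply: (jP E); rewrite expr0n (circ_height lg (arcC_circ s x1 x2)). Qed.

Lemma arcB_coord k t x : (k <= g)%N -> lo k <= x -> x <= hi k ->
  [/\ cX (arcB t x) = x, cY (arcB t x) = 0 & cZ (arcB t x) = sg t * Num.sqrt (height x 0)].
Proof.
by move=> kg x1 x2; apply: (jP E); rewrite sg_sqr sqr_sqrtr //; exact: (slice_height kg).
Qed.

Lemma arcC_cont l s : (l <= g)%N -> cont_on (Icc (cen l - rad l) (cen l + rad l)) (arcC l s).
Proof.
move=> lg; apply: (j_cont_on E) => x [x1 x2].
- by rewrite expr0n (circ_height lg (arcC_circ s x1 x2)).
- by cts.
- by cts.
- by cts.
Qed.

Lemma arcB_cont k t : (k <= g)%N -> cont_on (Icc (lo k) (hi k)) (arcB t).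
Proof.
move=> kg; apply: (j_cont_on E) => x [x1 x2].
- by rewrite sg_sqr sqr_sqrtr //; exact: (slice_height kg).
- by cts.
- by cts.
- apply: cts_mul; first exact: cts_cst.
  by apply: cts_sqrt; apply: height_cts; cts.
Qed.

Lemma arcC_end l s x : x = cen l - rad l \/ x = cen l + rad l -> arcC l s x = vert x.
Proof.
move=> xE; rewrite /arcC /vert; have -> : rad l ^+ 2 - (x - cen l) ^+ 2 = 0.
  by case: xE => ->; ring.
by rewrite sqrtr0 mulr0.
Qed.

Lemma arcB_end k t x : (k <= g)%N -> x = lo k \/ x = hi k -> arcB t x = vert x.
Proof.
move=> kg xE; rewrite /arcB /vert; have -> : height x 0 = 0; last by rewrite sqrtr0 mulr0.
case: xE => ->; first exact: circ_height kg (lo_circ R kg).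
exact: circ_height (next_le g k) (hi_circ R kg).
Qed.

Lemma arcC_point l s p : (l <= g)%N -> circ l (cX p) (cY p) = 0 -> 0 <= sg s * cY p ->
  (cen l - rad l <= cX p /\ cX p <= cen l + rad l) /\ p = arcC l s (cX p).
Proof.
move=> lg c0 Y0; have r0 := rad_gt0 R g l.
have [||b1 b2] := @sqr_le_itv R (cX p - cen l) (rad l); [lra| |].
  by move: c0; rewrite /circ; have := sqr_ge0 (cY p); lra.
have x1 : cen l - rad l <= cX p by lra.
have x2 : cX p <= cen l + rad l by lra.
split=> //; have [px py pz] := arcC_coord s lg x1 x2.
have pZ := circ_Z0 E lg c0.
apply: (coord_inj E); [by rewrite px| |by rewrite pz pZ]; rewrite py.
have -> : rad l ^+ 2 - (cX p - cen l) ^+ 2 = (sg s * cY p) ^+ 2.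
  by rewrite sg_sqr; move: c0; rewrite /circ; lra.
by rewrite sqrtr_sqr ger0_norm // sgK.
Qed.

Lemma arcB_point t p : cY p = 0 -> 0 <= sg t * cZ p ->
  (lo (sidx p) <= cX p /\ cX p <= hi (sidx p)) /\ p = arcB t (cX p).
Proof.
move=> Y0 Z0; have h0 : 0 <= height (cX p) 0 by have := height_coord E p; rewrite Y0.
have [l1 l2] := height_between_itv h0; rewrite -/(sidx p) in l1 l2; split=> //.
have [px py pz] := arcB_coord t (gap_le g (cX p)) l1 l2.
apply: (coord_inj E); rewrite ?px ?py ?pz //.
have -> : height (cX p) 0 = (sg t * cZ p) ^+ 2 by rewrite sg_sqr (cZE E) Y0.
by rewrite sqrtr_sqr ger0_norm // sgK.
Qed.

Lemma jump_potential s t s' t' n (h h' : T -> bool) : potential (face s t) n h ->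
  potential (face s' t') n h' ->
  potential (face s t `&` face s' t') nul (fun p => h p (+) h' p).
Proof.
move=> hp hp'; have H1 := potential_sub (@subIsetl _ (face s t) (face s' t')) hp.
have H2 := potential_sub (@subIsetr _ (face s t) (face s' t')) hp'.
by apply: potential_eq (potentialD H1 H2) => // p q _ _; rewrite /addcoc addbb.
Qed.

Section Jumps.
Variables (n : T -> T -> bool) (h : bool -> bool -> T -> bool).
Hypothesis hP : forall s t, potential (face s t) n (h s t).

Lemma jumpC l s x y : (l <= g)%N -> cen l - rad l <= x -> x <= cen l + rad l ->
  cen l - rad l <= y -> y <= cen l + rad l ->
  h s false (arcC l s x) (+) h s true (arcC l s x) = h s false (arcC l s y) (+) h s true (arcC l s y).
Proof.
move=> lg x1 x2 y1 y2.
have jp := jump_potential (@hP s false) (@hP s true).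
apply: (const_path jp (@arcC_cont l s lg)) => // z [z1 z2].
have [_ zy zz] := arcC_coord s lg z1 z2.
by split; rewrite /face /= zy zz sgK mulr0 sqrtr_ge0.
Qed.

Lemma jumpB k t x y : (k <= g)%N -> lo k <= x -> x <= hi k -> lo k <= y -> y <= hi k ->
  h false t (arcB t x) (+) h true t (arcB t x) = h false t (arcB t y) (+) h true t (arcB t y).
Proof.
move=> kg x1 x2 y1 y2.
have jp := jump_potential (@hP false t) (@hP true t).
apply: (const_path jp (@arcB_cont k t kg)) => // z [z1 z2].
have [_ zy zz] := arcB_coord t kg z1 z2.
by split; rewrite /face /= zy zz sgK mulr0 sqrtr_ge0.
Qed.

(** The sum of all four face potentials at p. Grouped one way it consists of two jumps across a
    circle, grouped the other way of two jumps across a slice, so it is invariant along both kinds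
    of arcs. *)
Definition corner p := (h false false p (+) h false true p) (+) (h true false p (+) h true true p).

Lemma cornerE p : corner p = (h false false p (+) h true false p) (+) (h false true p (+) h true true p).
Proof. exact: addbACA. Qed.

Lemma cornerC l : (l <= g)%N -> corner (vert (cen l - rad l)) = corner (vert (cen l + rad l)).
Proof.
move=> lg; have r0 := rad_gt0 R g l; set a := cen l - rad l; set b := cen l + rad l.
have ab : a <= b by rewrite /a /b; lra.
have H s : h s false (vert a) (+) h s true (vert a) = h s false (vert b) (+) h s true (vert b).
  have := @jumpC l s a b lg (lexx _) ab ab (lexx _).
  by rewrite (@arcC_end l s a (or_introl erefl)) (@arcC_end l s b (or_intror erefl)).
by rewrite /corner !H.
Qed.

Lemma cornerB k : (k <= g)%N -> corner (vert (lo k)) = corner (vert (hi k)).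
Proof.
move=> kg; have l2 : lo k <= hi k by have := lo_hi R kg; lra.
have H t : h false t (vert (lo k)) (+) h true t (vert (lo k)) =
    h false t (vert (hi k)) (+) h true t (vert (hi k)).
  have := @jumpB k t (lo k) (hi k) kg (lexx _) l2 l2 (lexx _).
  by rewrite (@arcB_end k t (lo k) kg (or_introl erefl)) (@arcB_end k t (hi k) kg (or_intror erefl)).
by rewrite !cornerE !H.
Qed.

(** Moving left along the axis, circles and gaps alternate, and each connects the corners at its two
    ends. *)
Lemma corner_right l : (l <= g)%N -> corner (vert (cen l + rad l)) = corner (vert (lo 0)).
Proof.
have left k : (k < g)%N -> corner (vert (cen k.+1 - rad k.+1)) = corner (vert (lo k)).
  by move=> kg; rewrite (left_vertex R kg) cornerB // ltnW.
elim: l => [_|l IH lg]; first by rewrite -cornerC // (left_vertex R (leq0n g)).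
rewrite -cornerC // left //; case: l IH lg => [//|l IH lg].
by rewrite -IH ?(ltnW lg) // (right_vertex R (ltnW lg)).
Qed.
End Jumps.

(* The signs of Y and Z cut the surface into four closed faces without cohomology.
   The potentials on two adjacent faces differ by a constant on each common arc. At a
   vertex the two jumps of the circle have the same sum as the two jumps of the slice,
   so this sum is the same for all circles and slices, and it becomes zero once one of
   the four potentials is adjusted. *)
Theorem genus_cocycle n : cocycle setT n -> exists u v, coboundary setT (addcoc n (Ncoc u v)).
Proof.
move=> cn.
have hh (st : bool * bool) : exists h, potential (face st.1 st.2) n h.
  by have [h hp] := @face_coboundary _ _ _ _ _ E st.1 st.2 n cn; exists h.
have [h0 h0P] := choice hh.
(* The common value of all corners. Adding it to the single potential of the face with both signs
   negative makes every corner vanish. *)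
pose D := corner (fun s t => h0 (s, t)) (vert (lo 0)).
pose h s t p := h0 (s, t) p (+) (s && t && D).
have hP s t : potential (face s t) n (h s t) by apply: potential_cst; exact: (h0P (s, t)).
have cE p : corner h p = corner (fun s t => h0 (s, t)) p (+) D.
  by rewrite /corner /h /= !addbF !addbA.
have h00 s t : potential (face s t) n (h0 (s, t)) := h0P (s, t).
have crn l : (l <= g)%N -> corner h (vert (cen l + rad l)) = false.
  by move=> lg; rewrite cE (corner_right h00 lg) addbb.
have crl k : (k <= g)%N -> corner h (vert (lo k)) = false.
  case: k => [|k] kg; first by rewrite cE addbb.
  by rewrite -(crn k.+1 kg) (right_vertex R kg).
pose u l := h false false (vert (cen l + rad l)) (+) h false true (vert (cen l + rad l)).
pose v k := h false false (vert (lo k)) (+) h true false (vert (lo k)).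
have uP s p : cZ p = 0 -> 0 <= sg s * cY p -> h s false p (+) h s true p = u (cidx p).
  move=> Z0 Y0; have [l lg c0] := Z0_circ E Z0.
  rewrite /cidx (clos_circ lg c0); have [[x1 x2] ->] := arcC_point lg c0 Y0.
  have r0 := rad_gt0 R g l.
  have := @jumpC n h hP l s (cX p) (cen l + rad l) lg x1 x2.
  rewrite (@arcC_end l s _ (or_intror erefl)) => -> //; last by lra.
  rewrite /u.
  case: s {Y0} => //; have := crn l lg; rewrite /corner.
  by case: (h false _ _); case: (h false _ _); case: (h true _ _); case: (h true _ _).
have vP t p : cY p = 0 -> 0 <= sg t * cZ p -> h false t p (+) h true t p = v (sidx p).
  move=> Y0 Z0; have [[x1 x2] pE] := arcB_point Y0 Z0.
  have kg : (sidx p <= g)%N := gap_le g (cX p).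
  have l2 : lo (sidx p) <= hi (sidx p) by have := lo_hi R kg; lra.
  have := @jumpB n h hP _ t (cX p) (lo (sidx p)) kg x1 x2 (lexx _) l2.
  rewrite -pE (@arcB_end _ t _ kg (or_introl erefl)) => ->; rewrite /v.
  case: t {Z0 pE} => //; have := crl _ kg; rewrite /corner.
  by case: (h false _ _); case: (h false _ _); case: (h true _ _); case: (h true _ _).
(* At each point the potential of the face given by the two signs is used, with zero counted as
   positive; passing to another face costs exactly the jumps recorded in [Ncoc]. *)
exists u, v, (fun p => h (cY p < 0)%R (cZ p < 0)%R p) => x _.
have [K [k [xK KP]]] := cn x Logic.I.
have [V xV VP] := Ncoc_local E u v x.
have near s t : exists2 W, nbhs x W & forall p, W p -> face s t p ->
    face s t x /\ n x p = h s t x (+) h s t p.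
  have [Fx|Fx] := pselect (face s t x).
    have [W Wx WP] := hP s t x Fx; exists W => // p Wp Fp; split=> //.
    by apply: WP => //; exact: nbhs_singleton.
  have [Yx|Yx] := ltP (sg s * cY x) 0.
    exists [set p | sg s * cY p < 0] => [|p /= Yp [] ]; last by rewrite leNgt Yp.
    apply: cts_lt => //; last exact: cts_cst.
    by apply: cts_mul; [exact: cts_cst|exact: (@cY_cts _ _ _ _ _ E x)].
  have Zx : sg t * cZ x < 0 by rewrite ltNge; apply/negP => Zx; apply: Fx.
  exists [set p | sg t * cZ p < 0] => [|p /= Yp [] ]; last by rewrite [0 <= sg t * _]leNgt Yp.
  apply: cts_lt => //; last exact: cts_cst.
  by apply: cts_mul; [exact: cts_cst|exact: (@cZ_cts _ _ _ _ _ E x)].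
have [W0 xW0 WP0] := near false false; have [W1 xW1 WP1] := near false true.
have [W2 xW2 WP2] := near true false; have [W3 xW3 WP3] := near true true.
pose W := (W0 `&` W1) `&` (W2 `&` W3).
have xW : nbhs x W by apply: filterI; apply: filterI.
have WP s t p : W p -> face s t p -> face s t x /\ n x p = h s t x (+) h s t p.
  move=> [[? ?] [? ?]]; case: s; case: t; first exact: WP3.
  - exact: WP2.
  - exact: WP1.
  - exact: WP0.
exists (W `&` (K `&` V)); first by apply: filterI => //; exact: filterI.
move=> p q [Wp [Kp Vp]] [Wq [Kq Vq]] _ _.
have Kx : K x by exact: nbhs_singleton.
have nE : n p q = n x p (+) n x q.
  by rewrite !KP //; case: (k x); case: (k p); case: (k q).
have Fp : face (cY p < 0)%R (cZ p < 0)%R p by split; exact: sg_lt.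
have Fq : face (cY q < 0)%R (cZ q < 0)%R q by split; exact: sg_lt.
have [[sx tx] np] := WP _ _ p Wp Fp; have [[sx' tx'] nq] := WP _ _ q Wq Fq.
rewrite /addcoc nE np nq VP //.
move: (cY p < 0)%R (cY q < 0)%R (cZ p < 0)%R (cZ q < 0)%R sx tx sx' tx' {np nq Fp Fq} => s s' t t' sx tx sx' tx'.
have opp (a : R) : 0 <= sg false * a -> 0 <= sg true * a -> a = 0.
  by rewrite /sg expr0 expr1 mul1r mulN1r; lra.
have Zs : t != t' -> cZ x = 0.
  by case: t tx {WP}; case: t' tx' => // z1 z2 _; exact: opp.
have Ys : s != s' -> cY x = 0.
  by case: s sx {WP}; case: s' sx' => // z1 z2 _; exact: opp.
have A : h s t x (+) h s t' x = (t (+) t') && u (cidx x).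
  case: (eqVneq t t') => [->|tt]; first by rewrite !addbb.
  have := uP s x (Zs tt) sx; case: t tt {tx Zs}; case: t' {tx'} => // _; by rewrite addbC.
have B : h s t' x (+) h s' t' x = (s (+) s') && v (sidx x).
  case: (eqVneq s s') => [->|ss]; first by rewrite !addbb.
  have := vP t' x (Ys ss) tx'; case: s ss {sx Ys A}; case: s' {sx'} => // _; by rewrite addbC.
rewrite -A -B; set a := h s t x; set b := h s t' x; set c := h s' t' x.
by case: a; case: b; case: c; case: (h s t p); case: (h s' t' q).
Qed.

End FirstCohomology.

(** * Orientability *)

Section SelfIntersection.
Variables (R : realType) (g : nat) (T : topologicalType) (e : T -> R * R * R) (j : R * R * R -> T).
Hypothesis E : genus_embedding g e j.
Hypothesis g_gt0 : (0 < g)%N.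
Local Notation P := (R * R)%type.
Local Notation cX := (cX e).
Local Notation cY := (cY e).
Local Notation cZ := (cZ e).
Local Notation cen := (cen R).
Local Notation rad := (rad R g).
Local Notation circ := (circ g).
Local Notation next := (next g).
Local Notation rgap := (rgap g).
Local Notation cidx := (cidx g e).
Local Notation sidx := (sidx g e).
Local Notation Ncoc := (Ncoc g e).
Local Notation gdist := (gdist e).
Local Notation cloop := (cloop g j).
Local Notation sloop := (sloop g j).
Implicit Types (l k : nat) (u v : nat -> bool) (x y : T) (p q : T) (n m : T -> T -> bool).
Let sT := genus_is_surface E.

Lemma dual_disjoint (c : R -> T) n e0 dd : dual_cocycle gdist c n e0 -> loop dd ->
  (forall t : R, ~ range c (dd t)) -> oint n dd false.
Proof.
move=> [_ _ lz _] ld off; apply: (oint_coboundary (A := ~` range c)) => //.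
by exists (fun=> false); apply: locally_zero_potential => x; exact: lz.
Qed.

Lemma axes_swap (U : set T) (f : T -> P) (h : P -> T) (a b : set T) (x : T) : axes_at U f h a b x ->
  exists (f' : T -> P) (h' : P -> T), axes_at U f' h' b a x.
Proof.
move=> [cU Ux fx aP bP]; exists (fun y => ((f y).2, (f y).1)), (fun w : P => h (w.2, w.1)).
have [c1 c2 c3 c4 [c5 c6]] := cU; split=> //; last by rewrite fx.
split=> //.
- by move=> y Uy /=; rewrite -surjective_pairing c2.
- by move=> w /=; rewrite c4 -surjective_pairing.
split=> [y Uy|w]; first by have := c5 y Uy => ?; cts.
apply: (@cts_comp _ _ _ (fun w : P => (w.2, w.1)) h); first by cts.
exact: c6.
Qed.

(** The parity of the number of common points of circle l and slice k, hence the intersection form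
    of the model. *)
Definition meet l k := (k == lgap l) (+) (k == rgap l).

Lemma meetE l k : (l <= g)%N -> (k <= g)%N -> meet l k = (k == l) (+) (next k == l).
Proof.
rewrite /meet /lgap /rgap /next; case: l => [|l] lg kg /=.
  by congr (_ (+) _); case: (ltngtP k g) kg => // ->; rewrite eqxx.
rewrite addbC; congr (_ (+) _); case: ltnP => // gk.
have -> : k = g by apply/eqP; rewrite eqn_leq kg.
by rewrite gtn_eqF.
Qed.

Lemma cs_axes l k p : (l <= g)%N -> (k <= g)%N -> range (cloop l) p -> range (sloop k) p ->
  exists U (f : T -> P) (h : P -> T), axes_at U f h (range (cloop l)) (range (sloop k)) p.
Proof.
move=> lg kg /(range_cloop E p lg) c0 /(range_sloop E p kg)[Y0 sk].
have Z0 := circ_Z0 E lg c0.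
have N1 := cidx_near E Z0; have N2 := sidx_near E Y0.
have [U [f [h [cU Up fp UV UP]]]] := vertex_chart E lg c0 Y0 (filterI N1 N2).
have cl : cidx p = l by rewrite /cidx (clos_circ lg c0).
exists U, f, h; split=> // y Uy; have [y1 y2] := UP y Uy; have [/= cy sy] := UV y Uy.
  apply: (iff_trans (range_cloop E y lg)); rewrite y2; split=> [|Zy]; first exact: (circ_Z0 E lg).
  have [l' l'g c'] := Z0_circ E Zy.
  by move: cy; rewrite {1}/cidx (clos_circ l'g c') cl => <-.
by apply: (iff_trans (range_sloop E y kg)); rewrite y1 sy sk; split=> [[]|].
Qed.

Lemma cs_points l k : (l <= g)%N -> (k <= g)%N -> exists Xs : seq T, [/\ uniq Xs,
  forall x, x \in Xs <-> range (cloop l) x /\ range (sloop k) x, odd (size Xs) = meet l k &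
  (size Xs <= 2)%N].
Proof.
move=> lg kg; have r0 := rad_gt0 R g l.
pose lv := j (cen l - rad l, 0, 0); pose rv := j (cen l + rad l, 0, 0).
have coord (x : R) : x = cen l - rad l \/ x = cen l + rad l ->
    [/\ cX (j (x, 0, 0)) = x, cY (j (x, 0, 0)) = 0 & cZ (j (x, 0, 0)) = 0].
  move=> xE; apply: (jP E); rewrite expr0n (@circ_height R g l) //.
  by case: xE => ->; rewrite /circ; ring.
have [lx ly lz] := coord _ (or_introl erefl); have [rx ry rz] := coord _ (or_intror erefl).
have lr : lv <> rv by move=> H; move: lx; rewrite -/lv H rx; lra.
have lC : range (cloop l) lv by apply/(range_cloop E _ lg); rewrite lx ly /circ; ring.
have rC : range (cloop l) rv by apply/(range_cloop E _ lg); rewrite rx ry /circ; ring.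
have lS : range (sloop k) lv <-> k = lgap l.
  by rewrite (range_sloop E _ kg) /sidx lx (gap_left R lg); split=> [[]|->].
have rS : range (sloop k) rv <-> k = rgap l.
  by rewrite (range_sloop E _ kg) /sidx rx (gap_right R lg); split=> [[]|->].
have only x : range (cloop l) x -> range (sloop k) x -> x = lv \/ x = rv.
  move=> /(range_cloop E _ lg) c0 /(range_sloop E _ kg)[Y0 _].
  have Z0 := circ_Z0 E lg c0.
  have : (cX x - cen l) ^+ 2 == rad l ^+ 2.
    by move: c0; rewrite /circ Y0 expr0n /= => ?; apply/eqP; lra.
  rewrite eqf_sqr => /orP[/eqP H|/eqP H]; [right|left]; apply: (coord_inj E); rewrite ?rx ?ry ?rz ?lx ?ly ?lz //; lra.
have dis : lgap l != rgap l.
  by rewrite /lgap /rgap; case: (l) => [|i] /=; [rewrite ltn_eqF|rewrite ltn_eqF].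
exists ((if k == lgap l then [:: lv] else [::]) ++ (if k == rgap l then [:: rv] else [::])).
rewrite /meet; split.
- by case: eqP => kl; case: eqP => kr //=; move: dis; rewrite -kl -kr eqxx.
- move=> x; rewrite mem_cat; split.
    move=> /orP[|]; [case: eqP => // kl|case: eqP => // kr]; rewrite inE => /eqP->; split=> //.
      by apply/lS.
    by apply/rS.
  move=> [xC xS]; have [xl|xr] := only x xC xS.
    have -> : (k == lgap l) by apply/eqP/lS; rewrite -xl.
    by rewrite inE xl eqxx.
  have -> : (k == rgap l) by apply/eqP/rS; rewrite -xr.
  by apply/orP; right; rewrite inE xr eqxx.
- by case: (k == lgap l); case: (k == rgap l).
- by case: (k == lgap l); case: (k == rgap l).
Qed.

Lemma dual_cs l k n e0 : (l <= g)%N -> (k <= g)%N -> dual_cocycle gdist (cloop l) n e0 ->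
  oint n (sloop k) (meet l k).
Proof.
move=> lg kg dn; have [Xs [uX XP <- _]] := cs_points lg kg.
apply: (cross_parity sT (cloop_simple E lg) (sloop_simple E kg) dn uX XP).
by move=> x /XP[xC xS]; exact: cs_axes.
Qed.

Lemma dual_sc l k n e0 : (l <= g)%N -> (k <= g)%N -> dual_cocycle gdist (sloop k) n e0 ->
  oint n (cloop l) (meet l k).
Proof.
move=> lg kg dn; have [Xs [uX XP <- _]] := cs_points lg kg.
apply: (cross_parity sT (sloop_simple E kg) (cloop_simple E lg) dn uX).
  by move=> x; rewrite XP; split=> -[].
move=> x /XP[xC xS]; have [U [f [h ax]]] := cs_axes lg kg xC xS.
by have [f' [h' ax']] := axes_swap ax; exists U, f', h'.
Qed.

Lemma cloop_off l l' t : (l <= g)%N -> (l' <= g)%N -> l != l' -> ~ range (cloop l) (cloop l' t).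
Proof.
move=> lg lg' ll /(range_cloop E _ lg) c0.
have c1 : circ l' (cX (cloop l' t)) (cY (cloop l' t)) = 0 by apply/(range_cloop E _ lg'); exists t.
by move: ll; rewrite -(clos_circ lg c0) (clos_circ lg' c1) eqxx.
Qed.

Lemma sloop_off k k' t : (k <= g)%N -> (k' <= g)%N -> k != k' -> ~ range (sloop k) (sloop k' t).
Proof.
move=> kg kg' kk /(range_sloop E _ kg)[_ s0].
have [_ s1] : cY (sloop k' t) = 0 /\ sidx (sloop k' t) = k' by apply/(range_sloop E _ kg'); exists t.
by move: kk; rewrite -s0 s1 eqxx.
Qed.

Lemma sum_eq (a : nat) v : (a <= g)%N -> \big[addb/false]_(k < g.+1) ((val k == a) && v k) = v a.
Proof.
move=> ag; have ag' : (a < g.+1)%N by [].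
rewrite (bigD1 (Ordinal ag')) //= eqxx /= big1 ?addbF // => k ka.
by rewrite (_ : (val k == a) = false) //; apply: contraNF ka => /eqP ka; apply/eqP/val_inj.
Qed.

Lemma lgap_le l : (l <= g)%N -> (lgap l <= g)%N.
Proof. by rewrite /lgap; lia. Qed.
Lemma rgap_le l : (l <= g)%N -> (rgap l <= g)%N.
Proof. by rewrite /rgap; case: l. Qed.

Lemma sum_meet_v l v : (l <= g)%N ->
  v (lgap l) (+) v (rgap l) = \big[addb/false]_(k < g.+1) (meet l k && v k).
Proof.
move=> lg; rewrite -(sum_eq v (lgap_le lg)) -(sum_eq v (rgap_le lg)) -big_split /=.
by apply: eq_bigr => k _; rewrite /meet andb_addl.
Qed.

Lemma sum_meet_u k u : (k <= g)%N ->
  u k (+) u (next k) = \big[addb/false]_(l < g.+1) (meet l k && u l).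
Proof.
move=> kg; rewrite -(sum_eq u kg) -(sum_eq u (next_le g k)) -big_split /=.
apply: eq_bigr => l _; rewrite meetE // ?andb_addl; last by rewrite -ltnS.
by rewrite eq_sym [next k == _]eq_sym.
Qed.

(** Together the circles bound one sheet, so their integrals add up to zero; combinatorially, each
    slice meets the circles in an even number of points. *)
Lemma sum_cloop v : \big[addb/false]_(l < g.+1) (v (lgap l) (+) v (rgap l)) = false.
Proof.
rewrite (eq_bigr (fun l : 'I_g.+1 => \big[addb/false]_(k < g.+1) (meet l k && v k))).
  rewrite exchange_big /= big1 // => k _.
  have H : \big[addb/false]_(l < g.+1) (meet l k && true) = false.
    by rewrite -(@sum_meet_u k (fun=> true)) // -ltnS.
  case: (v k); first exact: H.
  by rewrite big1 // => i _; rewrite andbF.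
by move=> l _; rewrite sum_meet_v // -ltnS.
Qed.

Lemma sum_sloop u : \big[addb/false]_(k < g.+1) (u (val k) (+) u (next k)) = false.
Proof.
rewrite (eq_bigr (fun k : 'I_g.+1 => \big[addb/false]_(l < g.+1) (meet l k && u l))).
  rewrite exchange_big /= big1 // => l _.
  have H : \big[addb/false]_(k < g.+1) (meet l k && true) = false.
    by rewrite -(@sum_meet_v l (fun=> true)) // -ltnS.
  case: (u l); first exact: H.
  by rewrite big1 // => i _; rewrite andbF.
by move=> k _; apply: sum_meet_u; rewrite -ltnS.
Qed.

Lemma class_oint n u v (c : R -> T) w : coboundary setT (addcoc n (Ncoc u v)) -> loop c ->
  oint (Ncoc u v) c w -> oint n c w.
Proof.
move=> cb lc; apply: (oint_cohomologous (A := setT)) => //.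
exact: coboundary_addC.
Qed.

(** The dual vanishes along all other circles, since they are disjoint from this one, and the
    relation among the circles then forces the remaining integral to vanish. *)
Lemma dual_cloop_self l n e0 : (l <= g)%N -> dual_cocycle gdist (cloop l) n e0 ->
  oint n (cloop l) false.
Proof.
move=> lg dn; have [cn _ _ _] := dn.
have [u [v cb]] := genus_cocycle E cn.
have val k (kg : (k <= g)%N) : oint n (cloop k) (v (lgap k) (+) v (rgap k)).
  by apply: (class_oint cb); [exact: (cloop_loop E kg)|exact: oint_cloop].
have zero k (kg : (k <= g)%N) : l != k -> v (lgap k) (+) v (rgap k) = false.
  move=> lk; apply: (oint_uniq (val k kg)); apply: (dual_disjoint dn); first exact: (cloop_loop E kg).
  by move=> t; exact: cloop_off.
have := sum_cloop v; have lg' : (l < g.+1)%N by [].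
rewrite (bigD1 (Ordinal lg')) //= big1 ?addbF => [<-|k kl]; first exact: val.
apply: zero; first by rewrite -ltnS.
by apply: contra kl => /eqP H; apply/eqP/val_inj.
Qed.

Lemma dual_sloop_self k n e0 : (k <= g)%N -> dual_cocycle gdist (sloop k) n e0 ->
  oint n (sloop k) false.
Proof.
move=> kg dn; have [cn _ _ _] := dn.
have [u [v cb]] := genus_cocycle E cn.
have val l (lg : (l <= g)%N) : oint n (sloop l) (u l (+) u (next l)).
  by apply: (class_oint cb); [exact: (sloop_loop E lg)|exact: oint_sloop].
have zero l (lg : (l <= g)%N) : k != l -> u l (+) u (next l) = false.
  move=> lk; apply: (oint_uniq (val l lg)); apply: (dual_disjoint dn); first exact: (sloop_loop E lg).
  by move=> t; exact: sloop_off.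
have := sum_sloop u; have kg' : (k < g.+1)%N by [].
rewrite (bigD1 (Ordinal kg')) //= big1 ?addbF => [<-|l kl]; first exact: val.
apply: zero; first by rewrite -ltnS.
by apply: contra kl => /eqP H; apply/eqP/val_inj.
Qed.

Lemma Ncoc_zero u v : (forall l, (l <= g)%N -> v (lgap l) = v (rgap l)) ->
  (forall k, (k <= g)%N -> u k = u (next k)) ->
  forall l, (l <= g)%N -> u l = u 0%N /\ v l = v 0%N.
Proof.
move=> vP uP; elim=> [//|l IH lg]; have [ul vl] := IH (ltnW lg); split.
  by rewrite -ul (uP l (ltnW lg)) /next lg.
by rewrite -vl -(vP l.+1 lg).
Qed.

Lemma Ncoc_const u v a b : (forall l, (l <= g)%N -> u l = a /\ v l = b) ->
  coboundary setT (Ncoc u v).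
Proof.
move=> uv; exists (fun p => (cZ p < 0)%R && a (+) (cY p < 0)%R && b) => x _.
exists setT; first exact: filterT.
move=> p q _ _ _ _; rewrite /Ncoc.
have [-> _] := uv _ (clos_le g (cX p) (cY p)); have [_ ->] := uv _ (gap_le g (cX p)).
by rewrite !andb_addl addbACA.
Qed.

Lemma NcocD u v u' v' p q : addcoc (Ncoc u v) (Ncoc u' v') p q =
  Ncoc (fun l => u l (+) u' l) (fun k => v k (+) v' k) p q.
Proof. by rewrite /addcoc /Ncoc !andb_addr addbACA. Qed.

(** Every class is some [Ncoc]; if its integrals along circles and slices vanish, then u and v are
    constant on the cyclic arrangement, and constant data give a coboundary. *)
Lemma detect n m : cocycle setT n -> cocycle setT m ->
  (forall l, (l <= g)%N -> exists2 w, oint n (cloop l) w & oint m (cloop l) w) ->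
  (forall k, (k <= g)%N -> exists2 w, oint n (sloop k) w & oint m (sloop k) w) ->
  coboundary setT (addcoc n m).
Proof.
move=> cn cm hC hS; have cnm := cocycleD cn cm.
have [u [v cb]] := genus_cocycle E cnm.
have vP l : (l <= g)%N -> v (lgap l) = v (rgap l).
  move=> lg; have [w nw mw] := hC l lg; have := ointD nw mw; rewrite addbb => o1.
  have o2 := class_oint cb (cloop_loop E lg) (oint_cloop E u v lg).
  by have := oint_uniq o1 o2; case: (v _); case: (v _).
have uP k : (k <= g)%N -> u k = u (next k).
  move=> lg; have [w nw mw] := hS k lg; have := ointD nw mw; rewrite addbb => o1.
  have o2 := class_oint cb (sloop_loop E lg) (oint_sloop E u v lg).
  by have := oint_uniq o1 o2; case: (u _); case: (u _).
have cN := Ncoc_const (Ncoc_zero vP uP).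
by apply: (coboundary_cancel cN); exact: coboundary_addC.
Qed.

Lemma oint_big (I : Type) (s : seq I) (N : I -> T -> T -> bool) (b : I -> bool) (c : R -> T) (w : I -> bool) :
  (forall i, oint (N i) c (w i)) -> oint (fun p q => \big[addb/false]_(i <- s) (b i && N i p q)) c
    (\big[addb/false]_(i <- s) (b i && w i)).
Proof.
move=> H; elim: s => [|i s IH].
  rewrite big_nil; exists (fun=> false) => // x _; exists setT; first exact: filterT.
  by move=> p q _ _ _ _; rewrite /pull big_nil.
rewrite big_cons.
have Hi : oint (fun p q => b i && N i p q) c (b i && w i).
  case: (b i); first exact: H.
  by exists (fun=> false) => // x _; exists setT; first exact: filterT.
have := ointD Hi IH; congr oint; apply/funext => p; apply/funext => q.
by rewrite /addcoc big_cons.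
Qed.

(** The dual of d is expanded as a class [Ncoc u v]. By [dual_symmetry], integrating the basis class
    of a circle or slice along d is the same as integrating the dual of d along that circle or
    slice, which is read off from u and v. The resulting quadratic expression is alternating. *)
Theorem dual_self_even (d : R -> T) n e0 : simple d -> dual_cocycle gdist d n e0 -> oint n d false.
Proof.
move=> sd dn; have [cn _ _ _] := dn; have ld : loop d := proj1 sd.
have [u [v cb]] := genus_cocycle E cn.
pose I := option ('I_g.+1 + 'I_g.+1)%type.
have ordle (i : 'I_g.+1) : (i <= g)%N by rewrite -ltnS.
pose dd (i : I) := match i with None => d | Some (inl l) => cloop l | Some (inr k) => sloop k end.
have sdd i : simple (dd i).
  by case: i => [[l|k]|] //=; [exact: (cloop_simple E (ordle l))|exact: (sloop_simple E (ordle k))].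
have dex i : exists ne : (T -> T -> bool) * R, dual_cocycle gdist (dd i) ne.1 ne.2 /\ (i = None -> ne.1 = n).
  case: i => [i|]; last by exists (n, e0).
  by have [n' [e' de]] := dual_exists sT (sdd (Some i)); exists (n', e').
have [ne neP] := choice dex.
have nN : (ne None).1 = n by exact: (proj2 (neP None)).
have dual i : dual_cocycle gdist (dd i) (ne i).1 (ne i).2 by exact: (proj1 (neP i)).
pose ind (l : nat) := fun k : nat => k == l.
pose no := fun _ : nat => false.
have kappa l : (l <= g)%N -> oint (Ncoc (ind l) no) d (v (lgap l) (+) v (rgap l)).
  move=> lg.
  have [z cz zP] := dual_symmetry sT (cloop_loop E lg) sdd dual.
  have nl : oint n (cloop l) (v (lgap l) (+) v (rgap l)).
    by apply: (class_oint cb); [exact: (cloop_loop E lg)|exact: oint_cloop].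
  have zd := zP None _; rewrite /= nN in zd; have {}zd := zd _ nl.
  apply: (oint_cohomologous (A := setT) ld _ _ zd) => //.
  apply: detect cz (Ncoc_cocycle E _ _) _ _.
    move=> l' lg'; exists false; last by have := oint_cloop E (ind l) no lg'.
    have lo' : (l' < g.+1)%N by [].
    apply: (zP (Some (inl (Ordinal lo')))).
    have dl := dual (Some (inl (Ordinal lo'))); rewrite /= in dl.
    have [ll|ll] := eqVneq l' l; first by rewrite -ll; exact: dual_cloop_self dl.
    by apply: (dual_disjoint dl (cloop_loop E lg)) => t; exact: cloop_off.
  move=> k kg; exists (meet l k).
    have ko : (k < g.+1)%N by [].
    apply: (zP (Some (inr (Ordinal ko)))).
    have dk := dual (Some (inr (Ordinal ko))); rewrite /= in dk.
    exact: dual_sc dk.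
  by rewrite meetE //; exact: oint_sloop.
have sigma k : (k <= g)%N -> oint (Ncoc no (ind k)) d (u k (+) u (next k)).
  move=> kg.
  have [z cz zP] := dual_symmetry sT (sloop_loop E kg) sdd dual.
  have nl : oint n (sloop k) (u k (+) u (next k)).
    by apply: (class_oint cb); [exact: (sloop_loop E kg)|exact: oint_sloop].
  have zd := zP None _; rewrite /= nN in zd; have {}zd := zd _ nl.
  apply: (oint_cohomologous (A := setT) ld _ _ zd) => //.
  apply: detect cz (Ncoc_cocycle E _ _) _ _.
    move=> l lg; exists (meet l k).
      have lo' : (l < g.+1)%N by [].
      apply: (zP (Some (inl (Ordinal lo')))).
      have dl := dual (Some (inl (Ordinal lo'))); rewrite /= in dl.
      exact: dual_cs dl.
    by rewrite /meet ![k == _]eq_sym; exact: oint_cloop.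
  move=> k' kg'; exists false; last by have := oint_sloop E no (ind k) kg'.
  have ko : (k' < g.+1)%N by [].
  apply: (zP (Some (inr (Ordinal ko)))).
  have dk := dual (Some (inr (Ordinal ko))); rewrite /= in dk.
  have [kk|kk] := eqVneq k' k; first by rewrite -kk; exact: dual_sloop_self dk.
  by apply: (dual_disjoint dk (sloop_loop E kg)) => t; exact: sloop_off.
apply: (class_oint cb ld).
have O1 := oint_big (index_enum 'I_g.+1) (fun l : 'I_g.+1 => u (val l)) (fun l : 'I_g.+1 => kappa l (ordle l)).
have O2 := oint_big (index_enum 'I_g.+1) (fun k : 'I_g.+1 => v (val k)) (fun k : 'I_g.+1 => sigma k (ordle k)).
have := ointD O1 O2; congr oint.
  apply/funext => p; apply/funext => q; rewrite /addcoc /Ncoc /no /ind; congr (_ (+) _).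
    rewrite (eq_bigr (fun l : 'I_g.+1 => (val l == cidx p) && (((cZ p < 0) (+) (cZ q < 0)) && u l))).
      by rewrite (@sum_eq _ (fun l => ((cZ p < 0) (+) (cZ q < 0)) && u l) (clos_le g _ _)).
    by move=> l _; rewrite andbF addbF eq_sym; case: (u l); case: (_ == _); rewrite ?andbF ?andbT.
  rewrite (eq_bigr (fun l : 'I_g.+1 => (val l == sidx p) && (((cY p < 0) (+) (cY q < 0)) && v l))).
    by rewrite (@sum_eq _ (fun l => ((cY p < 0) (+) (cY q < 0)) && v l) (gap_le g _)).
  by move=> l _; rewrite andbF addFb eq_sym; case: (v l); case: (_ == _); rewrite ?andbF ?andbT.
(* Both halves are the same double sum of [meet l k], u l and v k, once summed over circles and once
   over slices, and cancel modulo 2. *)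
rewrite (eq_bigr (fun l : 'I_g.+1 => \big[addb/false]_(k < g.+1) (meet l k && (u l && v k)))); last first.
  move=> l _; rewrite sum_meet_v // big_distrr /=; apply: eq_bigr => k _.
  by rewrite andbCA.
rewrite exchange_big /= -big_split big1 // => k _.
rewrite sum_meet_u // big_distrr /= -big_split big1 // => l _ /=.
by case: (meet l k); case: (u l); case: (v k).
Qed.

End SelfIntersection.

(** * The bound on the Euler characteristic *)

Section EulerBound.
Variables (R : realType) (g : nat) (T : topologicalType) (e : T -> R * R * R) (j : R * R * R -> T).
Hypothesis E : genus_embedding g e j.
Hypothesis g_gt0 : (0 < g)%N.
Variables (p0 : T) (ps : seq T).
Hypothesis ups : uniq (p0 :: ps).
Local Notation Ps := (p0 :: ps).
Local Notation n' := (size ps).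
Local Notation Ncoc := (Ncoc g e).
Let sT := genus_is_surface E.
Implicit Types (n m : T -> T -> bool) (p q x y : T).

(** Adding a constant to u or v changes [Ncoc] by a coboundary only, so the value at index 0 is
    normalised to false and g free bits remain. *)
Definition ext (u : {ffun 'I_g -> bool}) (l : nat) := [exists i : 'I_g, (l == i.+1) && u i].

Lemma ext0 u : ext u 0 = false. Proof. by apply/negbTE/existsP => -[i]. Qed.
Lemma extS u (i : 'I_g) : ext u i.+1 = u i.
Proof.
apply/existsP/idP => [[k /andP[/eqP[ik]] ]|ui]; last by exists i; rewrite eqxx.
by rewrite (_ : k = i) //; apply/val_inj.
Qed.

Lemma puncture_kernels : exists xi : 'I_n' -> T -> T -> bool,
  forall i : 'I_n', kernel (nth p0 ps i) p0 setT (xi i).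
Proof.
have ex (i : 'I_n') : exists n, kernel (nth p0 ps i) p0 setT n.
  apply: (kernel_any sT) => H; move: ups; rewrite /= => /andP[/negP p0ps _]; apply: p0ps.
  by rewrite -H mem_nth.
by have [xi xiP] := choice ex; exists xi.
Qed.

Lemma cocycle_big (I : Type) (s : seq I) (A : set T) (N : I -> T -> T -> bool) (b : I -> bool) :
  (forall i, cocycle A (N i)) -> cocycle A (fun p q => \big[addb/false]_(i <- s) (b i && N i p q)).
Proof.
move=> H; elim: s => [|i s IH].
  by move=> x _; exists setT, (fun=> false); split=> [|p q _ _ _ _]; [exact: filterT|rewrite big_nil].
apply: (cocycle_eq (n := addcoc (fun p q => b i && N i p q) (fun p q => \big[addb/false]_(i <- s) (b i && N i p q)))).
  by move=> p q _ _; rewrite /addcoc big_cons.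
apply: cocycleD IH; case: (b i); first exact: H.
by move=> x _; exists setT, (fun=> false); split=> [|p q _ _ _ _]; [exact: filterT|].
Qed.

Lemma triv_big (I : Type) (s : seq I) z (N : I -> T -> T -> bool) (b : I -> bool) :
  (forall i, triv z (fun p q => b i && N i p q)) ->
  triv z (fun p q => \big[addb/false]_(i <- s) (b i && N i p q)).
Proof.
move=> H; elim: s => [|i s IH].
  exists setT; first exact: filterT.
  by exists (fun=> false) => x _; exists setT; [exact: filterT|move=> p q _ _ _ _; rewrite big_nil].
have [V Vz [k kp]] := trivD (H i) IH; exists V => //; exists k.
by apply: potential_eq kp => // p q _ _; rewrite /addcoc big_cons.
Qed.

(** Two groups of g bits describe the classes of the closed surface, and one bit per further
    puncture says whether the kernel joining it to [p0] is added. *)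
Theorem independent_family : exists (W : finType) (nw : W -> T -> T -> bool),
  [/\ #|W| = (2 ^ (2 * g + n'))%N, forall w, cocycle (off Ps) (nw w) &
    forall w w', w != w' -> ~ coboundary (off Ps) (addcoc (nw w) (nw w'))].
Proof.
have [xi xiP] := puncture_kernels.
pose W := ({ffun 'I_g -> bool} * {ffun 'I_g -> bool} * {ffun 'I_n' -> bool})%type.
pose nw (w : W) := addcoc (Ncoc (ext w.1.1) (ext w.1.2))
  (fun p q => \big[addb/false]_(i : 'I_n') (w.2 i && xi i p q)).
have pin (i : 'I_n') : nth p0 ps i \in ps by rewrite mem_nth.
have xc i : cocycle (off Ps) (xi i).
  have [c _ _ _] := xiP i; apply: cocycle_sub c; apply: off_sub => x; rewrite !inE => /orP[/eqP->|->//].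
  by rewrite pin orbT.
exists W, nw; split.
- by rewrite !card_prod !card_ffun card_bool !card_ord -!expnD; congr (2 ^ _)%N; lia.
- move=> w; apply: cocycleD; first by apply: (cocycle_sub (A := setT)) => //; exact: Ncoc_cocycle E _ _.
  exact: cocycle_big.
move=> w w' ww cb; pose u l := ext w.1.1 l (+) ext w'.1.1 l; pose v l := ext w.1.2 l (+) ext w'.1.2 l.
pose b i := w.2 i (+) w'.2 i.
have {cb} cb : coboundary (off Ps) (addcoc (Ncoc u v) (fun p q => \big[addb/false]_(i : 'I_n') (b i && xi i p q))).
  apply: coboundary_eq cb => p q _ _; rewrite /nw /addcoc addbACA.
  congr (_ (+) _); first exact: (@NcocD R g T e (ext w.1.1) (ext w.1.2) (ext w'.1.1) (ext w'.1.2) p q).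
  by rewrite -big_split /=; apply: eq_bigr => i _; rewrite /b andb_addl.
(* Among all summands only the kernel [xi i] has a residue at puncture i, so a coboundary cannot
   contain it. *)
have b0 i : b i = false.
  apply/negbTE/negP => bi; pose z := nth p0 ps i.
  have zP : z \in Ps by rewrite inE pin orbT.
  have tall : triv z (addcoc (Ncoc u v) (fun p q => \big[addb/false]_(i : 'I_n') (b i && xi i p q))).
    have Vz := off_nbhs sT Ps z; exists [set x | x \in Ps -> x = z] => //.
    apply: coboundary_sub cb => x [/= xz nz]; rewrite /off /=; apply/negP => /xz; exact: nz.
  have tN : triv z (Ncoc u v) by apply: (cocycle_triv (A := setT)); [|exact: Ncoc_cocycle E _ _|exact: filterT].
  pose rest p q := \big[addb/false]_(k : 'I_n') ((b k && (k != i)) && xi k p q).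
  have tR : triv z rest.
    apply: triv_big => k; have [->|ki] := eqVneq k i.
      rewrite andbF; exists setT; first exact: filterT.
      by exists (fun=> false) => x _; exists setT; [exact: filterT|].
    case: (b k) => /=; last first.
      by exists setT; [exact: filterT|exists (fun=> false) => x _; exists setT; [exact: filterT|]].
    have [c _ _ _] := xiP k; apply: (cocycle_triv_off sT c).
    rewrite !inE negb_or /z nth_uniq //; last by move: ups => /andP[].
    have -> /= : (nat_of_ord i != nat_of_ord k) by rewrite eq_sym; exact: ki.
    by apply: contraTneq ups => /= zp; rewrite -zp mem_nth.
  have [_ nt _ _] := xiP i; apply: nt.
  have := trivD (trivD tall tN) tR; rewrite -/z => -[V Vz [k kp]]; exists V => //; exists k.
  apply: potential_eq kp => // p q _ _; rewrite /addcoc /rest.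
  rewrite (bigD1 i) //= bi /= [X in _ (+) X](bigD1 i) //= bi eqxx /=.
  rewrite [X in _ (+) X](eq_bigr (fun k => b k && xi k p q)); last by move=> l li; rewrite li andbT.
  by case: (Ncoc u v p q); case: (xi i p q); case: (\big[addb/false]_(_ < _ | _) _).
have cN : coboundary setT (Ncoc u v).
  apply: (coboundary_off sT (Ncoc_cocycle E u v) (F := Ps)).
  apply: coboundary_eq cb => p q _ _; rewrite /addcoc big1 ?addbF // => i _.
  by rewrite b0.
have vP l : (l <= g)%N -> v (lgap l) = v (rgap g l).
  move=> lg; have o1 := oint_coboundary (proj1 (cloop_simple E lg)) (fun _ => Logic.I) cN.
  by have := oint_uniq o1 (oint_cloop E u v lg); case: (v _); case: (v _).
have uP k : (k <= g)%N -> u k = u (next g k).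
  move=> lg; have o1 := oint_coboundary (proj1 (sloop_simple E lg)) (fun _ => Logic.I) cN.
  by have := oint_uniq o1 (oint_sloop E u v lg); case: (u _); case: (u _).
have z := Ncoc_zero vP uP.
move/eqP: ww; apply.
have E11 : w.1.1 = w'.1.1.
  apply/ffunP => i; have [ui _] := z i.+1 (ltn_ord i).
  by move: ui; rewrite /u !ext0 !extS; case: (w.1.1 i); case: (w'.1.1 i).
have E12 : w.1.2 = w'.1.2.
  apply/ffunP => i; have [_ vi] := z i.+1 (ltn_ord i).
  by move: vi; rewrite /v !ext0 !extS; case: (w.1.2 i); case: (w'.1.2 i).
have E2 : w.2 = w'.2 by apply/ffunP => i; move: (b0 i); rewrite /b; case: (w.2 i); case: (w'.2 i).
rewrite [w]surjective_pairing [w']surjective_pairing [w.1]surjective_pairing [w'.1]surjective_pairing.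
by rewrite E11 E12 E2.
Qed.

Variables (N : nat) (c : 'I_N -> R -> T) (m : 'I_N -> 'I_N -> nat) (pts : 'I_N -> 'I_N -> seq T).
Hypothesis sc : forall i, simple (c i).
Hypothesis cP : forall i t, off Ps (c i t).
Hypothesis mC : forall i k, m i k = m k i.
Hypothesis ptsP : forall i k x, i != k -> range (c i) x -> range (c k) x -> x \in pts i k.
Hypothesis pts_size : forall i k, i != k -> (size (pts i k) <= m i k)%N.
Local Notation X := (XS c [set: 'I_N]).
Hypothesis fill : forall x, (off Ps `\` X) x -> exists A', filled R Ps (connected_component (off Ps `\` X) x) A'.

(** Compares the 2 ^ (2 g + n') independent classes with the bits spent by [count_curves]. As n' is
    one less than the number of punctures, the second inequality is twice the bound on the Euler
    characteristic. *)
Theorem euler_bound : (0 < N)%N /\ (2 * (2 * g + n') <= 2 + \sum_i \sum_(k | k != i) m i k)%N.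
Proof.
have [W [nw [cW cw indep]]] := independent_family.
(* Without curves the whole punctured surface would be a single complementary component with at most
   2 classes, while positive genus provides at least 4. *)
have N0 : (0 < N)%N.
  rewrite lt0n; apply/negP => /eqP N0.
  have X0 : X = set0.
    by apply/seteqP; split=> x // [i]; have := ltn_ord i; rewrite {2}N0.
  have [p pP] : exists p, off Ps p.
    have [_ th] := thin_simple sT (cloop_simple E (leq0n g)).
    elim: Ps => [|q F [p pF]]; first by exists p0.
    have [_ th1] := thin1 sT q.
    have [y yF yq] := th1 p [set x | x \notin F] (ltac:(
      apply: filterS (off_nbhs sT F p) => x /= xF; apply/negP => /[dup] /xF ->; exact/negP)).
    by exists y; rewrite /off /= inE negb_or; apply/andP; split=> //; apply/eqP.
  have [A' fA'] := fill (x := p) (ltac:(by rewrite X0; split)).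
  have cE : connected_component (off Ps `\` X) p = off Ps.
    rewrite X0 setD0; apply: connected_component_id => //.
    by apply: conn_connected; exact: (conn_off sT).
  rewrite cE in fA'; have := no_curves cw indep fA'; rewrite cW.
  have : (2 ^ 2 <= 2 ^ (2 * g + n'))%N by rewrite leq_exp2l //; lia.
  by lia.
split=> //.
have [ex [Wex exm]] := count_curves sT cw indep sc cP mC ptsP pts_size fill N0.
by move: Wex; rewrite cW leq_exp2l //; lia.
Qed.

End EulerBound.

(** * Finite sets and the homeomorphism with the model *)

Local Open Scope card_scope.

Lemma card_I_enum (T : Type) (A : set T) (m : nat) : A #= `I_m -> exists f : 'I_m -> T,
  injective f /\ forall x, A x <-> exists i, f i = x.
Proof.
move=> /card_esym/card_bijP[f [f' fK f'K]].
have Im (i : 'I_m) : (i : nat) \in `I_m by apply/mem_set; exact: ltn_ord.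
pose h (i : 'I_m) : T := set_val (f (exist _ (i : nat) (Im i))).
exists h; split=> [i k|x]; rewrite /h.
  move=> /val_inj /(can_inj fK) /(congr1 val) /= ik; exact: val_inj.
split=> [Ax|[i <-]]; last by apply: set_mem; exact: (valP (f _)).
pose z := f' (exist _ x (mem_set Ax)).
have zm : (val z < m)%N by have := valP z; move=> /set_mem.
exists (Ordinal zm); rewrite (_ : exist _ _ _ = z); last by apply/val_inj.
by rewrite /z f'K.
Qed.

Lemma card_I_seq (T : choiceType) (A : set T) (k : nat) : A #<= `I_k -> exists s : seq T,
  [/\ uniq s, (size s <= k)%N & forall x, x \in s <-> A x].
Proof.
move=> Ak; have fA : finite_set A by apply: card_le_finite Ak (finite_II k).
have [m Am] := fA; have [f [fi fP]] := card_I_enum Am.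
exists [seq f i | i <- enum 'I_m]; split.
- by rewrite map_inj_uniq ?enum_uniq.
- by rewrite size_map size_enum_ord -card_le_II -(card_le_eql Am).
move=> x; rewrite fP; split=> [/mapP[i _ ->]|[i <-]]; first by exists i.
by apply: map_f; rewrite mem_enum.
Qed.

Lemma closed_surface_embedding (R : realType) (g : nat) (T : topologicalType) :
  closed_surface R g T -> exists e j, @genus_embedding R g T e j.
Proof.
move=> [e [[e1 e2 e3] ec [j [je jc]]]]; exists e, j; split.
- move=> p U fU; have [V Vp VU] := cont_on_within ec (Logic.I : setT p) fU.
  suff : nbhs p [set y | U (e y)] by [].
  by apply: filterS Vp => y Vy; exact: VU.
- by move=> p; exact: (e1 p Logic.I).
- by move=> p; exact: je.
- by move=> v /e3[p _ <-]; rewrite je.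
- exact: cont_on_within jc.
Qed.

(** * Transport to the model surface *)

Section Transport.
Variables (R : realType) (g : nat) (T : topologicalType) (e : T -> R * R * R) (j : R * R * R -> T).
Hypothesis E : genus_embedding g e j.
Hypothesis g_gt0 : (0 < g)%N.
Local Notation P := (R * R)%type.
Local Notation gdist := (gdist e).
Local Notation Sg := (genus_surface R g).
Let sT := genus_is_surface E.

Lemma eS p : e p \in Sg. Proof. by case: E => _ es _ _ _; apply/mem_set. Qed.
(** The number M_g(k) refers to curves on the subtype [Sg], while cocycles live on T; these two maps
    carry curves, crossings and homotopies across. *)
Definition toS (p : T) : Sg := exist _ (e p) (eS p).
Definition ofS (x : Sg) : T := j (set_val x).

Lemma toSK : cancel toS ofS.
Proof. by move=> p; rewrite /ofS /toS /= ; case: E => _ _ je _ _; exact: je. Qed.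

Lemma ofSK : cancel ofS toS.
Proof.
move=> x; apply/val_inj; rewrite /toS /ofS /=; case: E => _ _ _ ej _.
by apply: ej; apply: set_mem; exact: (valP x).
Qed.

Lemma toS_cts p : cts toS p.
Proof.
have : continuous toS by apply: continuous_comp_initial => q; case: E => ec _ _ _ _; exact: ec.
by apply.
Qed.

Lemma ofS_cts x : cts ofS x.
Proof.
case: E => _ _ _ _ jc U jU.
have xS : Sg (set_val x) by apply: set_mem; exact: (valP x).
have [V Vx VU] := jc (set_val x) xS U jU.
have vc : nbhs x (set_val @^-1` V) by apply: (@initial_continuous _ _ (set_val : Sg -> _)).
suff : nbhs x [set y | U (ofS y)] by [].
by apply: filterS vc => y Vy; apply: VU => //; apply: set_mem; exact: (valP y).
Qed.

Lemma simple_simple_loop (U : topologicalType) (Q : set U) (c : R -> U) : simple_loop Q c -> simple c.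
Proof.
move=> [cc _ ci]; split=> //; split=> [t|t]; first exact: cc.
by apply/ci; rewrite addrAC subrr add0r; exact: rpred1.
Qed.

Lemma simple_ofS (c : R -> Sg) : simple_loop set0 c -> simple (ofS \o c).
Proof.
move=> /simple_simple_loop[[cc cp] ci]; split.
  split=> [t|t]; last by rewrite /= cp.
  by apply: (@cts_comp _ _ _ c ofS); [exact: cc|exact: ofS_cts].
move=> s t; rewrite /=; split=> [/(can_inj ofSK)/ci//|]; by move=> /ci ->.
Qed.

Lemma simple_toS (c : R -> T) : simple c -> simple_loop set0 (toS \o c).
Proof.
move=> [[cc cp] ci]; split=> //.
- by move=> t; apply: (@cts_comp _ _ _ c toS); [exact: cc|exact: toS_cts].
- by move=> t [].
move=> s t; rewrite /=; split=> [/(can_inj toSK)/ci//|]; by move=> /ci ->.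
Qed.

Lemma crosses_axes (a b : set T) x : crosses_at R a b x ->
  exists U (f : T -> P) (h : P -> T), axes_at U f h a b x.
Proof.
move=> [U [f [[oU Ux [[f1 f2 f3] fc [h [hK hc]]] fa fb] fx]]].
have hU v : U (h v) /\ f (h v) = v by have [y Uy <-] := f3 v Logic.I; rewrite hK.
exists U, f, h; split=> //.
- split=> //.
  + by move=> y Uy; apply: open_nbhs_nbhs.
  + by move=> v; case: (hU v).
  + by move=> v; case: (hU v).
  split=> [y Uy V fV|v V hV].
    have [W Wy WV] := cont_on_within fc Uy fV.
    suff : nbhs y [set z | V (f z)] by [].
    by apply: filterS (filterI Wy (open_nbhs_nbhs (conj oU Uy))) => z [Wz Uz]; exact: WV.
  have [W Wy WV] := cont_on_within hc (Logic.I : setT v) hV.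
  suff : nbhs v [set z | V (h z)] by [].
  by apply: filterS Wy => z Wz; exact: WV.
- move=> y Uy; split=> [ay|y0].
    by have : (f @` (U `&` a)) (f y) by [exists y]; rewrite fa.
  have : (f @` (U `&` a)) (f y) by rewrite fa.
  by move=> [z [Uz az] zy]; rewrite -(f2 z y _ _ zy) //; exact: mem_set.
move=> y Uy; split=> [ay|y0].
  by have : (f @` (U `&` b)) (f y) by [exists y]; rewrite fb.
have : (f @` (U `&` b)) (f y) by rewrite fb.
by move=> [z [Uz az] zy]; rewrite -(f2 z y _ _ zy) //; exact: mem_set.
Qed.

Lemma axes_crosses (a b : set T) x U (f : T -> P) (h : P -> T) : axes_at U f h a b x ->
  crosses_at R (toS @` a) (toS @` b) (toS x).
Proof.
move=> [[c1 c2 c3 c4 [c5 c6]] Ux fx aP bP].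
have inS (A : set T) (y : Sg) : (toS @` A) y <-> A (ofS y).
  split=> [[z Az <-]|Ay]; first by rewrite toSK.
  by exists (ofS y) => //; exact: ofSK.
exists (ofS @^-1` U), (f \o ofS); split; last by rewrite /= toSK.
have axis (A : set T) (Q : set P) : (forall y, U y -> (A y <-> Q (f y))) ->
    (f \o ofS) @` (ofS @^-1` U `&` toS @` A) = Q.
  move=> AQ; apply/seteqP; split=> [v [y [Uy /inS Ay] <-]|v Qv].
    by apply/(AQ (ofS y) Uy).
  exists (toS (h v)); last by rewrite /= toSK.
  split; first by rewrite /= toSK.
  by apply/inS; rewrite toSK; apply/AQ => //; rewrite c4.
split.
- apply: nbhs_open => y Uy; exact: (cts_nbhs (@ofS_cts y) (c1 _ Uy)).
- by rewrite /= toSK.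
- split.
  + split=> [y _ //|y z /set_mem Uy /set_mem Uz /= yz|v _].
      by apply: (can_inj ofSK); rewrite -(c2 _ Uy) -(c2 _ Uz) yz.
    by exists (toS (h v)); rewrite /= toSK.
  + apply/subspace_continuousP => y Uy.
    apply: cvg_within_filter.
    by apply: (@cts_comp _ _ _ ofS f); [exact: ofS_cts|exact: c5].
  exists (toS \o h); split=> [y Uy|]; first by rewrite /= c2 // ofSK.
  apply: continuous_subspaceT => v.
  by apply: (@cts_comp _ _ _ h toS); [exact: c6|exact: toS_cts].
- exact: (axis a [set v | v.2 = 0]).
- exact: (axis b [set v | v.1 = 0]).
Qed.

Section OddFamily.
Variables (k : nat) (I : finType) (c : I -> R -> T) (S : {set I}).
Hypothesis sc : forall i, i \in S -> simple (c i).
Hypothesis S_big : (1 < #|S|)%N.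
Hypothesis cross : forall a b, a \in S -> b \in S -> a != b -> exists Xs : seq T,
  [/\ uniq Xs, forall x, x \in Xs <-> range (c a) x /\ range (c b) x,
    odd (size Xs) && (size Xs <= k)%N &
    forall x, x \in Xs -> exists U (f : T -> P) (h : P -> T), axes_at U f h (range (c a)) (range (c b)) x].

(** Stated for arbitrary parametrizations of the two curves, because a homotopy of unparametrized
    curves comes with its own. *)
Lemma odd_pairing a b (c1 c2 : R -> T) (n : T -> T -> bool) (e0 : R) : a \in S -> b \in S -> a != b -> simple c1 -> simple c2 ->
  range c1 = range (c a) -> range c2 = range (c b) -> dual_cocycle gdist c1 n e0 -> oint n c2 true.
Proof.
move=> aS bS ab s1 s2 r1 r2 dn; have [Xs [uX XP /andP[oX _] ax]] := cross aS bS ab.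
rewrite -oX; apply: (cross_parity sT s1 s2 dn uX) => x; first by rewrite r1 r2.
by rewrite r1 r2; exact: ax.
Qed.

Let G : set (set Sg) := [set A | exists2 i, i \in S & A = toS @` range (c i)].

Lemma param_ofS (c' : R -> Sg) i : parametrizes set0 c' (toS @` range (c i)) ->
  simple (ofS \o c') /\ range (ofS \o c') = range (c i).
Proof.
move=> [sl rc]; split; first exact: simple_ofS.
apply/seteqP; split=> [x [t _ <-]|x cx].
  have : range c' (c' t) by exists t.
  by rewrite rc => -[z cz zE]; rewrite /= -zE toSK.
have : range c' (toS x) by rewrite rc; exists x.
by move=> [t _ tE]; exists t => //=; rewrite tE toSK.
Qed.

Lemma homotopic_oint (c1 c2 : R -> Sg) (n : T -> T -> bool) v : cocycle setT n -> loop_homotopic set0 c1 c2 ->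
  oint n (ofS \o c1) v -> oint n (ofS \o c2) v.
Proof.
move=> cn [H [[Hc Hp H0 H1] _]].
have Hc' u : cts (ofS \o H) u by apply: (@cts_comp _ _ _ H ofS); [exact: Hc|exact: ofS_cts].
have Hp' s t : (ofS \o H) (s, t + 1) = (ofS \o H) (s, t) by rewrite /= Hp.
have := @oint_homotopy R T n (ofS \o H) v Hc' Hp' cn.
have -> : (fun t => (ofS \o H) (0, t)) = ofS \o c1 by apply/funext => t; rewrite /= H0.
by have -> : (fun t => (ofS \o H) (1, t)) = ofS \o c2 by apply/funext => t; rewrite /= H1.
Qed.

(** The dual of the first curve integrates to 0 along the first curve and to 1 along the second, but
    the integral is a homotopy invariant. *)
Lemma curves_distinct a b : a \in S -> b \in S -> a != b -> ~ homotopic R set0 (toS @` range (c a)) (toS @` range (c b)).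
Proof.
move=> aS bS ab [c1 [c2 [/param_ofS[s1 r1] /param_ofS[s2 r2] hom]]].
have [n [e0 dn]] := dual_exists sT s1; have [cn _ _ _] := dn.
have o1 := dual_self_even E g_gt0 s1 dn.
have := oint_uniq (homotopic_oint cn hom o1) (odd_pairing aS bS ab s1 s2 r1 r2 dn).
by [].
Qed.

Lemma range_toS i : range (toS \o c i) = toS @` range (c i).
Proof.
apply/seteqP; split=> x; first by move=> [t _ <-]; exists (c i t) => //; exists t.
by move=> [_ [t _ <-] <-]; exists t.
Qed.

Lemma odd_family_curves : curve_set R set0 G /\ pairwise_intersect_at_most R k G.
Proof.
split.
  split=> [A [a aS ->]|A B [a aS ->] [b bS ->] AB].
    exists (toS \o c a); split; first by split; [exact: simple_toS (sc aS)|exact: range_toS].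
    split=> // x _ hom.
    (* Essentiality of a curve is witnessed by a second member of the family: its dual has integral
       1 along the curve but 0 along a constant loop. *)
    have [b bS ba] : exists2 b, b \in S & b != a.
      have := S_big; rewrite (cardsD1 a) aS add1n ltnS => /card_gt0P[b].
      by rewrite !inE => /andP[ba bS]; exists b.
    have [n [e0 dn]] := dual_exists sT (sc bS); have [cn _ _ _] := dn.
    have o1 := odd_pairing bS aS ba (sc bS) (sc aS) erefl erefl dn.
    have o1' : oint n (ofS \o (toS \o c a)) true.
      by have -> : ofS \o (toS \o c a) = c a by apply/funext => t; rewrite /= toSK.
    have o2 := homotopic_oint cn hom o1'.
    have o3 : oint n (ofS \o (cst x : R -> Sg)) false by exact: (@oint_cst R T n (ofS x) cn).
    by have := oint_uniq o2 o3.
  apply: curves_distinct => //; apply: contra_notN AB => /eqP->.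
  by [].
move=> A B [a aS ->] [b bS ->] AB.
have ab : a != b by apply: contra_notN AB => /eqP->.
have [Xs [uX XP /andP[_ sX] ax]] := cross aS bS ab.
split.
  move=> _ [[x ax1 <-] [y bx /(can_inj toSK) yx]]; rewrite yx in bx.
  have [U [f [h axf]]] := ax x (proj2 (XP x) (conj ax1 bx)).
  exact: axes_crosses axf.
have -> : (toS @` range (c a)) `&` (toS @` range (c b)) = [set` [seq toS x | x <- Xs]].
  apply/seteqP; split=> [_ [[x ax1 <-] [y bx /(can_inj toSK) yx]]|z].
    rewrite yx in bx; apply/mapP; exists x => //; exact/XP.
  by move=> /mapP[x /XP[xa xb] ->]; split; exists x.
apply: (@card_le_trans _ _ _ `I_(size [seq toS x | x <- Xs])); last by rewrite card_le_II size_map.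
apply: (@card_le_trans _ _ _ (nth (toS (c a 0)) [seq toS x | x <- Xs] @` `I_(size [seq toS x | x <- Xs]))).
  apply: subset_card_le => z /= zX; exists (index z [seq toS x | x <- Xs]); last exact: nth_index.
  by rewrite /= index_mem.
exact: card_image_le.
Qed.

Lemma odd_family_bound m : is_max_curves R g k m -> (#|S| <= m)%N.
Proof.
move=> [_ /(_ G odd_family_curves)]; rewrite -card_le_II.
apply: card_le_trans.
have S0 : (0 < #|S|)%N by exact: ltnW.
have inj a b : a \in S -> b \in S -> toS @` range (c a) = toS @` range (c b) -> a = b.
  move=> aS bS ab; apply/eqP; apply/negPn/negP => nab; apply: (curves_distinct aS bS nab).
  (* Equal images would be homotopic through the constant homotopy, so the family has as many curves
     as indices. *)
  rewrite -ab; exists (toS \o c a), (toS \o c a).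
  have pa : parametrizes set0 (toS \o c a) (toS @` range (c a)).
    by split; [exact: simple_toS (sc aS)|exact: range_toS].
  split=> //; exists (fun u => (toS \o c a) u.2); split; last by move=> u [].
  split=> //.
    move=> u; apply: (@cts_comp _ _ _ (fun u : P => u.2) (toS \o c a)); first by cts.
    by case: pa => -[cc _ _] _; exact: cc.
  by move=> s t /=; rewrite (proj2 (proj1 (sc aS))).
pose F (i : nat) : set Sg := if insub i is Some i' then toS @` range (c (enum_val (i' : 'I_#|S|))) else set0.
have FE (i : 'I_#|S|) : F i = toS @` range (c (enum_val i)) by rewrite /F valK.
have -> : (`I_#|S| #<= G) = (F @` `I_#|S| #<= G).
  apply: card_le_eql; apply: card_esym; apply: inj_card_eq => i i' /set_mem /= iS /set_mem /= iS'.
  have := FE (Ordinal iS); have := FE (Ordinal iS'); rewrite /= => -> -> /inj H.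
  by have := H (enum_valP _) (enum_valP _) => /enum_val_inj[].
apply: subset_card_le => _ [i /= iS <-].
by exists (enum_val (Ordinal iS)); [exact: enum_valP|exact: (FE (Ordinal iS))].
Qed.

End OddFamily.

End Transport.

Local Open Scope card_scope.

(** The outer circle and slice 0 meet exactly once. This settles families with at most one curve, to
    which [odd_family_bound] does not apply. *)
Lemma two_odd_curves (R : realType) (g : nat) (T : topologicalType) (e : T -> R * R * R)
    (j : R * R * R -> T) (k m : nat) : genus_embedding g e j -> (0 < g)%N -> odd k ->
  is_max_curves R g k m -> (1 < m)%N.
Proof.
move=> E g0 ok mm; pose c (b : bool) := if b then cloop g j 0 else sloop g j 0.
have sc b : b \in [set: bool]%SET -> simple (c b).
  by case: b => _; [exact: (cloop_simple E (leq0n g))|exact: (sloop_simple E (leq0n g))].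
suff H : forall a b, a \in [set: bool]%SET -> b \in [set: bool]%SET -> a != b -> exists Xs : seq T,
  [/\ uniq Xs, forall x, x \in Xs <-> range (c a) x /\ range (c b) x,
    odd (size Xs) && (size Xs <= k)%N &
    forall x, x \in Xs -> exists U (f : T -> R * R) (h : R * R -> T), axes_at U f h (range (c a)) (range (c b)) x].
  have := odd_family_bound E g0 sc _ H mm; rewrite cardsT card_bool; exact.
have [Xs [uX XP oX sX]] := cs_points E g0 (leq0n g) (leq0n g).
have oX1 : odd (size Xs) by rewrite oX /meet /lgap /rgap /= ltn_eqF.
have sk : odd (size Xs) && (size Xs <= k)%N.
  rewrite oX1 /=; have : (0 < k)%N by case: (k) ok.
  by move: oX1 sX; case: (size Xs) => [|[|[|]]].
have ax x : x \in Xs -> exists U (f : T -> R * R) (h : R * R -> T),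
    axes_at U f h (range (c true)) (range (c false)) x.
  by move=> /XP[x1 x2]; exact: (cs_axes E (leq0n g) (leq0n g) x1 x2).
move=> a b _ _; case: a; case: b => // _; exists Xs; split=> //.
  by move=> x; rewrite XP; split=> -[].
move=> x /ax[U [f [h axf]]]; have [f' [h' axf']] := axes_swap axf.
by exists U, f', h'.
Qed.

Lemma euler_char_abs g n : (0 < g)%N -> (0 < n)%N -> `|euler_char g n| = (2 * g + n - 2)%N%:Z.
Proof.
move=> g0 n0; have -> : euler_char g n = - (2 * g + n - 2)%N%:Z.
  by rewrite /euler_char; lia.
by rewrite normrN; lia.
Qed.

Lemma odd_le_pred s k : odd k -> (s <= k)%N -> (s <= if odd s then k else k.-1)%N.
Proof.
move=> ok sk; case: ifP => // os; rewrite -ltnS prednK; last by case: (k) ok.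
by rewrite ltn_neqAle sk andbT; apply: contraFneq os => ->.
Qed.

(** S is the sum of the allowed intersection numbers and E the number of evenly crossing pairs, both
    over ordered pairs. Since an even pair loses one intersection, S + E = k a (a - 1). If M = 0,
    the quotient by M is 0 in the field and the bound holds trivially. *)
Lemma counting_arith (g n k a M S E : nat) : (0 < g)%N -> (0 < n)%N -> (0 < a)%N ->
  (2 * (2 * g + n.-1) <= 2 + S)%N -> (S + E = k * (a * a.-1))%N ->
  (a ^ 2 <= M * (a + E))%N \/ M = 0%N ->
  `|euler_char g n|%:~R <= k%:R / 2 * a%:R * (a%:R - 1) - a%:R / 2 * (a%:R / M%:R - 1) :> rat.
Proof.
move=> g0 n0 a0 hS hE hM; rewrite euler_char_abs //.
set c : rat := (2 * g + n - 2)%N%:~R.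
have c2 : 2 * c <= S%:R.
  rewrite /c -[(2 * g + n - 2)%N%:~R]/((2 * g + n - 2)%N%:R : rat) -natrM ler_nat; lia.
have hE' : S%:R + E%:R = k%:R * (a%:R * (a%:R - 1)) :> rat.
  have aE : a.-1%:R = a%:R - 1 :> rat by rewrite -[in RHS](prednK a0) -natr1 addrK.
  by rewrite -natrD hE !natrM aE.
have hx : a%:R * (a%:R / M%:R) <= a%:R + E%:R :> rat.
  case: hM => [hM|->]; last by rewrite invr0 !mulr0 -natrD ler0n.
  have [->|M0] := posnP M; first by rewrite invr0 !mulr0 -natrD ler0n.
  rewrite mulrA ler_pdivrMr ?ltr0n // -natrD -!natrM ler_nat.
  by rewrite mulnn mulnC.
have -> : k%:R / 2 * a%:R * (a%:R - 1) - a%:R / 2 * (a%:R / M%:R - 1) =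
    (k%:R * (a%:R * (a%:R - 1)) - a%:R * (a%:R / M%:R) + a%:R) / 2 :> rat.
  by set x : rat := a%:R / M%:R; field.
rewrite -hE'; lra.
Qed.

Theorem theorem2 (R : realType) (T : topologicalType) (g n k : nat)
    (P : set T) (G : set (set T)) (N : nat)
    (k_odd : odd k) (g_ge1 : (1 <= g)%N) (n_ge1 : (1 <= n)%N)
    (T_genus : closed_surface R g T) (P_punctures : P #= `I_n)
    (G_fills : filling_set R P G)
    (G_k : pairwise_intersect_at_most R k G)
    (N_gt0 : (0 < N)%N) (N_ineq : counting_inequality R g n k N)
    (N_min : forall m : nat, (0 < m)%N -> counting_inequality R g n k m ->
      (N <= m)%N) :
  `I_N #<= G.
Proof.
(* An infinite filling set has at least N elements anyway. *)
have [finG|/infiniteP] := pselect (finite_set G); last first.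
  by apply: card_le_trans; exact: subset_card_le.
have [M GM] := finG; have [a [ainj aP]] := card_I_enum GM.
rewrite (card_le_eqr GM) card_le_II.
have [e [j E]] := closed_surface_embedding T_genus.
have sT := genus_is_surface E.
have [fp [fpi fpP]] := card_I_enum P_punctures.
have [p0 [ps [ups PsP szp]]] : exists p0 ps, [/\ uniq (p0 :: ps), forall x, x \in p0 :: ps <-> P x &
    size ps = n.-1].
  have uP : uniq [seq fp i | i <- enum 'I_n] by rewrite map_inj_uniq ?enum_uniq.
  have iP x : x \in [seq fp i | i <- enum 'I_n] <-> P x.
    rewrite fpP; split=> [/mapP[i _ ->]|[i <-]]; first by exists i.
    by apply: map_f; rewrite mem_enum.
  have sP : size [seq fp i | i <- enum 'I_n] = n by rewrite size_map size_enum_ord.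
  case: [seq fp i | i <- enum 'I_n] uP iP sP => [|p0 ps] uP iP sP; first by move: n_ge1; rewrite -sP.
  by exists p0, ps; split=> //; rewrite -sP.
have offP : off (p0 :: ps) = ~` P.
  by apply/seteqP; split=> x; rewrite /off /=; [move=> /negP nx Px; apply: nx; exact/PsP|move=> nP; apply/negP => /PsP].
have [[Gc Gh] Gf] := G_fills.
have Ga i : G (a i) by apply/aP; exists i.
have exc i : exists c : R -> T, simple_loop P c /\ range c = a i.
  by have [c [pc _]] := Gc (a i) (Ga i); exists c.
have [c cP] := choice exc.
have sc i : simple (c i) by apply: (simple_simple_loop (proj1 (cP i))).
have rc i : range (c i) = a i by exact: (proj2 (cP i)).
have coff i t : off (p0 :: ps) (c i t) by rewrite offP; case: (cP i) => -[_ + _] _; exact.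
have expts (ik : 'I_M * 'I_M) : exists s : seq T, ik.1 != ik.2 -> [/\ uniq s, (size s <= k)%N &
    forall x, x \in s <-> a ik.1 x /\ a ik.2 x].
  have [ik2|ik2] := eqVneq ik.1 ik.2; first by exists [::].
  have aa : a ik.1 <> a ik.2 by move=> /ainj H; rewrite H eqxx in ik2.
  have [_ /card_I_seq[s [us ss sP]]] := G_k _ _ (Ga ik.1) (Ga ik.2) aa.
  by exists s.
have [pts0 pts0P] := choice expts; pose pts i l := pts0 (i, l).
have ptsP i l : i != l -> [/\ uniq (pts i l), (size (pts i l) <= k)%N &
    forall x, x \in pts i l <-> a i x /\ a l x] by exact: (pts0P (i, l)).
have szC i l : size (pts i l) = size (pts l i).
  have [->//|il] := eqVneq i l; have li : l != i by rewrite eq_sym.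
  have [u1 _ P1] := ptsP i l il; have [u2 _ P2] := ptsP l i li.
  apply: perm_size; apply: uniq_perm => // x.
  by apply/idP/idP => [/P1[? ?]|/P2[? ?]]; [apply/P2|apply/P1].
pose ev : rel 'I_M := fun i l => ~~ odd (size (pts i l)).
have ev_sym : symmetric ev by move=> i l; rewrite /ev szC.
(* The intersection bound by parity: as k is odd, an even number of common points is at most k -
   1. *)
pose m i l := if odd (size (pts i l)) then k else k.-1.
have k0 : (0 < k)%N by case: (k) k_odd.
have GX : XS c [set: 'I_M]%SET = \bigcup_(b in G) b.
  apply/seteqP; split=> x; first by move=> [i _]; rewrite rc => xi; exists (a i).
  by move=> [b /aP[i <-] bx]; exists i; rewrite ?finset.in_setT // rc.
have fill x : (off (p0 :: ps) `\` XS c [set: 'I_M]%SET) x -> exists A',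
    filled R (p0 :: ps) (connected_component (off (p0 :: ps) `\` XS c [set: 'I_M]%SET) x) A'.
  move=> Cx; apply: (filled_exists sT) => //.
  - exact: (@XS_closed _ _ _ sT).
  - by move=> p [i _ [t _ <-]]; exact: coff.
  rewrite offP GX in Cx *; have [dk|[p [Pp np dk]]] := Gf x Cx; [by left|right].
  by exists p; split=> //; exact/PsP.
have mC i l : m i l = m l i by rewrite /m szC.
have pin i l x : i != l -> range (c i) x -> range (c l) x -> x \in pts i l.
  by move=> il; rewrite !rc => xi xl; have [_ _ H] := ptsP i l il; exact/H.
have psz i l : i != l -> (size (pts i l) <= m i l)%N.
  by move=> il; have [_ H _] := ptsP i l il; exact: odd_le_pred.
have [M0 bound] := euler_bound E g_ge1 ups sc coff mC pin psz fill.
(* By minimality of N it is enough that the number of curves itself satisfies the inequality. *)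
apply: N_min => //.
have tot : (\sum_i \sum_(l | l != i) m i l + edges ev [set: 'I_M]%SET = k * (M * M.-1))%N.
  have -> : edges ev [set: 'I_M]%SET = (\sum_i deg ev [set: 'I_M]%SET i)%N.
    by apply: eq_bigl => i; rewrite finset.in_setT.
  rewrite -big_split /= (eq_bigr (fun=> (M.-1 * k)%N)); last first.
    move=> i _; have -> : deg ev [set: 'I_M]%SET i = (\sum_(l | l != i) ev i l)%N.
      rewrite /deg -sum1_card (eq_bigl (fun l => (l != i) && ev i l)); last first.
        by move=> l; rewrite !inE.
      by rewrite big_mkcondr; apply: eq_bigr => l _; case: (ev i l).
    rewrite -big_split /= (eq_bigr (fun=> k)); last first.
      by move=> l _; rewrite /m /ev; case: ifP => _ /=; rewrite ?addn0 // addn1 prednK.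
    rewrite sum_nat_const; congr (_ * _)%N.
    by rewrite cardC1 card_ord.
  by rewrite sum_nat_const card_ord mulnA mulnC.
rewrite szp in bound.
apply: (counting_arith g_ge1 n_ge1 M0 bound tot).
(* Without a maximum, [max_curves] takes its default value 0, which [counting_arith] covers
   separately. *)
have [[mx mxP]|none] := pselect (exists mx, is_max_curves R g k mx); last first.
  right; rewrite /max_curves; case: xgetP => // y _ yP.
  by case: none; exists y.
left; have maxP : is_max_curves R g k (max_curves R g k).
  by rewrite /max_curves; exact: (xgetI _ mxP).
rewrite -[X in (X ^ 2)%N](card_ord M) -cardsT -[X in (_ <= _ * (X + _))%N](card_ord M) -cardsT.
apply: turan => // S _ indS.
(* An independent set of the graph of even pairs is a family of curves crossing pairwise an odd
   number of times, so its size is bounded by M_g(k) once it has two members. *)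
have [S1|S2] := leqP #|S| 1.
  by apply: leq_trans S1 (ltnW (two_odd_curves E g_ge1 k_odd maxP)).
apply: (odd_family_bound E g_ge1 (c := c) (k := k)) maxP => // i l iS lS il.
have [us ss sP] := ptsP i l il; exists (pts i l); split=> //.
- by move=> x; rewrite !rc.
- rewrite ss andbT; have /forall_inP/(_ i iS)/forall_inP/(_ l lS) := indS.
  by rewrite il /= /ev negbK.
move=> x /sP[xi xl]; rewrite !rc; apply: crosses_axes.
have aa : a i <> a l by move=> /ainj H; rewrite H eqxx in il.
by have [H _] := G_k _ _ (Ga i) (Ga l) aa; apply: H.
Qed.
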